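(* Assume (A1)-(A4) on the chain and $\tau$, and (B1)-(B2) on $V$, all as listed in the context, with $\alpha\in(0,1)$ and $\beta\in(0,2)$; in particular $\int V\,d\pi=0$ when $\beta\in(1,2)$. Let $$\rho(\lambda):=C_{\alpha,\beta}|\lambda|^{\beta/\alpha},\quad\lambda\in\mathbb R,\qquad C_{\alpha,\beta}:=\left(\frac{c_\alpha}{c_\beta^-+c_\beta^+}\right)^{1/\alpha},$$ and suppose that for some $C_*>0$ and $\gamma>\alpha$ $$\pi\left[|\tau-\rho\circ V|\ge\lambda\right]\le\frac{C_*}{\lambda^\gamma},\qquad\forall\,\lambda>0 .$$ Let $K_N$ be an increasing sequence converging to $+\infty$, let $T^{(N)}_t:=K_N^{-1/\alpha}t_{[K_Nt]}$, and let $\{(S_t,T_t),\,t\ge0\}$ be the Lévy process on $\mathbb R^2$ with $\mathbb E e^{i\xi_1S_t+i\xi_2T_t}=e^{t\psi(\xi_1,\xi_2)}$, where $$\psi(\xi_1,\xi_2)=\int_{\mathbb R^2}e_{\alpha,\beta}(\xi_1,\xi_2,\lambda_1,\lambda_2)\,\nu_*(d\lambda_1,d\lambda_2)$$ and $\nu_*$ is the image of $\nu_\beta$ under the map $\lambda\mapsto(\lambda,\rho(\lambda))$, i.e. $\nu_*(d\lambda_1,d\lambda_2)=\delta_0(\lambda_2-\rho(\lambda_1))\nu_\beta(d\lambda_1)d\lambda_2$. Then: (i) If $\beta\neq1$ and $S^{(N)}_t:=K_N^{-1/\beta}S_{[K_Nt]}$, then $\{(S^{(N)}_t,T^{(N)}_t),\,t\ge0\}$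 converge in law, as $N\to+\infty$, to $\{(S_t,T_t),\,t\ge0\}$ on $D([0,+\infty),\mathbb R^2)$ with the $J_1$ topology. (ii) If $\beta=1$, put $V_N:=V1_{[|V|\le K_N]}$, $v_N:=\int V_N\,d\pi$ and $S^{(N)}_t:=K_N^{-1}S_{[K_Nt]}-v_Nt$, and assume in addition that $\sup_{N\ge1}\|PV_N\|_{L^{\beta'}(\pi)}<+\infty$ for some $\beta'>1$. Then the same convergence holds.
   Context: Setting. $(E,d)$ is a Polish space with Borel $\sigma$-algebra $\mathcal E$; $\{X_n,\,n\ge0\}$ is a Markov chain on $E$ with transition probability $P(x,dy)$ and transition operator $Pf(x)=\int f(y)P(x,dy)$; the law $\pi$ of $X_0$ is invariant and ergodic for the chain. (A1) Spectral gap: $\sup\{\|Pf\|_{L^2(\pi)}:\ \int f\,d\pi=0,\ \|f\|_{L^2(\pi)}=1\}=a<1$. (A2) There are a measurable family of Borel measures $Q(x,dy)$ and a measurable $p(x,y)\ge0$ with $P(x,dy)=P_a(x,dy)+Q(x,dy)$ for all $x\in E$, where $P_a(x,dy):=p(x,y)\pi(dy)$, and $\sup_{y\in E}\int p^2(x,y)\pi(dx)<+\infty$. (A3) $\tau:E\to[0,+\infty)$ is measurable, there is $t_*>0$ with $\tau(x)\ge t_*$ for all $x\in E$, and there are $\alpha\in(0,1)$, $c_\alpha>0$ with $\lim_{\lambda\to+\infty}\lambda^\alpha\pi(\tau\ge\lambda)=c_\alpha$. (A4) $\sup_{\lambda\ge0,x\in E}\dfrac{Q(x,[\tau\ge\lambda])}{P_a(x,[\tau\ge\lambda])}<+\infty$,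 i.e. $Q(x,[\tau\ge\lambda])\le C\,P_a(x,[\tau\ge\lambda])$ for all $\lambda\ge 0$, $x\in E$ and some constant $C$. (B1) $V:E\to\mathbb R$ is measurable and there are $\beta\in(0,2)$ and nonnegative constants $c_\beta^+,c_\beta^-$ with $c_\beta^++c_\beta^->0$ such that $\pi(V\ge\lambda)=c_\beta^+\lambda^{-\beta}(1+o(1))$ and $\pi(V\le-\lambda)=c_\beta^-\lambda^{-\beta}(1+o(1))$ as $\lambda\to+\infty$; moreover $\int V\,d\pi=0$ if $\beta\in(1,2)$. (B2) $\sup_{\lambda\ge0,x\in E}\dfrac{Q(x,[|V|\ge\lambda])}{P_a(x,[|V|\ge\lambda])}<+\infty$ (in the same sense as (A4)). Notation. $t_0:=0$, $t_N:=\sum_{k=0}^{N-1}\tau(X_k)$; $S_0:=0$, $S_N:=\sum_{k=0}^{N-1}V(X_k)$ (partial sums, not to be confused with the limit process $S_t$). $[\cdot]$ is the integer part when applied to a number. $\nu_\beta(d\lambda):=\beta c_\beta(\lambda)|\lambda|^{-1-\beta}d\lambda$ with $c_\beta(\lambda)=c_\beta^+$ for $\lambda>0$ and $c_\beta^-$ for $\lambda<0$. The function $e_{\alpha,\beta}(\xi_1,\xi_2,\lambda_1,\lambda_2)$ equals $e^{i(\lambda_1\xi_1+\lambda_2\xi_2)}-1$ for $\beta\in(0,1)$, $e^{i(\lambda_1\xi_1+\lambda_2\xi_2)}-1-i\xi_1\lambda_11_{[-1,1]}(\lambda_1)$ for $\beta=1$, and $e^{i(\lambda_1\xi_1+\lambda_2\xi_2)}-1-i\lambda_1\xi_1$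 for $\beta\in(1,2)$. *)

(* Defs.v *)
From HB Require Import structures.
From mathcomp Require Import all_boot all_order all_algebra.
From mathcomp Require Import all_classical all_reals all_analysis.
From mathcomp Require Import complex.

Set Implicit Arguments.
Unset Strict Implicit.
Unset Printing Implicit Defensive.

Import Order.TTheory GRing.Theory Num.Def Num.Theory.
Import numFieldNormedType.Exports.

Local Open Scope classical_set_scope.
Local Open Scope ring_scope.

#[short(type="completeMetricType")]
HB.structure Definition CompleteMetric (R : numDomainType) :=
  {T of Metric R T & Complete T}.

Definition separable (T : topologicalType) : Prop :=
  exists2 S : set T, countable S & dense S.

Notation borel E := (g_sigma_algebraType (@open E)).

Section MarkovChain.
Context {R : realType} {dE : measure_display} {E : measurableType dE}.
Context {d : measure_display} {Om : measurableType d}.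
Implicit Types (P : R.-pker E ~> E) (mu : probability E R).

(* Total function; for f in L^2 of an invariant law the integral is finite for
   almost every x, and the junk values do not affect L^p norms. *)
Definition transition_op P (f : E -> R) (x : E) : R := (\int[P x]_y f y)%R.

(* The sigma-algebra generated by X 0, ..., X n. *)
Definition history (X : nat -> Om -> E) (n : nat) : set (set Om) :=
  <<s \bigcup_(k in `I_n.+1) preimage_set_system setT (X k) measurable >>.

Definition markov_chain (Pr : probability Om R) P mu (X : nat -> {RV Pr >-> E})
    : Prop :=
  (forall A, measurable A -> Pr (X 0%N @^-1` A) = mu A) /\
  (forall n H A, history X n H -> measurable A ->
     Pr (H `&` X n.+1 @^-1` A) = (\int[Pr]_(w in H) P (X n w) A)%E).

Definition invariant_law P mu : Prop :=
  forall A, measurable A -> mu A = (\int[mu]_x P x A)%E.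

Definition ergodic_law P mu : Prop :=
  forall A, measurable A -> {ae mu, forall x, P x A = (\1_A x)%:E} ->
    mu A = 0%E \/ mu A = 1%E.

Definition spectral_gap P mu : Prop :=
  (ereal_sup [set 'N[mu]_2%:E[EFin \o transition_op P f] | f in
     [set f : E -> R | [/\ measurable_fun setT f,
        'N[mu]_2%:E[EFin \o f] = 1 & \int[mu]_x (f x)%:E = 0]]] < 1)%E.

Definition ac_part mu (p : E -> E -> R) (x : E) (A : set E) : \bar R :=
  (\int[mu]_(y in A) (p x y)%:E)%E.

(* sup Q(x, {g >= l}) / P_a(x, {g >= l}) < +oo, written without division so that
   both sides may vanish; here P_a(x, dy) = p(x, y) mu(dy). *)
Definition level_dominated mu (Q : R.-ker E ~> E) (p : E -> E -> R) (g : E -> R)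
    : Prop :=
  exists C : R, forall (l : R) (x : E), 0 <= l ->
    (Q x [set y | (l <= g y)%R] <= C%:E * ac_part mu p x [set y | (l <= g y)%R])%E.

Definition partial_sum (X : nat -> Om -> E) (f : E -> R) (w : Om) (n : nat) : R :=
  \sum_(k < n) f (X k w).

End MarkovChain.

Section Skorokhod.
Context {R : realType}.

(* A path on [0, +oo[ is represented by its extension to R that is constant
   on ]-oo, 0]. *)
Definition cadlag (V : normedModType R) (x : R -> V) : Prop :=
  [/\ forall t, t < 0 -> x t = x 0,
      forall t, 0 <= t -> x s @[s --> t^'+] --> x t
    & forall t, 0 < t -> cvg (x s @[s --> t^'-])].

Record skorokhod (V : normedModType R) := Skorokhod {
  path_fun :> R -> V;
  path_cadlag : cadlag path_fun }.

HB.instance Definition _ V := gen_eqMixin (skorokhod V).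
HB.instance Definition _ V := gen_choiceMixin (skorokhod V).

Definition time_change (l : R -> R) : Prop :=
  (forall s t, 0 <= s -> s < t -> l s < l t) /\
  l @` `[0, +oo[%classic = `[0, +oo[%classic.

Definition J1_nbhd (V : normedModType R) (x : skorokhod V) (T e : R)
    : set (skorokhod V) :=
  [set y | exists l : R -> R, [/\ time_change l,
     forall s, 0 <= s -> `|l s - s| < e
   & forall s, 0 <= s <= T -> `|y (l s) - x s| < e]].

(* The sets J1_nbhd x T e form a base of the J1 neighborhood filter at x:
   x_n --> x in J1 iff there are time changes l_n with sup_s |l_n s - s| --> 0
   and sup_(s <= T) |x_n (l_n s) - x s| --> 0 for all T. *)
Definition J1_open (V : normedModType R) (A : set (skorokhod V)) : Prop :=
  forall x, A x -> exists T e : R, 0 < e /\ J1_nbhd x T e `<=` A.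

Section J1.
Variable V : normedModType R.

Lemma J1_openT : J1_open (@setT (skorokhod V)).
Proof. by move=> x _; exists 0, 1. Qed.

Lemma J1_nbhdS (x : skorokhod V) T T' e e' : T' <= T -> e <= e' ->
  J1_nbhd x T e `<=` J1_nbhd x T' e'.
Proof.
move=> TT ee y [l [tl h1 h2]]; exists l; split=> // s.
- by move=> /h1 /lt_le_trans; exact.
- move=> /andP[s0 sT]; apply: lt_le_trans ee; apply: h2.
  by rewrite s0 (le_trans sT).
Qed.

Lemma J1_openI : setI_closed (@J1_open V).
Proof.
move=> A B oA oB x [/oA[T [e [e0 hA]]] /oB[T' [e' [e'0 hB]]]].
exists (Num.max T T'), (Num.min e e'); split; first by rewrite lt_min e0.
move=> y hy; split; [apply: hA|apply: hB]; apply: J1_nbhdS hy.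
- by rewrite le_max lexx.
- by rewrite ge_min lexx.
- by rewrite le_max lexx orbT.
- by rewrite ge_min lexx orbT.
Qed.

Lemma J1_open_bigcup (I : Type) (f : I -> set (skorokhod V)) :
  (forall i, J1_open (f i)) -> J1_open (\bigcup_i f i).
Proof.
move=> of_ x [i _ /of_[T [e [e0 h]]]]; exists T, e; split=> //.
by move=> y /h fy; exists i.
Qed.

HB.instance Definition _ :=
  isOpenTopological.Build (skorokhod V) J1_openT J1_openI J1_open_bigcup.

End J1.

(* The Borel sigma-algebra of the J1 topology is generated by the coordinate
   maps, so F \o Y n is measurable as soon as every w |-> Y n w t is. *)
Definition cvg_in_law (V : normedModType R) d d' (Om : measurableType d)
    (Om' : measurableType d') (Pr : probability Om R) (Pr' : probability Om' R)
    (Y : nat -> Om -> skorokhod V) (Z : Om' -> skorokhod V) : Prop :=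
  forall F : skorokhod V -> R, continuous F ->
    (exists M : R, forall x, `|F x| <= M) ->
    ('E_Pr[F \o Y n])%E @[n --> \oo] --> ('E_Pr'[F \o Z])%E.

(* t |-> (a1 * u1_[K t] - v * t, a2 * u2_[K t]); truncn is the integer part on
   [0, +oo[ and is 0 on negative numbers. *)
Definition rescaled_fun (K a1 a2 v : R) (u1 u2 : nat -> R) (t : R) : R * R :=
  let s := Num.max 0 t in
  (a1 * u1 (Num.truncn (K * s)) - v * s, a2 * u2 (Num.truncn (K * s))).

Lemma truncn_right (K t : R) : 0 <= t ->
  \forall s \near t^'+, Num.truncn (K * s) = Num.truncn (K * t).
Proof.
move=> t0; have [K0|K0] := leP K 0.
  have K0s s : t <= s -> Num.truncn (K * s) = 0%N.
    move=> ts; apply/truncn0Pn; rewrite -ltNge (le_lt_trans _ ltr01)//.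
    by rewrite mulr_le0_ge0// (le_trans t0).
  near=> s; have ts : t <= s by near: s; apply: nbhs_right_ge.
  by rewrite (K0s s ts) (K0s t (lexx t)).
have Kt0 : 0 <= K * t by rewrite mulr_ge0// ltW.
have tlt : t < (Num.truncn (K * t)).+1%:R / K.
  by rewrite ltr_pdivlMr// mulrC truncnS_gt.
near=> s.
have ts : t <= s by near: s; apply: nbhs_right_ge.
apply: truncn_def; apply/andP; split.
  by rewrite (@le_trans _ _ (K * t)) ?truncn_le// ler_wpM2l// ltW.
rewrite mulrC -ltr_pdivlMr//; near: s; exact: nbhs_right_lt.
Unshelve. all: by end_near. Qed.

Lemma truncn_left (K t : R) : 0 < t ->
  exists n, \forall s \near t^'-, Num.truncn (K * s) = n.
Proof.
move=> t0; have [K0|K0] := leP K 0.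
  exists 0%N; near=> s; apply/truncn0Pn; rewrite -ltNge (le_lt_trans _ ltr01)//.
  rewrite mulr_le0_ge0//; apply: ltW; near: s; exact: nbhs_left_gt.
have Kt0 : 0 <= K * t by rewrite mulr_ge0// ltW.
have [n /andP[nKt Ktn]] : exists n : nat, n%:R < K * t <= n.+1%:R.
  have /andP[] := truncn_itv Kt0; set m := Num.truncn _.
  rewrite le_eqVlt => /orP[/eqP mE _|mlt /ltW mle]; last by exists m; rewrite mlt.
  have m0 : (0 < m)%N by rewrite -(ltr_nat R) mE mulr_gt0.
  by exists m.-1; rewrite prednK// mE lexx -mE ltr_nat ltn_predL m0.
have nt : n%:R / K < t by rewrite ltr_pdivrMr// mulrC.
exists n; near=> s; apply: truncn_def; apply/andP; split.
  rewrite mulrC -ler_pdivrMr//; apply: ltW; near: s; exact: nbhs_left_gt.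
rewrite (lt_le_trans _ Ktn)// ltr_pM2l//; near: s; exact: nbhs_left_lt.
Unshelve. all: by end_near. Qed.

Lemma rescaled_fun_ge0 K a1 a2 v u1 u2 t : 0 <= t ->
  rescaled_fun K a1 a2 v u1 u2 t =
  (a1 * u1 (Num.truncn (K * t)) - v * t, a2 * u2 (Num.truncn (K * t))).
Proof. by move=> t0; rewrite /rescaled_fun max_r. Qed.

Lemma rescaled_cadlag K a1 a2 v u1 u2 :
  cadlag (rescaled_fun K a1 a2 v u1 u2).
Proof.
split=> [t t0|t t0|t t0].
- by rewrite /rescaled_fun max_l ?ltW// maxxx.
- rewrite rescaled_fun_ge0//.
  apply: (@cvg_trans _ ((a1 * u1 (Num.truncn (K * t)) - v * s,
     a2 * u2 (Num.truncn (K * t))) @[s --> t^'+])).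
    apply: near_eq_cvg; near=> s.
    have ts : t <= s by near: s; apply: nbhs_right_ge.
    rewrite rescaled_fun_ge0 ?(le_trans t0)//.
    suff -> : Num.truncn (K * s) = Num.truncn (K * t) by [].
    by near: s; exact: truncn_right.
  have c1 : a1 * u1 (Num.truncn (K * t)) - v * s @[s --> t^'+] --> a1 * u1 (Num.truncn (K * t)) - v * t.
    apply: cvgB; first exact: cvg_cst.
    by apply: cvgMr; apply: cvg_at_right_filter; exact: cvg_id.
  exact: (cvg_pair c1 (cvg_cst (a2 * u2 (Num.truncn (K * t))))).
- have [n nE] := truncn_left K t0.
  apply/cvg_ex; exists (a1 * u1 n - v * t, a2 * u2 n).
  apply: (@cvg_trans _ ((a1 * u1 n - v * s, a2 * u2 n) @[s --> t^'-])).
    apply: near_eq_cvg; near=> s.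
    rewrite rescaled_fun_ge0; last first.
      by apply: ltW; near: s; exact: nbhs_left_gt.
    suff -> : Num.truncn (K * s) = n by [].
    by near: s.
  have c1 : a1 * u1 n - v * s @[s --> t^'-] --> a1 * u1 n - v * t.
    apply: cvgB; first exact: cvg_cst.
    by apply: cvgMr; apply: cvg_at_left_filter; exact: cvg_id.
  exact: (cvg_pair c1 (cvg_cst (a2 * u2 n))).
Unshelve. all: by end_near. Qed.

Definition rescaled_path K a1 a2 v u1 u2 : skorokhod (R * R)%type :=
  Skorokhod (rescaled_cadlag K a1 a2 v u1 u2).

End Skorokhod.

Section Levy.
Context {R : realType}.
Local Open Scope complex_scope.

Definition cexp (z : R[i]) : R[i] :=
  (expR (complex.Re z))%:C * (cos (complex.Im z) +i* sin (complex.Im z)).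

Definition cintegral d (T : measurableType d) (mu : set T -> \bar R)
    (f : T -> R[i]) : R[i] :=
  fine (\int[mu]_x (complex.Re (f x))%:E)%E +i*
  fine (\int[mu]_x (complex.Im (f x))%:E)%E.

(* beta * c_beta(l) * |l|^(-1-beta) dl as a set function. *)
Definition nu_beta (beta cp cm : R) (A : set R) : \bar R :=
  (\int[lebesgue_measure]_(l in A)
     (beta * (if (0 < l)%R then cp else cm) * `|l| `^ (- 1 - beta))%:E)%E.

(* 0 +i* y is the imaginary number i y. *)
Definition e_fun (beta xi1 xi2 l1 l2 : R) : R[i] :=
  cexp (0 +i* (l1 * xi1 + l2 * xi2)) - 1 -
  (if beta < 1 then 0
   else if beta == 1 then 0 +i* (xi1 * l1 * \1_`[(-1 : R), 1] l1)
   else 0 +i* (l1 * xi1)).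

Definition levy_exponent (beta cp cm : R) (rho : R -> R) (xi1 xi2 : R) : R[i] :=
  cintegral (pushforward (nu_beta beta cp cm) (fun l => (l, rho l)))
    (fun l => e_fun beta xi1 xi2 l.1 l.2).

Record levy_process d (Om : measurableType d) (Pr : probability Om R)
    (Z : Om -> skorokhod (R * R)%type) : Prop := {
  levy_measurable : forall t, measurable_fun setT (fun w => Z w t);
  levy_start : {ae Pr, forall w, Z w 0 = 0};
  levy_independent : forall (n : nat) (t : nat -> R) (B : nat -> set (R * R)),
    0 <= t 0%N -> nondecreasing_seq t -> (forall i, measurable (B i)) ->
    Pr (\bigcap_(i in `I_n) [set w | B i (Z w (t i.+1) - Z w (t i))]) =
    (\prod_(i < n) Pr [set w | B i (Z w (t i.+1) - Z w (t i))%R])%E;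
  levy_stationary : forall (s t : R) (B : set (R * R)),
    0 <= s -> s <= t -> measurable B ->
    Pr [set w | B (Z w t - Z w s)] = Pr [set w | B (Z w (t - s) - Z w 0)];
  levy_stochastically_continuous : forall t e : R, 0 <= t -> 0 < e ->
    Pr [set w | e <= `|Z w s - Z w t| ] @[s --> t] --> 0%E }.

Definition has_exponent d (Om : measurableType d) (Pr : probability Om R)
    (Z : Om -> skorokhod (R * R)%type) (psi : R -> R -> R[i]) : Prop :=
  forall t xi1 xi2 : R, 0 <= t ->
    cintegral Pr (fun w => cexp (0 +i* (xi1 * (Z w t).1 + xi2 * (Z w t).2))) =
    cexp (t%:C * psi xi1 xi2).

End Levy.

(* Main.v *)
Require Import Defs.
From HB Require Import structures.
From mathcomp Require Import all_boot all_order all_algebra.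
From mathcomp Require Import all_classical all_reals all_analysis.
From mathcomp Require Import complex measurable_realfun ring lra.

Set Implicit Arguments.
Unset Strict Implicit.
Unset Printing Implicit Defensive.

Import Order.TTheory GRing.Theory Num.Def Num.Theory.
Import numFieldNormedType.Exports.

Local Open Scope classical_set_scope.
Local Open Scope ring_scope.

(** Rescale [V] and [tau] to [W = V / K^(1/beta)] and [T = tau / K^(1/alpha)]. Up to an error
    that is uniformly small on [[0, t]] with high probability, the rescaled sums are the
    sums of the jumps [(W, rho W)] over the times at which [|W| >= delta], plus a linear
    drift: the small jumps of [W], once centered, are controlled by a maximal inequality
    drawn from the spectral gap, the small values of [T] by their first moment, and
    [tau = rho V + o] at the big ones since [gamma > alpha]. By (A2) and (B2), [P] maps the
    indicator of a level set of [|V|] to a function of small L^2 norm, and the spectral gap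
    prevents these errors from accumulating. Hence the characteristic function of the sum
    of the big jumps is asymptotically a product of one-step characteristic functions, which
    gives the convergence of the finite-dimensional laws, and two big jumps are unlikely to
    happen within a time [K / m], so that rounding the time to a grid of step [1 / m] is a small
    J1 perturbation of the path. A bounded continuous functional of the path is approximated
    from below by functionals that are Lipschitz for J1, and those are functions of the values
    of the path on the grid. *)

(** * Expectations of bounded measurable functions *)

(** What has to be beaten is the number of steps. A level set [B] of [|V|] that is reached about
    once in [K] steps has mass [b] of order [1 / K]. Contractivity of [P] only bounds the L^2 norm
    of [P 1_B] by the square root of [b]; smoothing improves this to [C b]. By Cauchy-Schwarz a step
    then departs from independence by [b^(3/2)], and of the order of [K] steps cost [K^(-1/2)]. The
    laws of [V / K^(1/beta)] change with [N], and their limit has infinite mass near 0. Quantile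
    functions represent [K] times these laws, and the limit, as images of one Lebesgue measure, on
    which dominated convergence applies. Cutting the jumps at [delta] leaves a drift that depends on
    [delta] and [N]. It is kept inside the exponents, where it cancels; its own limit is never
    computed. The pseudo-distance is not symmetric, so grid approximation is proved in both
    directions. Laws on the grid are compared through explicit trigonometric polynomials, and
    functionals of paths through lower bounds for [F] and [- F], so that no compactness of families
    of measures is used. *)

Section BoundedMeasurable.
Context {R : realType} {d} {T : measurableType d}.
Implicit Types (f g : T -> R).

(** In this class expectations are real and linear without integrability conditions, and [P]
    preserves it. Unbounded functions are truncated, or treated together with the tails. *)
Definition bm f := measurable_fun setT f /\ exists M : R, forall x, `|f x| <= M.

Lemma bm_meas f : bm f -> measurable_fun setT f. Proof. by case. Qed.

Lemma bm_cst c : bm (fun=> c).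
Proof. by split; [exact: measurable_cst|exists `|c|]. Qed.

Lemma bmD f g : bm f -> bm g -> bm (fun x => f x + g x).
Proof.
move=> [mf [M fM]] [mg [N gN]]; split; first exact: measurable_funD.
by exists (M + N) => x; rewrite (le_trans (ler_normD _ _))// lerD.
Qed.

Lemma bmM f g : bm f -> bm g -> bm (fun x => f x * g x).
Proof.
move=> [mf [M fM]] [mg [N gN]]; split; first exact: measurable_funM.
by exists (M * N) => x; rewrite normrM ler_pM.
Qed.

Lemma bmZ c f : bm f -> bm (fun x => c * f x).
Proof. by move=> bf; apply: bmM => //; exact: bm_cst. Qed.

Lemma bmN f : bm f -> bm (fun x => - f x).
Proof.
move=> bf; rewrite (_ : (fun x => _) = (fun x => -1 * f x)); first exact: bmZ.
by apply/funext => x; rewrite mulN1r.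
Qed.

Lemma bmB f g : bm f -> bm g -> bm (fun x => f x - g x).
Proof. by move=> bf bg; apply: bmD => //; exact: bmN. Qed.

Lemma bm_sqr f : bm f -> bm (fun x => f x ^+ 2).
Proof. by move=> bf; under eq_fun do rewrite expr2; exact: bmM. Qed.

Lemma bm_indic A : measurable A -> bm (\1_A : T -> R).
Proof.
move=> mA; split; first exact: measurable_indic.
by exists 1 => x; rewrite indicE ger0_norm ?ler0n// lern1 leq_b1.
Qed.

Lemma bm_norm f : bm f -> bm (fun x => `|f x|).
Proof.
move=> [mf [M fM]]; split; first exact: measurableT_comp.
by exists M => x; rewrite normr_id.
Qed.

Lemma bm_sum (I : Type) (r : seq I) (P : pred I) (F : I -> T -> R) :
  (forall i, bm (F i)) -> bm (fun x => \sum_(i <- r | P i) F i x).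
Proof.
move=> bF; elim: r => [|i r IH].
  by under eq_fun do rewrite big_nil; exact: bm_cst.
under eq_fun do rewrite big_cons.
by case: (P i) => //; exact: bmD.
Qed.

Lemma bm_prod (I : Type) (r : seq I) (P : pred I) (F : I -> T -> R) :
  (forall i, bm (F i)) -> bm (fun x => \prod_(i <- r | P i) F i x).
Proof.
move=> bF; elim: r => [|i r IH].
  by under eq_fun do rewrite big_nil; exact: bm_cst.
under eq_fun do rewrite big_cons.
by case: (P i) => //; exact: bmM.
Qed.

Lemma bm_bounded M f : measurable_fun setT f -> (forall x, `|f x| <= M) -> bm f.
Proof. by move=> mf fM; split=> //; exists M. Qed.

Lemma bm_comp (g : R -> R) M f : measurable_fun setT g ->
  (forall x, `|g x| <= M) -> measurable_fun setT f -> bm (fun x => g (f x)).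
Proof.
move=> mg gM mf; split; first exact: measurableT_comp.
by exists M => x.
Qed.

Lemma bm_cos f : measurable_fun setT f -> bm (fun x => cos (f x)).
Proof.
apply: (@bm_comp cos 1); first by apply: continuous_measurable_fun; exact: continuous_cos.
by move=> x; rewrite ler_norml cos_geN1 cos_le1.
Qed.

Lemma bm_sin f : measurable_fun setT f -> bm (fun x => sin (f x)).
Proof.
apply: (@bm_comp sin 1); first by apply: continuous_measurable_fun; exact: continuous_sin.
by move=> x; rewrite ler_norml sin_geN1 sin_le1.
Qed.

End BoundedMeasurable.

Ltac bmt := repeat (first [assumption | exact: bm_cst | apply: bm_sqr |
  apply: bm_norm | apply: bmD | apply: bmN | apply: bmM |
  (apply: bm_indic => //) ]).

Lemma bm_compT {R : realType} {d d'} {T : measurableType d} {T' : measurableType d'}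
    (f : T -> R) (X : T' -> T) :
  bm f -> measurable_fun setT X -> bm (fun w => f (X w)).
Proof.
by move=> [mf [M fM]] mX; split; [exact: measurableT_comp|exists M].
Qed.

Section Expectation.
Context {R : realType} {d} {T : measurableType d} (mu : probability T R).
Implicit Types (f g : T -> R).

Definition Ex f : R := (\int[mu]_x f x)%R.

Lemma bm_integrable f : bm f -> mu.-integrable setT (EFin \o f).
Proof.
move=> [mf [M fM]]; apply: measurable_bounded_integrable => //.
  by rewrite -ge0_fin_numE // fin_num_measure.
exists M; split; first exact: num_real.
by move=> x Mx y _ /=; rewrite (le_trans (fM y))// ltW.
Qed.

Lemma ExE f : bm f -> (\int[mu]_x (f x)%:E)%E = (Ex f)%:E.
Proof.
move=> bf; rewrite /Ex /Rintegral fineK//.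
by apply: integrable_fin_num => //; exact: bm_integrable.
Qed.

Lemma Ex_cst c : Ex (fun=> c) = c.
Proof.
have mu1 : fine (mu setT) = 1 by rewrite probability_setT.
by rewrite /Ex Rintegral_cst// -[RHS]mulr1; congr (_ * _).
Qed.

Lemma ExD f g : bm f -> bm g -> Ex (fun x => f x + g x) = Ex f + Ex g.
Proof. by move=> bf bg; rewrite /Ex RintegralD//; exact: bm_integrable. Qed.

Lemma ExB f g : bm f -> bm g -> Ex (fun x => f x - g x) = Ex f - Ex g.
Proof. by move=> bf bg; rewrite /Ex RintegralB//; exact: bm_integrable. Qed.

Lemma ExZ c f : bm f -> Ex (fun x => c * f x) = c * Ex f.
Proof. by move=> bf; rewrite /Ex RintegralZl//; exact: bm_integrable. Qed.

Lemma ExN f : bm f -> Ex (fun x => - f x) = - Ex f.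
Proof.
move=> bf; rewrite -mulN1r -ExZ//; congr Ex; apply/funext => x.
by rewrite mulN1r.
Qed.

Lemma Ex_sum (I : Type) (r : seq I) (P : pred I) (F : I -> T -> R) :
  (forall i, bm (F i)) ->
  Ex (fun x => \sum_(i <- r | P i) F i x) = \sum_(i <- r | P i) Ex (F i).
Proof.
move=> bF; elim: r => [|i r IH].
  by rewrite big_nil; under eq_fun do rewrite big_nil; exact: Ex_cst.
rewrite big_cons; under eq_fun do rewrite big_cons.
by case: (P i) => //; rewrite ExD ?IH//; exact: bm_sum.
Qed.

Lemma Ex_le f g : bm f -> bm g -> (forall x, f x <= g x) -> Ex f <= Ex g.
Proof.
by move=> bf bg fg; apply: le_Rintegral => //; exact: bm_integrable.
Qed.

Lemma Ex_ge0 f : (forall x, 0 <= f x) -> 0 <= Ex f.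
Proof. by move=> f0; apply: Rintegral_ge0. Qed.

Lemma Ex_abs f : bm f -> `|Ex f| <= Ex (fun x => `|f x|).
Proof. by move=> bf; apply: le_normr_Rintegral => //; exact: bm_integrable. Qed.

Lemma Ex_le_cst f c : bm f -> (forall x, f x <= c) -> Ex f <= c.
Proof. by move=> bf fc; rewrite -(Ex_cst c); apply: Ex_le => //; exact: bm_cst. Qed.

Lemma Ex_abs_le f M : bm f -> (forall x, `|f x| <= M) -> `|Ex f| <= M.
Proof.
move=> bf fM; apply: (le_trans (Ex_abs bf)); apply: Ex_le_cst => //.
exact: bm_norm.
Qed.

Lemma Ex_dist f g e : bm f -> bm g -> (forall x, `|f x - g x| <= e) ->
  `|Ex f - Ex g| <= e.
Proof.
by move=> bf bg fg; rewrite -ExB//; apply: Ex_abs_le => //; exact: bmB.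
Qed.

Lemma Ex_indic A : measurable A -> Ex \1_A = fine (mu A).
Proof. by move=> mA; rewrite /Ex /Rintegral integral_indic// setIT. Qed.

Lemma fine_muE A : measurable A -> (fine (mu A))%:E = mu A.
Proof. by move=> mA; rewrite fineK// fin_num_measure. Qed.

(** The polynomial [t ^ 2 A - 2 t B + C] is an expectation of squares, hence nonnegative for every
    [t]. *)
Lemma Ex_CS f g : bm f -> bm g ->
  Ex (fun x => f x * g x) ^+ 2 <= Ex (fun x => f x ^+ 2) * Ex (fun x => g x ^+ 2).
Proof.
move=> bf bg; set A := Ex (fun x => f x ^+ 2); set C := Ex (fun x => g x ^+ 2).
set B := Ex _.
have bff := bm_sqr bf; have bgg := bm_sqr bg; have bfg := bmM bf bg.
have A0 : 0 <= A by apply: Ex_ge0 => x; exact: sqr_ge0.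
have C0 : 0 <= C by apply: Ex_ge0 => x; exact: sqr_ge0.
have key t : 0 <= t ^+ 2 * A - 2 * t * B + C.
  suff -> : t ^+ 2 * A - 2 * t * B + C = Ex (fun x => (t * f x - g x) ^+ 2).
    by apply: Ex_ge0 => x; exact: sqr_ge0.
  rewrite (_ : (fun x => _) =
    (fun x => t ^+ 2 * f x ^+ 2 - 2 * t * (f x * g x) + g x ^+ 2)); last first.
    by apply/funext => x; ring.
  by rewrite ExD ?ExB ?ExZ//; bmt.
have [A00|A1] := eqVneq A 0.
  have [->|B0] := eqVneq B 0; first by rewrite expr0n/= mulr_ge0.
  (* With [A = 0] the polynomial is affine in [t]; this value of [t] makes it equal to [-1]. *)
  have := key ((C + 1) / (2 * B)); rewrite A00 mulr0 add0r.
  have -> : 2 * ((C + 1) / (2 * B)) * B = C + 1.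
    by field; rewrite B0.
  by move=> h; exfalso; lra.
have Ap : 0 < A by rewrite lt_def A1.
have := key (B / A).
have -> : (B / A) ^+ 2 * A - 2 * (B / A) * B + C = (A * C - B ^+ 2) / A by field.
by rewrite pmulr_lge0 ?invr_gt0// subr_ge0.
Qed.

Lemma Ex_abs_sqr f : bm f -> Ex (fun x => `|f x|) ^+ 2 <= Ex (fun x => f x ^+ 2).
Proof.
move=> bf; have := Ex_CS (bm_norm bf) (bm_cst 1).
under eq_fun do rewrite mulr1.
under [X in Ex X * _]eq_fun do rewrite real_normK ?num_real//.
by under [X in _ * Ex X]eq_fun do rewrite expr1n; rewrite Ex_cst mulr1.
Qed.

Lemma Ex_cvg (F : nat -> T -> R) f (M : R) : (forall n, measurable_fun setT (F n)) ->
  (forall n x, `|F n x| <= M) -> (forall x, F n x @[n --> \oo] --> f x) ->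
  Ex (F n) @[n --> \oo] --> Ex f.
Proof.
move=> mF FM Ff.
have bF n : bm (F n) by exact: bm_bounded.
have mf : measurable_fun setT f.
  by apply: (@measurable_fun_cvg _ _ _ setT F).
have fM x : `|f x| <= M.
  apply: (ler_cvg_to (cvg_norm (Ff x)) (cvg_cst M)).
  by apply: nearW => n; exact: FM.
have bf : bm f by exact: bm_bounded fM.
have : (\int[mu]_x (EFin \o F n) x)%E @[n --> \oo] --> (\int[mu]_x (EFin \o f) x)%E.
  apply: (@dominated_cvg _ _ _ mu _ measurableT (fun n => EFin \o F n) (EFin \o f) (fun=> M%:E)).
  - by move=> n; apply/measurable_EFinP.
  - by move=> x _; apply: cvg_EFin; [exact: nearW|exact: Ff].
  - by [].
  - by apply: (bm_integrable (bm_cst M)).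
  - by move=> n x _; rewrite /= lee_fin.
under eq_cvg do rewrite /= ExE//.
by rewrite /= ExE// => /fine_cvgP[].
Qed.

(** Markov's inequality for any event on which [f] is large, so that it covers unions over times as
    well as level sets. *)
Lemma Ex_markov A f (l : R) : bm f -> measurable A -> 0 < l ->
  (forall x, 0 <= f x) -> (forall x, A x -> l <= f x) ->
  fine (mu A) <= Ex f / l.
Proof.
move=> bf mA l0 f0 fl; rewrite ler_pdivlMr// -Ex_indic// mulrC -ExZ; last exact: bm_indic.
apply: Ex_le => //; first by apply: bmZ; exact: bm_indic.
move=> x; rewrite indicE; case: (boolP (x \in A)) => [|_]; last by rewrite mulr0.
by rewrite inE mulr1; exact: fl.
Qed.

End Expectation.

Section BoundedMeasurableApprox.
Context {R : realType} {d} {T : measurableType d}.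

(* The level sets of [floor (f / e)] give the approximating step function. *)
Lemma bm_approx (f : T -> R) (e : R) : bm f -> 0 < e ->
  exists n (c : 'I_n -> R) (A : 'I_n -> set T), (forall i, measurable (A i)) /\
    forall x, `|f x - \sum_(i < n) c i * \1_(A i) x| <= e.
Proof.
move=> [mf [M fM]] e0.
pose n := (Num.truncn (2 * M / e)).+1.
pose A (i : 'I_n) := f @^-1` [set y | i%:R * e <= y + M < i.+1%:R * e].
exists n, (fun i => i%:R * e - M), A; split=> [i|x].
  rewrite -(setTI (A i)); apply: mf => //.
  rewrite [X in measurable X](_ : _ = [set` `[i%:R * e - M, i.+1%:R * e - M[%R])//.
  by apply/seteqP; split=> y /=; rewrite in_itv/= lerBlDr ltrBrDr.
have M0 : 0 <= M by rewrite (le_trans _ (fM x)).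
have fxM : 0 <= f x + M by have := fM x; rewrite ler_norml => /andP[]; lra.
have fx0 : 0 <= (f x + M) / e by rewrite divr_ge0// ltW.
have /andP[k1 k2] := truncn_itv fx0.
set k := Num.truncn _ in k1 k2.
have kn : (k < n)%N.
  rewrite ltnS; apply: le_truncn; rewrite ler_pM2r ?invr_gt0//.
  by have := fM x; rewrite ler_norml => /andP[]; lra.
have k1' : k%:R * e <= f x + M by rewrite -ler_pdivlMr.
have k2' : f x + M < k.+1%:R * e by rewrite -ltr_pdivrMr.
rewrite (bigD1 (Ordinal kn))//= big1 => [|i ik].
  have hA : A (Ordinal kn) x by rewrite /A /= k1' k2'.
  rewrite addr0 indicE (mem_set hA) mulr1.
  rewrite ler_norml; move: k2'; rewrite -addn1 natrD mulrDl mul1r; lra.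
rewrite indicE memNset ?mulr0//= => /andP[i1 i2].
move/eqP: ik; apply; apply: val_inj => /=.
apply/esym/truncn_def; by rewrite ler_pdivlMr// ltr_pdivrMr// i1 i2.
Qed.

(** A monotone class argument in linear form: uniform approximation by step functions replaces
    monotone limits. It is applied with [L] a difference of two expectations. *)
Lemma bm_linear_eq0 (L : (T -> R) -> R) (C : R) :
  (forall f g : T -> R, bm f -> bm g -> L (fun x => f x + g x) = L f + L g) ->
  (forall c f, bm f -> L (fun x => c * f x) = c * L f) ->
  (forall A, measurable A -> L \1_A = 0) ->
  (forall f (r : R), bm f -> (forall x, `|f x| <= r) -> `|L f| <= C * r) ->
  forall f, bm f -> L f = 0.
Proof.
move=> LD LZ L1 LC f bf; apply/eqP; rewrite -normr_le0.
apply/ler_addgt0Pl => e e0; rewrite addr0.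
have C0 : 0 < `|C| + 1 by rewrite ltr_wpDl.
have [n [c [A [mA fA]]]] := bm_approx bf (divr_gt0 e0 C0).
pose g x := \sum_(i < n) c i * \1_(A i) x.
have b1 i : bm (fun x => c i * \1_(A i) x) by apply: bmZ; exact: bm_indic.
have bg : bm g by exact: bm_sum.
have g0 : L g = 0.
  rewrite /g; elim: (index_enum _) => [|i s IH].
    rewrite (_ : (fun x => _) = (fun x => 0 * \1_set0 x)).
      by rewrite LZ ?mul0r//; exact: bm_indic.
    by apply/funext => x; rewrite big_nil mul0r.
  under eq_fun do rewrite big_cons.
  have b2 : bm (fun x => \sum_(j <- s) c j * \1_(A j) x) by exact: bm_sum.
  by rewrite (LD _ _ (b1 i) b2) IH addr0 LZ ?L1 ?mulr0//; exact: bm_indic.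
have -> : f = fun x => g x + (f x - g x) by apply/funext => x; rewrite addrC subrK.
rewrite LD//; last exact: bmB.
rewrite g0 add0r (le_trans (LC _ _ (bmB bf bg) fA))//.
rewrite mulrA ler_pdivrMr// mulrC ler_pM2l//.
by rewrite (le_trans (ler_norm C))// lerDl.
Qed.

End BoundedMeasurableApprox.

Section ExLaw.
Context {R : realType} {d d'} {T : measurableType d} {T' : measurableType d'}.

Lemma Ex_law (P : probability T R) (mu : probability T' R) (X : T -> T') (f : T' -> R) :
  measurable_fun setT X ->
  (forall A, measurable A -> P (X @^-1` A) = mu A) -> bm f ->
  Ex P (fun w => f (X w)) = Ex mu f.
Proof.
move=> mX lX bf; apply/eqP; rewrite -subr_eq0; apply/eqP.
have bX g : bm g -> bm (fun w => g (X w)) by move=> bg; exact: bm_compT.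
apply: (bm_linear_eq0 (L := fun g => Ex P (fun w => g (X w)) - Ex mu g) (C := 2)) bf.
- by move=> g h bg bh; rewrite !ExD//; [ring|exact: bX|exact: bX].
- by move=> c g bg; rewrite !ExZ//; [ring|exact: bX].
- move=> A mA; rewrite (_ : (fun w => \1_A (X w)) = \1_(X @^-1` A)); last first.
    by apply/funext => w; rewrite !indicE; congr (_%:R); rewrite !inE.
  by rewrite !Ex_indic ?lX ?subrr// -[_ @^-1` _]setTI; exact: mX.
- move=> g r bg gr; rewrite (le_trans (ler_normB _ _))// mulr_natl mulr2n.
  by rewrite lerD// Ex_abs_le//; exact: bX.
Qed.

End ExLaw.

(** * Time changes and cadlag paths *)

Section TimeChange.
Context {R : realType}.
Implicit Types (l : R -> R) (s t : R).

Lemma time_change_ge0 l s : time_change l -> 0 <= s -> 0 <= l s.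
Proof.
move=> [_ l0] s0; have : (l @` `[0, +oo[%classic) (l s).
  by exists s => //=; rewrite in_itv/= andbT.
by rewrite l0 /= in_itv/= andbT.
Qed.

Lemma time_change_lt l s t : time_change l -> 0 <= s -> 0 <= t ->
  (l s < l t) = (s < t).
Proof.
move=> [lm _] s0 t0; apply/idP/idP => [lst|]; last exact: lm.
rewrite ltNge; apply/negP; rewrite le_eqVlt => /predU1P[ts|ts].
  by move: lst; rewrite ts ltxx.
by have := lt_trans lst (lm _ _ t0 ts); rewrite ltxx.
Qed.

Lemma time_change_le l s t : time_change l -> 0 <= s -> 0 <= t ->
  (l s <= l t) = (s <= t).
Proof. by move=> tl s0 t0; rewrite !leNgt time_change_lt. Qed.

Lemma time_change_id : time_change (@id R).
Proof. by split=> //; rewrite image_id. Qed.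

Lemma time_change_comp l l' : time_change l -> time_change l' ->
  time_change (l' \o l).
Proof.
move=> tl tl'; split=> [s t s0 st /=|].
  by apply: (proj1 tl'); [exact: time_change_ge0|exact: (proj1 tl)].
by rewrite -image_comp (proj2 tl) (proj2 tl').
Qed.

(* The pairs of [p] are interpolated linearly; after the last pair the time
   change is a translation. *)
Lemma time_change_interpolation (p : seq (R * R)) (A B : R) :
  path (fun a b : R * R => (a.1 < b.1) && (a.2 < b.2)) (0, 0) p ->
  A <= 0 <= B -> {in p, forall a, A <= a.2 - a.1 <= B} ->
  exists l, [/\ time_change l, l 0 = 0, {in p, forall a, l a.1 = a.2}
    & forall s, 0 <= s -> A <= l s - s <= B].
Proof.
(* Induction on the number of pairs. Translating the first pair to the origin shifts the admissible
   displacements, so [A] and [B] have to vary. *)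
elim: {p}(size p) {-2}p (erefl (size p)) A B => [|n IH] [|[t1 u1] p]//= => [_|[sp]] A B.
  move=> _ AB _; exists id; split=> //; first exact: time_change_id.
  by move=> s _; rewrite subrr.
move=> /andP[/andP[/= t10 u10] pp] /andP[A0 B0] pAB.
have d1 : A <= u1 - t1 <= B by apply: (pAB (t1, u1)); rewrite mem_head.
pose sh (a : R * R) := (a.1 - t1, a.2 - u1).
have sps : size (map sh p) = n by rewrite size_map.
have [|||l [tl l0 lp lAB]] := IH _ sps (A - (u1 - t1)) (B - (u1 - t1)).
- rewrite -[(0, 0)](_ : sh (t1, u1) = _); last by rewrite /sh /= !subrr.
  by rewrite path_map; apply: sub_path pp => a b /=; rewrite !ltrD2r.
- by move: d1; rewrite subr_le0 subr_ge0.
- move=> a /mapP[b bp ->] /=; have := pAB b.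
  rewrite inE bp orbT => /(_ isT) /andP[b1 b2]; apply/andP; split; lra.
pose k s := if s <= t1 then s * (u1 / t1) else u1 + l (s - t1).
have t10' : t1 != 0 by rewrite gt_eqF.
have u10' : u1 != 0 by rewrite gt_eqF.
have r0 : 0 < u1 / t1 by rewrite divr_gt0.
have kt1 : t1 * (u1 / t1) = u1 by field.
have lpos s : 0 < s -> 0 < l s by move=> s0; rewrite -l0; apply: (proj1 tl).
have km s t : 0 <= s -> s < t -> k s < k t.
  move=> s0 st; rewrite /k; case: ifPn => st1; case: ifPn => tt1.
  - by rewrite ltr_pM2r.
  - rewrite -ltNge in tt1; apply: (@le_lt_trans _ _ u1).
      by rewrite -[leRHS]kt1 ler_pM2r.
    by rewrite ltrDl lpos// subr_gt0.
  - by move: st1; rewrite (le_trans (ltW st) tt1).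
  - rewrite -ltNge in st1; rewrite ltrD2l; apply: (proj1 tl); last by rewrite ltrD2r.
    by rewrite subr_ge0 ltW.
have k0 : k 0 = 0 by rewrite /k ltW// mul0r.
exists k; split=> //.
- split=> //; apply/seteqP; split=> y /=; rewrite in_itv/= andbT.
    move=> [s]; rewrite !in_itv/= !andbT => s0 <-.
    move: s0; rewrite le_eqVlt => /predU1P[<-|s0]; first by rewrite k0.
    by rewrite -k0 ltW// km.
  move=> y0; have [yu1|yu1] := leP y u1.
    exists (y / (u1 / t1)); rewrite ?in_itv/= ?andbT.
      by rewrite divr_ge0// ltW.
    have yt1 : y / (u1 / t1) <= t1 by rewrite ler_pdivrMr// kt1.
    by rewrite /k yt1 divfK// gt_eqF.
  have : `[0, +oo[%classic (y - u1) by rewrite /= in_itv/= andbT subr_ge0 ltW.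
  rewrite -(proj2 tl) => -[s /=]; rewrite in_itv/= andbT => s0 ls.
  have s1 : 0 < s.
    by rewrite lt_def s0 andbT; apply/negP => /eqP s00; move: ls; rewrite s00 l0; lra.
  exists (s + t1); first by rewrite in_itv/= andbT addr_ge0// ltW.
  rewrite /k ifN; last by rewrite -ltNge ltrDr.
  by rewrite addrK ls addrC subrK.
- move=> a; rewrite inE => /predU1P[->/=|ap]; first by rewrite /k lexx kt1.
  have at1 : t1 < a.1.
    have /(_ _ ap) : {in p, forall b, (t1 < b.1) && (u1 < b.2)}.
      apply/allP; have := pp.
      by apply: (@order_path_min _ (fun a b : R * R => (a.1 < b.1) && (a.2 < b.2)) (t1, u1)) => b c
        e /andP[h1 h2] /andP[h3 h4]; rewrite (lt_trans h1)// (lt_trans h2).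
    by case/andP.
  rewrite /k ifN -?ltNge//; have := lp (sh a) (map_f _ ap); rewrite /sh/= => ->.
  by rewrite addrC subrK.
- move=> s s0; rewrite /k; case: ifPn => st1.
    have sr : 0 <= s / t1 <= 1.
      by rewrite ler_pdivrMr// mul1r st1 divr_ge0// ltW.
    (* On the first piece the displacement is a fraction, between 0 and 1, of the displacement
       [u1 - t1] at its end. *)
    have -> : s * (u1 / t1) - s = (s / t1) * (u1 - t1) by field.
    case/andP: d1 => d1 d2; case/andP: sr => sr1 sr2.
    move: (s / t1) (u1 - t1) d1 d2 sr1 sr2 => r v h1 h2 h3 h4.
    by have [v0|v0] := leP 0 v; apply/andP; split; nra.
  rewrite -ltNge in st1; have := lAB (s - t1); rewrite subr_ge0 ltW// => /(_ isT).
  by move=> /andP[h1 h2]; apply/andP; split; lra.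
Qed.

Definition nat_ceil (x : R) : nat := `|Num.ceil x|%N.

Lemma nat_ceil_le x n : 0 <= x -> (nat_ceil x <= n)%N = (x <= n%:R).
Proof.
move=> x0; rewrite /nat_ceil -lez_nat gez0_abs ?ceil_ge0//; last first.
  by rewrite (lt_le_trans _ x0)// ltrN10.
by rewrite ceil_le_int.
Qed.

Lemma nat_ceil_ge x : 0 <= x -> x <= (nat_ceil x)%:R.
Proof. by move=> x0; rewrite -nat_ceil_le. Qed.

Lemma nat_ceil_lt x : 0 <= x -> (nat_ceil x)%:R < x + 1.
Proof.
move=> x0; rewrite ltNge; apply/negP => h.
have : (0 < nat_ceil x)%N.
  by rewrite lt0n; apply/negP => /eqP e; move: h; rewrite e; lra.
move=> c0; have : (nat_ceil x <= (nat_ceil x).-1)%N.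
  rewrite nat_ceil_le// -(lerD2r 1) (le_trans h)//.
  by rewrite -[in leLHS](prednK c0) -natr1.
by rewrite leqNgt ltn_predL c0.
Qed.

(** The Galois connection between floor and ceiling: a jump at time [x] is seen from the grid point
    below [y] exactly when the grid point above [x] has been reached. This is why jump times are
    rounded up. *)
Lemma le_truncn_ceil (x y : R) : 0 <= x -> 0 <= y ->
  (x <= (Num.truncn y)%:R) = ((nat_ceil x)%:R <= y).
Proof. by move=> x0 y0; rewrite -nat_ceil_le// truncn_ge_nat. Qed.

Section Grid.
Variables (m : nat) (ts : seq R).
Hypothesis m0 : (0 < m)%N.
Hypothesis ts0 : {in ts, forall t : R, 0 < t}.
Hypothesis tsm : sorted (fun a b : R => a + m%:R^-1 < b) ts.

Let c (t : R) : R := (nat_ceil (m%:R * t))%:R / m%:R.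
Let M0 : 0 < m%:R :> R. Proof. by rewrite ltr0n. Qed.
Let c_gt0 t : 0 < t -> 0 < c t.
Proof.
move=> t0; rewrite /c divr_gt0// (lt_le_trans _ (nat_ceil_ge _)) ?mulr_gt0//.
by rewrite ltW// mulr_gt0.
Qed.
Let c_bound t : 0 < t -> 0 <= c t - t <= m%:R^-1.
Proof.
move=> t0; have mt0 : 0 <= m%:R * t by rewrite ltW// mulr_gt0.
have h1 := nat_ceil_ge mt0; have h2 := nat_ceil_lt mt0.
rewrite subr_ge0 /c ler_pdivlMr// mulrC h1/= lerBlDr ler_pdivrMr//.
by rewrite mulrDl mulVf ?gt_eqF// mulrC addrC ltW// mulrC.
Qed.
Let c_mono (a b : R) : 0 < a -> a + m%:R^-1 < b -> c a < c b.
Proof.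
move=> a0 ab; rewrite /c ltr_pM2r ?invr_gt0//.
have h1 := nat_ceil_lt (ltW (mulr_gt0 M0 a0)); apply: (lt_le_trans h1).
have b0 : 0 < b by rewrite (lt_trans _ ab)// addr_gt0// invr_gt0.
apply: le_trans (nat_ceil_ge (ltW (mulr_gt0 M0 b0))).
rewrite -(ler_pM2l (x := m%:R^-1)) ?invr_gt0// mulrDr !mulKf ?gt_eqF// mulr1.
exact: ltW.
Qed.
Let gap_lt (a b : R) : a + m%:R^-1 < b -> a < b.
Proof. by move=> ab; rewrite (lt_trans _ ab)// ltrDl invr_gt0. Qed.

(** Jump times more than [1 / m] apart are rounded to distinct grid points, so they can be
    interpolated into a time change, which sends [t] to [c t]. Along it, the path sampled on the
    grid crosses the jump times at the same moments as the path itself. *)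
Lemma time_grid_fwd : exists l, [/\ time_change l,
  forall s, 0 <= s -> `|l s - s| <= m%:R^-1 &
  forall s, 0 <= s -> {in ts, forall t,
    (t <= s) = (t <= (Num.truncn (m%:R * l s))%:R / m%:R)}].
Proof.
have [|||l [tl l0 lp lB]] := @time_change_interpolation [seq (t, c t) | t <- ts] 0 m%:R^-1.
- case: ts ts0 tsm => [//|a s] /= h hp.
  have a0 : 0 < a by apply: h; rewrite mem_head.
  rewrite a0 c_gt0//= path_map.
  have hs : all (fun t => 0 < t) (a :: s) by apply/allP.
  apply: (sub_in_path (P := fun t => 0 < t)) hs hp => x y x0 y0 xy /=.
  by rewrite gap_lt//= c_mono.
- by rewrite lexx invr_ge0 ltW.
- by move=> _ /mapP[t tts ->] /=; apply: c_bound; exact: ts0.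
exists l; split=> // s s0.
  by have /andP[h1 h2] := lB _ s0; rewrite ger0_norm.
move=> t tts; have t0 := ts0 tts.
rewrite -(time_change_le tl (ltW t0) s0) (lp (t, c t)) ?map_f//=.
rewrite ler_pdivlMr// [t * _]mulrC le_truncn_ceil ?mulr_ge0 ?(ltW t0)// ?(ltW M0)//.
  by rewrite /c ler_pdivrMr// [l s * _]mulrC.
exact: time_change_ge0.
Qed.

(** The interpolation of the inverse correspondence, from [c t] to [t]. It serves for the other
    order of the arguments of [sdist]. *)
Lemma time_grid_bwd : exists l, [/\ time_change l,
  forall s, 0 <= s -> `|l s - s| <= m%:R^-1 &
  forall s, 0 <= s -> {in ts, forall t,
    (t <= l s) = (t <= (Num.truncn (m%:R * s))%:R / m%:R)}].
Proof.
have [|||l [tl l0 lp lB]] := @time_change_interpolation [seq (c t, t) | t <- ts] (- m%:R^-1) 0.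
- case: ts ts0 tsm => [//|a s] /= h hp.
  have a0 : 0 < a by apply: h; rewrite mem_head.
  rewrite a0 c_gt0//= path_map.
  have hs : all (fun t => 0 < t) (a :: s) by apply/allP.
  apply: (sub_in_path (P := fun t => 0 < t)) hs hp => x y x0 y0 xy /=.
  by rewrite c_mono//= gap_lt.
- by rewrite lexx oppr_le0 invr_ge0 ltW.
- move=> _ /mapP[t tts ->] /=; have /andP[? ?] := c_bound (ts0 tts).
  apply/andP; split; lra.
exists l; split=> // s s0.
  by have /andP[h1 h2] := lB _ s0; rewrite ler0_norm// lerNl.
move=> t tts; have t0 := ts0 tts.
have := lp (c t, t) (map_f _ tts) => /= {1}<-.
rewrite (time_change_le tl _ s0) ?(ltW (c_gt0 t0))//.
rewrite ler_pdivlMr// [t * _]mulrC le_truncn_ceil ?mulr_ge0 ?(ltW t0)// ?(ltW M0)//.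
by rewrite /c ler_pdivrMr// [s * _]mulrC.
Qed.

End Grid.
End TimeChange.

(** * A pseudo-distance for the J1 topology *)

Section SkorokhodDistance.
Context {R : realType} {V : normedModType R}.
Implicit Types (x y z : skorokhod V) (e : R).

(* Coupling the tolerance [e] with the horizon [1 / e] makes [sdist] satisfy the
   triangle inequality, although its balls are the [J1_nbhd]s. *)
Definition sdist_set x y : set R :=
  [set e | 0 < e <= 1 /\ (e = 1 \/ J1_nbhd x e^-1 e y)].
Definition sdist x y : R := inf (sdist_set x y).

Lemma sdist_set1 x y : sdist_set x y 1.
Proof. by split; [rewrite ltr01 lexx|left]. Qed.

Lemma sdist_has_inf x y : has_inf (sdist_set x y).
Proof.
split; first by exists 1; exact: sdist_set1.
by exists 0 => e [/andP[/ltW]].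
Qed.

Lemma sdist_le x y e : sdist_set x y e -> sdist x y <= e.
Proof. by move=> he; apply: ge_inf => //; case: (sdist_has_inf x y). Qed.

Lemma sdist_ge0 x y : 0 <= sdist x y.
Proof.
apply: lb_le_inf; first by exists 1; exact: sdist_set1.
by move=> e [/andP[/ltW]].
Qed.

Lemma sdist_le1 x y : sdist x y <= 1.
Proof. exact/sdist_le/sdist_set1. Qed.

Lemma sdist_lt x y r : sdist x y < r -> exists2 e, sdist_set x y e & e < r.
Proof.
rewrite -subr_gt0 => h; have [e he] := inf_adherent h (sdist_has_inf x y).
by rewrite -/(sdist x y) addrC subrK => er; exists e.
Qed.

Lemma sdist_nbhd_le x y e : 0 < e -> J1_nbhd x e^-1 e y -> sdist x y <= e.
Proof.
move=> e0 h; have [e1|e1] := leP e 1; first by apply: sdist_le; split; [rewrite e0|right].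
by apply: (le_trans (sdist_le1 _ _)); exact: ltW.
Qed.

Lemma sdist_triangle x y z : sdist x z <= sdist x y + sdist y z.
Proof.
apply/ler_addgt0Pl => r r0.
have r20 : 0 < r / 2 by rewrite divr_gt0.
have [e1 [/andP[e10 e11] h1] l1] : exists2 e, sdist_set x y e & e < sdist x y + r / 2.
  by apply: sdist_lt; rewrite ltrDl.
have [e2 [/andP[e20 e21] h2] l2] : exists2 e, sdist_set y z e & e < sdist y z + r / 2.
  by apply: sdist_lt; rewrite ltrDl.
suff : sdist x z <= e1 + e2 by move=> h; lra.
have [lt1|ge1] := ltP (e1 + e2) 1; last exact: le_trans (sdist_le1 _ _) _.
have {}h1 : J1_nbhd x e1^-1 e1 y by case: h1 => // h1; exfalso; lra.
have {}h2 : J1_nbhd y e2^-1 e2 z by case: h2 => // h2; exfalso; lra.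
have [l [tl ld lx]] := h1; have [l' [tl' ld' lx']] := h2.
apply: sdist_nbhd_le; first by rewrite addr_gt0.
exists (l' \o l); split; first exact: time_change_comp.
- move=> s s0 /=; rewrite -(subrK (l s) (l' _)) -addrA (le_lt_trans (ler_normD _ _))//.
  by rewrite [ltRHS]addrC ltrD// ?ld// ld'//; exact: time_change_ge0.
- move=> s /andP[s0 sT] /=.
  rewrite -(subrK (y (l s)) (z _)) -addrA (le_lt_trans (ler_normD _ _))//.
  have ls0 : 0 <= l s by exact: time_change_ge0.
  have sT1 : s <= e1^-1.
    by apply: (le_trans sT); rewrite lef_pV2 ?posrE// ?addr_gt0// lerDl ltW.
  rewrite [ltRHS]addrC ltrD//; last by apply: lx; rewrite s0.
  apply: lx'; rewrite ls0/=.
  have lsb : l s <= s + e1.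
    by have := ld _ s0; rewrite ltr_norml => /andP[_ /ltW]; rewrite lerBlDl.
  (* The first time change may go beyond the horizon by [e1]. The inequality
     [(e1 + e2)^-1 + e1 <= e2^-1] amounts to [e2 (e1 + e2) <= 1]; this is what capping the distance
     at 1 provides. *)
  apply: (le_trans lsb); apply: (@le_trans _ _ ((e1 + e2)^-1 + e1)).
    by rewrite lerD2r.
  have le1 : e2 * (e1 + e2) <= 1 by rewrite mulr_ile1// ltW// addr_gt0.
  rewrite -subr_ge0.
  have -> : e2^-1 - ((e1 + e2)^-1 + e1) = e1 * (1 - e2 * (e1 + e2)) / (e2 * (e1 + e2)).
    by field; rewrite !gt_eqF// addr_gt0.
  have e12 : 0 <= e1 + e2 by rewrite addr_ge0// ltW.
  by rewrite divr_ge0 ?mulr_ge0 ?subr_ge0 ?(ltW e10) ?(ltW e20).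
Qed.

Lemma continuous_sdist (F : skorokhod V -> R) x e : continuous F -> 0 < e ->
  exists2 r, 0 < r & forall y, sdist x y < r -> `|F y - F x| < e.
Proof.
move=> cF e0; have : open (F @^-1` ball (F x) e).
  by apply: open_comp; [move=> y _; exact: cF|exact: ball_open].
move=> /(_ x); have Fx : (F @^-1` ball (F x) e) x by exact: ballxx.
move=> /(_ Fx)[T [r [r0 hr]]].
(* Below 1 the degenerate element of [sdist_set] is excluded, and below the inverse of [Num.max T 1]
   the horizon contains [[0, T]]. *)
exists (Num.min (Num.min r 1) (Num.max T 1)^-1).
  by rewrite !lt_min r0 ltr01 invr_gt0 lt_max ltr01 orbT.
move=> y /sdist_lt[s [/andP[s0 s1] hs]]; rewrite !lt_min => /andP[/andP[sr slt1] sT].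
have {}hs : J1_nbhd x s^-1 s y by case: hs slt1 => // ->; rewrite ltxx.
have := hr y; rewrite /ball/= distrC; apply.
apply: J1_nbhdS hs; last exact: ltW.
apply: (@le_trans _ _ (Num.max T 1)); first by rewrite le_max lexx.
rewrite -[leLHS]invrK lef_pV2 ?posrE ?invr_gt0 ?lt_max ?ltr01 ?orbT//.
exact: ltW.
Qed.

End SkorokhodDistance.

(** * Approximation of bounded functionals from below by Lipschitz ones *)

Section InfConvolution.
Context {R : realType} {V : normedModType R}.
Variables (F : skorokhod V -> R) (M : R).
Hypothesis FM : forall x, `|F x| <= M.
Implicit Types (x y : skorokhod V) (j : nat).

(** The Pasch-Hausdorff envelope of [F] for the pseudo-distance. It lies below [F], so that passing
    from it to [F] costs nothing in a lower bound. *)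
Definition inf_conv j x : R := inf [set F y + j%:R * sdist x y | y in setT].

Let lb j x : lbound [set F y + j%:R * sdist x y | y in setT] (- M).
Proof.
move=> _ [y _ <-]; have := FM y; rewrite ler_norml => /andP[h _].
by rewrite (le_trans h)// lerDl mulr_ge0// sdist_ge0.
Qed.

Let hi j x : has_inf [set F y + j%:R * sdist x y | y in setT].
Proof. by split; [exists (F x + j%:R * sdist x x), x|exists (- M); exact: lb]. Qed.

Lemma inf_conv_ge j x : - M <= inf_conv j x.
Proof. by apply: lb_le_inf; [case: (hi j x)|exact: lb]. Qed.

Lemma inf_conv_le_dist j x y : inf_conv j x <= F y + j%:R * sdist x y.
Proof. by apply: ge_inf; [case: (hi j x)|exists y]. Qed.

Lemma sdist_refl x : sdist x x = 0.
Proof.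
apply/eqP; rewrite eq_le sdist_ge0 andbT; apply/ler_addgt0Pl => e e0; rewrite addr0.
apply: sdist_nbhd_le => //; exists id; split; first exact: time_change_id.
  by move=> s _; rewrite subrr normr0.
by move=> s _; rewrite subrr normr0.
Qed.

Lemma inf_conv_le j x : inf_conv j x <= F x.
Proof. by have := inf_conv_le_dist j x x; rewrite sdist_refl mulr0 addr0. Qed.

Lemma inf_conv_bounded j x : `|inf_conv j x| <= M.
Proof.
rewrite ler_norml inf_conv_ge/= (le_trans (inf_conv_le _ _))//.
by have := FM x; rewrite ler_norml => /andP[].
Qed.

Lemma inf_conv_lip j x y : inf_conv j x <= inf_conv j y + j%:R * sdist x y.
Proof.
rewrite -lerBlDr; apply: lb_le_inf; first by case: (hi j y).
move=> _ [z _ <-]; rewrite lerBlDr (le_trans (inf_conv_le_dist _ _ z))//.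
by rewrite -addrA lerD2l -mulrDr ler_wpM2l// addrC sdist_triangle.
Qed.

(** Points at distance at least [r] from [x] are ruled out once the penalty [j r] exceeds the
    oscillation [2 M]; closer ones are handled by the continuity of [F]. *)
Lemma inf_conv_cvg x : continuous F -> inf_conv j x @[j --> \oo] --> F x.
Proof.
move=> cF; apply/cvgrPdist_le => e e0.
have [r r0 hr] := continuous_sdist x cF e0.
have M0 : 0 <= M by rewrite (le_trans _ (FM x)).
near=> j; rewrite ger0_norm ?subr_ge0 ?inf_conv_le// lerBlDr -lerBlDl.
apply: lb_le_inf; first by case: (hi j x).
move=> _ [y _ <-].
have [yr|yr] := ltP (sdist x y) r.
  have := hr _ yr; rewrite ltr_norml => /andP[h _].
  have : 0 <= j%:R * sdist x y by rewrite mulr_ge0// sdist_ge0.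
  by move=> h2; lra.
have h1 : F x <= M by have := FM x; rewrite ler_norml => /andP[].
have h2 : - M <= F y by have := FM y; rewrite ler_norml => /andP[].
have h3 : 2 * M <= j%:R * sdist x y.
  rewrite (@le_trans _ _ (j%:R * r))//; last by rewrite ler_wpM2l.
  rewrite -ler_pdivrMr//; near: j; exact: nbhs_infty_ger.
lra.
Unshelve. all: by end_near. Qed.

End InfConvolution.

(** * Finite partitions adapted to a cadlag path *)

Section CadlagPartition.
Context {R : realType} {V : normedModType R}.
Variables (x : R -> V) (e : R).
Hypotheses (cx : cadlag x) (e0 : 0 < e).

(** Membership in the same interval of the partition cut at [ts], expressed by the order alone: [ts]
    may be unsorted and have repetitions, and adding points refines the partition. *)
Definition same_piece (ts : seq R) (s s' : R) := {in ts, forall t, (t <= s) = (t <= s')}.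

Let Good (T : R) := exists ts : seq R, forall s s', 0 <= s <= T -> 0 <= s' <= T ->
  same_piece ts s s' -> `|x s - x s'| < e.

Let good_right (T : R) : 0 <= T -> exists2 b, T < b &
  forall s s', T <= s < b -> T <= s' < b -> `|x s - x s'| < e.
Proof.
move=> T0; have [_ /(_ _ T0) rc _] := cx.
have e20 : 0 < e / 2 by rewrite divr_gt0.
have /cvgrPdist_lt /(_ _ e20) := rc.
move=> [r /= r0 hr]; exists (T + r); first by rewrite ltrDl.
have key s : T <= s < T + r -> `|x T - x s| < e / 2.
  move=> /andP[]; rewrite le_eqVlt => /predU1P[<- _|Ts sr]; first by rewrite subrr normr0.
  apply: hr => //=; rewrite ltr_norml; apply/andP; split; lra.
move=> s s' /key h1 /key h2; rewrite -(subrK (x T) (x s)) -addrA.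
rewrite (le_lt_trans (ler_normD _ _))// [ltRHS](splitr e) ltrD//.
by rewrite distrC.
Qed.

Let good_left (T : R) : 0 < T -> exists2 a, 0 <= a < T &
  forall s s', a < s < T -> a < s' < T -> `|x s - x s'| < e.
Proof.
move=> T0; have [_ _ /(_ _ T0)] := cx.
move=> /cvg_ex[l xl].
have e20 : 0 < e / 2 by rewrite divr_gt0.
have /cvgrPdist_lt /(_ _ e20) := xl.
move=> [r /= r0 hr]; exists (Num.max 0 (T - r)).
  by rewrite le_max lexx/= gt_max T0/= ltrBlDr ltrDl.
have key s : Num.max 0 (T - r) < s < T -> `|l - x s| < e / 2.
  rewrite gt_max => /andP[/andP[s0 sr] sT].
  apply: hr => //=; rewrite ltr_norml; apply/andP; split; lra.
move=> s s' /key h1 /key h2; rewrite -(subrK l (x s)) -addrA.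
rewrite (le_lt_trans (ler_normD _ _))// [ltRHS](splitr e) ltrD//.
by rewrite distrC.
Qed.

(** Let [sg] be the supremum of the good horizons. The left limit at [sg] completes a partition of a
    shorter interval, right continuity extends it slightly beyond [sg], and this is a contradiction
    unless [sg] is [T]. *)
Lemma cadlag_partition (T : R) : 0 <= T ->
  exists ts : seq R, forall s s', 0 <= s <= T -> 0 <= s' <= T ->
  same_piece ts s s' -> `|x s - x s'| < e.
Proof.
move=> T0; pose S := [set t | 0 <= t <= T /\ Good t].
have good0 : Good 0.
  exists [::] => s s' /andP[s0 s1] /andP[s0' s1'] _.
  have -> : s = s' by lra.
  by rewrite subrr normr0.
have S0 : S 0 by split => //; rewrite lexx.
have hS : has_sup S by split; [exists 0|exists T => t [/andP[]]].
pose sg := sup S.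
have sg0 : 0 <= sg by apply: sup_ubound => //; case: hS.
have sgT : sg <= T by apply: sup_le_ub => [|t [/andP[]]//]; exists 0.
have [b sgb hb] := good_right sg0.
(* A good horizon so close to [sg] that the path hardly oscillates between the two. If [sg = 0] the
   last condition is void. *)
have [tau /andP[tau0 tausg] [[ts hts] hl]] : exists2 tau, 0 <= tau <= sg & Good tau /\
    forall s s', tau <= s < sg -> tau <= s' < sg -> `|x s - x s'| < e.
  move: sg0; rewrite le_eqVlt => /predU1P[sg00|sg0].
    exists 0; first by rewrite lexx -sg00 lexx.
    by split=> // s s'; rewrite -sg00; lra.
  have [a /andP[a0 asg] ha] := good_left sg0.
  have asg' : 0 < sg - a by rewrite subr_gt0.
  have [t [/andP[t0 tT] gt] at_] := sup_adherent asg' hS.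
  have St : S t by split=> //; rewrite t0.
  exists t; last split=> //.
    by rewrite t0/=; apply: sup_ubound => //; case: hS.
  move: at_; rewrite -/sg => at_ s s' /andP[s1 s2] /andP[s1' s2']; apply: ha; apply/andP; split=>
    //; lra.
have good c : sg <= c -> c < b -> Good c.
  move=> sgc cb; exists [:: tau, sg & ts] => s s' /andP[s1 s2] /andP[s1' s2'] sp.
  have e1 : (tau <= s) = (tau <= s') by apply: sp; rewrite inE eqxx.
  have e2 : (sg <= s) = (sg <= s') by apply: sp; rewrite !inE eqxx orbT.
  have [sgs|ssg] := leP sg s.
    rewrite sgs in e2; apply: hb; rewrite ?sgs -?e2 /=; exact: le_lt_trans cb.
  have ssg' : s' < sg by rewrite ltNge -e2 -ltNge.
  have [ts1|ts1] := leP tau s.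
    by rewrite ts1 in e1; apply: hl; rewrite ?ts1 -?e1.
  have ts1' : s' < tau by rewrite ltNge -e1 -ltNge.
  apply: hts; rewrite ?s1 ?s1' ?ltW//.
  by move=> t tts; apply: sp; rewrite !inE tts !orbT.
have [Tsg|] := leP T sg.
  have -> : T = sg by apply/eqP; rewrite eq_le Tsg.
  exact: good.
move=> sgT'; pose c := Num.min T ((sg + b) / 2).
have csg : sg < c by rewrite lt_min sgT'/=; lra.
have : c <= sg.
  apply: sup_ubound; first by case: hS.
  split; first by rewrite (le_trans sg0 (ltW csg))/= ge_min lexx.
  by apply: good; [exact: ltW|rewrite gt_min; apply/orP; right; lra].
by rewrite leNgt csg.
Qed.

End CadlagPartition.

(** * Discretization of paths and convergence in law *)

Section GridPath.
Context {R : realType}.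
Local Notation path2 := (skorokhod (R * R)%type).
Implicit Types (x y : path2) (m : nat).

(** The times [i / m] with [i <= m ^ 2] cover [[0, m]]: the horizon grows while the mesh shrinks.
    The boolean selects the coordinate. *)
Definition grid_index m : finType := ('I_(m ^ 2).+1 * bool)%type.

(** Step paths are built from [rescaled_path], which is already known to be cadlag; [minn] freezes
    the path after time [m]. *)
Definition grid_path m (u : grid_index m -> R) : path2 :=
  rescaled_path m%:R 1 1 0 (fun i => u (inord (minn i (m ^ 2)), true))
    (fun i => u (inord (minn i (m ^ 2)), false)).

Definition grid_coord m (x : path2) (i : grid_index m) : R :=
  if i.2 then (x (i.1%:R / m%:R)).1 else (x (i.1%:R / m%:R)).2.

Definition grid m x : path2 := grid_path (@grid_coord m x).

Lemma grid_pathE m (u : grid_index m -> R) t : 0 <= t -> grid_path u t =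
  (u (inord (minn (Num.truncn (m%:R * t)) (m ^ 2)), true),
   u (inord (minn (Num.truncn (m%:R * t)) (m ^ 2)), false)).
Proof. by move=> t0; rewrite /grid_path /= rescaled_fun_ge0// !mul1r mul0r subr0. Qed.

Lemma gridE m x t : 0 <= t -> (Num.truncn (m%:R * t) <= m ^ 2)%N ->
  grid m x t = x ((Num.truncn (m%:R * t))%:R / m%:R).
Proof.
move=> t0 tm; rewrite grid_pathE// /grid_coord/= (minn_idPl tm) inordK ?ltnS//.
by case: (x _).
Qed.

Lemma sdist_grid_path m (u v : grid_index m -> R) e : 0 <= e ->
  (forall i, `|u i - v i| <= e) -> sdist (grid_path u) (grid_path v) <= e.
Proof.
move=> e0 uv; apply/ler_addgt0Pr => r r0; apply: sdist_nbhd_le; first by rewrite ltr_wpDl.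
exists id; split; first exact: time_change_id.
  by move=> s s0; rewrite subrr normr0 ltr_wpDl.
move=> s /andP[s0 _]; rewrite !grid_pathE//.
by rewrite prod_normE/= gt_max; apply/andP; split;
  rewrite distrC (le_lt_trans (uv _))// ltrDl.
Qed.

Lemma truncn_div_bounds m (t : R) : (0 < m)%N -> 0 <= t ->
  t - m%:R^-1 <= (Num.truncn (m%:R * t))%:R / m%:R <= t.
Proof.
move=> m0 t0; have M0 : 0 < m%:R :> R by rewrite ltr0n.
have mt0 : 0 <= m%:R * t by rewrite mulr_ge0// ltW.
have /andP[h1 h2] := truncn_itv mt0.
rewrite ler_pdivlMr// mulrBl mulVf ?gt_eqF// lerBlDr natr1 mulrC (ltW h2)/=.
by rewrite ler_pdivrMr// [t * _]mulrC.
Qed.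

(** Stated so as to serve twice: for a fixed path, with the cut points of a partition, and uniformly
    over the prelimit paths, with the times of their big jumps. The latter also drift between jumps,
    hence the restriction to times at distance at most [2 / m]. *)
Lemma sdist_grid (ts : seq R) m x (e : R) : (0 < m)%N -> 0 < e ->
  {in ts, forall t : R, 0 < t} -> sorted (fun a b : R => a + m%:R^-1 < b) ts ->
  m%:R^-1 < e -> e^-1 + 1 <= m%:R ->
  (forall s s', 0 <= s <= e^-1 + 1 -> 0 <= s' <= e^-1 + 1 ->
    `|s - s'| <= 2 / m%:R -> same_piece ts s s' -> `|x s - x s'| < e) ->
  sdist x (grid m x) <= e /\ sdist (grid m x) x <= e.
Proof.
move=> m0 e0 ts0 tsm me mT osc.
have M0 : 0 < m%:R :> R by rewrite ltr0n.
have M1 : m%:R^-1 <= 1 :> R by rewrite invf_le1// ler1n.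
have key (t : R) : 0 <= t <= e^-1 + 1 -> grid m x t = x ((Num.truncn (m%:R * t))%:R / m%:R).
  move=> /andP[t0 t1]; apply: gridE => //; rewrite -(ler_nat R) (@le_trans _ _ (m%:R * t))//.
    by rewrite truncn_le// mulr_ge0// ltW.
  by rewrite natrX expr2 ler_pM2l// (le_trans t1).
split; apply: sdist_nbhd_le => //.
  have [l [tl lm lts]] := time_grid_fwd m0 ts0 tsm.
  exists l; split=> // [s s0|s /andP[s0 se]]; first by rewrite (le_lt_trans (lm _ s0)).
  have ls0 := time_change_ge0 tl s0.
  have := lm _ s0; rewrite ler_norml => /andP[l1 l2].
  have /andP[b1 b2] := truncn_div_bounds m0 ls0.
  rewrite key; last by rewrite ls0/=; lra.
  apply: osc.
  - rewrite divr_ge0//=; lra.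
  - rewrite s0/=; lra.
  - rewrite ler_norml; apply/andP; split; lra.
  - by move=> t tts; rewrite [RHS]lts.
have [l [tl lm lts]] := time_grid_bwd m0 ts0 tsm.
exists l; split=> // [s s0|s /andP[s0 se]]; first by rewrite (le_lt_trans (lm _ s0)).
have ls0 := time_change_ge0 tl s0.
have := lm _ s0; rewrite ler_norml => /andP[l1 l2].
have /andP[b1 b2] := truncn_div_bounds m0 s0.
rewrite key; last by rewrite s0/=; lra.
apply: osc.
- rewrite ls0/=; lra.
- rewrite divr_ge0//=; lra.
- rewrite ler_norml; apply/andP; split; lra.
- by move=> t tts; rewrite [LHS]lts.
Qed.

Lemma sorted_gap (ts : seq R) : sorted <%R ts ->
  exists2 g : R, 0 < g & sorted (fun a b : R => a + g < b) ts.
Proof.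
case: ts => [_|a ts]; first by exists 1.
elim: ts a => [a _|b ts IH a]; first by exists 1.
move=> /= /andP[ab /IH[g g0 hg]].
exists (Num.min g ((b - a) / 2)); first by rewrite lt_min g0 divr_gt0// subr_gt0.
apply/andP; split.
  have : Num.min g ((b - a) / 2) <= (b - a) / 2 by rewrite ge_min lexx orbT.
  by move=> h; lra.
by apply: sub_path hg => c d; apply: le_lt_trans; rewrite lerD2l ge_min lexx.
Qed.

Lemma sdist_grid_cvg x (e : R) : 0 < e -> exists m0, forall m, (m0 <= m)%N ->
  sdist x (grid m x) <= e /\ sdist (grid m x) x <= e.
Proof.
move=> e0; have T0 : 0 <= e^-1 + 1 by rewrite addr_ge0// invr_ge0 ltW.
have [ts0 hts] := cadlag_partition (path_cadlag x) e0 T0.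
(* Cut points [t <= 0] separate no two nonnegative times, and the strict order is needed to find a
   positive minimal gap. *)
pose ts := sort <=%R (undup [seq t <- ts0 | 0 < t]).
have sts : sorted <%R ts by rewrite sort_lt_sorted undup_uniq.
have [g g0 gts] := sorted_gap sts.
pose r := Num.min e g.
have r0 : 0 < r by rewrite lt_min e0.
exists (Num.truncn (Num.max (r^-1) (e^-1 + 1))).+1 => m hm.
have : Num.max (r^-1) (e^-1 + 1) < m%:R.
  by rewrite (lt_le_trans (truncnS_gt _))// ler_nat.
rewrite gt_max => /andP[rm em].
have M0 : (0 < m)%N by apply: leq_trans hm.
have mr : m%:R^-1 < r.
  by rewrite -[ltRHS]invrK ltf_pV2 ?posrE ?invr_gt0 ?ltr0n.
apply: (@sdist_grid ts) => //.
- by move=> t; rewrite mem_sort mem_undup mem_filter => /andP[].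
- apply: sub_sorted gts => a b; apply: le_lt_trans; rewrite lerD2l.
  by rewrite (le_trans (ltW mr))// /r ge_min lexx orbT.
- by rewrite (lt_le_trans mr)// /r ge_min lexx.
- exact: ltW.
- move=> s s' hs hs' _ sp; apply: hts => // t tts.
  have [t0|t0] := ltP 0 t; first by apply: sp; rewrite mem_sort mem_undup mem_filter t0.
  by move: hs hs' => /andP[/(le_trans t0) -> _] /andP[/(le_trans t0) -> _].
Qed.

End GridPath.

(** * Measurability of functionals of a path *)

Section MeasurableComposition.
Context {R : realType} {d} {T : measurableType d}.

Lemma measurable_fun_countable {d'} {T' : measurableType d'} (C : countType)
    (c : T -> C) (G : C -> T') :
  (forall c0, measurable [set w | c w = c0]) -> measurable_fun setT (G \o c).
Proof.
move=> mc _ B mB; rewrite setTI.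
rewrite [X in measurable X](_ : _ = \bigcup_(n : nat)
   (if unpickle n is Some c0 then
      if `[< B (G c0) >] then [set w | c w = c0] else set0 else set0)).
  apply: bigcup_measurable => n _; case: (unpickle n) => // c0.
  by case: ifP.
apply/seteqP; split=> [w /= Bw|w [n _]].
  by exists (pickle (c w)) => //; rewrite pickleK; case: asboolP.
case: (unpickle n) => // c0; case: asboolP => // Bc /= cw; by rewrite cw.
Qed.

(* Rounding the coordinates down to multiples of [1 / (n + 1)] yields a map with
   countably many values. *)
Lemma measurable_seq_continuous (I : finType) (G : (I -> R) -> R) (v : T -> I -> R) :
  (forall (u : nat -> I -> R) u0, (forall i, u n i @[n --> \oo] --> u0 i) ->
     G (u n) @[n --> \oo] --> G u0) ->
  (forall i, measurable_fun setT (fun w => v w i)) ->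
  measurable_fun setT (fun w => G (v w)).
Proof.
move=> cG mv.
pose q n w := [ffun i => Num.floor (v w i * n.+1%:R)].
pose dec n (f : {ffun I -> int}) i := (f i)%:~R / n.+1%:R : R.
apply: (@measurable_fun_cvg _ _ _ setT (fun n w => G (dec n (q n w)))) => [n|w _].
- apply: (measurable_fun_countable (c := q n) (fun f => G (dec n f))) => f.
  rewrite [X in measurable X](_ : _ =
    \big[setI/setT]_(i : I) (fun w => v w i) @^-1`
      [set` `[(f i)%:~R / n.+1%:R, (f i + 1)%:~R / n.+1%:R[]).
    apply: bigsetI_measurable => i _; rewrite -[X in measurable X]setTI.
    by apply: mv => //; exact: measurable_itv.
  apply/seteqP; split=> [w /= qw|w].
    rewrite -bigcap_seq => i _ /=; rewrite in_itv/= -qw ffunE.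
    by rewrite ler_pdivrMr// ltr_pdivlMr// floor_le_tmp floorD1_gt.
  rewrite -bigcap_seq => hw; apply/ffunP => i; rewrite ffunE.
  have := hw i; rewrite /= mem_index_enum => /(_ isT).
  rewrite in_itv/= ler_pdivrMr// ltr_pdivlMr// => h; exact/floor_def.
- apply: cG => i; apply/cvgrPdist_le => e e0; near=> n.
  rewrite /dec ffunE; set y := v w i * n.+1%:R.
  have -> : v w i = y / n.+1%:R by rewrite /y mulfK.
  rewrite -mulrBl ger0_norm ?divr_ge0 ?subr_ge0 ?floor_le_tmp//.
  rewrite ler_pdivrMr//; apply: (@le_trans _ _ 1).
    by rewrite lerBlDl ltW// -[X in _ + X]/(1%:~R) -intrD floorD1_gt.
  rewrite mulrC -ler_pdivrMr// mul1r -natr1 (@le_trans _ _ n%:R) ?lerDl//.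
  by near: n; exact: nbhs_infty_ger.
Unshelve. all: by end_near. Qed.

End MeasurableComposition.

Section MeasurableFunctional.
Context {R : realType} {d} {T : measurableType d}.
Local Notation path2 := (skorokhod (R * R)%type).
Implicit Types (H : path2 -> R) (Y : T -> path2).

(** Continuity in which both distances are required to be small. The envelopes satisfy it, since
    their Lipschitz bound at [(x, y)] and at [(y, x)] involves different distances, and grid paths
    are close in both directions. *)
Definition sdist_continuous H := forall x (e : R), 0 < e -> exists2 r : R, 0 < r &
  forall y, sdist x y < r -> sdist y x < r -> `|H y - H x| < e.

Lemma continuous_sdist_continuous H : continuous H -> sdist_continuous H.
Proof.
move=> cH x e e0; have [r r0 h] := continuous_sdist x cH e0.
by exists r => // y xy _; exact: h.
Qed.

Lemma inf_conv_sdist_continuous H (M : R) j : (forall x, `|H x| <= M) ->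
  sdist_continuous (inf_conv H j).
Proof.
move=> HM x e e0; exists (e / (j.+1%:R)); first by rewrite divr_gt0.
move=> y h1 h2; have l1 := inf_conv_lip HM j x y; have l2 := inf_conv_lip HM j y x.
have key (a : R) : 0 <= a -> a < e / j.+1%:R -> j%:R * a < e.
  move=> a0; rewrite ltr_pdivlMr//; apply: le_lt_trans.
  by rewrite mulrC ler_wpM2l// ler_nat.
have k1 := key _ (sdist_ge0 _ _) h1; have k2 := key _ (sdist_ge0 _ _) h2.
rewrite ltr_norml ltrNl opprB !ltrBlDl.
by rewrite (le_lt_trans l1) ?ltrD2l// (le_lt_trans l2) ?ltrD2l.
Qed.

Lemma grid_functional_cvg H x : sdist_continuous H -> H (grid m x) @[m --> \oo] --> H x.
Proof.
move=> cH; apply/cvgrPdist_lt => e e0; have [r r0 hr] := cH x e e0.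
have [m0 hm] := sdist_grid_cvg x (divr_gt0 r0 (ltr0Sn R 1)).
have rr : r / 2 < r by rewrite ltr_pdivrMr// ltr_pMr// ltr1n.
exists m0 => // m /= /hm [h1 h2]; rewrite distrC.
by apply: hr; [exact: le_lt_trans h1 _|exact: le_lt_trans h2 _].
Qed.

Lemma measurable_grid_functional H m (v : T -> grid_index m -> R) :
  sdist_continuous H -> (forall i, measurable_fun setT (fun w => v w i)) ->
  measurable_fun setT (fun w => H (grid_path (v w))).
Proof.
move=> cH mv; apply: (measurable_seq_continuous (G := fun u => H (grid_path u))) => //.
move=> u u0 uu0; apply/cvgrPdist_lt => e e0.
have [r r0 hr] := cH (grid_path u0) e e0.
have r20 : 0 < r / 2 by rewrite divr_gt0.
have near_all : \forall n \near \oo, forall i, `|u0 i - u n i| < r / 2.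
  apply: filter_forall => i.
  by have /cvgrPdist_lt/(_ _ r20) := uu0 i.
near=> n; rewrite distrC; have hn : forall i, `|u0 i - u n i| < r / 2 by near: n.
by apply: hr; apply: (@le_lt_trans _ _ (r / 2)); try (by lra);
  apply: sdist_grid_path => [|i]; rewrite ?(ltW r20)// ?ltW// distrC.
Unshelve. all: by end_near. Qed.

Lemma measurable_grid_coord Y m : (forall t, 0 <= t -> measurable_fun setT (fun w => Y w t)) ->
  forall i, measurable_fun setT (fun w => @grid_coord R m (Y w) i).
Proof.
move=> mY [i b]; rewrite /grid_coord/=; have mi := mY (i%:R / m%:R) (divr_ge0 (ler0n _ _) (ler0n _
  _)).
case: b; first exact: (measurableT_comp measurable_fst mi).
exact: (measurableT_comp measurable_snd mi).
Qed.

(** Grid approximation makes [H (Y w)] a pointwise limit of functions of finitely many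
    coordinates. *)
Lemma measurable_functional H Y : sdist_continuous H ->
  (forall t, 0 <= t -> measurable_fun setT (fun w => Y w t)) ->
  measurable_fun setT (fun w => H (Y w)).
Proof.
move=> cH mY.
apply: (@measurable_fun_cvg _ _ _ setT (fun m w => H (grid m (Y w)))) => [m|w _].
  apply: (measurable_grid_functional (v := fun w => grid_coord (Y w))) => // i.
  exact: measurable_grid_coord.
exact: grid_functional_cvg.
Qed.

End MeasurableFunctional.

(** * From convergence on grids to convergence in law *)

Section Portmanteau.
Context {R : realType} d d' (Om : measurableType d) (Om' : measurableType d').
Variables (Pr : probability Om R) (Pr' : probability Om' R).
Variables (Y : nat -> Om -> skorokhod (R * R)%type) (Z : Om' -> skorokhod (R * R)%type).
Hypothesis mY : forall N t, 0 <= t -> measurable_fun setT (fun w => Y N w t).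
Hypothesis mZ : forall t, 0 <= t -> measurable_fun setT (fun w => Z w t).

Let dist_le_of_le (a b s s' t : R) :
  a <= b + s -> b <= a + s' -> s <= t -> s' <= t -> `|a - b| <= t.
Proof. by move=> h1 h2 h3 h4; rewrite ler_norml; apply/andP; split; lra. Qed.

Let le_of_norm_le (a b c M : R) : 0 <= c -> `|a| <= M -> `|b| <= M ->
  a <= b + c + 2 * M.
Proof. by rewrite !ler_norml => c0 /andP[? ?] /andP[? ?]; lra. Qed.

Let dist_le (a b e : R) : a - e <= b -> - a - e <= - b -> `|a - b| <= e.
Proof. by move=> h1 h2; rewrite ler_norml; apply/andP; split; lra. Qed.

Let chain_le (a b c a' b' c' e : R) : a - e / 5 <= b -> b - e / 5 <= c ->
  c - a' <= e / 5 -> a' <= b' + e / 5 + e / 5 -> b' <= c' -> a - e <= c'.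
Proof. by move=> h1 h2 h3 h4 h5; lra. Qed.

Definition lipschitz_sup (I : Type) (G : (I -> R) -> R) := exists L : R,
  forall (u v : I -> R) (e : R), 0 <= e -> (forall i, `|u i - v i| <= e) ->
  `|G u - G v| <= L * e.

Hypothesis grid_law : forall m (G : (grid_index m -> R) -> R), (0 < m)%N ->
  (exists M : R, forall u, `|G u| <= M) -> lipschitz_sup G ->
  Ex Pr (fun w => G (grid_coord (Y N w))) @[N --> \oo] -->
  Ex Pr' (fun w => G (grid_coord (Z w))).
Hypothesis grid_tight : forall e1 e2 : R, 0 < e1 -> 0 < e2 ->
  exists m0, forall m, (m0 <= m)%N -> exists N0, forall N, (N0 <= N)%N ->
  exists A, [/\ measurable A, (Pr A <= e2%:E)%E &
    forall w, ~ A w -> sdist (grid m (Y N w)) (Y N w) <= e1].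

(** Five losses of [e / 5]: from [F] to its envelope under the limit law, from the limit path to its
    grid, from the limit law to the prelimit law on the grid, and, for the prelimit, the Lipschitz
    error and the exceptional event when the grid is removed. The return from the envelope to [F] is
    free. *)
Let liminf_functional (F : skorokhod (R * R)%type -> R) (M e : R) :
  continuous F -> (forall x, `|F x| <= M) -> 0 < e ->
  \forall N \near \oo, Ex Pr' (F \o Z) - e <= Ex Pr (F \o Y N).
Proof.
move=> cF FM e0.
have M0 : 0 <= M by rewrite (le_trans _ (FM (grid_path (fun _ : grid_index 0 => 0))))//.
have scF := continuous_sdist_continuous cF.
have scFj j := inf_conv_sdist_continuous j FM.
have FjM j := inf_conv_bounded FM j.
have bY H N : sdist_continuous H -> (forall x, `|H x| <= M) -> bm (fun w => H (Y N w)).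
  by move=> sH HM; apply: (@bm_bounded _ _ _ M) => //; apply: measurable_functional => //; exact:
    mY.
have bYg H N m : sdist_continuous H -> (forall x, `|H x| <= M) -> bm (fun w => H (grid m (Y N w))).
  move=> sH HM; apply: (@bm_bounded _ _ _ M) => //.
  apply: (measurable_grid_functional (v := fun w => grid_coord (Y N w))) => //.
  by apply: measurable_grid_coord; exact: mY.
have bZ H : sdist_continuous H -> (forall x, `|H x| <= M) -> bm (fun w => H (Z w)).
  by move=> sH HM; apply: (@bm_bounded _ _ _ M) => //; exact: measurable_functional.
have e50 : 0 < e / 5 by rewrite divr_gt0.
have [j hj] : exists j, Ex Pr' (F \o Z) - e / 5 <= Ex Pr' (fun w => inf_conv F j (Z w)).
  have : Ex Pr' (fun w => inf_conv F j (Z w)) @[j --> \oo] --> Ex Pr' (F \o Z).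
    apply: (@Ex_cvg _ _ _ _ _ _ M).
    - by move=> j; apply: bm_meas; exact: bZ.
    - by move=> j w; exact: FjM.
    - by move=> w; apply: inf_conv_cvg FM _ cF.
  move=> /cvgrPdist_le /(_ _ e50) [j _ /(_ j (leqnn _))] /= h; exists j.
  by move: h; rewrite ler_norml => /andP[_]; rewrite lerBlDl -lerBlDr.
pose e1 := e / 5 / j.+1%:R.
have e10 : 0 < e1 by rewrite divr_gt0.
pose e2 := e / 5 / (2 * M + 1).
have e20 : 0 < e2 by rewrite divr_gt0// ltr_wpDl// mulr_ge0.
have [m0 hm0] := grid_tight e10 e20.
have [m [mm0 m1 hm]] : exists m, [/\ (m0 <= m)%N, (0 < m)%N &
    Ex Pr' (fun w => inf_conv F j (Z w)) - e / 5 <=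
    Ex Pr' (fun w => inf_conv F j (grid m (Z w)))].
  have : Ex Pr' (fun w => inf_conv F j (grid m (Z w))) @[m --> \oo] -->
      Ex Pr' (fun w => inf_conv F j (Z w)).
    apply: (@Ex_cvg _ _ _ _ _ _ M).
    - move=> m; apply: (measurable_grid_functional (v := fun w => grid_coord (Z w))) => //.
      exact: measurable_grid_coord.
    - by move=> m w; exact: FjM.
    - by move=> w; exact: grid_functional_cvg.
  move=> /cvgrPdist_le /(_ _ e50) [m1 _ hm1].
  have [m2 [m02 m20 m12]] : exists m2, [/\ (m0 <= m2)%N, (0 < m2)%N & (m1 <= m2)%N].
    exists (m0 + m1).+1; split=> //; rewrite leqW//.
      exact: leq_addr.
    exact: leq_addl.
  exists m2; split; [exact: m02|exact: m20|].
  have := hm1 _ m12; rewrite /= ler_norml => /andP[_].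
  by rewrite lerBlDl -lerBlDr.
have [N0 hN0] := hm0 _ mm0.
have := @grid_law m (fun u => inf_conv F j (grid_path u)) m1 _ _.
move=> /(_ (ex_intro _ M (fun u => FjM j _))).
have : lipschitz_sup (fun u : grid_index m -> R => inf_conv F j (grid_path u)).
  exists j%:R => u v r r0 uv.
  have h1 := sdist_grid_path r0 uv.
  have h2 : sdist (grid_path v) (grid_path u) <= r.
    by apply: sdist_grid_path => // i; rewrite distrC.
  have l1 := inf_conv_lip FM j (grid_path u) (grid_path v).
  have l2 := inf_conv_lip FM j (grid_path v) (grid_path u).
  have j0 : 0 <= j%:R :> R by [].
  exact: dist_le_of_le l1 l2 (ler_wpM2l j0 h1) (ler_wpM2l j0 h2).
move=> lipG /(_ lipG) /cvgrPdist_le /(_ _ e50) [N1 _ hN1].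
exists (maxn N0 N1) => // N /= hN.
have [A [mA PA hA]] := hN0 N (leq_trans (leq_maxl _ _) hN).
have := hN1 N (leq_trans (leq_maxr _ _) hN).
rewrite /= ler_norml => /andP[_ h1].
have h2 : Ex Pr (fun w => inf_conv F j (Y N w)) <= Ex Pr (F \o Y N).
  by apply: Ex_le => [||w]; [exact: bY|exact: bY|exact: inf_conv_le FM _ _].
have PA' : fine (Pr A) <= e2 by rewrite -lee_fin fine_muE.
have h3 : Ex Pr (fun w => inf_conv F j (grid m (Y N w))) <=
    Ex Pr (fun w => inf_conv F j (Y N w)) + e / 5 + e / 5.
  apply: (@le_trans _ _ (Ex Pr (fun w => inf_conv F j (Y N w) + e / 5 + 2 * M * \1_A w))).
    apply: Ex_le; [exact: bYg| |].
      apply: bmD; last by apply: bmZ; exact: bm_indic.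
      by apply: bmD; [exact: bY|exact: bm_cst].
    move=> w; rewrite indicE; case: (boolP (w \in A)) => [_|/negP wA].
      have := FjM j (Y N w); have := FjM j (grid m (Y N w)).
      by rewrite mulr1; exact: le_of_norm_le (ltW e50).
    rewrite mulr0 addr0; apply: (le_trans (inf_conv_lip FM j _ (Y N w))).
    rewrite lerD2l; have /hA k : ~ A w by move=> Aw; apply: wA; rewrite inE.
    rewrite (@le_trans _ _ (j.+1%:R * sdist (grid m (Y N w)) (Y N w)))//.
      by rewrite ler_wpM2r ?sdist_ge0// ler_nat.
    by rewrite mulrC -ler_pdivlMr.
  rewrite ExD; last first.
  - by apply: bmZ; exact: bm_indic.
  - by apply: bmD; [exact: bY|exact: bm_cst].
  rewrite ExD; [|exact: bY|exact: bm_cst].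
  rewrite Ex_cst ExZ ?Ex_indic//; last exact: bm_indic.
  rewrite lerD2l (@le_trans _ _ (2 * M * e2))// ?ler_wpM2l ?mulr_ge0//.
  rewrite /e2 mulrA ler_pdivrMr ?ltr_wpDl ?mulr_ge0//.
  by rewrite mulrC ler_pM2l// lerDl.
exact: chain_le hj hm h1 h3 h2.
Qed.

(** The lower bound is applied to [F] and to [- F]. *)
Theorem cvg_in_law_of_grids : cvg_in_law Pr Pr' Y Z.
Proof.
move=> F cF [M FM].
have cNF : continuous (fun x => - F x) 
  by move=> x; apply: (@continuous_comp _ _ _ F -%R); [exact: cF|exact: opp_continuous].
have bY N : bm (F \o Y N).
  apply: (@bm_bounded _ _ _ M) => [|w]; last exact: FM.
  by apply: measurable_functional; [exact: continuous_sdist_continuous|exact: mY].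
have bZ : bm (F \o Z).
  apply: (@bm_bounded _ _ _ M) => [|w]; last exact: FM.
  by apply: measurable_functional; [exact: continuous_sdist_continuous|exact: mZ].
have -> : (fun n => 'E_Pr[F \o Y n])%E = EFin \o (fun n => Ex Pr (F \o Y n)).
  by apply/funext => n; rewrite unlock/= -ExE.
have -> : ('E_Pr'[F \o Z])%E = (Ex Pr' (F \o Z))%:E by rewrite unlock -ExE.
apply: cvg_EFin; first exact: nearW.
apply/cvgrPdist_le => e e0.
have h1 := liminf_functional cF FM e0.
have NFM x : `|- F x| <= M by rewrite normrN.
have h2 := liminf_functional cNF NFM e0.
near=> N.
have k1 : Ex Pr' (F \o Z) - e <= Ex Pr (F \o Y N) by near: N.
have k2 : Ex Pr' ((fun x => - F x) \o Z) - e <= Ex Pr ((fun x => - F x) \o Y N) by near: N.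
have E1 : Ex Pr' ((fun x => - F x) \o Z) = - Ex Pr' (F \o Z) := ExN Pr' bZ.
have E2 : Ex Pr ((fun x => - F x) \o Y N) = - Ex Pr (F \o Y N) := ExN Pr (bY N).
by rewrite E1 E2 in k2; exact: dist_le.
Unshelve. all: by end_near. Qed.

End Portmanteau.

(** * Trigonometric approximation and the continuity theorem *)

Section TrigBounds.
Context {R : realType}.
Implicit Types x y : R.

Lemma mvt_cos_sin (f df : R -> R) x y : (forall z, is_derive z (1 : R) f (df z)) ->
  exists2 c, `|c| <= Num.max `|x| `|y| & f y - f x = df c * (y - x).
Proof.
move=> fd; have cf : continuous f.
  by move=> z; apply: differentiable_continuous; apply/derivable1_diffP; case: (fd z).
wlog xy : x y / x <= y => [hw|].
  have [/hw//|/ltW/hw[c cM fc]] := leP x y.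
  exists c; first by rewrite maxC.
  by rewrite -(opprB (f x)) fc -mulrN opprB.
have [|c] := @MVT_segment _ f df x y xy; first exact: continuous_subspaceT.
rewrite in_itv/= => /andP[xc cy] fc; exists c => //.
rewrite le_max !ler_norml; have [c0|c0] := leP 0 c.
  apply/orP; right; rewrite (le_trans cy (ler_norm y)) andbT.
  by rewrite (le_trans _ c0)// oppr_le0.
apply/orP; left; rewrite (le_trans (ltW c0) (normr_ge0 x)) andbT.
by rewrite (le_trans _ xc)// lerNl -normrN ler_norm.
Qed.

Lemma abs_sin_le1 x : `|sin x| <= 1.
Proof. by rewrite ler_norml sin_geN1 sin_le1. Qed.

Lemma abs_cos_le1 x : `|cos x| <= 1.
Proof. by rewrite ler_norml cos_geN1 cos_le1. Qed.

Lemma sin_lip x y : `|sin y - sin x| <= `|y - x|.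
Proof.
have [c _ ->] := @mvt_cos_sin sin cos x y (fun z => is_derive_sin z).
by rewrite normrM ler_piMl// abs_cos_le1.
Qed.

Lemma cos_lip x y : `|cos y - cos x| <= `|y - x|.
Proof.
have [c _ ->] := @mvt_cos_sin cos (fun z => - sin z) x y (fun z => is_derive_cos z).
by rewrite normrM normrN ler_piMl// abs_sin_le1.
Qed.

Lemma abs_sin_le x : `|sin x| <= `|x|.
Proof. by have := sin_lip 0 x; rewrite sin0 !subr0. Qed.

Lemma cosB1_le x : `|cos x - 1| <= x ^+ 2.
Proof.
have [c] := @mvt_cos_sin cos (fun z => - sin z) 0 x (fun z => is_derive_cos z).
rewrite cos0 normr0 subr0 => cx ->.
rewrite normrM normrN -[leRHS]real_normK ?num_real// expr2.
rewrite ler_pM// (le_trans (abs_sin_le c))// (le_trans cx)//.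
by rewrite max_r.
Qed.

Lemma sinB_le x : `|sin x - x| <= x ^+ 2.
Proof.
have dz (z : R) : is_derive z (1 : R) (fun z => sin z - z) (cos z - 1).
  by apply: is_deriveB.
have [c] := @mvt_cos_sin (fun z => sin z - z) (fun z => cos z - 1) 0 x dz.
rewrite sin0 normr0 !subr0 => cx ->.
rewrite normrM -[leRHS]real_normK ?num_real// expr2 ler_pM//.
have := cos_lip 0 c; rewrite cos0 subr0 => /le_trans; apply.
by rewrite (le_trans cx)// max_r.
Qed.

End TrigBounds.

(** * Trigonometric polynomials in several variables *)

Section TrigPolynomial.
Context {R : realType} {I : finType}.
Implicit Types (xi x : I -> R) (f g : (I -> R) -> R).

Definition dot xi x : R := \sum_i xi i * x i.

(** Sums of shifted cosines. They are closed under products, by the product-to-sum formula, and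
    their expectations involve nothing but the real and imaginary parts of the characteristic
    function. *)
Inductive trig : ((I -> R) -> R) -> Prop :=
| trig_cos a xi c : trig (fun x => a * cos (dot xi x + c))
| trig_add f g : trig f -> trig g -> trig (fun x => f x + g x).

Lemma trig_eq f g : trig f -> f =1 g -> trig g.
Proof. by move=> tf /funext <-. Qed.

Lemma dotD xi xi' x : dot (fun i => xi i + xi' i) x = dot xi x + dot xi' x.
Proof. by rewrite -big_split; apply: eq_bigr => i _; rewrite mulrDl. Qed.

Lemma dotN xi x : dot (fun i => - xi i) x = - dot xi x.
Proof. by rewrite -sumrN; apply: eq_bigr => i _; rewrite mulNr. Qed.

Lemma trig_mul f g : trig f -> trig g -> trig (fun x => f x * g x).
Proof.
elim=> [a xi c|f1 f2 _ IH1 _ IH2] tg; last first.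
  by apply: trig_eq (trig_add (IH1 tg) (IH2 tg)) _ => x; rewrite mulrDl.
elim: tg => [b xi' c'|g1 g2 _ IH1 _ IH2]; last first.
  by apply: trig_eq (trig_add IH1 IH2) _ => x; rewrite mulrDr.
apply: trig_eq (trig_add (trig_cos (a * b / 2) (fun i => xi i + xi' i) (c + c'))
  (trig_cos (a * b / 2) (fun i => xi i + - xi' i) (c - c'))) _ => x.
rewrite !dotD dotN; set u := dot xi x; set w := dot xi' x.
have -> : u + w + (c + c') = (u + c) + (w + c') by ring.
have -> : u - w + (c - c') = (u + c) - (w + c') by ring.
by rewrite cosD cosB; field.
Qed.

Lemma trig_cst c : trig (fun=> c).
Proof.
apply: trig_eq (trig_cos c (fun=> 0) 0) _ => x.
by rewrite /dot big1 ?addr0 ?cos0 ?mulr1// => i _; rewrite mul0r.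
Qed.

Lemma trig_sum (J : Type) (s : seq J) (P : pred J) (F : J -> (I -> R) -> R) :
  (forall j, trig (F j)) -> trig (fun x => \sum_(j <- s | P j) F j x).
Proof.
move=> tF; elim: s => [|j s IH].
  by apply: trig_eq (trig_cst 0) _ => x; rewrite big_nil.
have [Pj|Pj] := boolP (P j).
  by apply: trig_eq (trig_add (tF j) IH) _ => x; rewrite big_cons Pj.
by apply: trig_eq IH _ => x; rewrite big_cons (negbTE Pj).
Qed.

Lemma trig_prod (J : Type) (s : seq J) (P : pred J) (F : J -> (I -> R) -> R) :
  (forall j, trig (F j)) -> trig (fun x => \prod_(j <- s | P j) F j x).
Proof.
move=> tF; elim: s => [|j s IH].
  by apply: trig_eq (trig_cst 1) _ => x; rewrite big_nil.
have [Pj|Pj] := boolP (P j).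
  by apply: trig_eq (trig_mul (tF j) IH) _ => x; rewrite big_cons Pj.
by apply: trig_eq IH _ => x; rewrite big_cons (negbTE Pj).
Qed.

Lemma trig_sin i (a : R) : trig (fun x => sin (x i * a)).
Proof.
apply: trig_eq (trig_cos 1 (fun j => (j == i)%:R * a) (- (pi / 2))) _ => x.
rewrite mul1r /dot (bigD1 i)//= eqxx mul1r big1 ?addr0; last first.
  by move=> j /negbTE ->; rewrite !mul0r.
by rewrite cosB cos_pihalf sin_pihalf mulr0 add0r mulr1 mulrC.
Qed.

End TrigPolynomial.

(** * Bernstein polynomials *)

Section Bernstein.
Context {R : realType}.
Implicit Types (t : R) (m k : nat).

(* The Bernstein polynomial [binomial(m, k) t^k (1 - t)^(m - k)], through the
   recursion for the law of a sum of Bernoulli variables. *)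
Fixpoint bern m k t : R :=
  match m, k with
  | 0, 0 => 1
  | 0, _.+1 => 0
  | m'.+1, 0 => (1 - t) * bern m' 0 t
  | m'.+1, k'.+1 => t * bern m' k' t + (1 - t) * bern m' k'.+1 t
  end.

Lemma bern_ge0 m k t : 0 <= t <= 1 -> 0 <= bern m k t.
Proof.
move=> /andP[t0 t1]; elim: m k => [|m IH] [|k] //=.
  by rewrite mulr_ge0// subr_ge0.
by rewrite addr_ge0// mulr_ge0// subr_ge0.
Qed.

Lemma bern_out m k t : (m < k)%N -> bern m k t = 0.
Proof.
elim: m k => [|m IH] [|k]//= mk.
by rewrite !IH ?mulr0 ?addr0// (ltn_trans _ mk).
Qed.

Let bern_rec m t (f : nat -> R) : \sum_(k < m.+2) f k * bern m.+1 k t =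
  t * \sum_(k < m.+1) f k.+1 * bern m k t + (1 - t) * \sum_(k < m.+1) f k * bern m k t.
Proof.
have -> : \sum_(k < m.+1) f k * bern m k t = \sum_(k < m.+2) f k * bern m k t.
  by rewrite [RHS]big_ord_recr/= bern_out// mulr0 addr0.
rewrite [X in _ = _ + _ * X]big_ord_recl [LHS]big_ord_recl/= mulrDr addrCA.
congr (_ + _); first by ring.
rewrite !mulr_sumr -big_split; apply: eq_bigr => i _ /=; rewrite /bump/= add1n; ring.
Qed.

Lemma bern_sum m t : \sum_(k < m.+1) bern m k t = 1.
Proof.
elim: m => [|m IH]; first by rewrite big_ord1.
have := bern_rec m t (fun=> 1); under eq_bigr do rewrite mul1r.
move=> ->; under eq_bigr do rewrite mul1r.
by rewrite IH; ring.
Qed.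

Let bern_mean m t : \sum_(k < m.+1) k%:R * bern m k t = m%:R * t.
Proof.
elim: m => [|m IH]; first by rewrite big_ord1 !mul0r.
rewrite (bern_rec m t (fun k => k%:R)) IH.
under eq_bigr do rewrite -natr1 mulrDl mul1r.
by rewrite big_split/= IH bern_sum -natr1; ring.
Qed.

Let bern_var m t :
  \sum_(k < m.+1) (k%:R - m%:R * t) ^+ 2 * bern m k t = m%:R * (t * (1 - t)).
Proof.
elim: m => [|m IH]; first by rewrite big_ord1 !mul0r subr0 expr0n/= mul0r.
rewrite (bern_rec m t (fun k => (k%:R - m.+1%:R * t) ^+ 2)).
have E (c : R) : \sum_(k < m.+1) (k%:R - m%:R * t + c) ^+ 2 * bern m k t =
    m%:R * (t * (1 - t)) + c ^+ 2.
  transitivity (\sum_(k < m.+1) ((k%:R - m%:R * t) ^+ 2 * bern m k t +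
     2 * c * (k%:R * bern m k t) + (c ^+ 2 - 2 * c * m%:R * t) * bern m k t)).
    by apply: eq_bigr => k _; ring.
  by rewrite !big_split/= IH -!mulr_sumr bern_mean bern_sum; ring.
have -> : \sum_(k < m.+1) (k.+1%:R - m.+1%:R * t) ^+ 2 * bern m k t =
    m%:R * (t * (1 - t)) + (1 - t) ^+ 2.
  by rewrite -E; apply: eq_bigr => k _; rewrite -!natr1; congr (_ ^+ 2 * _); ring.
have -> : \sum_(k < m.+1) (k%:R - m.+1%:R * t) ^+ 2 * bern m k t =
    m%:R * (t * (1 - t)) + (- t) ^+ 2.
  by rewrite -E; apply: eq_bigr => k _; rewrite -!natr1; congr (_ ^+ 2 * _); ring.
by rewrite -natr1; ring.
Qed.

(** The variance of the binomial law together with [|z| <= e + z^2 / e], which spares a square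
    root. *)
Lemma bern_abs m t (e : R) : (0 < m)%N -> 0 <= t <= 1 -> 0 < e ->
  \sum_(k < m.+1) `|k%:R / m%:R - t| * bern m k t <= e + (m%:R * e)^-1.
Proof.
move=> m0 t01 e0; have M0 : 0 < m%:R :> R by rewrite ltr0n.
apply: (@le_trans _ _ (\sum_(k < m.+1) (e * bern m k t +
    (k%:R - m%:R * t) ^+ 2 * bern m k t / (m%:R ^+ 2 * e)))).
  apply: ler_sum => k _.
  have -> : e * bern m k t + (k%:R - m%:R * t) ^+ 2 * bern m k t / (m%:R ^+ 2 * e) =
      (e + (k%:R / m%:R - t) ^+ 2 / e) * bern m k t.
    by field; rewrite !gt_eqF.
  rewrite ler_wpM2r ?bern_ge0//; set z := _ - _.
  rewrite -(ler_pM2r e0) mulrDl divfK ?gt_eqF// -(real_normK (num_real z)).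
  have := sqr_ge0 (`|z| - e); have := normr_ge0 z; set y := `|z|; nra.
rewrite big_split/= -mulr_sumr bern_sum mulr1 lerD2l -mulr_suml bern_var.
have -> : m%:R * (t * (1 - t)) / (m%:R ^+ 2 * e) = (t * (1 - t)) * (m%:R * e)^-1.
  by field; rewrite !gt_eqF.
rewrite ler_piMl ?invr_ge0 ?mulr_ge0// ?(ltW e0)//.
by case/andP: t01 => h1 h2; nra.
Qed.

End Bernstein.

Section TrigApproximation.
Context {R : realType} {I : finType}.
Variables (G : (I -> R) -> R) (M L : R).
Hypothesis GM : forall u, `|G u| <= M.
Hypothesis GL : forall (u v : I -> R) (e : R), 0 <= e ->
  (forall i, `|u i - v i| <= e) -> `|G u - G v| <= L * e.

(** The probability that independent binomial variables with parameters [t i] take the values [f i];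
    the Bernstein polynomial is the mean of [G] under this law. *)
Let wt m (t : I -> R) (f : {ffun I -> 'I_m.+1}) : R := \prod_i bern m (f i) (t i).

Let wt_ge0 m t (f : {ffun I -> 'I_m.+1}) : (forall i, 0 <= t i <= 1) -> 0 <= wt t f.
Proof. by move=> t01; apply: prodr_ge0 => i _; exact: bern_ge0. Qed.

Let wt_sum m t : \sum_(f : {ffun I -> 'I_m.+1}) wt t f = 1.
Proof.
rewrite -(bigA_distr_bigA (fun i (k : 'I_m.+1) => bern m k (t i))).
by rewrite big1// => i _; rewrite bern_sum.
Qed.

Let wt_abs m t i (e : R) : (0 < m)%N -> (forall i, 0 <= t i <= 1) -> 0 < e ->
  \sum_(f : {ffun I -> 'I_m.+1}) `|(f i)%:R / m%:R - t i| * wt t f <= e + (m%:R * e)^-1.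
Proof.
move=> m0 t01 e0.
pose F j (k : 'I_m.+1) := (if j == i then `|k%:R / m%:R - t i| else 1) * bern m k (t j).
have -> : \sum_(f : {ffun I -> 'I_m.+1}) `|(f i)%:R / m%:R - t i| * wt t f =
    \sum_(f : {ffun I -> 'I_m.+1}) \prod_j F j (f j).
  apply: eq_bigr => f _; rewrite /F big_split/=; congr (_ * _).
  by rewrite (bigD1 i)//= eqxx big1 ?mulr1// => j /negbTE ->.
rewrite -(bigA_distr_bigA F) (bigD1 i)//= [X in _ * X]big1 ?mulr1; last first.
  move=> j ji; rewrite /F (negbTE ji).
  by under eq_bigr do rewrite mul1r; rewrite bern_sum.
by rewrite /F eqxx; exact: bern_abs.
Qed.

Let trig_bern (m k : nat) (t : (I -> R) -> R) : trig t -> trig (fun x => bern m k (t x)).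
Proof.
move=> tt; have t1 : trig (fun x => 1 - t x).
  apply: trig_eq (trig_add (trig_cst 1) (trig_mul (trig_cst (-1)) tt)) _ => x.
  by rewrite mulN1r.
elim: m k => [|m IH] [|k] /=; do ?exact: trig_cst.
  exact: trig_mul.
by apply: trig_add; exact: trig_mul.
Qed.

(* [p] is the Bernstein polynomial of [G] evaluated at [Lam * sin (x / Lam)],
   which is close to [x] on a bounded box. *)
Lemma trig_approx (B e : R) : 0 <= B -> 0 < e -> exists p : (I -> R) -> R, [/\ trig p,
  forall x, `|p x| <= M &
  forall x, (forall i, `|x i| <= B) -> `|p x - G x| <= e].
Proof.
move=> B0 e0.
pose L1 := `|L| + 1; have L10 : 0 < L1 by rewrite ltr_wpDl.
have GL1 u v r : 0 <= r -> (forall i, `|u i - v i| <= r) -> `|G u - G v| <= L1 * r.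
  move=> r0 /(GL r0) /le_trans; apply; rewrite ler_wpM2r// /L1.
  by rewrite (le_trans (ler_norm L))// lerDl.
(* Two errors of [e / 2]. Replacing [x] by [Lam * sin (x / Lam)] moves it by at most [B ^ 2 / Lam].
   The Bernstein error is at most [2 L1 Lam] times the sum over [I] of the mean deviations, each at
   most [2 r]; [n] exceeds the number of coordinates. *)
pose Lam := 2 * L1 * (B ^+ 2 + 1) / e.
have Lam0 : 0 < Lam by rewrite divr_gt0// mulr_gt0 ?mulr_gt0// ltr_wpDl ?sqr_ge0.
pose n := #|I|%:R + 1 : R; have n0 : 0 < n by rewrite ltr_wpDl.
pose r := e / (8 * L1 * Lam * n); have r0 : 0 < r.
  by apply: divr_gt0 => //; do 3 (apply: mulr_gt0 => //).
have [m m0 hm] : exists2 m : nat, (0 < m)%N & (m%:R * r)^-1 <= r.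
  exists (Num.truncn (r ^- 2)).+1 => //.
  have h := truncnS_gt (r ^- 2); set k := _.+1 in h *.
  have k0 : 0 < k%:R :> R by rewrite ltr0n.
  rewrite invfM ler_pdivrMr// -expr2 -[leRHS]invrK lef_pV2 ?posrE ?invr_gt0 ?exprn_gt0//.
  exact: ltW.
have M0 : 0 < m%:R :> R by rewrite ltr0n.
pose t (x : I -> R) i := (1 + sin (x i * Lam^-1)) / 2.
have t01 x i : 0 <= t x i <= 1.
  have := abs_sin_le1 (x i * Lam^-1); rewrite ler_norml /t => /andP[h1 h2].
  by apply/andP; split; lra.
(* The affine map [t |-> Lam (2 t - 1)] sends the parameter [t x i] to [Lam * sin (x i / Lam)]. *)
pose node (f : {ffun I -> 'I_m.+1}) i := Lam * (2 * ((f i)%:R / m%:R) - 1).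
exists (fun x => \sum_f G (node f) * wt (t x) f); split.
- apply: trig_sum => f; apply: trig_mul; first exact: trig_cst.
  apply: trig_prod => i; apply: trig_bern.
  apply: trig_eq (trig_mul (trig_cst 2^-1) (trig_add (trig_cst 1) (trig_sin i Lam^-1))) _ => x.
  by rewrite /t mulrC.
(* The bound by [M] holds outside the box too, because the sine keeps the parameters in [[0, 1]]. It
   controls the event that the random vector leaves the box. *)
- move=> x; apply: (le_trans (ler_norm_sum _ _ _)).
  rewrite -[leRHS]mulr1 -(wt_sum m (t x)) mulr_sumr; apply: ler_sum => f _.
  by rewrite normrM (ger0_norm (wt_ge0 _ (t01 x))) ler_wpM2r// wt_ge0.
- move=> x xB; pose y i := Lam * sin (x i * Lam^-1).
  have h1 : `|G y - G x| <= e / 2.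
    have -> : e / 2 = L1 * ((B ^+ 2 + 1) / Lam).
      by rewrite /Lam; field; rewrite !gt_eqF// ltr_wpDl ?sqr_ge0.
    apply: GL1 => [|i]; first by rewrite divr_ge0 ?(ltW Lam0)// addr_ge0 ?sqr_ge0.
    have -> : y i - x i = Lam * (sin (x i * Lam^-1) - x i * Lam^-1).
      by rewrite /y; field; rewrite gt_eqF.
    rewrite normrM (gtr0_norm Lam0) ler_pdivlMr//.
    apply: (@le_trans _ _ (Lam * (x i * Lam^-1) ^+ 2 * Lam)).
      by rewrite ler_pM2r// ler_pM2l// sinB_le.
    have -> : Lam * (x i * Lam^-1) ^+ 2 * Lam = x i ^+ 2.
      by field; rewrite gt_eqF.
    rewrite -real_normK ?num_real// (@le_trans _ _ (B ^+ 2)) ?lerDl//.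
    by rewrite lerXn2r ?nnegrE.
  rewrite -(subrK (G y) (\sum__ _)) -addrA (le_trans (ler_normD _ _))//.
  rewrite (splitr e) lerD//.
  have -> : \sum_f G (node f) * wt (t x) f - G y =
      \sum_f (G (node f) - G y) * wt (t x) f.
    under [RHS]eq_bigr do rewrite mulrBl.
    by rewrite sumrB -mulr_sumr wt_sum mulr1.
  apply: (le_trans (ler_norm_sum _ _ _)).
  pose a (f : {ffun I -> 'I_m.+1}) i := `|(f i)%:R / m%:R - t x i|.
  apply: (@le_trans _ _ (\sum_(f : {ffun I -> 'I_m.+1})
    L1 * (2 * Lam * \sum_i a f i) * wt (t x) f)).
    apply: ler_sum => f _; rewrite normrM (ger0_norm (wt_ge0 _ (t01 x))).
    rewrite ler_wpM2r ?wt_ge0//; apply: GL1 => [|i].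
      apply: mulr_ge0; first by apply: mulr_ge0 => //; exact: ltW.
      by apply: sumr_ge0 => j _; exact: normr_ge0.
    have -> : node f i - y i = 2 * Lam * ((f i)%:R / m%:R - t x i).
      by rewrite /node /y /t; field; rewrite gt_eqF.
    have L20 : 0 <= 2 * Lam by apply: mulr_ge0 => //; exact: ltW.
    rewrite normrM (ger0_norm L20) ler_wpM2l//.
    by rewrite (bigD1 i)//= lerDl; apply: sumr_ge0 => j _; exact: normr_ge0.
  have -> : \sum_(f : {ffun I -> 'I_m.+1}) L1 * (2 * Lam * \sum_i a f i) * wt (t x) f =
      2 * L1 * Lam * \sum_i \sum_(f : {ffun I -> 'I_m.+1}) a f i * wt (t x) f.
    rewrite exchange_big/= mulr_sumr; apply: eq_bigr => f _.
    by rewrite -mulr_suml; ring.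
  apply: (@le_trans _ _ (2 * L1 * Lam * \sum_(i : I) (2 * r))).
    have L20 : 0 <= 2 * L1 * Lam.
      by apply: mulr_ge0; [apply: mulr_ge0 => //|]; exact: ltW.
    rewrite ler_wpM2l//; apply: ler_sum => i _.
    have rm := wt_abs i m0 (t01 x) r0.
    by rewrite (le_trans rm)// mulr2n mulrDl mul1r lerD2l.
  rewrite sumr_const.
  have -> : 2 * L1 * Lam * (2 * r *+ #|I|) = e / 2 * (#|I|%:R / n).
    by rewrite -[2 * r *+ _]mulr_natr /r; field; rewrite !gt_eqF.
  rewrite ler_piMr ?divr_ge0 ?(ltW e0)//.
  by rewrite ler_pdivrMr// mul1r lerDl.
Qed.

End TrigApproximation.

(** * Levy's continuity theorem for bounded Lipschitz functions *)

Section LevyContinuity.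
Context {R : realType} {I : finType} d d' (Om : measurableType d) (Om' : measurableType d').
Variables (Pr : probability Om R) (Pr' : probability Om' R).
Variables (v : nat -> Om -> I -> R) (v' : Om' -> I -> R).
Hypothesis mv : forall N i, measurable_fun setT (fun w => v N w i).
Hypothesis mv' : forall i, measurable_fun setT (fun w => v' w i).
Hypothesis cvg_cos : forall xi : I -> R, Ex Pr (fun w => cos (dot xi (v N w))) @[N --> \oo] -->
  Ex Pr' (fun w => cos (dot xi (v' w))).
Hypothesis cvg_sin : forall xi : I -> R, Ex Pr (fun w => sin (dot xi (v N w))) @[N --> \oo] -->
  Ex Pr' (fun w => sin (dot xi (v' w))).
Hypothesis tight : forall e : R, 0 < e -> exists B : R, exists N0, forall N, (N0 <= N)%N ->
  exists A, [/\ measurable A, (Pr A <= e%:E)%E & forall w, ~ A w -> forall i, `|v N w i| <= B].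

Let bm_trig {dT} {T : measurableType dT} (u : T -> I -> R) (p : (I -> R) -> R) :
  (forall i, measurable_fun setT (fun w => u w i)) -> trig p -> bm (fun w => p (u w)).
Proof.
move=> mu; elim=> [a xi c|f g _ bf _ bg]; last exact: bmD.
apply: bmZ; apply: bm_cos; apply: measurable_funD => //.
by apply: measurable_sum => i; apply: measurable_funM.
Qed.

Let cvg_trig p : trig p -> Ex Pr (fun w => p (v N w)) @[N --> \oo] -->
  Ex Pr' (fun w => p (v' w)).
Proof.
elim=> [a xi c|f g tf IHf tg IHg]; last first.
  rewrite ExD; [|exact: bm_trig|exact: bm_trig].
  under eq_cvg do rewrite (ExD Pr (bm_trig (mv _) tf) (bm_trig (mv _) tg)).
  exact: cvgD.
have E dT (T : measurableType dT) (mu : probability T R) (u : T -> I -> R) :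
    (forall i, measurable_fun setT (fun w => u w i)) ->
    Ex mu (fun w => a * cos (dot xi (u w) + c)) =
    a * (cos c * Ex mu (fun w => cos (dot xi (u w))) - sin c * Ex mu (fun w => sin (dot xi (u w)))).
  move=> mu_; have md : measurable_fun setT (fun w => dot xi (u w)).
    by apply: measurable_sum => i; apply: measurable_funM.
  rewrite -!ExZ -?ExB ?ExZ; do ?[exact: bm_cos|exact: bm_sin].
  - by congr (_ * Ex _ _); apply/funext => w; rewrite cosD; ring.
  - by apply: bm_cos; apply: measurable_funD.
  - by apply: bmZ; exact: bm_cos.
  - by apply: bmZ; exact: bm_sin.
rewrite E//; under eq_cvg do rewrite E//.
apply: cvgM; first exact: cvg_cst.
by apply: cvgB; apply: cvgM => //; exact: cvg_cst.
Qed.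

(** Tightness confines the vectors to a box, on which [G] is uniformly close to a trigonometric
    polynomial; convergence is known for the latter. *)
Theorem levy_continuity (G : (I -> R) -> R) :
  (exists M : R, forall u, `|G u| <= M) -> lipschitz_sup G ->
  Ex Pr (fun w => G (v N w)) @[N --> \oo] --> Ex Pr' (fun w => G (v' w)).
Proof.
move=> [M GM] [L GL].
have M0 : 0 <= M by rewrite (le_trans _ (GM (fun=> 0))).
have bG dT (T : measurableType dT) (u : T -> I -> R) :
    (forall i, measurable_fun setT (fun w => u w i)) -> bm (fun w => G (u w)).
  move=> mu; apply: (@bm_bounded _ _ _ M) => //.
  apply: measurable_seq_continuous => // z z0 zz0; apply/cvgrPdist_le => e e0.
  have L0 : 0 < `|L| + 1 by rewrite ltr_wpDl.
  have near_all : \forall n \near \oo, forall i, `|z0 i - z n i| <= e / (`|L| + 1).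
    apply: filter_forall => i; have /cvgrPdist_le := zz0 i; apply; exact: divr_gt0.
  near=> n; have hn : forall i, `|z0 i - z n i| <= e / (`|L| + 1) by near: n.
  have h := GL _ _ _ (ltW (divr_gt0 e0 L0)) hn; rewrite (le_trans h)//.
  by rewrite mulrA ler_pdivrMr// mulrC ler_pM2l// (le_trans (ler_norm L))// lerDl.
apply/cvgrPdist_le => e e0.
(* Replacing [G] by [p] costs [(2 M + 1) e1] under each of the two laws, and the convergence for [p]
   costs [e1]. *)
pose e1 := e / (4 * M + 3).
have M2 : 0 < 4 * M + 3 by rewrite ltr_wpDl ?mulr_ge0.
have e10 : 0 < e1 by rewrite divr_gt0.
have [B [N0 hB]] := tight e10.
(* A single law on a finite-dimensional space is tight. *)
have [B' [A' [mA' PA' hA']]] : exists B' A', [/\ measurable A', (Pr' A' <= e1%:E)%E &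
    forall w, ~ A' w -> forall i, `|v' w i| <= B'].
  pose A n := \bigcup_(i in [set: I]) [set w | n%:R < `|v' w i|].
  have mA n : measurable (A n).
    apply: fin_bigcup_measurable => // i _.
    have : measurable_fun setT (fun w => `|v' w i|) by apply: measurableT_comp.
    by move=> /(_ measurableT _ (measurable_itv `]n%:R, +oo[)); rewrite setTI set_itvoy.
  have : Ex Pr' \1_(A n) @[n --> \oo] --> Ex Pr' (fun=> 0).
    apply: (@Ex_cvg _ _ _ _ _ _ 1).
    - by move=> n; exact: measurable_indic.
    - by move=> n w; rewrite indicE ger0_norm// lern1 leq_b1.
    move=> w; apply: cvg_near_cst; near=> n.
    rewrite indicE memNset// => -[i _ /=]; apply/negP; rewrite -leNgt.
    apply: (@le_trans _ _ (\sum_i `|v' w i|)).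
      by rewrite (bigD1 i)//= lerDl sumr_ge0.
    by near: n; exact: nbhs_infty_ger.
  rewrite Ex_cst => /cvgrPdist_le /(_ _ e10) [n _ /(_ n (leqnn _))] /=.
  rewrite sub0r normrN Ex_indic// ger0_norm ?fine_ge0// => h.
  exists n%:R, (A n); split=> //; first by rewrite -fine_muE// lee_fin.
  by move=> w nA i; rewrite leNgt; apply/negP => h2; apply: nA; exists i.
pose C := Num.max `|B| `|B'|.
have BC : B <= C by rewrite (le_trans (ler_norm B))// le_max lexx.
have BC' : B' <= C by rewrite (le_trans (ler_norm B'))// le_max lexx orbT.
have C0 : 0 <= C by rewrite le_max normr_ge0.
have [p [tp pM pG]] := trig_approx GM GL C0 e10.
have key dT (T : measurableType dT) (mu : probability T R) (u : T -> I -> R) (A : set T) :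
    (forall i, measurable_fun setT (fun w => u w i)) ->
    measurable A -> (mu A <= e1%:E)%E -> (forall w, ~ A w -> forall i, `|u w i| <= C) ->
    `|Ex mu (fun w => p (u w)) - Ex mu (fun w => G (u w))| <= (2 * M + 1) * e1.
  move=> mu_ mA PA hA; rewrite -ExB; [|exact: bm_trig|exact: bG].
  have b1 : bm (fun w => p (u w) - G (u w)) by apply: bmB; [exact: bm_trig|exact: bG].
  apply: (le_trans (Ex_abs _ b1)).
  apply: (@le_trans _ _ (Ex mu (fun w => e1 + 2 * M * \1_A w))).
    apply: Ex_le; first exact: bm_norm.
      by apply: bmD; [exact: bm_cst|apply: bmZ; exact: bm_indic].
    move=> w; rewrite indicE; case: (boolP (w \in A)) => [_|/negP wA].
      rewrite mulr1 (le_trans (ler_normB _ _))// (le_trans (lerD (pM _) (GM _)))//.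
      by rewrite -mulr2n mulr_natl lerDr ltW.
    rewrite mulr0 addr0; apply: pG; apply: hA => Aw; apply: wA; by rewrite inE.
  rewrite ExD; [|exact: bm_cst|by apply: bmZ; exact: bm_indic].
  rewrite Ex_cst ExZ; last exact: bm_indic.
  have -> : (2 * M + 1) * e1 = e1 + 2 * M * e1 by ring.
  rewrite Ex_indic// lerD2l ler_wpM2l ?mulr_ge0//.
  by rewrite -lee_fin fine_muE.
near=> N.
have [A [mA PA hA]] : exists A, [/\ measurable A, (Pr A <= e1%:E)%E &
    forall w, ~ A w -> forall i, `|v N w i| <= B].
  by apply: hB; near: N; exact: nbhs_infty_ge.
have k1 := key _ _ Pr (v N) A (mv N) mA PA
  (fun w nA i => le_trans (hA w nA i) BC).
have k2 := key _ _ Pr' v' A' mv' mA' PA'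
  (fun w nA i => le_trans (hA' w nA i) BC').
have k3 : `|Ex Pr' (fun w => p (v' w)) - Ex Pr (fun w => p (v N w))| <= e1.
  by near: N; have /cvgrPdist_le := cvg_trig tp; apply.
have -> : e = (2 * M + 1) * e1 + (e1 + (2 * M + 1) * e1).
  by rewrite /e1; field; rewrite gt_eqF.
rewrite -(subrK (Ex Pr' (fun w => p (v' w))) (Ex Pr' _)) -addrA.
rewrite (le_trans (ler_normD _ _))// lerD//; first by rewrite distrC.
rewrite -(subrK (Ex Pr (fun w => p (v N w))) (Ex Pr' _)) -addrA.
by rewrite (le_trans (ler_normD _ _))// lerD.
Unshelve. all: by end_near. Qed.

End LevyContinuity.

(** * Kernels and the spectral gap *)

Section KernelProbability.
Context {R : realType} {d} {E : measurableType d}.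
Variable P : R.-pker E ~> E.

(** A copy of [P x] that carries a probability structure, so that the results on [Ex] apply to the
    transition operator pointwise. *)
Definition kprob (x : E) : set E -> \bar R := P x.

Let kprob0 x : kprob x set0 = 0%E. Proof. exact: measure0. Qed.
Let kprob_ge0 x A : (0 <= kprob x A)%E. Proof. exact: measure_ge0. Qed.
Let kprob_sigma_additive x : semi_sigma_additive (kprob x).
Proof. exact: (@measure_semi_sigma_additive _ _ _ (P x)). Qed.

HB.instance Definition _ x := isMeasure.Build _ _ _ (kprob x)
  (kprob0 x) (kprob_ge0 x) (@kprob_sigma_additive x).
HB.instance Definition _ x := Measure_isProbability.Build _ _ _ (kprob x)
  (prob_kernel x).

End KernelProbability.

Section L2Norm.
Context {R : realType} {d} {E : measurableType d} (mu : probability E R).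
Implicit Types f g : E -> R.

Definition n2 f : R := Num.sqrt (Ex mu (fun x => f x ^+ 2)).

Lemma Ex_sqr_ge0 f : 0 <= Ex mu (fun x => f x ^+ 2).
Proof. by apply: Ex_ge0 => x; exact: sqr_ge0. Qed.

Lemma n2_ge0 f : 0 <= n2 f. Proof. exact: sqrtr_ge0. Qed.

Lemma n2_sqr f : n2 f ^+ 2 = Ex mu (fun x => f x ^+ 2).
Proof. by rewrite sqr_sqrtr// Ex_sqr_ge0. Qed.

Lemma n2_le_of_sqr f (c : R) : 0 <= c -> Ex mu (fun x => f x ^+ 2) <= c ^+ 2 -> n2 f <= c.
Proof. by move=> c0 h; rewrite -[leRHS]ger0_norm// -sqrtr_sqr ler_wsqrtr. Qed.

Lemma Ex_mul_le f g : bm f -> bm g -> `|Ex mu (fun x => f x * g x)| <= n2 f * n2 g.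
Proof.
move=> bf bg; rewrite -[leLHS]ger0_norm// -ler_sqr ?nnegrE ?mulr_ge0 ?n2_ge0//.
by rewrite normr_id real_normK ?num_real// exprMn !n2_sqr; exact: Ex_CS.
Qed.

Lemma Ex_norm_le f : bm f -> Ex mu (fun x => `|f x|) <= n2 f.
Proof.
move=> bf; have : 0 <= Ex mu (fun x => `|f x|) by exact: Ex_ge0.
by move=> h; rewrite -ler_sqr ?nnegrE ?n2_ge0// n2_sqr; exact: Ex_abs_sqr.
Qed.

Lemma n2D f g : bm f -> bm g -> n2 (fun x => f x + g x) <= n2 f + n2 g.
Proof.
move=> bf bg; apply: n2_le_of_sqr; first by rewrite addr_ge0 ?n2_ge0.
have -> : (fun x => (f x + g x) ^+ 2) = (fun x => f x ^+ 2 + 2 * (f x * g x) + g x ^+ 2).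
  by apply/funext => x; ring.
rewrite !ExD ?ExZ; do ?by bmt.
rewrite -!n2_sqr; have := Ex_mul_le bf bg.
rewrite ler_norml => /andP[_]; set u := n2 f; set w := n2 g; nra.
Qed.

Lemma n2_le f g : bm f -> bm g -> (forall x, `|f x| <= `|g x|) -> n2 f <= n2 g.
Proof.
move=> bf bg fg; rewrite ler_wsqrtr//; apply: Ex_le; do ?by bmt.
move=> x; rewrite -(real_normK (num_real (f x))) -(real_normK (num_real (g x))).
by rewrite lerXn2r ?nnegrE.
Qed.

Lemma n2Z c f : bm f -> n2 (fun x => c * f x) = `|c| * n2 f.
Proof.
move=> bf; rewrite /n2; under eq_fun do rewrite exprMn.
by rewrite ExZ; [rewrite sqrtrM ?sqr_ge0// sqrtr_sqr|bmt].
Qed.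

Lemma n2_cst c : n2 (fun=> c) = `|c|.
Proof. by rewrite /n2 Ex_cst sqrtr_sqr. Qed.

Lemma n2_center f : bm f -> n2 (fun x => f x - Ex mu f) <= n2 f.
Proof.
move=> bf; apply: n2_le_of_sqr; first exact: n2_ge0.
set c := Ex mu f; rewrite n2_sqr.
have -> : (fun x => (f x - c) ^+ 2) = (fun x => f x ^+ 2 - 2 * c * f x + c ^+ 2).
  by apply/funext => x; ring.
rewrite ExD ?ExB ?ExZ ?Ex_cst; do ?by bmt.
by rewrite -/c; have := sqr_ge0 c; nra.
Qed.

Lemma n2_indic A : measurable A -> n2 \1_A = Num.sqrt (fine (mu A)).
Proof.
move=> mA; rewrite /n2 -Ex_indic//; congr (Num.sqrt (Ex _ _)); apply/funext => x.
by rewrite indicE; case: (x \in A); rewrite ?expr1n ?expr0n.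
Qed.

End L2Norm.

Section TransitionOperator.
Context {R : realType} {d} {E : measurableType d}.
Variables (P : R.-pker E ~> E) (mu : probability E R).
Hypothesis mu_invariant : invariant_law P mu.
Implicit Types f g : E -> R.

Local Notation top := (transition_op P).

Lemma topE f x : top f x = Ex (kprob P x) f. Proof. by []. Qed.

Lemma top_indic A x : measurable A -> top \1_A x = fine (P x A).
Proof. by move=> mA; rewrite topE Ex_indic. Qed.

Lemma top_abs_le f x (M : R) : bm f -> (forall x, `|f x| <= M) -> `|top f x| <= M.
Proof. by move=> bf fM; rewrite topE; exact: Ex_abs_le. Qed.

Let measurable_top_indic A : measurable A -> measurable_fun setT (top \1_A).
Proof.
move=> mA; rewrite (_ : top \1_A = fun x => fine (P x A)); last first.
  by apply/funext => x; exact: top_indic.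
by apply: measurableT_comp => //; exact: measurable_kernel.
Qed.

(** Step functions approximate [f] uniformly, and averaging over [P x] preserves uniform
    approximation. *)
Lemma measurable_top f : bm f -> measurable_fun setT (top f).
Proof.
move=> bf; have e0 n : 0 < (n.+1%:R^-1 : R) by rewrite invr_gt0.
have h n : exists g, [/\ bm g, measurable_fun setT (top g) &
    forall x, `|f x - g x| <= n.+1%:R^-1].
  have [k [c [A [mA fA]]]] := bm_approx bf (e0 n).
  exists (fun x => \sum_(i < k) c i * \1_(A i) x); split=> //.
    by apply: bm_sum => i; apply: bmZ; exact: bm_indic.
  rewrite (_ : top _ = fun x => \sum_(i < k) c i * top \1_(A i) x).
    by apply: measurable_sum => i; apply: measurable_funM => //; exact: measurable_top_indic.
  apply/funext => x; rewrite topE Ex_sum; last by move=> i; apply: bmZ; exact: bm_indic.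
  by apply: eq_bigr => i _; rewrite ExZ//; exact: bm_indic.
pose g n := sval (cid (h n)); have gP n := svalP (cid (h n)).
apply: (@measurable_fun_cvg _ _ _ setT (fun n => top (g n))) => [n|x _].
  by have [] := gP n.
apply/cvgrPdist_le => e e_gt0; near=> n; have [bg _ fg] := gP n.
rewrite !topE (le_trans (Ex_dist _ bf bg fg))//.
rewrite invf_ple ?posrE// (@le_trans _ _ n%:R) ?ler_nat//.
by near: n; exact: nbhs_infty_ger.
Unshelve. all: by end_near. Qed.

Lemma bm_top f : bm f -> bm (top f).
Proof.
move=> bf; have [_ [M fM]] := bf; apply: (@bm_bounded _ _ _ M).
  exact: measurable_top.
by move=> x; exact: top_abs_le.
Qed.

Lemma top_cst c x : top (fun=> c) x = c. Proof. by rewrite topE Ex_cst. Qed.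

Lemma topD f g x : bm f -> bm g -> top (fun y => f y + g y) x = top f x + top g x.
Proof. by move=> bf bg; rewrite !topE ExD. Qed.

Lemma topB f g x : bm f -> bm g -> top (fun y => f y - g y) x = top f x - top g x.
Proof. by move=> bf bg; rewrite !topE ExB. Qed.

Lemma topZ c f x : bm f -> top (fun y => c * f y) x = c * top f x.
Proof. by move=> bf; rewrite !topE ExZ. Qed.

Lemma Ex_top f : bm f -> Ex mu (top f) = Ex mu f.
Proof.
move=> bf; apply/eqP; rewrite -subr_eq0; apply/eqP.
apply: (bm_linear_eq0 (L := fun g => Ex mu (top g) - Ex mu g) (C := 2)) bf.
- move=> g h bg bh; rewrite ExD// -addrACA -opprD; congr (_ - _).
  by rewrite -ExD; [congr Ex; apply/funext => x; exact: topD|exact: bm_top|exact: bm_top].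
- move=> c g bg; rewrite ExZ// mulrBr; congr (_ - _).
  by rewrite -ExZ; [congr Ex; apply/funext => x; exact: topZ|exact: bm_top].
- move=> A mA; apply/eqP; rewrite subr_eq0; apply/eqP.
  rewrite Ex_indic// mu_invariant// /Ex /Rintegral.
  congr fine; apply: eq_integral => x _; rewrite top_indic//.
  exact: (fine_muE (kprob P x)).
- move=> g r bg gr; rewrite (le_trans (ler_normB _ _))// mulr_natl mulr2n lerD//.
    by apply: Ex_abs_le => [|x]; [exact: bm_top|exact: top_abs_le].
  exact: Ex_abs_le.
Qed.

(** Jensen's inequality under each [P x], then invariance of [mu]. *)
Lemma n2_top f : bm f -> n2 mu (top f) <= n2 mu f.
Proof.
move=> bf; apply: n2_le_of_sqr; first exact: n2_ge0.
rewrite n2_sqr -(Ex_top (bm_sqr bf)); apply: Ex_le.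
- by apply: bm_sqr; exact: bm_top.
- by apply: bm_top; exact: bm_sqr.
move=> x; rewrite !topE; apply: le_trans (Ex_abs_sqr _ bf).
rewrite -(real_normK (num_real (Ex _ f))) lerXn2r ?nnegrE ?Ex_ge0//.
exact: Ex_abs.
Qed.

Definition gap_bound (a : R) := 0 <= a < 1 /\
  forall f, bm f -> Ex mu f = 0 -> n2 mu (top f) <= a * n2 mu f.

Lemma Lnorm2 f : bm f -> 'N[mu]_2%:E[EFin \o f]%E = (n2 mu f)%:E.
Proof.
move=> bf; rewrite unlock/= /n2 -[Num.sqrt _]powR12_sqrt; last exact: Ex_sqr_ge0.
rewrite -poweR_EFin; congr (_ `^ _)%E.
rewrite -ExE; last exact: bm_sqr.
by apply: eq_integral => x _ /=; rewrite powR_mulrn// real_normK ?num_real.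
Qed.

Lemma spectral_gap_bound : spectral_gap P mu -> exists a, gap_bound a.
Proof.
rewrite /spectral_gap; set S := (X in ereal_sup X) => S1.
(* The supremum is [-oo] when no centered function of norm 1 exists, for instance if [mu] is a Dirac
   mass. *)
pose b := maxe (ereal_sup S) 0%E.
have b0 : (0 <= b)%E by rewrite le_max lexx orbT.
have b1 : (b < 1)%E by rewrite gt_max S1 lte01.
have bfin : b \is a fin_num by rewrite ge0_fin_numE// (lt_trans b1)// ltry.
exists (fine b); split.
  by rewrite fine_ge0//= -lte_fin fineK.
move=> f bf f0; have [n0|n1] := eqVneq (n2 mu f) 0.
  by rewrite n0 mulr0 -n0 n2_top.
have np : 0 < n2 mu f by rewrite lt_def n1 n2_ge0.
pose g x := (n2 mu f)^-1 * f x.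
have bg : bm g by exact: bmZ.
have ng : n2 mu g = 1 by rewrite n2Z// gtr0_norm ?invr_gt0// mulVf.
have h : S (n2 mu (top g))%:E.
  exists g; last by rewrite Lnorm2//; exact: bm_top.
  split; [exact: bm_meas|by rewrite Lnorm2// ng|].
  by rewrite ExE// ExZ// f0 mulr0.
have : n2 mu (top g) <= fine b.
  by rewrite -lee_fin fineK// le_max ereal_sup_ubound.
rewrite (_ : top g = fun x => (n2 mu f)^-1 * top f x); last first.
  by apply/funext => x; exact: topZ.
have btf := bm_top bf.
by rewrite n2Z// gtr0_norm ?invr_gt0// mulrC ler_pdivrMr.
Qed.

End TransitionOperator.

(** * Complex exponentials *)

Section ComplexModulus.
Context {R : realType}.
Local Open Scope complex_scope.
Implicit Types (z w : R[i]) (x y : R).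

Definition cmod z : R := ComplexField.Normc.normc z.

#[global] Arguments cmod : simpl never.

Lemma cmodE x y : cmod (x +i* y) = Num.sqrt (x ^+ 2 + y ^+ 2). Proof. by []. Qed.

Lemma cmod_ge0 z : 0 <= cmod z. Proof. by case: z => x y; rewrite cmodE sqrtr_ge0. Qed.

Lemma cmodM z w : cmod (z * w) = cmod z * cmod w.
Proof. exact: ComplexField.Normc.normcM. Qed.

Lemma cmodD z w : cmod (z + w) <= cmod z + cmod w.
Proof. exact: le_normcD. Qed.

Lemma cmodN z : cmod (- z) = cmod z. Proof. exact: normcN. Qed.

Lemma cmod0 : cmod 0 = 0. Proof. exact: ComplexField.Normc.normc0. Qed.

Lemma cmod1 : cmod 1 = 1. Proof. exact: ComplexField.Normc.normc1. Qed.

Lemma cmodB z w : cmod (z - w) = cmod (w - z).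
Proof. by rewrite -cmodN opprB. Qed.

Lemma cmod_dist z w u : cmod (z - w) <= cmod (z - u) + cmod (u - w).
Proof. by rewrite -[z - w](subrKA u); exact: cmodD. Qed.

Lemma cmod_le x y : cmod (x +i* y) <= `|x| + `|y|.
Proof.
rewrite cmodE -[leRHS]ger0_norm ?addr_ge0// -sqrtr_sqr ler_wsqrtr// sqrrD !real_normK ?num_real//.
by rewrite lerD2r lerDl mulrn_wge0// mulr_ge0.
Qed.

Lemma cmod_Re x y : `|x| <= cmod (x +i* y).
Proof. by rewrite cmodE -sqrtr_sqr ler_wsqrtr// lerDl sqr_ge0. Qed.

Lemma cmod_Im x y : `|y| <= cmod (x +i* y).
Proof. by rewrite cmodE -sqrtr_sqr ler_wsqrtr// lerDr sqr_ge0. Qed.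

Lemma cmod_sub_le z w x y : `|complex.Re z - complex.Re w| <= x ->
  `|complex.Im z - complex.Im w| <= y -> cmod (z - w) <= x + y.
Proof.
case: z w => z1 z2 [w1 w2] /= h1 h2.
by apply: (le_trans (cmod_le _ _)); rewrite lerD.
Qed.

Lemma cmod_le1 x y : x ^+ 2 + y ^+ 2 <= 1 -> cmod (x +i* y) <= 1.
Proof. by move=> h; rewrite cmodE -[leRHS]sqrtr1 ler_wsqrtr. Qed.

Lemma cmod_prod (I : Type) (r : seq I) (F : I -> R[i]) :
  (forall i, cmod (F i) <= 1) -> cmod (\prod_(i <- r) F i) <= 1.
Proof.
move=> F1; elim: r => [|i r IH]; first by rewrite big_nil cmod1.
by rewrite big_cons cmodM mulr_ile1// cmod_ge0.
Qed.

(** Telescoping: the factors lie in the unit disc, so the errors simply add. *)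
Lemma cmod_prodB (I : Type) (r : seq I) (F G : I -> R[i]) :
  (forall i, cmod (F i) <= 1) -> (forall i, cmod (G i) <= 1) ->
  cmod (\prod_(i <- r) F i - \prod_(i <- r) G i) <= \sum_(i <- r) cmod (F i - G i).
Proof.
move=> F1 G1; elim: r => [|i r IH]; first by rewrite !big_nil subrr cmod0.
rewrite !big_cons.
set p := \prod_(j <- r) F j; set q := \prod_(j <- r) G j.
have -> : F i * p - G i * q = (F i - G i) * p + G i * (p - q) by ring.
apply: (le_trans (cmodD _ _)); rewrite !cmodM lerD//.
  by rewrite ler_piMr ?cmod_ge0// cmod_prod.
by apply: le_trans IH; rewrite ler_piMl ?cmod_ge0.
Qed.

Lemma cexpE x y : cexp (x +i* y) = (expR x * cos y) +i* (expR x * sin y).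
Proof. by rewrite /cexp /=; simpc. Qed.

Lemma cexpD z w : cexp (z + w) = cexp z * cexp w.
Proof.
case: z w => x y [x' y']; rewrite [(x +i* y) + _]/(GRing.add _ _)/= !cexpE; simpc.
by apply/eqP; rewrite eq_complex/= expRD cosD sinD; apply/andP; split; apply/eqP; ring.
Qed.

Lemma cexp0 : cexp (0 : R[i]) = 1.
Proof. by rewrite -[0]/(0 +i* 0) cexpE expR0 cos0 sin0 mulr1 mulr0. Qed.

Lemma cexp_sum (I : Type) (r : seq I) (F : I -> R[i]) :
  cexp (\sum_(i <- r) F i) = \prod_(i <- r) cexp (F i).
Proof.
elim: r => [|i r IH]; first by rewrite !big_nil cexp0.
by rewrite !big_cons cexpD IH.
Qed.

Lemma cmod_cexp x y : cmod (cexp (x +i* y)) = expR x.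
Proof.
rewrite cexpE cmodE !exprMn -mulrDr cos2Dsin2 mulr1 sqrtr_sqr ger0_norm// expR_ge0.
Qed.

Lemma expR_sub_bound x : x <= 0 -> 0 <= expR x - 1 - x <= x ^+ 2.
Proof.
move=> x0; have h1 := expR_ge1Dx x; have h2 := expR_ge1Dx (- x).
have e0 : 0 < expR (- x) by exact: expR_gt0.
have x1 : 0 < 1 - x by rewrite subr_gt0 (le_lt_trans x0).
have h3 : expR x <= (1 - x)^-1.
  by rewrite -[x in expR x]opprK expRN lef_pV2 ?posrE.
apply/andP; split; first lra.
apply: (@le_trans _ _ ((1 - x)^-1 - 1 - x)); first by rewrite !lerD2r.
have -> : (1 - x)^-1 - 1 - x = x ^+ 2 / (1 - x) by field; rewrite gt_eqF.
by rewrite ler_pdivrMr// ler_peMr ?sqr_ge0// lerDl oppr_ge0.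
Qed.

Lemma cexp_second_order x y : x <= 0 ->
  cmod (cexp (x +i* y) - 1 - (x +i* y)) <= 4 * (x ^+ 2 + y ^+ 2).
Proof.
move=> x0; rewrite cexpE.
have /andP[h1 h2] := expR_sub_bound x0.
have e1 : expR x <= 1 by rewrite -expR0 ler_expR.
have e0 : 0 <= expR x by exact: expR_ge0.
have -> : (expR x * cos y +i* (expR x * sin y)) - 1 - (x +i* y) =
    (expR x * (cos y - 1) + (expR x - 1 - x)) +i* (expR x * (sin y - y) + (expR x - 1) * y).
  by apply/eqP; rewrite eq_complex/=; apply/andP; split; apply/eqP; ring.
apply: (le_trans (cmod_le _ _)).
have k1 : `|expR x * (cos y - 1)| <= y ^+ 2.
  rewrite normrM ger0_norm// (@le_trans _ _ (1 * `|cos y - 1|))//.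
    by rewrite ler_wpM2r.
  by rewrite mul1r cosB1_le.
have k2 : `|expR x * (sin y - y)| <= y ^+ 2.
  rewrite normrM ger0_norm// (@le_trans _ _ (1 * `|sin y - y|))//.
    by rewrite ler_wpM2r.
  by rewrite mul1r sinB_le.
have k3 : `|(expR x - 1) * y| <= x ^+ 2 + y ^+ 2.
  have hx : `|expR x - 1| <= `|x|.
    by rewrite !ler0_norm ?subr_le0//; lra.
  rewrite normrM (le_trans (ler_wpM2r (normr_ge0 y) hx))//.
  rewrite -(real_normK (num_real x)) -(real_normK (num_real y)).
  have := sqr_ge0 (`|x| - `|y|); have := sqr_ge0 `|x|; have := sqr_ge0 `|y|.
  by move: `|x| `|y| => u w; rewrite sqrrB; nra.
have k4 : `|expR x - 1 - x| <= x ^+ 2 by rewrite ger0_norm.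
have := ler_normD (expR x * (cos y - 1)) (expR x - 1 - x).
have := ler_normD (expR x * (sin y - y)) ((expR x - 1) * y).
have := sqr_ge0 x; have := sqr_ge0 y.
move: k1 k2 k3 k4; clear; move: (`|_ + _|) (`|_ + _|) => u w.
move: (`|_|) (`|_|) (`|_|) (`|_|) => *; lra.
Qed.

End ComplexModulus.

(** * Characteristic functions along the chain *)

Section MarkovChain.
Context {R : realType} {dE} {E : measurableType dE} {d} {Om : measurableType d}.
Variables (Pr : probability Om R) (P : R.-pker E ~> E) (mu : probability E R).
Variable X : nat -> {RV Pr >-> E}.
Hypothesis X_markov : markov_chain P mu X.
Hypothesis mu_invariant : invariant_law P mu.

Local Notation top := (transition_op P).

Lemma measurable_chain n : measurable_fun setT (X n).
Proof. exact: measurable_funPT. Qed.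

(** The space [Om] with the sigma-algebra of the past as a measurable type: [bm (f : hist n -> R)]
    says that [f] is a bounded function of the chain up to time [n]. *)
Definition hist n := g_sigma_algebraType
  (\bigcup_(k in `I_n.+1) preimage_set_system setT (X k) measurable).

Lemma hist_measurable n A : history X n A -> measurable A.
Proof.
apply: smallest_sub; first exact: sigma_algebra_measurable.
move=> B [k _ [C mC <-]]; exact: measurable_chain.
Qed.

Lemma history_le n m A : (n <= m)%N -> history X n A -> history X m A.
Proof.
move=> nm; apply: smallest_sub; first exact: smallest_sigma_algebra.
move=> B [k /= kn hB]; apply: sub_sigma_algebra; exists k => //=.
exact: leq_trans kn _.
Qed.

Lemma bm_hist n (f : hist n -> R) : bm f -> bm (f : Om -> R).
Proof.
move=> [mf [M fM]]; split; last by exists M.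
by move=> _ B mB; apply: (@hist_measurable n); exact: mf.
Qed.

Lemma bm_hist_le n m (f : hist n -> R) : (n <= m)%N -> bm f -> bm (f : hist m -> R).
Proof.
move=> nm [mf [M fM]]; split; last by exists M.
by move=> _ B mB; apply: (history_le nm); exact: mf.
Qed.

Lemma bm_hist_chain n k (f : E -> R) : (k <= n)%N -> bm f ->
  bm (fun w : hist n => f (X k w)).
Proof.
move=> kn [mf [M fM]]; split; last by exists M.
move=> _ B mB; rewrite setTI; apply: sub_sigma_algebra; exists k => //=.
exists (f @^-1` B); last by rewrite setTI.
by rewrite -[X in measurable X]setTI; exact: mf.
Qed.

Lemma bm_chain n (f : E -> R) : bm f -> bm (fun w => f (X n w)).
Proof. by move=> bf; apply: bm_compT => //; exact: measurable_chain. Qed.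

Let markov_indic n (H : set Om) (A : set E) : history X n H -> measurable A ->
  Ex Pr (fun w => \1_H w * \1_A (X n.+1 w)) = Ex Pr (fun w => \1_H w * top \1_A (X n w)).
Proof.
move=> hH mA; have mH := hist_measurable hH.
rewrite (_ : (fun w => \1_H w * \1_A (X n.+1 w)) = \1_(H `&` X n.+1 @^-1` A)); last first.
  by rewrite indicI; apply/funext => w; congr (_ * _); rewrite !indicE.
rewrite Ex_indic; last first.
  apply: measurableI => //; rewrite -[_ @^-1` _]setTI.
  exact: measurable_chain.
rewrite (proj2 X_markov)// /Ex /Rintegral; congr fine.
rewrite [LHS]integral_mkcond; apply: eq_integral => w _; rewrite /patch indicE.
case: (w \in H); last by rewrite mul0r.
by rewrite mul1r top_indic//; apply/esym; exact: (fine_muE (kprob P (X n w))).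
Qed.

(** The Markov property is given for events. It is extended to functions in two stages, first in [g]
    for an event of the past, then in [f]. *)
Lemma markov_ex n (f : hist n -> R) (g : E -> R) : bm f -> bm g ->
  Ex Pr (fun w => f w * g (X n.+1 w)) = Ex Pr (fun w => f w * top g (X n w)).
Proof.
move=> bf bg; apply/eqP; rewrite -subr_eq0; apply/eqP.
have [_ [M gM]] := bg.
have bgX := bm_chain n.+1 bg; have btX := bm_chain n (bm_top P bg).
apply: (bm_linear_eq0 (T := hist n) (L := fun h => Ex Pr (fun w => h w * g (X n.+1 w)) -
  Ex Pr (fun w => h w * top g (X n w))) (C := M + M)) bf.
- move=> h h' /bm_hist bh /bm_hist bh'.
  under eq_fun do rewrite mulrDl.
  under [X in _ - Ex _ X]eq_fun do rewrite mulrDl.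
  by rewrite !ExD; [rewrite opprD addrACA|exact: bmM|exact: bmM|exact: bmM|exact: bmM].
- move=> c h /bm_hist bh.
  under eq_fun do rewrite -mulrA.
  under [X in _ - Ex _ X]eq_fun do rewrite -mulrA.
  by rewrite !ExZ; [ring|exact: bmM|exact: bmM].
- move=> H mH; have bH := bm_indic (R := R) (hist_measurable mH).
  apply: (bm_linear_eq0 (L := fun g => Ex Pr (fun w => \1_H w * g (X n.+1 w)) -
    Ex Pr (fun w => \1_H w * top g (X n w))) (C := 2)) bg.
  + move=> h h' bh bh'.
    under eq_fun do rewrite mulrDr.
    under [X in _ - Ex _ X]eq_fun do rewrite topD// mulrDr.
    have k1 := bm_chain n.+1 bh; have k2 := bm_chain n.+1 bh'.
    have k3 := bm_chain n (bm_top P bh); have k4 := bm_chain n (bm_top P bh').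
    by rewrite !ExD; [rewrite opprD addrACA|exact: bmM|exact: bmM|exact: bmM|exact: bmM].
  + move=> c h bh.
    under eq_fun do rewrite mulrCA.
    under [X in _ - Ex _ X]eq_fun do rewrite topZ// mulrCA.
    have k1 := bm_chain n.+1 bh; have k3 := bm_chain n (bm_top P bh).
    by rewrite !ExZ; [ring|exact: bmM|exact: bmM].
  + by move=> A mA; rewrite markov_indic// subrr.
  + move=> h r bh hr; rewrite (le_trans (ler_normB _ _))// mulr_natl mulr2n.
    have ind1 (u : R) w : `|u| <= r -> `|\1_H w * u| <= r.
      by move=> ur; rewrite indicE; case: (w \in H); rewrite ?mul1r// mul0r normr0 (le_trans _ ur).
    rewrite lerD//; apply: Ex_abs_le => [|w].
    * by apply: bmM => //; exact: bm_chain.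
    * exact: ind1.
    * by apply: bmM => //; apply: bm_chain; exact: bm_top.
    * by apply: ind1; exact: top_abs_le.
- move=> h r /bm_hist bh hr; rewrite (le_trans (ler_normB _ _))// mulrDl.
  rewrite lerD//; apply: Ex_abs_le => [|w].
  + exact: bmM.
  + by rewrite normrM mulrC ler_pM.
  + exact: bmM.
  + by rewrite normrM mulrC ler_pM//; exact: top_abs_le.
Qed.

Lemma chain_law n A : measurable A -> Pr (X n @^-1` A) = mu A.
Proof.
elim: n A => [|n IH] A mA; first exact: (proj1 X_markov).
have hT : history X n setT := @measurableT _ (hist n).
have := proj2 X_markov n setT A hT mA; rewrite setTI => ->.
have bt : bm (top (\1_A : E -> R)) by apply: bm_top; exact: bm_indic.
transitivity (Ex Pr (fun w => top \1_A (X n w)))%:E.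
  rewrite -ExE; last exact: bm_chain.
  apply: eq_integral => w _; rewrite top_indic//.
  by apply/esym; exact: (fine_muE (kprob P (X n w))).
rewrite (Ex_law (measurable_chain n) IH bt) (Ex_top mu_invariant) ?Ex_indic//.
  exact: fine_muE.
exact: bm_indic.
Qed.

Lemma Ex_chain n (f : E -> R) : bm f -> Ex Pr (fun w => f (X n w)) = Ex mu f.
Proof. by move=> bf; apply: Ex_law bf; [exact: measurable_chain|exact: chain_law]. Qed.

Lemma bm_iter_top m (f : E -> R) : bm f -> bm (iter m top f).
Proof. by move=> bf; elim: m => //= m; exact: bm_top. Qed.

Lemma markov_iter n m (f : hist n -> R) (g : E -> R) : bm f -> bm g ->
  Ex Pr (fun w => f w * g (X (n + m)%N w)) = Ex Pr (fun w => f w * iter m top g (X n w)).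
Proof.
move=> bf; elim: m g => [|m IH] g bg; first by rewrite addn0.
rewrite addnS (@markov_ex (n + m) f g (bm_hist_le (leq_addr _ _) bf) bg).
by rewrite (IH _ (bm_top P bg)) -iterSr.
Qed.

Let bound (u w y z : R) : `|u| <= 1 -> `|w| <= 1 -> `|y| <= 1 -> `|z| <= 1 ->
  `|(u - 1) * y + w * z| <= 3.
Proof.
move=> h1 h2 h3 h4; rewrite (le_trans (ler_normD _ _))// !normrM.
have h5 : `|u - 1| <= 2.
  by rewrite (le_trans (ler_normB _ _))// normr1 -[leRHS]/(1 + 1) lerD2r.
have -> : 3 = 2 * 1 + 1 * 1 :> R by ring.
by rewrite lerD// ler_pM.
Qed.

(** * Sums of phases supported by a small set [B] *)

Section CharacteristicFunction.
Variables (a : R) (B : set E) (C : R).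
Hypothesis gap : gap_bound P mu a.
Hypothesis mB : measurable B.
Hypothesis C0 : 0 <= C.
Hypothesis smoothing : n2 mu (top \1_B) <= C * fine (mu B).

Let a0 : 0 <= a. Proof. by case: gap => /andP[]. Qed.
Let a1 : 0 < 1 - a. Proof. by case: gap => /andP[_]; rewrite subr_gt0. Qed.
Let b : R := fine (mu B).
Let b0 : 0 <= b. Proof. exact: fine_ge0. Qed.

(* [(char_fun th n).1] and [.2] are the real and imaginary parts of the function
   obtained by applying alternately [P] and the multiplication by [exp (i th k)]. *)
Fixpoint char_fun (th : nat -> E -> R) (n : nat) : (E -> R) * (E -> R) :=
  if n is m.+1 then
    let pq := char_fun (fun k => th k.+1) m in
    (fun x => cos (th 0 x) * top pq.1 x - sin (th 0 x) * top pq.2 x,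
     fun x => sin (th 0 x) * top pq.1 x + cos (th 0 x) * top pq.2 x)
  else (fun=> 1, fun=> 0).

Lemma bm_char_fun (th : nat -> E -> R) n : (forall k, measurable_fun setT (th k)) ->
  bm (char_fun th n).1 /\ bm (char_fun th n).2.
Proof.
elim: n th => [|n IH] th mth; first by split; exact: bm_cst.
have [b1 b2] := IH (fun k => th k.+1) (fun k => mth k.+1).
have k1 := bm_top P b1; have k2 := bm_top P b2.
have k3 := bm_cos (mth 0%N); have k4 := bm_sin (mth 0%N).
by split; [apply: bmB|apply: bmD]; exact: bmM.
Qed.

(** The starting time [j] and the weight [f] are free because of the induction: the first phase is
    absorbed into [f], which then depends on the past of time [j.+1]. *)
Lemma Ex_char_fun (th : nat -> E -> R) n j (f : hist j -> R) : (forall k, measurable_fun setT (th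
  k)) -> bm f ->
  Ex Pr (fun w => f w * cos (\sum_(k < n) th k (X (j + k)%N w))) =
    Ex Pr (fun w => f w * (char_fun th n).1 (X j w)) /\
  Ex Pr (fun w => f w * sin (\sum_(k < n) th k (X (j + k)%N w))) =
    Ex Pr (fun w => f w * (char_fun th n).2 (X j w)).
Proof.
elim: n th j f => [|n IH] th j f mth bf.
  split; congr (Ex _ _); apply/funext => w; rewrite big_ord0 ?cos0 ?sin0//.
pose th' k := th k.+1.
have mth' k : measurable_fun setT (th' k) by exact: mth.
have bc : bm (fun w : hist j => f w * cos (th 0 (X j w))).
  by apply: bmM => //; exact: bm_hist_chain (leqnn j) (bm_cos (mth 0%N)).
have bs : bm (fun w : hist j => f w * sin (th 0 (X j w))).
  by apply: bmM => //; exact: bm_hist_chain (leqnn j) (bm_sin (mth 0%N)).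
have [c1 c2] := IH th' j.+1 _ mth' (bm_hist_le (leqnSn j) bc).
have [s1 s2] := IH th' j.+1 _ mth' (bm_hist_le (leqnSn j) bs).
have [bp bq] := bm_char_fun n mth'.
have tE w : \sum_(k < n.+1) th k (X (j + k)%N w) =
    th 0 (X j w) + \sum_(k < n) th' k (X (j.+1 + k)%N w).
  rewrite big_ord_recl addn0; congr (_ + _); apply: eq_bigr => k _.
  by rewrite /th' /= /bump/= add1n addSnnS.
have mS : measurable_fun setT (fun w => \sum_(k < n) th' k (X (j.+1 + k)%N w)).
  by apply: measurable_sum => k; apply: measurableT_comp => //; exact: measurable_chain.
have bC := bm_cos mS; have bS := bm_sin mS.
have bc' := bm_hist bc; have bs' := bm_hist bs.
have k1 := bm_chain j (bm_top P bp); have k2 := bm_chain j (bm_top P bq).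
rewrite (markov_ex bc bp) in c1; rewrite (markov_ex bc bq) in c2.
rewrite (markov_ex bs bp) in s1; rewrite (markov_ex bs bq) in s2.
split.
  transitivity (Ex Pr (fun w => f w * cos (th 0 (X j w)) * cos (\sum_(k < n) th' k (X (j.+1 + k)%N
    w)) -
     f w * sin (th 0 (X j w)) * sin (\sum_(k < n) th' k (X (j.+1 + k)%N w)))).
    by congr (Ex _ _); apply/funext => w; rewrite tE cosD; ring.
  rewrite ExB; [|exact: bmM|exact: bmM]; rewrite c1 s2 -ExB; [|exact: bmM|exact: bmM].
  by congr (Ex _ _); apply/funext => w /=; ring.
transitivity (Ex Pr (fun w => f w * sin (th 0 (X j w)) * cos (\sum_(k < n) th' k (X (j.+1 + k)%N
  w)) +
   f w * cos (th 0 (X j w)) * sin (\sum_(k < n) th' k (X (j.+1 + k)%N w)))).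
  by congr (Ex _ _); apply/funext => w; rewrite tE sinD; ring.
rewrite ExD; [|exact: bmM|exact: bmM]; rewrite s1 c2 -ExD; [|exact: bmM|exact: bmM].
by congr (Ex _ _); apply/funext => w /=; ring.
Qed.

Lemma char_fun_le1 (th : nat -> E -> R) n x : (forall k, measurable_fun setT (th k)) ->
  (char_fun th n).1 x ^+ 2 + (char_fun th n).2 x ^+ 2 <= 1.
Proof.
elim: n th x => [|n IH] th x mth /=; first by rewrite expr1n expr0n addr0.
have mth' k : measurable_fun setT (th k.+1) by exact: mth.
have [bp bq] := bm_char_fun n mth'.
set p := (char_fun _ n).1 in bp *; set q := (char_fun _ n).2 in bq *.
have -> : (cos (th 0 x) * top p x - sin (th 0 x) * top q x) ^+ 2 +
    (sin (th 0 x) * top p x + cos (th 0 x) * top q x) ^+ 2 =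
    (cos (th 0 x) ^+ 2 + sin (th 0 x) ^+ 2) * (top p x ^+ 2 + top q x ^+ 2) by ring.
rewrite cos2Dsin2 mul1r.
have sq f : bm f -> top f x ^+ 2 <= top (fun y => f y ^+ 2) x.
  move=> bf; rewrite !topE; apply: le_trans (Ex_abs_sqr _ bf).
  rewrite -(real_normK (num_real (Ex _ f))) lerXn2r ?nnegrE ?Ex_ge0//.
  exact: Ex_abs.
apply: (le_trans (lerD (sq _ bp) (sq _ bq))).
rewrite -topD; [|exact: bm_sqr|exact: bm_sqr].
rewrite topE; apply: Ex_le_cst; first by apply: bmD; exact: bm_sqr.
by move=> y; exact: (IH (fun k => th k.+1)).
Qed.

(** The solution of [D = a D + 3 (C + 1)], the balance between the contraction and the error created
    by one multiplication. *)
Let D : R := 3 * (C + 1) / (1 - a).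
Let D0 : 0 <= D. Proof. by rewrite divr_ge0 ?(ltW a1)// mulr_ge0// addr_ge0. Qed.

Let n2_top_small (e : E -> R) : bm e -> (forall x, `|e x| <= 3 * \1_B x) ->
  n2 mu (fun x => top e x - Ex mu e) <= 3 * (C + 1) * b.
Proof.
move=> be eB; have b1 : bm (\1_B : E -> R) by exact: bm_indic.
have bte := bm_top P be; have bt1 := bm_top P b1.
apply: (@le_trans _ _ (n2 mu (top e) + n2 mu (fun=> - Ex mu e))).
  by apply: n2D => //; exact: bm_cst.
rewrite n2_cst normrN mulrDr mulr1 mulrDl lerD//.
  apply: (@le_trans _ _ (n2 mu (fun x => 3 * top \1_B x))).
    apply: n2_le => //; first exact: bmZ.
    move=> x; rewrite -topZ// [leRHS]ger0_norm; last first.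
      by rewrite topE; apply: Ex_ge0 => y; rewrite mulr_ge0.
    rewrite topE (le_trans (Ex_abs _ be))// topE; apply: Ex_le => //; first exact: bm_norm.
    exact: bmZ.
  by rewrite n2Z// ger0_norm// -mulrA ler_wpM2l.
rewrite (le_trans (Ex_abs _ be))// /b -(Ex_indic mu mB) -ExZ//.
by apply: Ex_le => //; [exact: bm_norm|exact: bmZ].
Qed.

(* The multiplication by [exp (i th)] only changes a function on [B], where it is
   smoothed out by the next application of [P]; the spectral gap prevents these
   errors from accumulating. *)
Lemma char_fun_almost_cst (th : nat -> E -> R) n : (forall k, measurable_fun setT (th k)) ->
  (forall k x, ~ B x -> th k x = 0) ->
  n2 mu (fun x => top (char_fun th n).1 x - Ex mu (char_fun th n).1) <= D * b /\
  n2 mu (fun x => top (char_fun th n).2 x - Ex mu (char_fun th n).2) <= D * b.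
Proof.
elim: n th => [|n IH] th mth thB.
  by split => /=; under eq_fun do rewrite top_cst; rewrite Ex_cst subrr n2_cst normr0 mulr_ge0.
have mth' k : measurable_fun setT (th k.+1) by exact: mth.
have [IH1 IH2] := IH (fun k => th k.+1) mth' (fun k => thB k.+1).
have [bp bq] := bm_char_fun n mth'.
have le1 := fun x => char_fun_le1 n x mth'.
set p := (char_fun _ n).1 in bp le1 IH1 *; set q := (char_fun _ n).2 in bq le1 IH2 *.
have btp := bm_top P bp; have btq := bm_top P bq.
have p1 x : `|p x| <= 1.
  rewrite -ler_sqr ?nnegrE// expr1n real_normK ?num_real//.
  by rewrite (le_trans _ (le1 x))// lerDl sqr_ge0.
have q1 x : `|q x| <= 1.
  rewrite -ler_sqr ?nnegrE// expr1n real_normK ?num_real//.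
  by rewrite (le_trans _ (le1 x))// lerDr sqr_ge0.
have tp1 x : `|top p x| <= 1 by exact: top_abs_le.
have tq1 x : `|top q x| <= 1 by exact: top_abs_le.
have k3 := bm_cos (mth 0%N); have k4 := bm_sin (mth 0%N).
(* One multiplication turns [P r] into [P r + e] with [e] supported by [B]. The next [P] contracts
   the centered part of [P r] by [a], and smoothing bounds the centered [P e] by [3 (C + 1) b]. *)
have step r r' e : bm r -> bm e -> (forall x, `|e x| <= 3 * \1_B x) ->
    r' = (fun x => top r x + e x) -> n2 mu (fun x => top r x - Ex mu r) <= D * b ->
    n2 mu (fun x => top r' x - Ex mu r') <= D * b.
  move=> br be eB -> IHr; have btr := bm_top P br.
  have bc : bm (fun x => top r x - Ex mu r) by apply: bmB => //; exact: bm_cst.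
  have -> : (fun x => top (fun y => top r y + e y) x - Ex mu (fun y => top r y + e y)) =
      (fun x => top (fun y => top r y - Ex mu r) x + (top e x - Ex mu e)).
    apply/funext => x; rewrite topD// ExD// (Ex_top mu_invariant)// topB//; last exact: bm_cst.
    by rewrite top_cst; ring.
  apply: (le_trans (n2D mu (bm_top P bc) _)).
    by apply: bmB; [exact: bm_top|exact: bm_cst].
  have g1 : n2 mu (top (fun y => top r y - Ex mu r)) <= a * (D * b).
    apply: (le_trans (proj2 gap _ bc _)); last by rewrite ler_wpM2l.
    by rewrite ExB ?Ex_cst ?(Ex_top mu_invariant) ?subrr//; exact: bm_cst.
  apply: (le_trans (lerD g1 (n2_top_small be eB))).
  by rewrite mulrA -mulrDl ler_wpM2r// /D; rewrite le_eqVlt; apply/orP; left; apply/eqP; field;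
    rewrite gt_eqF.
have cB x : ~ B x -> cos (th 0%N x) = 1 by move=> xB; rewrite thB// cos0.
have sB x : ~ B x -> sin (th 0%N x) = 0 by move=> xB; rewrite thB// sin0.
split.
  apply: (step p _ (fun x => (cos (th 0 x) - 1) * top p x + - sin (th 0 x) * top q x)) IH1 => //.
  - by apply: bmD; apply: bmM => //; [apply: bmB => //; exact: bm_cst|exact: bmN].
  - move=> x; rewrite indicE; case: (boolP (x \in B)) => [_|/negP xB].
      by rewrite mulr1 bound ?normrN ?abs_cos_le1 ?abs_sin_le1.
    have nB : ~ B x by move=> h; apply: xB; rewrite inE.
    by rewrite cB// sB// subrr oppr0 !mul0r addr0 normr0 mulr0.
  - apply/funext => x /=; rewrite -/p -/q.
    by move: (top p x) (top q x) (cos _) (sin _) => u w c s; ring.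
apply: (step q _ (fun x => (cos (th 0 x) - 1) * top q x + sin (th 0 x) * top p x)) IH2 => //.
- by apply: bmD; apply: bmM => //; apply: bmB => //; exact: bm_cst.
- move=> x; rewrite indicE; case: (boolP (x \in B)) => [_|/negP xB].
    by rewrite mulr1 bound ?abs_cos_le1 ?abs_sin_le1.
  have nB : ~ B x by move=> h; apply: xB; rewrite inE.
  by rewrite cB// sB// subrr !mul0r addr0 normr0 mulr0.
- apply/funext => x /=; rewrite -/p -/q.
  by move: (top p x) (top q x) (cos _) (sin _) => u w c s; ring.
Qed.

Local Open Scope complex_scope.

Definition mean_char (t : E -> R) : R[i] :=
  Ex mu (fun x => cos (t x)) +i* Ex mu (fun x => sin (t x)).

Let cch th n : R[i] := Ex mu (char_fun th n).1 +i* Ex mu (char_fun th n).2.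

(** The covariance of [g] and [P p] by Cauchy-Schwarz: the support of [g] gives the square root of
    [b] and the near constancy of [P p] gives [D b]. The product is small compared with [b]. *)
Let factor_error (g p : E -> R) : bm g -> bm p ->
  (forall x, `|g x| <= 2 * \1_B x) -> n2 mu (fun x => top p x - Ex mu p) <= D * b ->
  `|Ex mu (fun x => g x * top p x) - Ex mu g * Ex mu p| <= 2 * D * b * Num.sqrt b.
Proof.
move=> bg bp gB hp; have btp := bm_top P bp.
have bc : bm (fun x => top p x - Ex mu p) by apply: bmB => //; exact: bm_cst.
have -> : Ex mu (fun x => g x * top p x) - Ex mu g * Ex mu p =
    Ex mu (fun x => g x * (top p x - Ex mu p)).
  rewrite mulrC -ExZ// -ExB; [|exact: bmM|exact: bmZ].
  by congr (Ex _ _); apply/funext => x; ring.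
apply: (le_trans (Ex_mul_le _ bg bc)).
have -> : 2 * D * b * Num.sqrt b = (2 * Num.sqrt b) * (D * b) by ring.
rewrite ler_pM ?n2_ge0//.
have b1 : bm (\1_B : E -> R) by exact: bm_indic.
apply: (@le_trans _ _ (n2 mu (fun x => 2 * \1_B x))).
  by apply: n2_le => //; [exact: bmZ|move=> x; rewrite (le_trans (gB x))// ler_norm].
by rewrite n2Z// n2_indic// ger0_norm.
Qed.

Lemma mean_char_le1 t : measurable_fun setT t -> cmod (mean_char t) <= 1.
Proof.
move=> mt; have bc := bm_cos mt; have bs := bm_sin mt.
have sq f : bm f -> Ex mu f ^+ 2 <= Ex mu (fun x => f x ^+ 2).
  move=> bf; apply: le_trans (Ex_abs_sqr _ bf).
  rewrite -(real_normK (num_real (Ex _ f))) lerXn2r ?nnegrE ?Ex_ge0//.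
  exact: Ex_abs.
apply: cmod_le1; apply: (le_trans (lerD (sq _ bc) (sq _ bs))).
rewrite -ExD; [|exact: bm_sqr|exact: bm_sqr].
by under eq_fun do rewrite cos2Dsin2; rewrite Ex_cst.
Qed.

Let char_step (th : nat -> E -> R) n : (forall k, measurable_fun setT (th k)) ->
  (forall k x, ~ B x -> th k x = 0) ->
  cmod (cch th n.+1 - mean_char (th 0%N) * cch (fun k => th k.+1) n) <=
  8 * D * b * Num.sqrt b.
Proof.
move=> mth thB; have mth' k : measurable_fun setT (th k.+1) by exact: mth.
have [h1 h2] := char_fun_almost_cst n mth' (fun k => thB k.+1).
have [bp bq] := bm_char_fun n mth'.
rewrite /cch /=; set p := (char_fun _ n).1 in bp h1 *.
set q := (char_fun _ n).2 in bq h2 *.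
have btp := bm_top P bp; have btq := bm_top P bq.
have k3 := bm_cos (mth 0%N); have k4 := bm_sin (mth 0%N).
have k5 : bm (fun x => cos (th 0%N x) - 1) by apply: bmB => //; exact: bm_cst.
have cB x : `|cos (th 0%N x) - 1| <= 2 * \1_B x.
  rewrite indicE; case: (boolP (x \in B)) => [_|/negP xB].
    rewrite mulr1 (le_trans (ler_normB _ _))// normr1 -[leRHS]/(1 + 1) lerD2r.
    exact: abs_cos_le1.
  have nB : ~ B x by move=> h; apply: xB; rewrite inE.
  by rewrite thB// cos0 subrr normr0 mulr0.
have sB x : `|sin (th 0%N x)| <= 2 * \1_B x.
  rewrite indicE; case: (boolP (x \in B)) => [_|/negP xB].
    by rewrite mulr1 (le_trans (abs_sin_le1 _))// ler1n.
  have nB : ~ B x by move=> h; apply: xB; rewrite inE.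
  by rewrite thB// sin0 normr0 mulr0.
have e1 := factor_error k5 bp cB h1; have e2 := factor_error k5 bq cB h2.
have e3 := factor_error k4 bp sB h1; have e4 := factor_error k4 bq sB h2.
(* The cosine is not supported by [B] but [cos - 1] is, and subtracting a constant does not change a
   covariance. *)
have cE r : bm r -> Ex mu (fun x => cos (th 0%N x) * top r x) - Ex mu (fun x => cos (th 0%N x)) *
  Ex mu r =
    Ex mu (fun x => (cos (th 0%N x) - 1) * top r x) - Ex mu (fun x => cos (th 0%N x) - 1) * Ex mu r.
  move=> br; have btr := bm_top P br.
  under [X in _ = Ex _ X - _]eq_fun do rewrite mulrBl mul1r.
  rewrite !ExB//; [|exact: bm_cst|exact: bmM].
  by rewrite Ex_cst (Ex_top mu_invariant)//; ring.
rewrite -cE// in e1; rewrite -cE// in e2.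
rewrite ExB; [|exact: bmM|exact: bmM]; rewrite ExD; [|exact: bmM|exact: bmM].
rewrite /mean_char.
set c := Ex mu (fun x => cos (th 0%N x)) in e1 e2 *.
set s := Ex mu (fun x => sin (th 0%N x)) in e3 e4 *.
set cp := Ex mu _ in e1 *; set cq := Ex mu _ in e2 *.
set sp := Ex mu _ in e3 *; set sq' := Ex mu _ in e4 *.
have -> : 8 * D * b * Num.sqrt b = (2 * D * b * Num.sqrt b + 2 * D * b * Num.sqrt b) +
   (2 * D * b * Num.sqrt b + 2 * D * b * Num.sqrt b) by ring.
apply: (le_trans (cmod_le _ _)); rewrite lerD//.
  by rewrite opprD addrACA -opprD (le_trans (ler_normB _ _))// lerD.
rewrite [c * Ex mu q + _]addrC opprD addrACA (le_trans (ler_normD _ _))//.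
by rewrite (lerD e3 e2).
Qed.

Let char_prod (th : nat -> E -> R) n : (forall k, measurable_fun setT (th k)) ->
  (forall k x, ~ B x -> th k x = 0) ->
  cmod (cch th n - \prod_(k < n) mean_char (th k)) <= n%:R * (8 * D * b * Num.sqrt b).
Proof.
elim: n th => [|n IH] th mth thB.
  have -> : cch th 0 = 1 by rewrite /cch /= !Ex_cst.
  by rewrite big_ord0 mul0r subrr cmod0.
rewrite big_ord_recl/=; set M := 8 * D * b * Num.sqrt b.
set pr := \prod_(_ < _) _; set ph := mean_char _.
apply: (le_trans (cmod_dist _ _ (ph * cch (fun k => th k.+1) n))).
rewrite -natr1 mulrDl mul1r addrC lerD//; last exact: char_step.
rewrite -mulrBr cmodM; apply: le_trans (IH (fun k => th k.+1) _ _).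
- by rewrite ler_piMl ?cmod_ge0// mean_char_le1.
- by move=> k; exact: mth.
- by move=> k; exact: thB.
Qed.

(** The one-step errors add up to a multiple of [n b^(3/2)], which vanishes when [b] is of order
    [1 / K] and [n] of order [K]. *)
Theorem chain_char (th : nat -> E -> R) n : (forall k, measurable_fun setT (th k)) ->
  (forall k x, ~ B x -> th k x = 0) ->
  cmod ((Ex Pr (fun w => cos (\sum_(k < n) th k (X k w))) +i*
         Ex Pr (fun w => sin (\sum_(k < n) th k (X k w)))) -
        \prod_(k < n) mean_char (th k)) <=
  n%:R * (24 * (C + 1) / (1 - a) * b * Num.sqrt b).
Proof.
move=> mth thB; have [bp bq] := bm_char_fun n mth.
have [h1 h2] := @Ex_char_fun th n 0%N (fun=> 1) mth (bm_cst 1).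
have one (f g : Om -> R) : Ex Pr (fun w => 1 * f w) = Ex Pr (fun w => 1 * g w) ->
    Ex Pr f = Ex Pr g.
  by under eq_fun do rewrite mul1r; under [X in _ = Ex _ X]eq_fun do rewrite mul1r.
rewrite (one _ _ h1) (one _ _ h2) !Ex_chain//.
by have := char_prod n mth thB; rewrite /D; congr (_ <= _ * _); ring.
Qed.

(** The first of the [m.+1] steps smooths the indicator and the other [m] contract it, so the excess
    over independence is summable in [m], with a sum of order [b^(3/2)]. *)
Lemma pair_bound j m : (fine (Pr (X j @^-1` B `&` X (j + m.+1)%N @^-1` B)) <=
  b ^+ 2 + a ^+ m * (C * b * Num.sqrt b)).
Proof.
have b1 : bm (\1_B : E -> R) by exact: bm_indic.
have bt := bm_iter_top m.+1 b1; have btt := bm_top P b1.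
have mX n : measurable (X n @^-1` B) by rewrite -[_ @^-1` _]setTI; exact: measurable_chain.
rewrite -Ex_indic; last exact: measurableI.
rewrite indicI (_ : \1__ \* _ = fun w => \1_B (X j w) * \1_B (X (j + m.+1)%N w)); last first.
  by apply/funext => w; congr (_ * _); rewrite !indicE; congr (_%:R); rewrite !inE.
rewrite (markov_iter m.+1 (bm_hist_chain (leqnn j) b1) b1).
rewrite (Ex_chain j (bmM b1 bt)).
have it f k : bm f -> n2 mu (fun x => iter k top f x - Ex mu f) <= a ^+ k * n2 mu f.
  move=> bf; elim: k => [|k IH]; first by rewrite expr0 mul1r /= n2_center.
  have bi := bm_iter_top k bf.
  have bc : bm (fun x => iter k top f x - Ex mu f) by apply: bmB => //; exact: bm_cst.
  have Ei : Ex mu (iter k top f) = Ex mu f.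
    by elim: k {IH bi bc} => //= k IH; rewrite (Ex_top mu_invariant) ?IH//; exact: bm_iter_top.
  have -> : (fun x => iter k.+1 top f x - Ex mu f) = top (fun x => iter k top f x - Ex mu f).
    by apply/funext => x; rewrite topB//; [rewrite top_cst|exact: bm_cst].
  apply: (le_trans (proj2 gap _ bc _)).
    by rewrite ExB// ?Ex_cst ?Ei ?subrr//; exact: bm_cst.
  by rewrite exprS -mulrA ler_wpM2l.
have bE : Ex mu \1_B = b by rewrite Ex_indic.
have := it _ m btt; rewrite (Ex_top mu_invariant)// bE => hm.
have bc : bm (fun x => iter m top (top \1_B) x - b).
  by apply: bmB; [exact: bm_iter_top|exact: bm_cst].
have -> : Ex mu (fun x => \1_B x * iter m.+1 top \1_B x) =
    b ^+ 2 + Ex mu (fun x => \1_B x * (iter m top (top \1_B) x - b)).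
  under [X in _ = _ + Ex _ X]eq_fun do rewrite mulrBr [_ * b]mulrC.
  rewrite ExB; [|by apply: bmM => //; exact: bm_iter_top|exact: bmZ].
  rewrite ExZ// bE -iterSr expr2; ring.
rewrite lerD2l; apply: (le_trans (ler_norm _)).
apply: (le_trans (Ex_mul_le _ b1 bc)); rewrite n2_indic// -/b.
have -> : a ^+ m * (C * b * Num.sqrt b) = Num.sqrt b * (a ^+ m * (C * b)) by ring.
rewrite ler_wpM2l// (le_trans hm)// ler_wpM2l// exprn_ge0//.
Qed.

End CharacteristicFunction.
End MarkovChain.

(** * A maximal inequality *)

Section MaximalInequality.
Context {R : realType} {dE} {E : measurableType dE} {d} {Om : measurableType d}.
Variables (Pr : probability Om R) (P : R.-pker E ~> E) (mu : probability E R).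
Variable X : nat -> {RV Pr >-> E}.
Hypothesis X_markov : markov_chain P mu X.
Hypothesis mu_invariant : invariant_law P mu.

Local Notation top := (transition_op P).
Local Notation hist := (hist X).

(** * Kolmogorov's inequality for the martingale part *)

Section Kolmogorov.
Variables (chi : E -> R) (l : R).
Hypothesis bchi : bm chi.
Hypothesis l0 : 0 < l.

(** Martingale increments: [top chi (X j)] is the conditional mean of [chi (X j.+1)] given the
    past. *)
Let D j (w : Om) : R := chi (X j.+1 w) - top chi (X j w).
Let M k (w : Om) : R := \sum_(j < k) D j w.
(* [g k] is the indicator that [M] has not left [ ]-l, l[ ] up to time [k]. *)
Let g k (w : Om) : R := \prod_(i < k.+1) \1_`]- l, l[%classic (M i w).
(** The martingale [M] stopped when it leaves []-l, l[]. *)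
Let N k (w : Om) : R := \sum_(j < k) g j w * D j w.

Let bD j k : (j < k)%N -> bm (D j : hist k -> R).
Proof.
move=> jk; apply: bmB; first exact: bm_hist_chain jk bchi.
exact: bm_hist_chain (ltnW jk) (bm_top P bchi).
Qed.

Let bM i k : (i <= k)%N -> bm (M i : hist k -> R).
Proof.
elim: i => [|i IH] ik.
  have -> : M 0 = fun=> 0 by apply/funext => w; rewrite /M big_ord0.
  exact: bm_cst.
have -> : M i.+1 = fun w => M i w + D i w by apply/funext => w; rewrite /M big_ord_recr.
by apply: bmD; [exact: IH (ltnW ik)|exact: bD].
Qed.

Let bg j k : (j <= k)%N -> bm (g j : hist k -> R).
Proof.
move=> jk; rewrite /g; apply: bm_prod => i.
apply: (@bm_compT _ _ _ _ _ (\1_`]- l, l[%classic)); first exact: bm_indic.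
by apply: bm_meas; apply: bM; rewrite (leq_trans _ jk)// -ltnS.
Qed.

Let bN k : bm (N k : hist k -> R).
Proof.
elim: k => [|k IH].
  have -> : N 0 = fun=> 0 by apply/funext => w; rewrite /N big_ord0.
  exact: bm_cst.
have -> : N k.+1 = fun w => N k w + g k w * D k w.
  by apply/funext => w; rewrite /N big_ord_recr.
apply: bmD; first exact: bm_hist_le (leqnSn k) IH.
by apply: bmM; [exact: bg (leqnSn k)|exact: bD].
Qed.

Let g01 k w : 0 <= g k w <= 1.
Proof.
apply: (big_ind (fun x : R => 0 <= x <= 1)) => [|x y|i _].
- by rewrite ler01 lexx.
- by move=> /andP[? ?] /andP[? ?]; rewrite mulr_ge0// mulr_ile1.
- by rewrite indicE ler0n lern1 leq_b1.
Qed.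

Let orth k : Ex Pr (fun w => N k w * g k w * D k w) = 0.
Proof.
have bNg : bm (fun w : hist k => N k w * g k w) by apply: bmM; [exact: bN|exact: bg].
rewrite /D; under eq_fun do rewrite mulrBr.
have b1 := bm_chain X k.+1 bchi; have b2 := bm_chain X k (bm_top P bchi).
have b3 := bm_hist bNg.
rewrite ExB; [|exact: bmM|exact: bmM].
by rewrite (markov_ex X_markov bNg bchi) subrr.
Qed.

Let D_sqr k : Ex Pr (fun w => D k w ^+ 2) <= 4 * Ex mu (fun x => chi x ^+ 2).
Proof.
have b1 := bm_chain X k.+1 bchi; have bt := bm_top P bchi; have b2 := bm_chain X k bt.
apply: (@le_trans _ _ (Ex Pr (fun w => 2 * chi (X k.+1 w) ^+ 2 + 2 * top chi (X k w) ^+ 2))).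
  apply: Ex_le; [by apply: bm_sqr; exact: bmB|by apply: bmD; apply: bmZ; exact: bm_sqr|].
  move=> w; rewrite /D; move: (chi _) (top _ _) => u z; have := sqr_ge0 (u + z).
  by rewrite sqrrD sqrrB; nra.
rewrite ExD; [|by apply: bmZ; exact: bm_sqr|by apply: bmZ; exact: bm_sqr].
rewrite !ExZ; [|exact: bm_sqr|exact: bm_sqr].
rewrite (Ex_chain X_markov mu_invariant k.+1 (bm_sqr bchi)).
rewrite (Ex_chain X_markov mu_invariant k (bm_sqr bt)).
have : Ex mu (fun x => top chi x ^+ 2) <= Ex mu (fun x => chi x ^+ 2).
  rewrite -!n2_sqr lerXn2r ?nnegrE ?n2_ge0//; exact: n2_top.
move: (Ex _ _) (Ex _ _) => u z; lra.
Qed.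

Let N_sqr k : Ex Pr (fun w => N k w ^+ 2) <= k%:R * (4 * Ex mu (fun x => chi x ^+ 2)).
Proof.
elim: k => [|k IH].
  rewrite mul0r; under eq_fun do rewrite /N big_ord0 expr0n/=.
  by rewrite Ex_cst.
have bN' := bm_hist (bN k); have bg' := bm_hist (bg (leqnn k)).
have bD' := bm_hist (bD (ltnSn k)).
have -> : (fun w => N k.+1 w ^+ 2) =
    (fun w => N k w ^+ 2 + 2 * (N k w * g k w * D k w) + (g k w * D k w) ^+ 2).
  by apply/funext => w; rewrite /N big_ord_recr/=; ring.
have b1 : bm (fun w => N k w * g k w * D k w) by apply: bmM => //; exact: bmM.
have b2 : bm (fun w => (g k w * D k w) ^+ 2) by apply: bm_sqr; exact: bmM.
have b3 := bm_sqr bN'.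
rewrite ExD//; last by apply: bmD => //; exact: bmZ.
rewrite ExD//; last exact: bmZ.
rewrite ExZ// orth mulr0 addr0 -natr1 mulrDl mul1r lerD//.
apply: le_trans (D_sqr k); apply: Ex_le => //; first exact: bm_sqr.
move=> w; have /andP[h1 h2] := g01 k w.
by rewrite exprMn ler_piMl ?sqr_ge0// expr_le1.
Qed.

Let A n : set Om := \bigcup_(k in `I_n.+1) [set w | l <= `|M k w|].

Let mA n : measurable (A n).
Proof.
apply: bigcup_measurable => k /= kn.
have bMk := bm_norm (bm_hist (bM (leqnn k))).
have := bm_meas bMk measurableT (measurable_itv `[l, +oo[).
by rewrite setTI set_itvcy.
Qed.

(** From the first exit time [k] on, [N] is frozen at [M k]; so the terminal value of [N] controls
    the running maximum of [M]. *)
Let N_large n w : A n w -> l <= `|N n w|.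
Proof.
move=> [k0 /= k0n k0l].
have ex : exists k, l <= `|M k w| by exists k0.
case: (ex_minnP ex) => k kl kmin.
have kn : (k <= n)%N by rewrite (leq_trans (kmin _ k0l)).
suff -> : N n w = M k w by [].
rewrite /M (big_ord_widen n (fun j => D j w) kn) [RHS]big_mkcond/=.
apply: eq_bigr => j _; case: ifPn => jk.
  rewrite /g big1 ?mul1r// => i _; rewrite indicE mem_set//=.
  rewrite in_itv/= -ltr_norml ltNge; apply/negP => /kmin ki.
  by have := leq_ltn_trans ki (leq_trans (ltn_ord i) jk); rewrite ltnn.
have kj : (k < j.+1)%N by rewrite ltnS leqNgt.
rewrite /g (bigD1 (Ordinal kj))//= indicE memNset ?mul0r//=.
by rewrite in_itv/= -ltr_norml ltNge kl.
Qed.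

Lemma kolmogorov n : exists A : set Om, [/\ measurable A,
  fine (Pr A) <= n%:R * (4 * Ex mu (fun x => chi x ^+ 2)) / l ^+ 2 &
  forall w k, ~ A w -> (k <= n)%N ->
    `|\sum_(j < k) (chi (X j.+1 w) - top chi (X j w))| < l].
Proof.
exists (A n); split; [exact: mA| |].
  have b1 := bm_sqr (bm_hist (bN n)).
  apply: (le_trans (@Ex_markov _ _ _ Pr (A n) _ (l ^+ 2) b1 (mA n) _ _ _)).
  - by rewrite exprn_gt0.
  - by move=> w; exact: sqr_ge0.
  - move=> w /N_large Nl; rewrite -[leRHS]real_normK ?num_real//.
    by rewrite lerXn2r ?nnegrE// ltW.
  - by rewrite ler_wpM2r ?invr_ge0 ?exprn_ge0 ?(ltW l0)//; exact: N_sqr.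
move=> w k nA kn; rewrite ltNge; apply/negP => Ml; apply: nA.
by exists k.
Qed.

End Kolmogorov.

Variable a : R.
Hypothesis gap : gap_bound P mu a.

Let a0 : 0 <= a. Proof. by case: gap => /andP[]. Qed.
Let a1 : 0 < 1 - a. Proof. by case: gap => /andP[_]; rewrite subr_gt0. Qed.

Let Ex_iter_top f k : bm f -> Ex mu (iter k top f) = Ex mu f.
Proof.
move=> bf; elim: k => //= k IH.
by rewrite (Ex_top mu_invariant) ?IH//; exact: bm_iter_top.
Qed.

Let n2_iter_top f k : bm f -> Ex mu f = 0 -> n2 mu (iter k top f) <= a ^+ k * n2 mu f.
Proof.
move=> bf f0; elim: k => [|k IH]; first by rewrite expr0 mul1r.
have bi : bm (iter k top f) by exact: bm_iter_top.
apply: (le_trans (proj2 gap _ bi _)); first by rewrite Ex_iter_top.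
by rewrite exprS -mulrA ler_wpM2l.
Qed.

(** A truncated resolvent. Being a finite sum it stays bounded, and it solves Poisson's equation up
    to [P^r f], which the gap makes geometrically small. *)
Let potential f r x : R := \sum_(i < r) iter i top f x.

Let bm_potential f r : bm f -> bm (potential f r).
Proof. by move=> bf; apply: bm_sum => i; exact: bm_iter_top. Qed.

Let potentialE f r x : bm f -> potential f r x - top (potential f r) x = f x - iter r top f x.
Proof.
move=> bf; elim: r => [|r IH].
  rewrite /potential big_ord0 subrr.
  rewrite (_ : (fun x => _) = fun=> 0) ?top_cst ?subrr//.
  by apply/funext => y; rewrite big_ord0.
have E1 : potential f r.+1 = (fun x => potential f r x + iter r top f x).
  by apply/funext => y; rewrite /potential big_ord_recr.
rewrite E1 topD//; [|exact: bm_potential|exact: bm_iter_top].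
by rewrite opprD addrACA IH /= addrA subrK.
Qed.

Let n2_potential f r : bm f -> Ex mu f = 0 -> n2 mu (potential f r) <= n2 mu f / (1 - a).
Proof.
move=> bf f0; suff h : n2 mu (potential f r) <= n2 mu f * ((1 - a ^+ r) / (1 - a)).
  apply: (le_trans h); rewrite ler_wpM2l ?n2_ge0//.
  by rewrite ler_pdivrMr// mulVf ?gt_eqF// gerBl exprn_ge0.
elim: r => [|r IH].
  rewrite expr0 subrr mul0r mulr0 /potential.
  rewrite (_ : (fun x => _) = fun=> 0) ?n2_cst ?normr0//.
  by apply/funext => y; rewrite big_ord0.
have E1 : potential f r.+1 = (fun x => potential f r x + iter r top f x).
  by apply/funext => y; rewrite /potential big_ord_recr.
rewrite E1; apply: (le_trans (n2D _ (bm_potential r bf) _)); first exact: bm_iter_top.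
apply: (le_trans (lerD IH (n2_iter_top r bf f0))).
rewrite le_eqVlt; apply/orP; left; apply/eqP; rewrite exprS; field.
by rewrite gt_eqF.
Qed.

(** Martingale approximation: the sums of [f] are those of a martingale, up to boundary values of
    the potential and a remainder. Since the left side does not involve the truncation level [r],
    the remainder disappears from the bound. *)
Theorem max_ineq f n (l : R) : bm f -> Ex mu f = 0 -> 0 < l ->
  exists A : set Om, [/\ measurable A,
    fine (Pr A) <= 5 * n.+1%:R * Ex mu (fun x => f x ^+ 2) / ((1 - a) * l) ^+ 2 &
    forall w k, ~ A w -> (k <= n)%N -> `|\sum_(j < k) f (X j w)| < 4 * l].
Proof.
move=> bf f0 l0; have l40 : 0 < 4 * l by rewrite mulr_gt0.
pose S k w : R := \sum_(j < k) f (X j w).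
have bS k : bm (S k) by apply: bm_sum => j; exact: (bm_chain X j bf).
pose A := \bigcup_(k in `I_n.+1) [set w | 4 * l <= `|S k w|].
have mA : measurable A.
  apply: bigcup_measurable => k _.
  have := bm_meas (bm_norm (bS k)) measurableT (measurable_itv `[4 * l, +oo[).
  by rewrite setTI set_itvcy.
exists A; split => //; last first.
  by move=> w k nA kn; rewrite ltNge; apply/negP => h; apply: nA; exists k.
apply/ler_addgt0Pr => e e0.
(* The remainder is estimated in L^1, summed over [n] steps; [r] makes its probability of exceeding
   [l] smaller than the slack [e]. *)
have [r hr] : exists r, a ^+ r * (n%:R * n2 mu f / l) <= e.
  have : a ^+ r * (n%:R * n2 mu f / l) @[r --> \oo] --> 0 * (n%:R * n2 mu f / l).
    apply: cvgM; last exact: cvg_cst.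
    by apply: cvg_expr; rewrite ger0_norm// -subr_gt0.
  rewrite mul0r => /cvgrPdist_le /(_ _ e0) [r _ /(_ r (leqnn r))] /=.
  by rewrite sub0r normrN => h; exists r; rewrite (le_trans (ler_norm _)).
pose chi := potential f r; have bchi : bm chi by exact: bm_potential.
pose h := iter r top f; have bh : bm h by exact: bm_iter_top.
have [A1 [mA1 PA1 hA1]] := kolmogorov bchi l0 n.
pose A2 := \bigcup_(k in `I_n.+1) [set w | l <= `|chi (X k w)|].
have mA2k k : measurable [set w | l <= `|chi (X k w)|].
  have := bm_meas (bm_norm (bm_chain X k bchi)) measurableT (measurable_itv `[l, +oo[).
  by rewrite setTI set_itvcy.
pose A3 := [set w | l <= \sum_(j < n) `|h (X j w)|].
have b3 : bm (fun w => \sum_(j < n) `|h (X j w)|).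
  by apply: bm_sum => j; apply: bm_norm; exact: (bm_chain X j bh).
have mA3 : measurable A3.
  have := bm_meas b3 measurableT (measurable_itv `[l, +oo[).
  by rewrite setTI set_itvcy.
have mA2 : measurable A2 by apply: bigcup_measurable => k _.
have sub : A `<=` A1 `|` A2 `|` A3.
  move=> w [k /= kn Sk]; apply: contrapT => /not_orP[/not_orP[n1 n2] n3].
  have k1 := hA1 w k n1 kn.
  have k2 i : (i < n.+1)%N -> `|chi (X i w)| < l.
    by move=> i_n; rewrite ltNge; apply/negP => hi; apply: n2; exists i.
  have k3 : \sum_(j < n) `|h (X j w)| < l by rewrite ltNge; apply/negP.
  (* Poisson's equation summed along the path: a martingale, two boundary terms and a remainder,
     each below [l] in modulus. This is the origin of [4 * l]. *)
  have SE : S k w = \sum_(j < k) (chi (X j.+1 w) - top chi (X j w)) +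
      chi (X 0%N w) - chi (X k w) + \sum_(j < k) h (X j w).
    rewrite /S; elim: (k) => [|i IH]; first by rewrite !big_ord0; ring.
    rewrite !big_ord_recr/= IH.
    have := potentialE r (X i w) bf; rewrite -/chi -/h; move: (f _) (chi _) (top _ _) => u1 u2 u3
      e1.
    have -> : u1 = u2 - u3 + h (X i w) by rewrite e1 subrK.
    by ring.
  have k4 : `|\sum_(j < k) h (X j w)| < l.
    apply: (le_lt_trans (ler_norm_sum _ _ _)); apply: le_lt_trans k3.
    rewrite (big_ord_widen n (fun j => `|h (X j w)|) kn) big_mkcond/=.
    by apply: ler_sum => j _; case: ifP.
  move: Sk; rewrite leNgt SE => /negP; apply.
  have -> : 4 * l = l + l + l + l by ring.
  rewrite (le_lt_trans (ler_normD _ _))// ltrD//.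
  rewrite (le_lt_trans (ler_normB _ _))// ltrD//; last by rewrite k2.
  by rewrite (le_lt_trans (ler_normD _ _))// ltrD// k2.
have chi2 : Ex mu (fun x => chi x ^+ 2) <= Ex mu (fun x => f x ^+ 2) / (1 - a) ^+ 2.
  rewrite -!n2_sqr -expr_div_n lerXn2r ?nnegrE ?n2_ge0//; first by rewrite divr_ge0 ?n2_ge0// ltW.
  exact: n2_potential.
have PA2 : fine (Pr A2) <= n.+1%:R * (Ex mu (fun x => chi x ^+ 2) / l ^+ 2).
  pose F w := \sum_(k < n.+1) chi (X k w) ^+ 2.
  have bF : bm F by apply: bm_sum => k; apply: bm_sqr; exact: (bm_chain X k bchi).
  apply: (le_trans (@Ex_markov _ _ _ Pr A2 F (l ^+ 2) bF mA2 _ _ _)).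
  - by rewrite exprn_gt0.
  - by move=> w; apply: sumr_ge0 => k _; exact: sqr_ge0.
  - move=> w [k /= kn hk]; rewrite /F (bigD1 (Ordinal kn))//= ler_wpDr//.
      by apply: sumr_ge0 => i _; exact: sqr_ge0.
    by rewrite -[leRHS]real_normK ?num_real// lerXn2r ?nnegrE// ltW.
  - rewrite Ex_sum; last by move=> k; apply: bm_sqr; exact: (bm_chain X k bchi).
    under eq_bigr do rewrite (Ex_chain X_markov mu_invariant _ (bm_sqr bchi)).
    by rewrite sumr_const card_ord -[_ *+ n.+1]mulr_natl mulrA.
have PA3 : fine (Pr A3) <= e.
  apply: (le_trans (@Ex_markov _ _ _ Pr A3 _ l b3 mA3 l0 _ _)).
  - by move=> w; apply: sumr_ge0.
  - by [].
  apply: le_trans hr; rewrite Ex_sum; last by move=> k; apply: bm_norm; exact: (bm_chain X k bh).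
  under eq_bigr do rewrite (Ex_chain X_markov mu_invariant _ (bm_norm bh)).
  rewrite sumr_const card_ord -[_ *+ n]mulr_natl !mulrA ler_pM2r ?invr_gt0//.
  rewrite mulrAC [leRHS]mulrC ler_wpM2l// (le_trans (Ex_norm_le _ bh))// mulrC.
  rewrite mulrC; exact: n2_iter_top.
have PA : fine (Pr A) <= fine (Pr A1) + fine (Pr A2) + fine (Pr A3).
  rewrite -!fineD ?fin_num_measure//; last by rewrite fin_numD !fin_num_measure.
  apply: fine_le; [exact: fin_num_measure|by rewrite !fin_numD !fin_num_measure|].
  have mU := measurableU _ _ (measurableU _ _ mA1 mA2) mA3.
  apply: (le_trans (le_measure Pr _ _ sub)); rewrite ?inE//.
  apply: (le_trans (measureU2 _ _ _)) => //; first exact: measurableU.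
  by rewrite leeD2r// measureU2.
apply: (le_trans PA); rewrite lerD//.
apply: (le_trans (lerD PA1 PA2)).
set v := Ex mu (fun x => chi x ^+ 2) in chi2 *; set u := Ex mu (fun x => f x ^+ 2) in chi2 *.
have v0 : 0 <= v by exact: Ex_sqr_ge0.
have -> : 5 * n.+1%:R * u / ((1 - a) * l) ^+ 2 = 5 * n.+1%:R * (u / (1 - a) ^+ 2 / l ^+ 2).
  by field; rewrite !gt_eqF.
have vl : 0 <= v / l ^+ 2 by rewrite divr_ge0// exprn_ge0// ltW.
apply: (@le_trans _ _ (5 * n.+1%:R * (v / l ^+ 2))).
  have -> : n%:R * (4 * v) / l ^+ 2 = 4 * n%:R * (v / l ^+ 2).
    by field; rewrite gt_eqF.
  rewrite -mulrDl ler_wpM2r//.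
  (* The constant 5 adds the 4 from the squares of the martingale increments and the 1 from the
     boundary terms. *)
  have -> : 5 * n.+1%:R = 4 * n%:R + n.+1%:R + 4 :> R by rewrite -[n.+1%:R]natr1; ring.
  by rewrite lerDl.
by rewrite ler_wpM2l ?mulr_ge0// ler_wpM2r// invr_ge0 exprn_ge0// ltW.
Qed.

End MaximalInequality.

(** * Regularly varying tails *)

Section ImageMeasure.
Context {R : realType} {d d'} {T : measurableType d} {T' : measurableType d'}.
Variables (m : {measure set T -> \bar R}) (f : T -> T').
Hypothesis mf : measurable_fun setT f.

Definition image_measure : {measure set T' -> \bar R} :=
  measure_function_pushforward__canonical__measure_function_Measure m mf.

Lemma image_measureE A : image_measure A = m (f @^-1` A). Proof. by []. Qed.

Lemma ge0_integral_image (phi : T' -> \bar R) : measurable_fun setT phi ->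
  (forall y, 0 <= phi y)%E -> (\int[image_measure]_y phi y = \int[m]_x phi (f x))%E.
Proof. by move=> mphi phi0; apply: ge0_integral_pushforward => // y _; exact: phi0. Qed.

End ImageMeasure.

(** * Measures on the positive half-line determined by their tails *)

Section TailUnique.
Context {R : realType}.
Implicit Types m : {measure set (measurableTypeR R) -> \bar R}.

(** The masses may be infinite near 0. Restricted to [[1 / (n + 1), +oo[] both measures are finite
    and agree on a pi-system of half-lines; then [n] tends to infinity. *)
Lemma tail_unique m1 m2 :
  (forall l : R, 0 < l -> m1 `[l, +oo[%classic = m2 `[l, +oo[%classic) ->
  (forall l : R, 0 < l -> (m1 `[l, +oo[%classic < +oo)%E) ->
  forall A : set (measurableTypeR R), measurable A -> A `<=` `]0%R, +oo[%classic -> m1 A = m2 A.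
Proof.
move=> m12 fin1 A mA A0.
pose I n : set (measurableTypeR R) := `[n.+1%:R^-1, +oo[%classic.
have mI n : measurable (I n) by exact: measurable_itv.
have key n : m1 (A `&` I n) = m2 (A `&` I n).
  pose G := @RGenCInfty.G R.
  have GM : G `<=` (measurable : set (set (measurableTypeR R))).
    by move=> _ [x ->]; exact: measurable_itv.
  pose g k : set (measurableTypeR R) := `[- k%:R, +oo[%classic.
  have gE x : mrestr m1 (mI n) `[x, +oo[%classic = m1 `[Num.max x n.+1%:R^-1, +oo[%classic.
    rewrite /mrestr; congr (m1 _); apply/seteqP; split => y /=; rewrite /I/= !in_itv/= !andbT
      ge_max.
      by move=> [-> ->].
    by move=> /andP[].
  have gE2 x : mrestr m2 (mI n) `[x, +oo[%classic = m2 `[Num.max x n.+1%:R^-1, +oo[%classic.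
    rewrite /mrestr; congr (m2 _); apply/seteqP; split => y /=; rewrite /I/= !in_itv/= !andbT
      ge_max.
      by move=> [-> ->].
    by move=> /andP[].
  have p0 x : 0 < Num.max x n.+1%:R^-1 :> R by rewrite lt_max invr_gt0 ltr0n orbT.
  apply: (@g_sigma_algebra_measure_unique _ R (measurableTypeR R) G GM g _ _ (mrestr m1 (mI n))
    (mrestr m2 (mI n))).
  - by move=> k; exists (- k%:R).
  - rewrite -subTset => x _; exists (Num.truncn `|x|).+1 => //=.
    rewrite /g/= in_itv/= andbT lerNl (le_trans (ler_norm _))// normrN ltW//.
    exact: truncnS_gt.
  - move=> B C [b ->] [c ->]; exists (Num.max b c); apply/seteqP; split => x /=; rewrite !in_itv/=
    !andbT ge_max.
      by move=> [-> ->].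
    by move=> /andP[].
  - by move=> _ [x ->]; rewrite [LHS]gE [RHS]gE2 m12.
  - by move=> k; rewrite [X in (X < _)%E]gE fin1.
  - by have := mA; rewrite RGenCInfty.measurableE.
have AE : A = \bigcup_n (A `&` I n).
  rewrite -setI_bigcupr; apply/esym/setIidl => x /A0/=; rewrite in_itv/= andbT => x0.
  exists (Num.truncn x^-1) => //=; rewrite /I/= in_itv/= andbT.
  by rewrite invf_ple ?posrE// ltW// truncnS_gt.
have nd : nondecreasing_seq (fun n => A `&` I n).
  move=> n k nk; apply/subsetPset; apply: setIS => x; rewrite /I/= !in_itv/= !andbT.
  by apply: le_trans; rewrite lef_pV2 ?posrE ?ltr0n// ler_nat.
have mAI n : measurable (A `&` I n) by exact: measurableI.
have c1 := @nondecreasing_cvg_mu _ _ R m1 _ mAI (bigcupT_measurable _ mAI) nd.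
have c2 := @nondecreasing_cvg_mu _ _ R m2 _ mAI (bigcupT_measurable _ mAI) nd.
rewrite -AE in c1 c2.
apply: (cvg_unique _ c1); first exact: ereal_hausdorff.
by rewrite (_ : m1 \o _ = m2 \o (fun n => A `&` I n))//; apply/funext => n /=; exact: key.
Qed.

Lemma tail_ge0_integral m1 m2 (phi : R -> \bar R) :
  (forall l : R, 0 < l -> m1 `[l, +oo[%classic = m2 `[l, +oo[%classic) ->
  (forall l : R, 0 < l -> (m1 `[l, +oo[%classic < +oo)%E) ->
  (forall l : R, l <= 0 -> phi l = 0%E) ->
  (\int[m1]_x phi x = \int[m2]_x phi x)%E.
Proof.
move=> m12 fin1 phi0.
have red m : (\int[m]_x phi x = \int[m]_(x in `]0%R, +oo[) phi x)%E.
  rewrite [RHS]integral_mkcond; apply: eq_integral => x _; rewrite patchE.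
  case: ifPn => //; rewrite notin_setE/= in_itv/= andbT => /negP; rewrite -leNgt.
  exact: phi0.
rewrite !red; apply: eq_measure_integral => A mA A0; exact: tail_unique.
Qed.

End TailUnique.

(** * Generalized inverses of tail functions *)

Section Quantile.
Context {R : realType}.
Variable H : R -> R.
Hypothesis H_noninc : forall x y : R, 0 < x -> x <= y -> H y <= H x.
Hypothesis H_left : forall l u : R, 0 < l -> (forall x : R, 0 < x -> x < l -> u <= H x) -> u <= H l.
Hypothesis H_0 : forall u : R, 0 < u -> exists2 l : R, 0 < l & H l < u.

(* The value on [u <= 0] is junk: only the image of the Lebesgue measure on [0, +oo[ matters. *)
Definition quantile (u : R) : R := if u <= 0 then 0 else
  sup [set l : R | l = 0 \/ 0 < l /\ u <= H l].

Let has_sup_q u : 0 < u -> has_sup [set l : R | l = 0 \/ 0 < l /\ u <= H l].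
Proof.
move=> u0; split; first by exists 0; left.
have [l l0 Hl] := H_0 u0; exists l => x /= [->|[x0 ux]]; first exact: ltW.
by rewrite leNgt; apply/negP => /ltW /(H_noninc l0); lra.
Qed.

Lemma quantile_ge0 u : 0 <= quantile u.
Proof.
rewrite /quantile; case: (leP u 0) => // u0; by apply: (sup_upper_bound (has_sup_q u0)); left.
Qed.

(** The Galois connection between a nonincreasing function and its inverse; left continuity makes
    the supremum attained. *)
Lemma quantile_ge (l u : R) : 0 < l -> 0 < u -> (l <= quantile u) = (u <= H l).
Proof.
move=> l0 u0; have hs := has_sup_q u0; rewrite /quantile [u <= 0]leNgt u0/=.
apply/idP/idP => [lq|uH]; last by apply: (sup_upper_bound hs); right.
apply: H_left => // x x0 xl.
have /sup_adherent/(_ hs)[y] : 0 < sup [set l : R | l = 0 \/ 0 < l /\ u <= H l] - x by lra.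
rewrite subKr => /= [[->|[y0 uy]]] xy; first by lra.
exact: le_trans uy (H_noninc x0 (ltW xy)).
Qed.

Let preimE (l : R) : 0 < l -> quantile @^-1` `[l, +oo[ = `]0, H l]%classic.
Proof.
move=> l0; apply/seteqP; split => u /=; rewrite !in_itv/= andbT.
  have [u0|u0] := leP u 0; last by rewrite quantile_ge.
  by rewrite /quantile u0 => /(lt_le_trans l0); rewrite ltxx.
by move=> /andP[u0]; rewrite quantile_ge.
Qed.

Lemma measurable_quantile : measurable_fun setT (quantile : measurableTypeR R -> measurableTypeR R).
Proof.
apply: (measurability (@RGenCInfty.G R)); first exact: RGenCInfty.measurableE.
move=> _ [_ [l ->] <-]; rewrite setTI.
have [l0|l0] := leP l 0; last by rewrite preimE//; exact: measurable_itv.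
rewrite (_ : _ @^-1` _ = setT)//; apply/seteqP; split => // u _ /=.
by rewrite in_itv/= andbT (le_trans l0 (quantile_ge0 u)).
Qed.

Lemma quantile_tail (l : R) : 0 < l -> 0 <= H l ->
  pushforward lebesgue_measure quantile `[l, +oo[%classic = (H l)%:E.
Proof.
move=> l0 Hl; rewrite /pushforward preimE// lebesgue_measure_itv/= lte_fin.
by case: ltP => [_|h]; [rewrite oppr0 adde0|congr EFin; lra].
Qed.

End Quantile.

(** * Integrals of powers *)

Section PowerIntegrals.
Context {R : realType}.
Local Notation leb := (@lebesgue_measure R).

Lemma continuous_powR_gt0 (p x : R) : 0 < x -> {for x, continuous (fun y : R => y `^ p)}.
Proof.
move=> x0; apply: differentiable_continuous; apply/derivable1_diffP.
by apply: derivable_powR; rewrite in_itv/= x0.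
Qed.

Lemma continuous_cpowR_gt0 (c p x : R) : 0 < x -> {for x, continuous (fun y : R => c * y `^ p)}.
Proof. by move=> x0; apply: continuousM; [exact: cvg_cst|exact: continuous_powR_gt0]. Qed.

Lemma cvg_powR_pinfty (p : R) : 0 < p -> (x : R) `^ p @[x --> +oo] --> +oo.
Proof.
move=> p0; apply/cvgryPge => A.
near=> x; have x1 : 1 <= x by near: x; exact: nbhs_pinfty_ge.
have : (Num.max 1 A) `^ p^-1 <= x by near: x; exact: nbhs_pinfty_ge.
move=> /(ge0_ler_powR (ltW p0)); rewrite !nnegrE powR_ge0 (le_trans ler01 x1) => /(_ isT isT).
rewrite -powRrM mulVf ?gt_eqF// powRr1; last by rewrite le_max ler01.
by apply: le_trans; rewrite le_max lexx orbT.
Unshelve. all: by end_near. Qed.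

Lemma cvg_powRN_pinfty (p : R) : 0 < p -> (x : R) `^ (- p) @[x --> +oo] --> 0.
Proof.
move=> p0; under eq_fun do rewrite powRN.
apply/gtr0_cvgV0; last exact: cvg_powR_pinfty.
by near=> x; apply: powR_gt0; near: x; exact: nbhs_pinfty_gt.
Unshelve. all: by end_near. Qed.

Lemma integral_powR_tail (a p : R) : 0 < a -> 0 < p ->
  (\int[leb]_(x in `[a, +oo[) (p * x `^ (-1 - p))%:E = (a `^ (- p))%:E)%E.
Proof.
move=> a0 p0.
have d (x : R) : 0 < x -> is_derive x 1 (fun y : R => - y `^ (- p)) (p * x `^ (-1 - p)).
  move=> x0; have h := @is_derive1_powR R (- p) x x0.
  have := is_deriveN h; rewrite mulNr opprK (addrC (- p)); exact.
rewrite (@ge0_continuous_FTC2y _ _ (fun x => - x `^ (- p)) a (- 0)).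
- by rewrite oppr0 EFinN oppeK add0e.
- by move=> x _; rewrite mulr_ge0 ?powR_ge0// ltW.
- apply/continuous_within_itvcyP; split=> [x|].
    rewrite in_itv/= andbT => ax; exact: (@continuous_cpowR_gt0 p (-1 - p) x (lt_trans a0 ax)).
  by apply: cvg_at_right_filter; exact: (@continuous_cpowR_gt0 p (-1 - p) a a0).
- by apply: cvgN; exact: cvg_powRN_pinfty.
- by move=> x ax; have [] := d x (lt_trans a0 ax).
- apply: cvgN; apply: cvg_at_right_filter; exact: continuous_powR_gt0.
- move=> x; rewrite in_itv/= andbT => ax; rewrite derive1E.
  by have [_ ->] := d x (lt_trans a0 ax).
Qed.

Lemma integral_powR_zero (p : R) : 0 <= p -> p < 1 ->
  (\int[leb]_(x in `]0%R, 1%R]) ((1 - p) * x `^ (- p))%:E <= 1)%E.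
Proof.
move=> p0 p1.
have d (x : R) : 0 < x -> is_derive x 1 (fun y : R => y `^ (1 - p)) ((1 - p) * x `^ (- p)).
  move=> x0; have := @is_derive1_powR R (1 - p) x x0.
  by rewrite (_ : 1 - p - 1 = - p)//; lra.
pose I n : set (measurableTypeR R) := `[n.+2%:R^-1, 1]%classic.
have IE : `]0%R, 1%R]%classic = \bigcup_n I n.
  apply/seteqP; split => x /=; rewrite in_itv/=.
    move=> /andP[x0 x1]; exists (Num.truncn x^-1) => //=; rewrite /I/= in_itv/= x1 andbT.
    rewrite invf_ple ?posrE// ltW// (lt_trans (truncnS_gt _))// ltr_nat//.
  move=> [n _]; rewrite /I/= in_itv/= => /andP[h ->]; rewrite andbT.
  by apply: lt_le_trans h; rewrite invr_gt0 ltr0n.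
have mf A : measurable_fun A (fun x : R => ((1 - p) * x `^ (- p))%:E).
  have h : measurable_fun [set: R] (fun x : R => (1 - p) * x `^ (- p)).
    by apply: measurable_funM; [exact: measurable_cst|exact: measurable_powR].
  by apply/measurable_EFinP; exact: (measurable_funTS h).
have nd : nondecreasing_seq I.
  move=> n k nk; apply/subsetPset => x; rewrite /I/= !in_itv/= => /andP[h ->]; rewrite andbT.
  by apply: le_trans h; rewrite lef_pV2 ?posrE ?ltr0n// ler_nat ltnS.
have c : (\int[leb]_(x in I i) ((1 - p) * x `^ (- p))%:E @[i --> \oo] -->
    \int[leb]_(x in `]0%R, 1%R]) ((1 - p) * x `^ (- p))%:E)%E.
  rewrite IE; apply: (@ge0_nondecreasing_set_cvg_integral _ _ R I) => //.
  - by move=> i; exact: measurable_itv.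
  - by move=> i; exact: mf.
  - by move=> i x _; rewrite lee_fin mulr_ge0 ?powR_ge0//; lra.
rewrite -(cvg_lim _ c)//; apply: lime_le; first by apply/cvg_ex; eexists; exact: c.
apply: nearW => n.
have n1 : n.+2%:R^-1 < 1 :> R by rewrite invf_lt1 ?ltr0n// ltr1n.
have n0 : 0 < n.+2%:R^-1 :> R by rewrite invr_gt0 ltr0n.
have pos x : n.+2%:R^-1 <= x -> 0 < x :> R by apply: lt_le_trans.
rewrite /I (@continuous_FTC2 _ _ (fun x => x `^ (1 - p)) n.+2%:R^-1 1)//.
- by rewrite powR1 -EFinB lee_fin lerBlDr lerDl powR_ge0.
- apply: continuous_in_subspaceT => x; rewrite inE/= in_itv/= => /andP[/pos x0 _].
  exact: (@continuous_cpowR_gt0 (1 - p) (- p) x x0).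
- split.
  + by move=> x; rewrite in_itv/= => /andP[/ltW/pos x0 _]; have [] := d x x0.
  + by apply: cvg_at_right_filter; exact: continuous_powR_gt0.
  + by apply: cvg_at_left_filter; exact: continuous_powR_gt0.
- move=> x; rewrite in_itv/= => /andP[/ltW/pos x0 _]; rewrite derive1E.
  by have [_ ->] := d x x0.
Qed.

End PowerIntegrals.

(** * Limits of rescaled expectations under a regularly varying tail *)

Section RegularTail.
Context {R : realType} {d} {T : measurableType d} (mu : probability T R).
Variables (U : T -> R) (kappa c : R).
Hypothesis mU : measurable_fun setT U.
Hypothesis kappa0 : 0 < kappa.
Hypothesis c0 : 0 <= c.
Hypothesis tail : l `^ kappa * fine (mu [set x | l <= U x]) @[l --> +oo] --> c.
Local Notation leb := (@lebesgue_measure R).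

Let f (l : R) := fine (mu [set x | l <= U x]).

Lemma measurable_ge (l : R) : measurable [set x | l <= U x].
Proof.
rewrite (_ : [set x | _] = U @^-1` `[l, +oo[%classic).
  by rewrite -[X in measurable X]setTI; apply: mU => //; exact: measurable_itv.
by apply/seteqP; split => x /=; rewrite in_itv/= andbT.
Qed.

Let f_ge0 l : 0 <= f l. Proof. exact: fine_ge0. Qed.

Let f_le1 l : f l <= 1.
Proof.
rewrite -lee_fin fine_muE; last exact: measurable_ge.
by apply: probability_le1; exact: measurable_ge.
Qed.

Let f_noninc x y : x <= y -> f y <= f x.
Proof.
move=> xy; rewrite -lee_fin !fine_muE; [|exact: measurable_ge..].
by apply: le_measure; rewrite ?inE; [exact: measurable_ge..|move=> z /=; exact: le_trans].
Qed.

Lemma tail_bound : exists2 A : R, 0 < A & forall l : R, 0 < l -> f l <= A * l `^ (- kappa).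
Proof.
have /cvgrPdist_le/(_ 1 ltr01) := tail => -[L [_ hL]].
pose L1 := Num.max L 0 + 1.
exists (Num.max (c + 1) (L1 `^ kappa)); first by rewrite lt_max ltr_wpDl.
move=> l l0; have lk := powR_gt0 kappa l0.
rewrite powRN ler_pdivlMr// mulrC le_max.
have [lL|Ll] := leP l L1; apply/orP; [right|left].
  rewrite (@le_trans _ _ (l `^ kappa * 1))// ?ler_wpM2l ?powR_ge0 ?f_le1// mulr1.
  have L10 : 0 < L1 by rewrite /L1 ltr_wpDl// le_max lexx orbT.
  by apply: ge0_ler_powR => //; rewrite ?nnegrE ltW.
have Ll' : L < l by apply: le_lt_trans Ll; rewrite /L1; have := le_max L L 0; rewrite lexx => /=;
  lra.
by have := hL l Ll'; rewrite -/(f l) => /ler_normlP[h _]; lra.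
Qed.

(** The inverse of the limit tail [c l^(- kappa)] in closed form. It is set to 0 for [u <= 0], as
    [quantile] is, so that the pointwise limit also holds there. *)
Definition stable_quantile (u : R) : R := if u <= 0 then 0 else (c / u) `^ kappa^-1.

Lemma stable_quantile_gt0 u : 0 < u -> stable_quantile u = (c / u) `^ kappa^-1.
Proof. by rewrite ltNge /stable_quantile => /negbTE ->. Qed.

Let powRK x : 0 <= x -> (x `^ kappa^-1) `^ kappa = x.
Proof. by move=> x0; rewrite -powRrM mulVf ?gt_eqF// powRr1. Qed.

Let powRK' x : 0 <= x -> (x `^ kappa) `^ kappa^-1 = x.
Proof. by move=> x0; rewrite -powRrM mulfV ?gt_eqF// powRr1. Qed.

Lemma le_powRV (x y : R) : 0 <= x -> 0 <= y -> (x <= y `^ kappa^-1) = (x `^ kappa <= y).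
Proof.
move=> x0 y0; apply/idP/idP.
  by move=> /(ge0_ler_powR (ltW kappa0)); rewrite !nnegrE powR_ge0 powRK// => ->.
have kV : 0 <= kappa^-1 by rewrite invr_ge0 ltW.
by move=> /(ge0_ler_powR kV); rewrite !nnegrE powR_ge0 powRK'// => ->.
Qed.

Lemma measurable_stable_quantile : measurable_fun setT stable_quantile.
Proof.
have -> : stable_quantile = fun u => if u <= 0 then 0 else (c * u `^ (-1)) `^ kappa^-1.
  by apply/funext => u; rewrite /stable_quantile; case: (leP u 0) => // u0; rewrite powR_inv1// ltW.
apply: measurable_fun_ifT => //.
- by apply: measurable_fun_ler => //; exact: measurable_id.
- apply: (@measurableT_comp _ _ _ _ _ _ (fun x : R => x `^ kappa^-1)); first exact: measurable_powR.
  by apply: measurable_funM => //; exact: measurable_powR.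
Qed.

Lemma stable_quantile_tail (l : R) : 0 < l ->
  pushforward leb stable_quantile `[l, +oo[%classic = (c * l `^ (- kappa))%:E.
Proof.
move=> l0; rewrite /pushforward (_ : _ @^-1` _ = `]0, c * l `^ (- kappa)]%classic).
  rewrite lebesgue_measure_itv/= lte_fin; case: ltP => [_|h].
    by rewrite oppr0 adde0.
  by congr EFin; apply/eqP; rewrite eq_le h mulr_ge0// powR_ge0.
apply/seteqP; split => u /=; rewrite !in_itv/= ?andbT.
  have [u0|u0] := leP u 0; first by rewrite /stable_quantile u0 leNgt l0.
  rewrite stable_quantile_gt0// le_powRV ?divr_ge0// ?(ltW l0) ?(ltW u0)// ler_pdivlMr//.
  by rewrite powRN ler_pdivlMr ?powR_gt0// mulrC.
move=> /andP[u0]; rewrite stable_quantile_gt0// le_powRV ?divr_ge0// ?(ltW l0) ?(ltW u0)//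
  ler_pdivlMr//.
by rewrite powRN ler_pdivlMr ?powR_gt0// mulrC.
Qed.

Section Scaling.
Variables (K : R) .
Hypothesis K0 : 0 < K.
Let s := K `^ kappa^-1.
Let s0 : 0 < s. Proof. exact: powR_gt0. Qed.

(** The tail of [K] times the law of [U / s], a measure of total mass [K]. *)
Definition scaled_tail (l : R) := K * f (s * l).

Lemma scaled_tailE l : 0 < l -> scaled_tail l = (s * l) `^ kappa * f (s * l) * l `^ (- kappa).
Proof.
move=> l0; rewrite /scaled_tail powRM ?ltW// powRK ?ltW// powRN mulrAC -!mulrA; congr (_ * _).
by rewrite mulrA mulfV ?mul1r// gt_eqF// powR_gt0.
Qed.

Lemma scaled_tail_noninc x y : 0 < x -> x <= y -> scaled_tail y <= scaled_tail x.
Proof. by move=> _ xy; rewrite ler_wpM2l ?(ltW K0)// f_noninc// ler_wpM2l// ltW. Qed.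

Lemma scaled_tail_ge0 l : 0 <= scaled_tail l.
Proof. by rewrite mulr_ge0// ltW. Qed.

Lemma scaled_tail_left l u : 0 < l -> (forall x : R, 0 < x -> x < l -> u <= scaled_tail x) ->
  u <= scaled_tail l.
Proof.
move=> l0 h.
pose x (n : nat) := l * (1 - n.+2%:R^-1) : R.
have n1 n : 0 < (n.+2%:R^-1 : R) < 1 by rewrite invr_gt0 ltr0n invf_lt1 ?ltr0n// ltr1n.
have xl n : x n < l by rewrite /x gtr_pMr//; have := n1 n; lra.
have x0 n : 0 < x n by rewrite /x mulr_gt0// subr_gt0; case/andP: (n1 n).
have xc : x n @[n --> \oo] --> l.
  rewrite -[X in _ --> X]mulr1 -[X in _ * X]subr0.
  apply: cvgM; first exact: cvg_cst.
  apply: cvgB; first exact: cvg_cst.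
  by have := @cvg_harmonic R; rewrite -cvg_shiftS.
have c1 : f (s * x n) @[n --> \oo] --> f (s * l).
  have fE y : f y = Ex mu \1_[set z | y <= U z] by rewrite Ex_indic//; exact: measurable_ge.
  rewrite fE; under eq_fun do rewrite fE.
  apply: (@Ex_cvg _ _ _ mu _ _ 1).
  - by move=> n; apply: measurable_indic; exact: measurable_ge.
  - by move=> n y; rewrite indicE; case: (_ \in _); rewrite ?normr1 ?normr0.
  - move=> y; have [slU|Usl] := leP (s * l) (U y).
      apply: (@cvg_trans _ (cst (1 : R) @ \oo)); last first.
        by rewrite indicE mem_set//; exact: cvg_cst.
      apply: near_eq_cvg; apply: nearW => n; rewrite indicE mem_set//=.
      by apply: le_trans slU; rewrite ler_wpM2l// ltW.
    apply: (@cvg_trans _ (cst (0 : R) @ \oo)); last first.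
      by rewrite indicE memNset/=; [exact: cvg_cst|apply/negP; rewrite -ltNge].
    apply: near_eq_cvg.
    have cx : s * x n @[n --> \oo] --> s * l by apply: cvgM; [exact: cvg_cst|].
    near=> n; rewrite indicE memNset//=; apply/negP; rewrite -ltNge.
    by near: n; apply: (cvgr_gt _ cx).
have c2 : K * f (s * x n) @[n --> \oo] --> K * f (s * l) by apply: cvgM; [exact: cvg_cst|].
rewrite /scaled_tail -(cvg_lim _ c2)//; apply: limr_ge; first by apply/cvg_ex; eexists; exact: c2.
by apply: nearW => n; exact: h.
Unshelve. all: by end_near. Qed.

Lemma scaled_tail_bound A l : 0 < l -> (forall x : R, 0 < x -> f x <= A * x `^ (- kappa)) ->
  scaled_tail l <= A * l `^ (- kappa).
Proof.
move=> l0 hA; have sl0 : 0 < s * l by rewrite mulr_gt0.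
rewrite scaled_tailE// ler_wpM2r ?powR_ge0// mulrC -ler_pdivlMr ?powR_gt0// -powRN; exact: hA.
Qed.

Lemma scaled_tail_small u : 0 < u -> exists2 l : R, 0 < l & scaled_tail l < u.
Proof.
move=> u0; have [A A0 hA] := tail_bound.
exists ((2 * A / u) `^ kappa^-1); first by rewrite powR_gt0// divr_gt0// mulr_gt0.
have h0 : 0 < 2 * A / u by rewrite divr_gt0// mulr_gt0.
apply: (le_lt_trans (scaled_tail_bound (powR_gt0 _ h0) hA)).
rewrite powRN powRK ?ltW// invf_div mulrCA -[X in _ < X]mulr1 ltr_pM2l//.
by rewrite invfM mulrCA mulfV ?gt_eqF// mulr1 invf_lt1// ltr1n.
Qed.

Definition tail_quantile := quantile scaled_tail.

Lemma measurable_tail_quantile : measurable_fun setT (tail_quantile : measurableTypeR R ->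
  measurableTypeR R).
Proof. exact: measurable_quantile scaled_tail_noninc scaled_tail_left scaled_tail_small. Qed.

Lemma tail_quantile_ge l u : 0 < l -> 0 < u -> (l <= tail_quantile u) = (u <= scaled_tail l).
Proof. exact: quantile_ge scaled_tail_noninc scaled_tail_left scaled_tail_small _ _. Qed.

Lemma tail_quantile_ge0 u : 0 <= tail_quantile u.
Proof. exact: quantile_ge0 scaled_tail_noninc scaled_tail_small _. Qed.

(** The bound does not involve [K]: the scale [s] is the one for which the power tail is invariant.
    It yields the dominating function. *)
Lemma tail_quantile_bound A u : 0 < u -> 0 < A ->
  (forall x : R, 0 < x -> f x <= A * x `^ (- kappa)) -> tail_quantile u <= (A / u) `^ kappa^-1.
Proof.
move=> u0 A0 hA; have := tail_quantile_ge0 u; rewrite le_eqVlt => /predU1P[<-|q0]; first exact: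
  powR_ge0.
rewrite le_powRV ?divr_ge0 ?(ltW A0) ?(ltW u0) ?(ltW q0)//.
have : u <= scaled_tail (tail_quantile u) by rewrite -tail_quantile_ge// lexx.
move=> /le_trans/(_ (scaled_tail_bound q0 hA)).
by rewrite powRN ler_pdivlMr ?powR_gt0// ler_pdivlMr// mulrC.
Qed.

(** Two measures with the same tails integrate alike. The dependence on [K] is thereby moved from
    the measure into the integrand. *)
Lemma ge0_integral_tail_quantile (phi : R -> \bar R) : measurable_fun setT phi ->
  (forall x, 0 <= phi x)%E -> (forall x, x <= 0 -> phi x = 0%E) ->
  (K%:E * \int[mu]_x phi (U x / s)%R = \int[leb]_u phi (tail_quantile u))%E.
Proof.
move=> mphi phi0 phiN.
have mUs : measurable_fun setT (fun x => U x / s : measurableTypeR R).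
  by apply: measurable_funM => //; exact: measurable_cst.
pose m1 : {measure set (measurableTypeR R) -> \bar R} := mscale (NngNum (ltW K0)) (image_measure mu
  mUs).
have <- : (\int[m1]_x phi x = K%:E * \int[mu]_x phi (U x / s)%R)%E.
  by rewrite ge0_integral_mscale//= ge0_integral_image.
rewrite -(ge0_integral_image _ measurable_tail_quantile)//.
have tE (l : R) : 0 < l -> m1 `[l, +oo[%classic = (scaled_tail l)%:E.
  move=> l0; rewrite /scaled_tail EFinM fine_muE; last exact: measurable_ge.
  by congr (_ * mu _)%E; apply/seteqP; split => x /=; rewrite in_itv/= andbT ler_pdivlMr// mulrC.
apply: tail_ge0_integral => // l l0; rewrite tE//; last exact: ltry.
exact: esym (quantile_tail scaled_tail_noninc scaled_tail_left scaled_tail_small l0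
  (scaled_tail_ge0 l)).
Qed.

End Scaling.
Section StableLimit.
Variables (K : nat -> R).
Hypothesis K0 : forall N, 0 < K N.
Hypothesis Koo : K N @[N --> \oo] --> +oo.
Variables (phi : R -> R) (C q r : R).
Hypothesis mphi : measurable_fun setT phi.
Hypothesis phiN : forall x, x <= 0 -> phi x = 0.
Hypothesis qr : 0 <= r /\ r < kappa < q.
Hypothesis C0 : 0 <= C.
Hypothesis phi_small : forall x, 0 < x -> `|phi x| <= C * x `^ q.
Hypothesis phi_large : forall x, 0 < x -> `|phi x| <= C * x `^ r.
Hypothesis phi_cont : forall x, 0 < x -> x != 1 -> {for x, continuous phi}.

Let Q N := tail_quantile (K N).

Let r0 : 0 <= r. Proof. by case: qr. Qed.
Let rk : r < kappa. Proof. by case: qr => _ /andP[]. Qed.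
Let kq : kappa < q. Proof. by case: qr => _ /andP[]. Qed.
Let q0 : 0 <= q. Proof. exact: ltW (lt_trans kappa0 kq). Qed.

Lemma scaled_tail_cvg l : 0 < l -> scaled_tail (K N) l @[N --> \oo] --> c * l `^ (- kappa).
Proof.
move=> l0; under eq_fun => N do rewrite (scaled_tailE (K0 N) l0).
apply: cvgM; last exact: cvg_cst.
have soo : K N `^ kappa^-1 * l @[N --> \oo] --> +oo.
  have kV : 0 < kappa^-1 by rewrite invr_gt0.
  have Kk : K N `^ kappa^-1 @[N --> \oo] --> +oo := cvg_comp K (fun x => x `^ kappa^-1) Koo
    (cvg_powR_pinfty kV).
  exact: (cvg_comp _ _ Kk (gt0_cvgMly l0 cvg_id)).
exact: (cvg_comp _ _ soo tail).
Qed.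

(** Through the Galois connection, pointwise convergence of the tails gives convergence of their
    inverses, because the limit tail is strictly decreasing when [c > 0]. *)
Lemma tail_quantile_cvg u : 0 < u -> Q N u @[N --> \oo] --> stable_quantile u.
Proof.
move=> u0; rewrite stable_quantile_gt0//; set F := (c / u) `^ kappa^-1.
have F0 : 0 <= F by exact: powR_ge0.
have up l : 0 < l -> F < l -> \forall N \near \oo, Q N u < l.
  move=> l0 Fl; have h : c * l `^ (- kappa) < u.
    move: Fl; rewrite ltNge le_powRV ?divr_ge0 ?(ltW l0) ?(ltW u0)// -ltNge ltr_pdivrMr//.
    by rewrite powRN ltr_pdivrMr ?powR_gt0// mulrC.
  near=> N; rewrite ltNge (tail_quantile_ge (K0 N))// -ltNge.
  by near: N; exact: (cvgr_lt _ (scaled_tail_cvg l0)).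
have lo l : 0 < l -> l < F -> \forall N \near \oo, l <= Q N u.
  move=> l0 lF.
  have l1 : 0 < (l + F) / 2 by lra.
  have h : u < c * l `^ (- kappa).
    have : ((l + F) / 2) `^ kappa <= c / u.
      by rewrite -le_powRV ?divr_ge0 ?(ltW u0) ?(ltW l1)// -/F; lra.
    rewrite ler_pdivlMr// -ler_pdivlMl ?powR_gt0//.
    move=> /le_lt_trans; apply.
    have c1 : 0 < c.
      rewrite lt_neqAle c0 andbT; apply: contra_ltN (lt_trans l0 lF) => /eqP c00.
      by rewrite /F -c00 mul0r powR0// invr_eq0 gt_eqF.
    rewrite powRN mulrC ltr_pM2l// ltf_pV2 ?posrE ?powR_gt0//.
    by apply: gt0_ltr_powR; rewrite ?nnegrE ?(ltW l0) ?(ltW l1)//; lra.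
  near=> N; rewrite (tail_quantile_ge (K0 N))//.
  by apply: ltW; near: N; exact: (cvgr_gt _ (scaled_tail_cvg l0)).
apply/cvgrPdist_le => e e0.
have lo' : \forall N \near \oo, F - e <= Q N u.
  have [Fe|Fe] := leP (F - e) 0; last by apply: lo => //; lra.
  by apply: nearW => N; apply: le_trans Fe _; exact: tail_quantile_ge0.
near=> N; rewrite distrC ler_distl.
apply/andP; split; first by near: N; exact: lo'.
by apply: ltW; near: N; apply: up; lra.
Unshelve. all: by end_near. Qed.

Let phi_cvg u : 0 < u -> u != c -> phi (Q N u) @[N --> \oo] --> phi (stable_quantile u).
Proof.
move=> u0 uc; have := tail_quantile_cvg u0.
have : 0 <= stable_quantile u by rewrite stable_quantile_gt0// powR_ge0.
rewrite le_eqVlt => /predU1P[F0|F0] cQ; last first.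
  apply: continuous_cvg => //; apply: phi_cont => //.
  rewrite stable_quantile_gt0//; apply: contra uc => /eqP h.
  have := powRK (divr_ge0 c0 (ltW u0)); rewrite h powR1 => h1.
  by rewrite -[u]mul1r h1 divfK// gt_eqF.
(* Here [c = 0] and the quantiles tend to 0, where convergence comes from the power bound on [phi]
   and not from [phi_cont]. *)
rewrite -F0 in cQ *; rewrite phiN//; apply/cvgr0Pnorm_le => e e0.
pose x1 := (e / (C + 1)) `^ q^-1.
have q1 : 0 < q by apply: lt_trans kq.
have x10 : 0 < x1 by rewrite powR_gt0// divr_gt0// ltr_wpDl.
near=> N.
have := tail_quantile_ge0 (K0 N) u; rewrite le_eqVlt -/(Q N) => /predU1P[<-|Q0].
  by rewrite phiN// normr0 ltW.
apply: le_trans (phi_small Q0) _.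
have Qx : Q N u <= x1 by apply: ltW; near: N; exact: (cvgr_lt _ cQ).
have : Q N u `^ q <= x1 `^ q by apply: ge0_ler_powR => //; rewrite nnegrE ltW.
rewrite /x1 -powRrM mulVf ?gt_eqF// powRr1; last by rewrite divr_ge0 ?ltW// ltr_wpDl.
rewrite ler_pdivlMr ?ltr_wpDl// => /(le_trans _); apply.
by rewrite mulrC ler_wpM2l ?powR_ge0// lerDl.
Unshelve. all: by end_near. Qed.

Let p1 := q / kappa - 1.
Let p2 := r / kappa.
Let p10 : 0 < p1. Proof. by rewrite subr_gt0 ltr_pdivlMr// mul1r. Qed.
Let p20 : 0 <= p2. Proof. by rewrite divr_ge0// ltW. Qed.
Let p21 : 0 < 1 - p2. Proof. by rewrite subr_gt0 ltr_pdivrMr// mul1r. Qed.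

(** Multiples of [u^(- q / kappa)] on [[1, +oo[] and, in [g2], of [u^(- r / kappa)] on []0, 1]],
    normalized so that their integrals are bounded by 1. Large [u] corresponds to small jumps. *)
Let g1 : R -> \bar R := (fun u => (p1 * u `^ (-1 - p1))%:E) \_ `[1, +oo[%classic.
Let g2 : R -> \bar R := (fun u => ((1 - p2) * u `^ (- p2))%:E) \_ `]0%R, 1%R]%classic.

Let mpow (A : set R) a b : measurable_fun A (fun u : R => (a * u `^ b)%:E).
Proof.
apply/measurable_EFinP; apply: measurable_funTS.
by apply: measurable_funM; [exact: measurable_cst|exact: measurable_powR].
Qed.

Let ig1 : leb.-integrable setT g1.
Proof.
apply: (iffLR (integrable_mkcond (fun u : measurableTypeR R => (p1 * u `^ (-1 - p1))%:E)
  (measurable_itv _))).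
apply/integrableP; split; first exact: mpow.
under eq_integral => x _ do rewrite gee0_abs ?lee_fin ?(mulr_ge0 (ltW p10)) ?powR_ge0//.
by rewrite integral_powR_tail// ltry.
Qed.

Let ig2 : leb.-integrable setT g2.
Proof.
apply: (iffLR (integrable_mkcond (fun u : measurableTypeR R => ((1 - p2) * u `^ (- p2))%:E)
  (measurable_itv _))).
apply/integrableP; split; first exact: mpow.
under eq_integral => x _ do rewrite gee0_abs ?lee_fin ?(mulr_ge0 (ltW p21)) ?powR_ge0//.
by apply: le_lt_trans (integral_powR_zero p20 _) _; [rewrite -subr_gt0|exact: ltry].
Qed.

Let g10 u : (0 <= g1 u)%E.
Proof. by rewrite /g1 patchE; case: ifPn => // _; rewrite lee_fin mulr_ge0 ?powR_ge0 ?(ltW p10).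
  Qed.

Let g20 u : (0 <= g2 u)%E.
Proof. by rewrite /g2 patchE; case: ifPn => // _; rewrite lee_fin mulr_ge0 ?powR_ge0 ?(ltW p21).
  Qed.

Let Q_dominated : exists2 g : R -> \bar R, leb.-integrable setT g &
  forall N u, (`|(phi (Q N u))%:E| <= g u)%E.
Proof.
have [A A0 hA] := tail_bound.
pose a1 := C * A `^ (q / kappa) / p1; pose a2 := C * A `^ (r / kappa) / (1 - p2).
have a10 : 0 <= a1 by rewrite divr_ge0 ?(ltW p10)// mulr_ge0// powR_ge0.
have a20 : 0 <= a2 by rewrite divr_ge0 ?(ltW p21)// mulr_ge0// powR_ge0.
exists (fun u => a1%:E * g1 u + a2%:E * g2 u)%E.
  by apply: (integrableD measurableT); exact: (integrableZl measurableT).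
move=> N u.
have ge0 : (0 <= a1%:E * g1 u + a2%:E * g2 u)%E by rewrite adde_ge0// mule_ge0.
have [u0|u0] := leP u 0.
  by rewrite /Q /tail_quantile /quantile u0 phiN// abse0.
have := tail_quantile_ge0 (K0 N) u; rewrite le_eqVlt -/(Q N) => /predU1P[<-|Q0].
  by rewrite phiN// abse0.
have QA : Q N u <= (A / u) `^ kappa^-1 by exact: (tail_quantile_bound (K0 N)).
have pow x : 0 <= x -> C * Q N u `^ x <= C * A `^ (x / kappa) * u `^ (- (x / kappa)).
  move=> x0; rewrite -mulrA ler_wpM2l//.
  apply: (@le_trans _ _ (((A / u) `^ kappa^-1) `^ x)).
    by apply: ge0_ler_powR => //; rewrite nnegrE ?powR_ge0// ltW.
  rewrite -powRrM (mulrC kappa^-1) powRM ?(ltW A0) ?invr_ge0 ?(ltW u0)//.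
  by rewrite -(powR_inv1 (ltW u0)) -(powRrM u) mulN1r.
have [u1|u1] := leP 1 u.
  apply: (@le_trans _ _ (a1%:E * g1 u)%E); last by rewrite leeDl// mule_ge0.
  rewrite /g1 patchE mem_set/=; last by rewrite in_itv/= u1.
  rewrite -EFinM lee_fin (le_trans (phi_small Q0))// (le_trans (pow _ q0))//.
  rewrite /a1 mulrA divfK ?gt_eqF// /p1 (_ : -1 - (q / kappa - 1) = - (q / kappa))//; ring.
apply: (@le_trans _ _ (a2%:E * g2 u)%E); last by rewrite leeDr// mule_ge0.
rewrite /g2 patchE mem_set/=; last by rewrite in_itv/= u0 ltW.
rewrite -EFinM lee_fin (le_trans (phi_large Q0))// (le_trans (pow _ r0))//.
by rewrite /a2 mulrA divfK ?gt_eqF.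
Qed.

Let mQ N : measurable_fun setT (fun u => (phi (Q N u))%:E).
Proof.
apply/measurable_EFinP; apply: (measurableT_comp mphi); exact: (measurable_tail_quantile (K0 N)).
Qed.

Let mUs N : measurable_fun setT (fun x => U x / K N `^ kappa^-1).
Proof. by apply: measurable_funM => //; exact: measurable_cst. Qed.

Lemma stable_limit_integrable N : mu.-integrable setT (fun x => (phi (U x / K N `^ kappa^-1))%:E).
Proof.
apply/integrableP; split; first by apply/measurable_EFinP; exact: measurableT_comp.
have [g ig hg] := Q_dominated.
have := @ge0_integral_tail_quantile _ (K0 N) (fun x => `|(phi x)%:E|%E) _ _ _.
rewrite /= => /(_ _ _ _)/wrap[].
- by apply/measurable_EFinP; exact: (measurableT_comp (@normr_measurable R setT) mphi).
- by move=> x; rewrite lee_fin.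
- by move=> x /phiN ->; rewrite normr0.
move=> E1; have : ((K N)%:E * \int[mu]_x `|phi (U x / K N `^ kappa^-1)|%:E < +oo)%E.
  rewrite E1; apply: (@le_lt_trans _ _ (\int[leb]_x g x)%E).
    apply: ge0_le_integral => //.
    - apply/measurable_EFinP; apply: (measurableT_comp (@normr_measurable R setT)).
      by apply/measurable_EFinP; exact: mQ.
    - exact: measurable_int ig.
    - by move=> x _; exact: hg.
  exact: (integrable_lty measurableT ig).
by case: (\int[mu]_x _)%E => // [x|]; rewrite ?ltry// gt0_muley// lte_fin.
Qed.

(** The orders [q > kappa] at 0 and [r < kappa] at infinity give an integrable bound uniform in [N].
    A discontinuity is allowed at 1, where the compensator of the case [beta = 1] is cut. *)
Lemma stable_limit :
  leb.-integrable setT (fun u => (phi (stable_quantile u))%:E) /\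
  K N * Ex mu (fun x => phi (U x / K N `^ kappa^-1)) @[N --> \oo] -->
    (\int[leb]_u phi (stable_quantile u))%R.
Proof.
have [g ig hg] := Q_dominated.
have [||//||i1 _ i2] := @dominated_convergence _ _ _ leb setT measurableT (fun N u => (phi (Q N
  u))%:E)
  (fun u => (phi (stable_quantile u))%:E) g mQ.
- by apply/measurable_EFinP; exact: measurableT_comp measurable_stable_quantile.
(* Only at [u = c] can [stable_quantile] take the value 1, where [phi] may be discontinuous. *)
- exists [set c]; split; first exact: measurable_set1.
    exact: lebesgue_measure_set1.
  move=> u /= h; apply: contrapT => uc; apply: h => _.
  have [u0|u0] := leP u 0.
    rewrite /Q /tail_quantile /quantile /stable_quantile u0; exact: cvg_cst.
  by apply: cvg_EFin; [exact: nearW|apply: phi_cvg => //; apply/eqP].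
- by apply: aeW => u N _; exact: hg.
split => //.
have E1 N : ((K N)%:E * \int[mu]_x (phi (U x / K N `^ kappa^-1))%:E = \int[leb]_u (phi (Q N
  u))%:E)%E.
  have im := stable_limit_integrable N.
  rewrite [in RHS]integralE [in LHS]integralE muleBr//; last exact: integrable_add_def.
  congr (_ - _)%E.
    rewrite (eq_integral (fun x => maxe (phi (U x / K N `^ kappa^-1))%:E 0%E)); last by move=> x _;
      rewrite funeposE.
    transitivity (\int[leb]_u maxe (phi (Q N u))%:E 0%E)%E; last by apply: eq_integral => x _;
      rewrite funeposE.
    apply: (@ge0_integral_tail_quantile _ (K0 N) (fun y => maxe (phi y)%:E 0%E)) => //.
    - by apply: measurable_maxe => //; apply/measurable_EFinP.
    - by move=> x; rewrite le_max lexx orbT.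
    - by move=> x x0; rewrite phiN// maxxx.
  rewrite (eq_integral (fun x => maxe (- (phi (U x / K N `^ kappa^-1))%:E)%E 0%E)); last by move=>
    x _; rewrite funenegE.
  transitivity (\int[leb]_u maxe (- (phi (Q N u))%:E)%E 0%E)%E; last by apply: eq_integral => x _;
    rewrite funenegE.
  apply: (@ge0_integral_tail_quantile _ (K0 N) (fun y => maxe (- (phi y)%:E)%E 0%E)) => //.
  - by apply: measurable_maxe => //; apply: measurableT_comp => //; apply/measurable_EFinP.
  - by move=> x; rewrite le_max lexx orbT.
  - by move=> x x0; rewrite phiN// oppe0 maxxx.
have E2 N : K N * Ex mu (fun x => phi (U x / K N `^ kappa^-1)) = fine (\int[leb]_u (phi (Q N
  u))%:E)%E.
  rewrite -E1 fineM//; exact: (integrable_fin_num _ (stable_limit_integrable N)).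
under eq_fun do rewrite E2.
rewrite /Rintegral; apply: fine_cvg; rewrite fineK//.
exact: (integrable_fin_num _ i1).
Qed.

End StableLimit.
End RegularTail.

(** * The Levy measure *)

Section LevyMeasure.
Context {R : realType}.
Variables (beta cp cm : R).
Hypothesis beta0 : 0 < beta.
Hypothesis cp0 : 0 <= cp.
Hypothesis cm0 : 0 <= cm.
Local Notation leb := (@lebesgue_measure R).

Let dens (l : R) := beta * (if 0 < l then cp else cm) * `|l| `^ (- 1 - beta).

Let dens_ge0 l : 0 <= dens l.
Proof. by rewrite /dens; case: ifPn => _; rewrite !mulr_ge0 ?powR_ge0// ltW. Qed.

Let mdens : measurable_fun setT dens.
Proof.
apply: measurable_funM.
  apply: measurable_funM; first exact: measurable_cst.
  by apply: measurable_fun_ifT => //; apply: measurable_fun_ltr => //; exact: measurable_id.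
apply: (measurableT_comp (measurable_powR (- 1 - beta))); exact: (@normr_measurable R setT).
Qed.

Let nu (A : set (measurableTypeR R)) : \bar R := nu_beta beta cp cm A.

Let nu0 : nu set0 = 0%E. Proof. exact: integral_set0. Qed.

Let nu_ge0 A : (0 <= nu A)%E.
Proof. by apply: integral_ge0 => x _; rewrite lee_fin; exact: dens_ge0. Qed.

Let nu_sigma : semi_sigma_additive nu.
Proof.
apply: (semi_sigma_additive_nng_induced (mu := leb)); first by apply/measurable_EFinP.
by move=> x; rewrite lee_fin; exact: dens_ge0.
Qed.

HB.instance Definition _ := isMeasure.Build _ _ _ nu nu0 nu_ge0 nu_sigma.

Definition levy_measure : {measure set (measurableTypeR R) -> \bar R} := nu.

Lemma levy_measure_right (l : R) : 0 < l ->
  levy_measure `[l, +oo[%classic = (cp * l `^ (- beta))%:E.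
Proof.
move=> l0; rewrite /levy_measure/= /nu /nu_beta.
transitivity (\int[leb]_(x in `[l, +oo[) (cp%:E * (beta * x `^ (-1 - beta))%:E))%E.
  apply: eq_integral => x; rewrite inE/= in_itv/= andbT => lx.
  have x0 := lt_le_trans l0 lx.
  by rewrite x0 (gtr0_norm x0) -EFinM mulrA (mulrC cp).
rewrite ge0_integralZl_EFin//.
- by rewrite integral_powR_tail.
- by move=> x _; rewrite lee_fin mulr_ge0 ?powR_ge0// ltW.
- apply/measurable_EFinP; apply: measurable_funTS.
  by apply: measurable_funM; [exact: measurable_cst|exact: measurable_powR].
Qed.

Lemma levy_measure_left (l : R) : 0 < l ->
  levy_measure `]-oo, - l]%classic = (cm * l `^ (- beta))%:E.
Proof.
move=> l0; rewrite /levy_measure/= /nu /nu_beta.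
transitivity (\int[leb]_(x in `]-oo, (- l)%R]) (cm%:E * (beta * (- x) `^ (-1 - beta))%:E))%E.
  apply: eq_integral => x; rewrite inE/= in_itv/= => lx.
  have x0 : x < 0 by lra.
  by rewrite ltNge (ltW x0)/= (ltr0_norm x0) -EFinM mulrA (mulrC cm).
rewrite ge0_integralZl_EFin//.
- rewrite EFinM; congr (_ * _)%E; apply: etrans (@integral_powR_tail _ l beta l0 beta0).
  rewrite ge0_integration_by_substitutionNy.
  + by apply: eq_integral => x _ /=; rewrite opprK.
  + apply: continuous_in_subspaceT => x; rewrite inE/= in_itv/= => xl.
    have x0 : 0 < - x by lra.
    apply: (@continuous_comp _ _ _ -%R (fun y : R => beta * y `^ (-1 - beta)) x).
      exact: opp_continuous.
    exact: continuous_cpowR_gt0.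
  + by move=> x _; rewrite mulr_ge0 ?powR_ge0// ltW.
- by move=> x _; rewrite lee_fin mulr_ge0 ?powR_ge0// ltW.
- apply/measurable_EFinP; apply: measurable_funTS.
  apply: measurable_funM; first exact: measurable_cst.
  by apply: (measurableT_comp (measurable_powR _)); exact: oppr_measurable.
Qed.

Let mopp : measurable_fun setT (-%R : measurableTypeR R -> measurableTypeR R).
Proof. exact: oppr_measurable. Qed.

(** Reflection brings the negative half-line back to tails on the positive one. *)
Definition levy_measure_opp : {measure set (measurableTypeR R) -> \bar R} :=
  image_measure levy_measure mopp.

Lemma levy_measure_oppE (l : R) : 0 < l ->
  levy_measure_opp `[l, +oo[%classic = (cm * l `^ (- beta))%:E.
Proof.
move=> l0; rewrite /levy_measure_opp image_measureE -levy_measure_left//; congr (levy_measure _).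
by apply/seteqP; split => x /=; rewrite !in_itv/= andbT lerNr.
Qed.

End LevyMeasure.

(** Uniqueness of the measure with a given tail. It turns the limits, obtained as integrals over
    [u], into integrals against the Levy measure. *)
Lemma tail_transport {R : realType} (m : {measure set (measurableTypeR R) -> \bar R}) (kappa c : R)
    (phi : R -> R) : 0 < kappa -> 0 <= c ->
  (forall l : R, 0 < l -> m `[l, +oo[%classic = (c * l `^ (- kappa))%:E) ->
  measurable_fun setT phi -> (forall x, x <= 0 -> phi x = 0) ->
  lebesgue_measure.-integrable setT (fun u => (phi (stable_quantile kappa c u))%:E) ->
  m.-integrable setT (EFin \o phi) /\
  (\int[m]_x (phi x)%:E = \int[lebesgue_measure]_u (phi (stable_quantile kappa c u))%:E)%E.
Proof.
move=> k0 c0 mt mphi phi0 iF.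
have mF : measurable_fun setT (stable_quantile kappa c : measurableTypeR R -> measurableTypeR R).
  exact: measurable_stable_quantile.
pose m2 : {measure set (measurableTypeR R) -> \bar R} := image_measure lebesgue_measure mF.
have m12 (l : R) : 0 < l -> m `[l, +oo[%classic = m2 `[l, +oo[%classic.
  by move=> l0; rewrite mt// /m2 image_measureE -(stable_quantile_tail k0 c0 l0).
have fin (l : R) : 0 < l -> (m `[l, +oo[%classic < +oo)%E by move=> l0; rewrite mt// ltry.
have mE : measurable_fun setT (EFin \o phi) by apply/measurable_EFinP.
split.
  apply/integrableP; split => //.
  rewrite (@tail_ge0_integral R m m2)//; last by move=> l l0 /=; rewrite phi0// normr0.
  rewrite ge0_integral_image//; first by case/integrableP : iF.
  by apply: measurableT_comp.
rewrite (@tail_ge0_integral R m m2)//; last by move=> l l0 /=; rewrite phi0.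
exact: (@integral_pushforward _ _ _ _ _ _ mF lebesgue_measure setT (EFin \o phi)).
Qed.

(** * Convergence of the rescaled two-sided law to the Levy measure *)

Section VagueLimit.
Context {R : realType} {d} {T : measurableType d} (mu : probability T R).
Variables (V : T -> R) (beta cp cm : R) (K : nat -> R).
Hypothesis mV : measurable_fun setT V.
Hypothesis beta0 : 0 < beta.
Hypothesis cp0 : 0 <= cp.
Hypothesis cm0 : 0 <= cm.
Hypothesis right_tail : l `^ beta * fine (mu [set x | l <= V x]) @[l --> +oo] --> cp.
Hypothesis left_tail : l `^ beta * fine (mu [set x | V x <= - l]) @[l --> +oo] --> cm.
Hypothesis K0 : forall N, 0 < K N.
Hypothesis Koo : K N @[N --> \oo] --> +oo.
Variables (phi : R -> R) (C q r : R).
Hypothesis mphi : measurable_fun setT phi.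
Hypothesis phi0 : phi 0 = 0.
Hypothesis qr : 0 <= r /\ r < beta < q.
Hypothesis C0 : 0 <= C.
Hypothesis phi_small : forall x, x != 0 -> `|phi x| <= C * `|x| `^ q.
Hypothesis phi_large : forall x, x != 0 -> `|phi x| <= C * `|x| `^ r.
Hypothesis phi_cont : forall x, x != 0 -> `|x| != 1 -> {for x, continuous phi}.

Let pos_part (g : R -> R) (x : R) := if 0 < x then g x else 0.

Let m_pos (g : R -> R) : measurable_fun setT g -> measurable_fun setT (pos_part g).
Proof.
move=> mg; apply: measurable_fun_ifT => //.
by apply: measurable_fun_ltr => //; exact: measurable_id.
Qed.

Let cont_pos (g : R -> R) x : 0 < x -> {for x, continuous g} -> {for x, continuous (pos_part g)}.
Proof.
move=> x0 cg; have px : pos_part g x = g x by rewrite /pos_part x0.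
suff : pos_part g @ x --> pos_part g x by [].
rewrite px; apply: cvg_trans cg.
apply: near_eq_cvg; near=> y; rewrite /pos_part ifT//; near: y; exact: lt_nbhsr.
Unshelve. all: by end_near. Qed.

Let neg (x : R) := phi (- x).
Let mneg : measurable_fun setT neg.
Proof. exact: (measurableT_comp mphi (@oppr_measurable R setT)). Qed.

Let left_tail' : l `^ beta * fine (mu [set x | l <= - V x]) @[l --> +oo] --> cm.
Proof.
rewrite (_ : (fun l => _) = fun l : R => l `^ beta * fine (mu [set x | V x <= - l]))//.
by apply/funext => l; congr (_ * fine (mu _)); apply/seteqP; split => x /=; rewrite lerNr.
Qed.

Let mNV : measurable_fun setT (fun x => - V x).
Proof. exact: (measurableT_comp (@oppr_measurable R setT) mV). Qed.

Let Ppos x : x <= 0 -> pos_part phi x = 0.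
Proof. by rewrite /pos_part ltNge => ->. Qed.
Let Pneg x : x <= 0 -> pos_part neg x = 0.
Proof. by rewrite /pos_part ltNge => ->. Qed.

Let small_pos x : 0 < x -> `|pos_part phi x| <= C * x `^ q.
Proof. by move=> x0; rewrite /pos_part x0 -{2}(gtr0_norm x0) phi_small// gt_eqF. Qed.
Let large_pos x : 0 < x -> `|pos_part phi x| <= C * x `^ r.
Proof. by move=> x0; rewrite /pos_part x0 -{2}(gtr0_norm x0) phi_large// gt_eqF. Qed.
Let small_neg x : 0 < x -> `|pos_part neg x| <= C * x `^ q.
Proof. move=> x0; rewrite /pos_part x0 /neg; have := @phi_small (- x).
by rewrite oppr_eq0 gt_eqF// normrN (gtr0_norm x0); exact. Qed.
Let large_neg x : 0 < x -> `|pos_part neg x| <= C * x `^ r.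
Proof. move=> x0; rewrite /pos_part x0 /neg; have := @phi_large (- x).
by rewrite oppr_eq0 gt_eqF// normrN (gtr0_norm x0); exact. Qed.

Let c_pos x : 0 < x -> x != 1 -> {for x, continuous (pos_part phi)}.
Proof. by move=> x0 x1; apply: cont_pos => //; apply: phi_cont; [rewrite gt_eqF|rewrite gtr0_norm].
  Qed.
Let c_neg x : 0 < x -> x != 1 -> {for x, continuous (pos_part neg)}.
Proof.
move=> x0 x1; apply: cont_pos => //; apply: (@continuous_comp _ _ _ -%R phi x); first exact:
  opp_continuous.
by apply: phi_cont; [rewrite oppr_eq0 gt_eqF|rewrite normrN gtr0_norm].
Qed.

Let phiE x : phi x = pos_part phi x + pos_part neg (- x).
Proof.
rewrite /pos_part /neg opprK oppr_gt0.
by case: ltgtP => [x0|x0|<-]; rewrite ?addr0 ?add0r// phi0 addr0.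
Qed.

Let s N := K N `^ beta^-1.

Let ip N := stable_limit_integrable mV beta0 cp0 right_tail K0 (m_pos mphi) Ppos qr C0 small_pos
  large_pos N.
Let im N := stable_limit_integrable mNV beta0 cm0 left_tail' K0 (m_pos mneg) Pneg qr C0 small_neg
  large_neg N.
Let lp := stable_limit mV beta0 cp0 right_tail K0 Koo (m_pos mphi) Ppos qr C0 small_pos large_pos
  c_pos.
Let lm := stable_limit mNV beta0 cm0 left_tail' K0 Koo (m_pos mneg) Pneg qr C0 small_neg large_neg
  c_neg.

Lemma vague_integrable N : mu.-integrable setT (fun x => (phi (V x / s N))%:E).
Proof.
rewrite (_ : (fun x => _) = (fun x => (pos_part phi (V x / s N))%:E + (pos_part neg (- V x / s
  N))%:E)%E).
  by apply: (integrableD measurableT); [exact: ip|exact: im].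
by apply/funext => x; rewrite -EFinD [in LHS]phiE mulNr.
Qed.

Let np := tail_transport beta0 cp0 (levy_measure_right beta0 cp0 cm0) (m_pos mphi) Ppos lp.1.
Let nm := tail_transport beta0 cm0 (levy_measure_oppE beta0 cp0 cm0) (m_pos mneg) Pneg lm.1.

Let nm' : (levy_measure beta0 cp0 cm0).-integrable setT (fun x => (pos_part neg (- x))%:E) /\
  (\int[levy_measure beta0 cp0 cm0]_x (pos_part neg (- x))%:E =
   \int[lebesgue_measure]_u (pos_part neg (stable_quantile beta cm u))%:E)%E.
Proof.
have mopp : measurable_fun setT (-%R : measurableTypeR R -> measurableTypeR R) by exact:
  oppr_measurable.
have mE : measurable_fun setT (EFin \o pos_part neg) by apply/measurable_EFinP; exact: m_pos.
have i1 : (levy_measure beta0 cp0 cm0).-integrable setT (fun x => (pos_part neg (- x))%:E).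
  apply/integrableP; split; first exact: (measurableT_comp mE mopp).
  have /integrableP[_] := nm.1.
  by rewrite /levy_measure_opp ge0_integral_image//; exact: measurableT_comp.
split => //; rewrite -nm.2.
exact: esym (@integral_pushforward _ _ _ _ _ _ mopp (levy_measure beta0 cp0 cm0) setT (EFin \o
  pos_part neg) mE i1 measurableT).
Qed.

Lemma levy_integrable : (levy_measure beta0 cp0 cm0).-integrable setT (EFin \o phi).
Proof.
rewrite (_ : EFin \o phi = (fun x => (pos_part phi x)%:E + (pos_part neg (- x))%:E)%E).
  by apply: (integrableD measurableT); [exact: np.1|exact: nm'.1].
by apply/funext => x /=; rewrite -EFinD [in LHS]phiE.
Qed.

(** The function is split along the two half-lines, on which [V] and [- V] have one-sided regular
    tails. *)
Theorem vague_limit : K N * Ex mu (fun x => phi (V x / s N)) @[N --> \oo] -->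
  fine (\int[levy_measure beta0 cp0 cm0]_x (phi x)%:E)%E.
Proof.
have E1 N : K N * Ex mu (fun x => phi (V x / s N)) =
    K N * Ex mu (fun x => pos_part phi (V x / s N)) + K N * Ex mu (fun x => pos_part neg (- V x / s
      N)).
  rewrite -mulrDr /Ex -RintegralD//; [|exact: ip|exact: im].
  by congr (_ * _); apply: eq_Rintegral => x _; rewrite [in LHS]phiE mulNr.
under eq_fun do rewrite E1.
have -> : fine (\int[levy_measure beta0 cp0 cm0]_x (phi x)%:E)%E =
    (\int[lebesgue_measure]_u pos_part phi (stable_quantile beta cp u))%R +
    (\int[lebesgue_measure]_u pos_part neg (stable_quantile beta cm u))%R.
  rewrite /Rintegral -np.2 -nm'.2 -fineD; [|exact: integrable_fin_num np.1|exact: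
    integrable_fin_num nm'.1].
  rewrite -integralD//; [|exact: np.1|exact: nm'.1].
  by congr fine; apply: eq_integral => x _; rewrite -EFinD [in LHS]phiE.
exact: cvgD lp.2 lm.2.
Qed.

End VagueLimit.

(** * Smoothing of level sets *)

Section Smoothing.
Context {R : realType} {d} {E : measurableType d}.
Variables (P : R.-pker E ~> E) (mu : probability E R) (Q : R.-ker E ~> E) (p : E -> E -> R).
Hypothesis mp : measurable_fun setT (fun z : E * E => p z.1 z.2).
Hypothesis p0 : forall x y, 0 <= p x y.
Hypothesis PE : forall x A, measurable A -> P x A = (ac_part mu p x A + Q x A)%E.
Hypothesis p_sqr : (ereal_sup [set \int[mu]_x ((p x y) ^+ 2)%:E | y in setT] < +oo)%E.
Hypothesis mu_invariant : invariant_law P mu.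

Let p_sqr_bound : exists2 M : R, 0 <= M &
  forall y, (\int[mu]_x ((p x y) ^+ 2)%:E <= M%:E)%E.
Proof.
have ge0 y : (0 <= \int[mu]_x ((p x y) ^+ 2)%:E)%E.
  by apply: integral_ge0 => x _; rewrite lee_fin sqr_ge0.
case ES : (ereal_sup _) p_sqr => [M| |] // _.
  exists (Num.max M 0); first by rewrite le_max lexx orbT.
  move=> y; apply: (@le_trans _ _ M%:E); last by rewrite lee_fin le_max lexx.
  by rewrite -ES; apply: ereal_sup_ubound; exists y.
exists 0 => // y; apply: (@le_trans _ _ -oo%E); last exact: leNye.
by rewrite -ES; apply: ereal_sup_ubound; exists y.
Qed.

Let mpy y : measurable_fun setT (p ^~ y).
Proof. exact: (measurableT_comp mp (pair2_measurable y)). Qed.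

Let ac_le x A (c : R) : measurable A -> 0 <= c -> (Q x A <= c%:E * ac_part mu p x A)%E ->
  (P x A <= (1 + c)%:E * ac_part mu p x A)%E.
Proof.
move=> mA c0 QA; have a0 : (0 <= ac_part mu p x A)%E by apply: integral_ge0 => y _; rewrite lee_fin.
by rewrite PE// EFinD ge0_muleDl ?lee_fin// mul1e leeD2l.
Qed.

(** Let [u = P 1_A]. Bounding one factor of [u^2] by the absolutely continuous part and exchanging
    the integrals leaves the integral over [y] in [A] of that of [u(x) p(x, y)] in [x]. The latter
    is at most a multiple of the norm [N] of [u], uniformly in [y], whence [N^2] is at most a
    constant times [N mu(A)]. *)
Lemma smoothing (A : set E) (M c : R) : measurable A -> 0 <= M -> 0 <= c ->
  (forall y, (\int[mu]_x ((p x y) ^+ 2)%:E <= M%:E)%E) ->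
  (forall x, (Q x A <= c%:E * ac_part mu p x A)%E) ->
  n2 mu (transition_op P \1_A) <= (1 + c) * ((1 + M) / 2) * fine (mu A).
Proof.
move=> mA M0 c0 pM QA; set u := transition_op P \1_A.
have bu : bm u by apply: bm_top; exact: bm_indic.
have uE x : (u x)%:E = P x A.
  rewrite /u top_indic//; apply: fineK; rewrite ge0_fin_numE//.
  by apply: (le_lt_trans (probability_le1 (kprob P x) mA)); exact: ltry.
have u0 x : 0 <= u x by rewrite -lee_fin uE.
set N := n2 mu u; have := n2_ge0 mu u; rewrite -/N le_eqVlt => /predU1P[<-|N0].
  by rewrite !mulr_ge0 ?addr_ge0// fine_ge0.
suff : N ^+ 2 <= (1 + c) * ((1 + M) / 2) * fine (mu A) * N by rewrite expr2 ler_pM2r.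
have mxy : measurable_fun setT (fun z : E * E => (u z.1 * p z.1 z.2 * \1_A z.2)%:E).
  apply/measurable_EFinP; apply: measurable_funM.
    apply: measurable_funM => //; apply: (measurableT_comp (bm_meas bu)); exact: measurable_fst.
  by apply: (measurableT_comp (measurable_indic mA)); exact: measurable_snd.
have fxy0 z : (0 <= (u z.1 * p z.1 z.2 * \1_A z.2)%:E)%E by rewrite lee_fin !mulr_ge0.
have mF : measurable_fun setT (fun x => \int[mu]_y (u x * p x y * \1_A y)%:E)%E.
  exact: (@measurable_fun_fubini_tonelli_F _ _ E E R mu _ mxy fxy0).
have mG : measurable_fun setT (fun y => \int[mu]_x (u x * p x y * \1_A y)%:E)%E.
  exact: (@measurable_fun_fubini_tonelli_G _ _ E E R mu _ mxy fxy0).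
(* Young's inequality [u p <= u^2 / (2 N) + N p^2 / 2] replaces Cauchy-Schwarz, which [Ex_CS] offers
   only for bounded functions. *)
have inner y : (\int[mu]_x (u x * p x y * \1_A y)%:E <= (N * ((1 + M) / 2) * \1_A y)%:E)%E.
  apply: (@le_trans _ _ (\int[mu]_x ((\1_A y / 2 * (N^-1 * u x ^+ 2))%:E + (\1_A y / 2 * N)%:E *
    ((p x y) ^+ 2)%:E))%E).
    apply: ge0_le_integral => //.
    - by move=> x _; rewrite lee_fin !mulr_ge0.
    - by apply/measurable_EFinP; do 2 apply: measurable_funM => //; exact: bm_meas bu.
    - apply: emeasurable_funD; apply/measurable_EFinP.
        by do 2 (apply: measurable_funM => //); apply: measurable_funX; exact: bm_meas bu.
      by apply: measurable_funM => //; apply: measurable_funX.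
    - move=> x _; rewrite -EFinM -EFinD lee_fin.
      have : 0 <= (\1_A y : R) by [].
      rewrite -subr_ge0; move: (\1_A y) => i i0.
      have -> : i / 2 * (N^-1 * u x ^+ 2) + i / 2 * N * p x y ^+ 2 - u x * p x y * i =
        i / 2 * N * (u x / N - p x y) ^+ 2 by field; rewrite gt_eqF.
      by rewrite mulr_ge0 ?sqr_ge0// mulr_ge0 ?(ltW N0)// divr_ge0.
  rewrite ge0_integralD//; last first.
  - by apply/measurable_EFinP; apply: measurable_funM => //; apply: measurable_funX.
  - by move=> x _; rewrite lee_fin mulr_ge0 ?sqr_ge0// mulr_ge0 ?divr_ge0// ltW.
  - by apply/measurable_EFinP; do 2 (apply: measurable_funM => //); apply: measurable_funX; exact:
    bm_meas bu.
  - by move=> x _; rewrite lee_fin !mulr_ge0 ?sqr_ge0 ?invr_ge0 ?(ltW N0).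
  have b2 : bm (fun x => u x ^+ 2) by exact: bm_sqr.
  rewrite ge0_integralZl_EFin//; last first.
  - by rewrite mulr_ge0 ?divr_ge0// ltW.
  - by apply/measurable_EFinP; apply: measurable_funX.
  - by move=> x _; rewrite lee_fin sqr_ge0.
  rewrite (ExE mu (f := fun x => \1_A y / 2 * (N^-1 * u x ^+ 2))); last by do 2 apply: bmZ.
  rewrite ExZ; last exact: bmZ.
  rewrite ExZ// -n2_sqr -/N.
  apply: (@le_trans _ _ ((\1_A y / 2 * (N^-1 * N ^+ 2))%:E + (\1_A y / 2 * N)%:E * M%:E)%E).
    by rewrite leeD2l// lee_wpmul2l ?pM// lee_fin mulr_ge0 ?divr_ge0// ltW.
  rewrite -EFinM -EFinD lee_fin.
  have -> : N^-1 * N ^+ 2 = N by rewrite expr2 mulrA mulVf ?mul1r// gt_eqF.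
  by rewrite le_eqVlt; apply/orP; left; apply/eqP; field.
rewrite -lee_fin; apply: (@le_trans _ _ ((1 + c)%:E * \int[mu]_x \int[mu]_y (u x * p x y * \1_A
  y)%:E)%E).
  have F0 x : setT x -> (0 <= \int[mu]_y (u x * p x y * \1_A y)%:E)%E.
    by move=> _; apply: integral_ge0 => y _; rewrite lee_fin !mulr_ge0.
  have c10 : 0 <= 1 + c by rewrite addr_ge0.
  rewrite /N n2_sqr -(ExE mu (bm_sqr bu)) -(@ge0_integralZl_EFin _ _ _ mu setT measurableT _ F0 mF
    _ c10).
  apply: ge0_le_integral => //.
  - by move=> x _; rewrite lee_fin sqr_ge0.
  - by apply/measurable_EFinP; apply: measurable_funX; exact: bm_meas bu.
  - apply: measurable_funeM.
    exact: mF.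
  - move=> x _; have -> : (\int[mu]_y (u x * p x y * \1_A y)%:E = (u x)%:E * ac_part mu p x A)%E.
      rewrite /ac_part -ge0_integralZl_EFin//.
      + rewrite [RHS]integral_mkcond; apply: eq_integral => y _; rewrite patchE indicE; case: (_
        \in _).
          by rewrite mulr1 EFinM.
        by rewrite mulr0.
      + by move=> y _; rewrite lee_fin.
      + apply: measurable_funTS; apply/measurable_EFinP.
        exact: (measurableT_comp mp (pair1_measurable x)).
    rewrite muleCA expr2 EFinM; apply: lee_pmul => //; rewrite ?lee_fin//.
    by rewrite uE; apply: ac_le.
rewrite (@fubini_tonelli _ _ E E R mu mu _ mxy fxy0)/=.
apply: (@le_trans _ _ ((1 + c)%:E * \int[mu]_y (N * ((1 + M) / 2) * \1_A y)%:E)%E).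
  rewrite lee_wpmul2l ?lee_fin ?addr_ge0//; apply: ge0_le_integral => //.
  - by move=> y _; apply: integral_ge0 => x _; rewrite lee_fin !mulr_ge0.
  - by apply/measurable_EFinP; apply: measurable_funM.
rewrite (ExE mu (f := fun y => N * ((1 + M) / 2) * \1_A y)); last by apply: bmZ; exact: bm_indic.
rewrite ExZ ?Ex_indic//; last exact: bm_indic.
by rewrite -EFinM lee_fin le_eqVlt; apply/orP; left; apply/eqP; ring.
Qed.

Lemma level_smoothing (g : E -> R) : measurable_fun setT g -> level_dominated mu Q p g ->
  exists2 C : R, 0 <= C & forall l, 0 <= l ->
    n2 mu (transition_op P \1_[set y | l <= g y]) <= C * fine (mu [set y | l <= g y]).
Proof.
move=> mg [c hc]; have [M M0 hM] := p_sqr_bound.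
have c0 : 0 <= Num.max c 0 by rewrite le_max lexx orbT.
exists ((1 + Num.max c 0) * ((1 + M) / 2)); first by rewrite mulr_ge0 ?divr_ge0 ?addr_ge0.
move=> l l0; apply: smoothing => //; first exact: measurable_ge.
move=> x; apply: le_trans (hc l x l0) _; apply: lee_wpmul2r.
  by apply: integral_ge0 => y _; rewrite lee_fin.
by rewrite lee_fin le_max lexx.
Qed.

End Smoothing.

(** * The Levy exponent *)

Section Exponent.
Context {R : realType}.
Variables (beta c p : R) (rho : R -> R).
Hypothesis beta0 : 0 < beta.
Hypothesis beta2 : beta < 2.
Hypothesis betap : beta < p.
Hypothesis c0 : 0 <= c.
Hypothesis rhoE : forall l, rho l = c * `|l| `^ p.

(** What [e_fun] subtracts, without its factor [xi1]. Keeping the three regimes in one function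
    postpones the distinction of cases on [beta] to the very end. *)
Definition compensator (x : R) : R :=
  if beta < 1 then 0 else if beta == 1 then x * \1_`[(-1 : R), 1] x else x.

Lemma e_funE xi1 xi2 l1 l2 : e_fun beta xi1 xi2 l1 l2 =
  Complex (cos (l1 * xi1 + l2 * xi2) - 1) (sin (l1 * xi1 + l2 * xi2) - xi1 * compensator l1).
Proof.
rewrite /e_fun cexpE expR0 !mul1r /compensator.
case: ifP => _; first by apply/eqP; rewrite eq_complex/= !subr0 mulr0 subr0 !eqxx.
case: ifP => _; apply/eqP; rewrite eq_complex/= !subr0 ?mulrA eqxx//=.
by rewrite (mulrC l1).
Qed.

Lemma measurable_compensator : measurable_fun setT compensator.
Proof.
rewrite /compensator; case: (beta < 1); first exact: measurable_cst.
case: (beta == 1); last exact: measurable_id.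
by apply: measurable_funM; [exact: measurable_id|apply: measurable_indic; exact: measurable_itv].
Qed.

Lemma measurable_rho : measurable_fun setT rho.
Proof.
rewrite (_ : rho = fun l => c * `|l| `^ p); last by apply/funext => l; rewrite rhoE.
apply: measurable_funM; first exact: measurable_cst.
exact: (measurableT_comp (measurable_powR p) (@normr_measurable R setT)).
Qed.

Lemma continuous_normr_powR (x : R) : x != 0 -> {for x, continuous rho}.
Proof.
move=> x0; rewrite (_ : rho = fun l => c * `|l| `^ p); last by apply/funext => l; rewrite rhoE.
apply: (@continuous_comp _ _ _ (fun l : R => `|l|) (fun y : R => c * y `^ p) x).
  exact: norm_continuous.
by apply: continuous_cpowR_gt0; rewrite normr_gt0.
Qed.

Lemma continuous_compensator (x : R) : `|x| != 1 -> {for x, continuous compensator}.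
Proof.
move=> x1; rewrite /compensator; case: (beta < 1); first exact: cvg_cst.
case: (beta == 1); last exact: cvg_id.
have [xl|xg] := ltP `|x| 1.
  suff : (fun y : R => y * \1_`[(-1 : R), 1] y) y @[y --> x] --> x * \1_`[(-1 : R), 1] x by [].
  rewrite (_ : \1_`[(-1 : R), 1] x = 1); last first.
    by rewrite indicE mem_set//= in_itv/= -ler_norml ltW.
  rewrite mulr1; apply: (@cvg_trans _ ((fun y : R => y) @ x)); last exact: cvg_id.
  apply: near_eq_cvg; near=> y.
  rewrite indicE mem_set ?mulr1//= in_itv/= -ler_norml ltW//.
  near: y; apply: (cvgr_lt `|x|) => //; exact: (@norm_continuous _ _ x).
have xg' : 1 < `|x| by rewrite lt_neqAle eq_sym x1.
suff : (fun y : R => y * \1_`[(-1 : R), 1] y) y @[y --> x] --> x * \1_`[(-1 : R), 1] x by [].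
have off y : 1 < `|y| -> \1_`[(-1 : R), 1] y = 0 :> R.
  by move=> h; rewrite indicE memNset//= in_itv/= -ler_norml; apply/negP; rewrite -ltNge.
rewrite off// mulr0; have : (fun y : R => (0 : R)) y @[y --> x] --> (0 : R) by apply: cvg_cst.
apply: cvg_trans; apply: near_eq_cvg; near=> y.
rewrite off ?mulr0//; near: y; apply: (cvgr_gt `|x|) => //; exact: (@norm_continuous _ _ x).
Unshelve. all: by end_near. Qed.

Variables (xi1 xi2 : R).
Let th (x : R) := x * xi1 + rho x * xi2.
Definition exponent_Re (x : R) := cos (th x) - 1.
Definition exponent_Im (x : R) := sin (th x) - xi1 * compensator x.

Let mth : measurable_fun setT th.
Proof.
apply: measurable_funD; apply: measurable_funM; try exact: measurable_cst.
  exact: measurable_id.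
exact: measurable_rho.
Qed.

Lemma measurable_exponent_Re : measurable_fun setT exponent_Re.
Proof.
apply: measurable_funB; last exact: measurable_cst.
exact: bm_meas (bm_cos mth).
Qed.

Lemma measurable_exponent_Im : measurable_fun setT exponent_Im.
Proof.
apply: measurable_funB; first exact: bm_meas (bm_sin mth).
by apply: measurable_funM; [exact: measurable_cst|exact: measurable_compensator].
Qed.

Let cth (x : R) : x != 0 -> {for x, continuous th}.
Proof.
move=> x0; apply: cvgD; apply: cvgM; try exact: cvg_cst; first exact: cvg_id.
exact: continuous_normr_powR.
Qed.

Lemma continuous_exponent_Re (x : R) : x != 0 -> {for x, continuous exponent_Re}.
Proof.
move=> x0; apply: cvgB; last exact: cvg_cst.
by apply: (@continuous_comp _ _ _ th cos x); [exact: cth|exact: continuous_cos].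
Qed.

Lemma continuous_exponent_Im (x : R) : x != 0 -> `|x| != 1 -> {for x, continuous exponent_Im}.
Proof.
move=> x0 x1; apply: cvgB; last by apply: cvgM; [exact: cvg_cst|exact: continuous_compensator].
by apply: (@continuous_comp _ _ _ th sin x); [exact: cth|exact: continuous_sin].
Qed.

(** The orders of the integrand at 0 and at infinity. At 0 the first coordinate contributes order 1
    without compensation and order 2 with it, and [rho] contributes order [p]. At infinity the
    linear compensator of the case [beta > 1] has order 1; otherwise the integrand is bounded. *)
Definition small_exp := Num.min (if beta < 1 then 1 else 2) p.
Definition large_exp : R := if 1 < beta then 1 else 0.

Lemma exp_order : 0 <= large_exp /\ large_exp < beta < small_exp.
Proof.
rewrite /large_exp /small_exp; split; first by case: ifP.
apply/andP; split; first by case: ifP => //; rewrite ltr01.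
by rewrite lt_min betap andbT; case: ifP => // /negbT; lra.
Qed.

Definition exponent_bound := 2 + 2 * `|xi1| + 2 * xi1 ^+ 2 + (`|xi2| * c) + 2 * (xi2 ^+ 2 * c ^+ 2).

Let powle (x a b : R) : `|x| <= 1 -> 0 < a -> a <= b -> `|x| `^ b <= `|x| `^ a.
Proof.
move=> x1 a0 ab; have [->|x0] := eqVneq x 0.
  by rewrite normr0 !powR0 ?gt_eqF// (lt_le_trans a0).
by apply: ger_powR => //; rewrite normr_gt0 x0.
Qed.

Let s0 : 0 < small_exp.
Proof. by have [_ /andP[_]] := exp_order; apply: lt_trans. Qed.

Let rho_small x : `|x| <= 1 -> 0 <= rho x <= c * `|x| `^ small_exp.
Proof.
move=> x1; rewrite rhoE mulr_ge0 ?powR_ge0//= ler_wpM2l// powle//.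
by rewrite ge_min lexx orbT.
Qed.

Let sqr_small x : `|x| <= 1 -> x ^+ 2 <= `|x| `^ small_exp.
Proof.
move=> x1; rewrite -[x ^+ 2]ger0_norm ?sqr_ge0// normrX -powR_mulrn//.
apply: powle => //; rewrite ge_min; apply/orP; left; case: ifP => //; lra.
Qed.

Let pow_le1 (x : R) : `|x| <= 1 -> 0 <= `|x| `^ small_exp <= 1.
Proof.
move=> x1; rewrite powR_ge0/=.
by have := ge0_ler_powR (ltW s0) (normr_ge0 x) ler01 x1; rewrite powR1.
Qed.

Let th_sqr (x y z : R) : 0 <= z <= c * y -> 0 <= y <= 1 -> x ^+ 2 <= y ->
  (x * xi1 + z * xi2) ^+ 2 <= (2 * xi1 ^+ 2 + 2 * (xi2 ^+ 2 * c ^+ 2)) * y.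
Proof.
move=> /andP[z0 zy] /andP[y0 y1] xy.
have h1 : (x * xi1 + z * xi2) ^+ 2 <= 2 * (x ^+ 2 * xi1 ^+ 2) + 2 * (z ^+ 2 * xi2 ^+ 2).
  by rewrite -subr_ge0 (_ : _ - _ = (x * xi1 - z * xi2) ^+ 2) ?sqr_ge0//; ring.
have h2 : z ^+ 2 <= c ^+ 2 * y.
  apply: (@le_trans _ _ ((c * y) ^+ 2)); first by rewrite !expr2 ler_pM.
  by rewrite exprMn ler_wpM2l ?sqr_ge0// expr2 ler_piMl.
have h3 : x ^+ 2 * xi1 ^+ 2 <= y * xi1 ^+ 2 by rewrite ler_wpM2r ?sqr_ge0.
have h4 : z ^+ 2 * xi2 ^+ 2 <= c ^+ 2 * y * xi2 ^+ 2 by rewrite ler_wpM2r ?sqr_ge0.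
apply: (le_trans h1).
have -> : (2 * xi1 ^+ 2 + 2 * (xi2 ^+ 2 * c ^+ 2)) * y =
  2 * (y * xi1 ^+ 2) + 2 * (c ^+ 2 * y * xi2 ^+ 2) by ring.
lra.
Qed.

Let xi_ge0 : [/\ 0 <= `|xi1|, 0 <= xi1 ^+ 2, 0 <= `|xi2| * c & 0 <= xi2 ^+ 2 * c ^+ 2].
Proof. by split; rewrite ?sqr_ge0// mulr_ge0 ?sqr_ge0. Qed.

Lemma exponent_bound_ge0 : 0 <= exponent_bound.
Proof. by rewrite /exponent_bound; case: xi_ge0; lra. Qed.

Let mul_bound (k y : R) : 0 <= y -> k <= exponent_bound -> k * y <= exponent_bound * y.
Proof. by move=> y0 kb; rewrite ler_wpM2r. Qed.

Lemma small_Re x : `|x| <= 1 -> `|exponent_Re x| <= exponent_bound * `|x| `^ small_exp.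
Proof.
move=> x1; apply: (le_trans (cosB1_le _)).
apply: (le_trans (th_sqr (rho_small x1) (pow_le1 x1) (sqr_small x1))).
by apply: mul_bound; rewrite ?powR_ge0// /exponent_bound; case: xi_ge0; lra.
Qed.

Lemma small_Im x : `|x| <= 1 -> `|exponent_Im x| <= exponent_bound * `|x| `^ small_exp.
Proof.
move=> x1; rewrite /exponent_Im /compensator; set y := `|x| `^ small_exp.
have y0 : 0 <= y by exact: powR_ge0.
have /andP[r0 ry] := rho_small x1; rewrite -/y in ry.
have r2 : `|rho x * xi2| <= `|xi2| * c * y.
  by rewrite normrM (ger0_norm r0) mulrC -mulrA ler_wpM2l.
case: ifP => b1.
  rewrite mulr0 subr0; apply: (le_trans (abs_sin_le _)); rewrite /th.
  apply: (le_trans (ler_normD _ _)); rewrite normrM.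
  have xy : `|x| <= y.
    rewrite -[leLHS]powRr1//; apply: powle => //; by rewrite /small_exp b1 ge_min lexx.
  have h : `|x| * `|xi1| <= `|xi1| * y by rewrite mulrC ler_wpM2l.
  apply: (@le_trans _ _ ((`|xi1| + `|xi2| * c) * y)); first by rewrite mulrDl; lra.
  by apply: mul_bound => //; rewrite /exponent_bound; case: xi_ge0; lra.
have cE : (if beta == 1 then x * \1_`[(-1 : R), 1] x else x) = x.
  by case: ifP => // _; rewrite indicE mem_set ?mulr1//= in_itv/= -ler_norml.
rewrite cE (_ : sin (th x) - xi1 * x = (sin (th x) - th x) + rho x * xi2); last by rewrite /th;
  ring.
apply: (le_trans (ler_normD _ _)).
have h := le_trans (sinB_le _) (th_sqr (rho_small x1) (pow_le1 x1) (sqr_small x1)).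
apply: (le_trans (lerD h r2)); rewrite -/y -mulrDl.
by apply: mul_bound => //; rewrite /exponent_bound; case: xi_ge0; lra.
Qed.

Lemma large_Re x : 1 <= `|x| -> `|exponent_Re x| <= exponent_bound * `|x| `^ large_exp.
Proof.
move=> x1; apply: (@le_trans _ _ 2).
  rewrite /exponent_Re; apply: (le_trans (ler_normB _ _)); rewrite normr1.
  by have := abs_cos_le1 (th x); lra.
have : 1 <= `|x| `^ large_exp.
  rewrite /large_exp; case: ifP => _; last by rewrite powRr0.
  by rewrite powRr1.
have : 2 <= exponent_bound by rewrite /exponent_bound; case: xi_ge0; lra.
move: exponent_bound_ge0 => b0 b2 y1; apply: (le_trans b2); exact: ler_peMr.
Qed.

Lemma large_Im x : 1 <= `|x| -> `|exponent_Im x| <= exponent_bound * `|x| `^ large_exp.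
Proof.
move=> x1; rewrite /exponent_Im; apply: (le_trans (ler_normB _ _)).
have s1 := abs_sin_le1 (th x).
have b1 : 1 + `|xi1| <= exponent_bound by rewrite /exponent_bound; case: xi_ge0; lra.
have b2 : 0 <= `|xi1| by [].
apply: (@le_trans _ _ ((1 + `|xi1|) * `|x| `^ large_exp)); last by rewrite ler_wpM2r ?powR_ge0.
rewrite /compensator /large_exp normrM; case: ltgtP => bb.
- by rewrite normr0 mulr0 powRr0; lra.
- rewrite powRr1// mulrDl; lra.
- rewrite powRr0 mulr1; apply: lerD => //; rewrite normrM indicE.
  case: (boolP (x \in _)) => xI; last by rewrite normr0 !mulr0.
  rewrite normr1 mulr1 ler_piMr//; move: xI; rewrite inE/= in_itv/= -ler_norml//.
Qed.

Let two_sided (phi : R -> R) :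
  (forall x, `|x| <= 1 -> `|phi x| <= exponent_bound * `|x| `^ small_exp) ->
  (forall x, 1 <= `|x| -> `|phi x| <= exponent_bound * `|x| `^ large_exp) ->
  (forall x, x != 0 -> `|phi x| <= exponent_bound * `|x| `^ small_exp) /\
  (forall x, x != 0 -> `|phi x| <= exponent_bound * `|x| `^ large_exp).
Proof.
move=> small large; have [r0 /andP[rb bq]] := exp_order.
have rq : large_exp <= small_exp by exact: ltW (lt_trans rb bq).
split=> x x0; have [x1|/ltW x1] := leP `|x| 1; try by [exact: small|exact: large].
  by apply: le_trans (large _ x1) _; rewrite ler_wpM2l ?exponent_bound_ge0// ler_powR.
by apply: le_trans (small _ x1) _; rewrite ler_wpM2l ?exponent_bound_ge0// ger_powR// normr_gt0 x0.
Qed.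

Lemma exponent_Re_bounds :
  (forall x, x != 0 -> `|exponent_Re x| <= exponent_bound * `|x| `^ small_exp) /\
  (forall x, x != 0 -> `|exponent_Re x| <= exponent_bound * `|x| `^ large_exp).
Proof. exact: two_sided small_Re large_Re. Qed.

Lemma exponent_Im_bounds :
  (forall x, x != 0 -> `|exponent_Im x| <= exponent_bound * `|x| `^ small_exp) /\
  (forall x, x != 0 -> `|exponent_Im x| <= exponent_bound * `|x| `^ large_exp).
Proof. exact: two_sided small_Im large_Im. Qed.

End Exponent.

Section ExponentLimit.
Context {R : realType} {d} {T : measurableType d} (mu : probability T R).
Variables (V : T -> R) (beta cp cm : R) (K : nat -> R) (c p : R) (rho : R -> R).
Hypothesis mV : measurable_fun setT V.
Hypothesis beta0 : 0 < beta.
Hypothesis beta2 : beta < 2.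
Hypothesis cp0 : 0 <= cp.
Hypothesis cm0 : 0 <= cm.
Hypothesis right_tail : l `^ beta * fine (mu [set x | l <= V x]) @[l --> +oo] --> cp.
Hypothesis left_tail : l `^ beta * fine (mu [set x | V x <= - l]) @[l --> +oo] --> cm.
Hypothesis K0 : forall N, 0 < K N.
Hypothesis Koo : K N @[N --> \oo] --> +oo.
Hypothesis betap : beta < p.
Hypothesis c0 : 0 <= c.
Hypothesis rhoE : forall l, rho l = c * `|l| `^ p.

Let s N := K N `^ beta^-1.
Let nu := levy_measure beta0 cp0 cm0.

Section Frequency.
Variables xi1 xi2 : R.

Let eo := exp_order beta0 beta2 betap.
Let bR := exponent_Re_bounds beta0 beta2 betap c0 rhoE xi1 xi2.
Let bI := exponent_Im_bounds beta0 beta2 betap c0 rhoE xi1 xi2.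
Let b0 := exponent_bound_ge0 c0 xi1 xi2.

Let rho0 : rho 0 = 0.
Proof. by rewrite rhoE normr0 powR0 ?mulr0// gt_eqF// (lt_trans beta0). Qed.

Let R0 : exponent_Re rho xi1 xi2 0 = 0.
Proof. by rewrite /exponent_Re rho0 !mul0r addr0 cos0 subrr. Qed.

Let I0 : exponent_Im beta rho xi1 xi2 0 = 0.
Proof.
rewrite /exponent_Im rho0 !mul0r addr0 sin0 /compensator.
by case: ifP => _; [|case: ifP => _]; rewrite ?mul0r mulr0 subr0.
Qed.

Let mR := measurable_exponent_Re rhoE xi1 xi2.
Let mI : measurable_fun setT (exponent_Im beta rho xi1 xi2) := measurable_exponent_Im beta rhoE xi1
  xi2.
Let cR (x : R) : x != 0 -> `|x| != 1 -> {for x, continuous (exponent_Re rho xi1 xi2)}.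
Proof. by move=> x0 _; exact: (continuous_exponent_Re rhoE). Qed.
Let cI (x : R) : x != 0 -> `|x| != 1 -> {for x, continuous (exponent_Im beta rho xi1 xi2)}.
Proof. exact: (continuous_exponent_Im rhoE). Qed.

Let iR : nu.-integrable setT (EFin \o exponent_Re rho xi1 xi2) :=
  levy_integrable mV beta0 cp0 cm0 right_tail left_tail K0 Koo mR R0 eo b0 bR.1 bR.2 cR.
Let iI : nu.-integrable setT (EFin \o exponent_Im beta rho xi1 xi2) :=
  levy_integrable mV beta0 cp0 cm0 right_tail left_tail K0 Koo mI I0 eo b0 bI.1 bI.2 cI.

Lemma levy_exponentE : levy_exponent beta cp cm rho xi1 xi2 =
  Complex (fine (\int[nu]_x (exponent_Re rho xi1 xi2 x)%:E)%E)
          (fine (\int[nu]_x (exponent_Im beta rho xi1 xi2 x)%:E)%E).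
Proof.
have mg : measurable_fun setT ((fun l => (l, rho l)) : measurableTypeR R -> (R * R)%type).
  by apply/measurable_fun_pair; [exact: measurable_id|exact: measurable_rho rhoE].
have mth : measurable_fun setT (fun l : R * R => l.1 * xi1 + l.2 * xi2).
  by apply: measurable_funD; apply: measurable_funM => //; exact: measurable_cst.
rewrite /levy_exponent /cintegral; congr Complex.
  rewrite (_ : (fun l => (complex.Re (e_fun beta xi1 xi2 l.1 l.2))%:E) =
    (fun l => (cos (l.1 * xi1 + l.2 * xi2) - 1)%:E)); last by apply/funext => l; rewrite e_funE.
  have mcos : measurable_fun setT (fun l : R * R => (cos (l.1 * xi1 + l.2 * xi2) - 1)%:E).
    by apply/measurable_EFinP; apply: measurable_funB => //; exact: bm_meas (bm_cos mth).
  congr fine; exact: (@integral_pushforward _ _ _ _ R _ mg nu setT _ mcos iR measurableT).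
rewrite (_ : (fun l => (complex.Im (e_fun beta xi1 xi2 l.1 l.2))%:E) =
  (fun l => (sin (l.1 * xi1 + l.2 * xi2) - xi1 * compensator beta l.1)%:E)); last by apply/funext
    => l; rewrite e_funE.
have msin : measurable_fun setT (fun l : R * R => (sin (l.1 * xi1 + l.2 * xi2) - xi1 * compensator
  beta l.1)%:E).
  apply/measurable_EFinP; apply: measurable_funB; first exact: bm_meas (bm_sin mth).
  apply: measurable_funM => //; exact: (measurableT_comp (measurable_compensator beta)
    measurable_fst).
congr fine; exact: (@integral_pushforward _ _ _ _ R _ mg nu setT _ msin iI measurableT).
Qed.

Lemma limit_Re : K N * Ex mu (fun x => exponent_Re rho xi1 xi2 (V x / s N)) @[N --> \oo] -->
  complex.Re (levy_exponent beta cp cm rho xi1 xi2).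
Proof.
rewrite levy_exponentE/=.
exact: (vague_limit mV right_tail left_tail K0 Koo mR R0 eo b0 bR.1 bR.2 cR).
Qed.

Lemma limit_Im : K N * Ex mu (fun x => exponent_Im beta rho xi1 xi2 (V x / s N)) @[N --> \oo] -->
  complex.Im (levy_exponent beta cp cm rho xi1 xi2).
Proof.
rewrite levy_exponentE/=.
exact: (vague_limit mV right_tail left_tail K0 Koo mI I0 eo b0 bI.1 bI.2 cI).
Qed.

Lemma integrable_exponent_Im N :
  mu.-integrable setT (fun x => (exponent_Im beta rho xi1 xi2 (V x / s N))%:E).
Proof.
exact: (vague_integrable mV beta0 cp0 cm0 right_tail left_tail K0 mI I0 eo b0 bI.1 bI.2 N).
Qed.

End Frequency.

Let mVs N : measurable_fun setT (fun x => V x / s N).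
Proof. by apply: measurable_funM => //; exact: measurable_cst. Qed.

(** Read off at the frequency [(1, 0)], where the compensator is the bounded function [sin] minus
    [exponent_Im]. *)
Lemma integrable_compensator N : mu.-integrable setT (fun x => (compensator beta (V x / s N))%:E).
Proof.
have i1 := @integrable_exponent_Im 1 0 N.
have i2 := bm_integrable mu (bm_sin (mVs N)).
rewrite (_ : (fun x => _) = ((EFin \o (fun x => sin (V x / s N))) \-
    (fun x => (exponent_Im beta rho 1 0 (V x / s N))%:E))%E).
  exact: integrableB.
by apply/funext => x /=; rewrite -EFinB /exponent_Im mulr1 mulr0 addr0 mul1r subKr.
Qed.

Lemma limit_Im_drift xi1 xi2 :
  K N * Ex mu (fun x => sin (V x / s N * xi1 + rho (V x / s N) * xi2)) -
    xi1 * (K N * Ex mu (fun x => compensator beta (V x / s N))) @[N --> \oo] -->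
  complex.Im (levy_exponent beta cp cm rho xi1 xi2).
Proof.
have := @limit_Im xi1 xi2; apply: cvg_trans; apply: near_eq_cvg; apply: nearW => N.
have mth : measurable_fun setT (fun x => V x / s N * xi1 + rho (V x / s N) * xi2).
  apply: measurable_funD; apply: measurable_funM; try exact: measurable_cst; first exact: mVs.
  exact: (measurableT_comp (measurable_rho rhoE) (mVs N)).
rewrite /Ex /exponent_Im RintegralB//; last 2 first.
- exact: bm_integrable (bm_sin mth).
- exact: (integrableZl measurableT xi1 (integrable_compensator N)).
rewrite RintegralZl//; last exact: integrable_compensator.
by rewrite mulrBr [in RHS]mulrCA.
Qed.

End ExponentLimit.

(** * Truncated moments *)

Section Moments.
Context {R : realType} {d} {T : measurableType d} (mu : probability T R).
Variables (V : T -> R) (beta cp cm : R) (K : nat -> R).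
Hypothesis mV : measurable_fun setT V.
Hypothesis beta0 : 0 < beta.
Hypothesis cp0 : 0 <= cp.
Hypothesis cm0 : 0 <= cm.
Hypothesis right_tail : l `^ beta * fine (mu [set x | l <= V x]) @[l --> +oo] --> cp.
Hypothesis left_tail : l `^ beta * fine (mu [set x | V x <= - l]) @[l --> +oo] --> cm.
Hypothesis K0 : forall N, 0 < K N.

(** A bounded test function with order [q] at 0: its means, multiplied by [K], stay bounded for
    every [q] above the tail index. *)
Definition capped_power (q x : R) : R := Num.min 1 (`|x| `^ q).

Lemma measurable_capped_power q : measurable_fun setT (capped_power q).
Proof.
apply: measurable_minr; first exact: measurable_cst.
exact: (measurableT_comp (measurable_powR q) (@normr_measurable R setT)).
Qed.

Lemma capped_power_ge0 q x : 0 <= capped_power q x.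
Proof. by rewrite le_min ler01 powR_ge0. Qed.

Lemma capped_power_le1 q x : capped_power q x <= 1.
Proof. by rewrite ge_min lexx. Qed.

Lemma bm_capped_power q (f : T -> R) : measurable_fun setT f -> bm (fun x => capped_power q (f x)).
Proof.
move=> mf; apply: (@bm_comp _ _ _ (capped_power q) 1) => //; first exact: measurable_capped_power.
by move=> x; rewrite ger0_norm ?capped_power_ge0 ?capped_power_le1.
Qed.

Lemma moment_bound q : beta < q -> K N @[N --> \oo] --> +oo -> exists2 M : R, 0 <= M &
  forall N, K N * Ex mu (fun x => capped_power q (V x / K N `^ beta^-1)) <= M.
Proof.
move=> bq Koo; have q0 : 0 < q := lt_trans beta0 bq.
have c0 : capped_power q 0 = 0 :> R by rewrite /capped_power normr0 powR0 ?gt_eqF// min_r.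
have sm x : x != 0 -> `|capped_power q x| <= 1 * `|x| `^ q :> R.
  by move=> _; rewrite ger0_norm ?capped_power_ge0// mul1r ge_min lexx orbT.
have lg x : x != 0 -> `|capped_power q x| <= 1 * `|x| `^ 0 :> R.
  by move=> _; rewrite ger0_norm ?capped_power_ge0// powRr0 mulr1 capped_power_le1.
have cont (x : R) : x != 0 -> `|x| != 1 -> {for x, continuous (capped_power q)}.
  move=> x0 _; apply: (@continuous_comp _ _ _ (fun y : R => `|y|) (fun y : R => Num.min 1 (y `^ q))
    x).
    exact: norm_continuous.
  apply: (@continuous_comp _ _ _ (fun y : R => y `^ q) (fun y : R => Num.min 1 y)).
    by apply: continuous_powR_gt0; rewrite normr_gt0.
  exact: (@continuous_min R R (fun=> 1) id (`|x| `^ q) (cvg_cst _) (@cvg_id _ _)).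
have qr : 0 <= (0 : R) /\ (0 : R) < beta < q by rewrite lexx beta0.
have c := vague_limit mV right_tail left_tail K0 Koo (measurable_capped_power q) c0 qr ler01 sm lg
  cont.
have /cvg_seq_bounded[M [_ hM]] : cvgn (fun N => K N * Ex mu (fun x => capped_power q (V x / K N `^
  beta^-1))).
  by apply/cvg_ex; eexists; exact: c.
exists (`|M| + 1); first by rewrite addr_ge0.
move=> N; apply: le_trans (ler_norm _) _; apply: hM => //.
by apply: le_lt_trans (ler_norm _) _; rewrite ltrDl.
Qed.

Lemma abs_tail_bound : exists2 A : R, 0 < A & forall N l, 0 < l ->
  K N * fine (mu [set x | l <= `|V x / K N `^ beta^-1|]) <= A * l `^ (- beta).
Proof.
have mNV : measurable_fun setT (fun x => - V x) by exact: (measurableT_comp (@oppr_measurable R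
  setT) mV).
have left_tail' : l `^ beta * fine (mu [set x | l <= - V x]) @[l --> +oo] --> cm.
  rewrite (_ : (fun l => _) = fun l : R => l `^ beta * fine (mu [set x | V x <= - l]))//.
  by apply/funext => l; congr (_ * fine (mu _)); apply/seteqP; split => x /=; rewrite lerNr.
have [A1 A10 h1] := tail_bound mV beta0 cp0 right_tail.
have [A2 A20 h2] := tail_bound mNV beta0 cm0 left_tail'.
exists (A1 + A2); first by rewrite addr_gt0.
move=> N l l0; set s := K N `^ beta^-1.
have s0 : 0 < s by exact: powR_gt0.
have sl0 : 0 < s * l by rewrite mulr_gt0.
have m1 := measurable_ge mV (s * l); have m2 := measurable_ge mNV (s * l).
have le : fine (mu [set x | l <= `|V x / s|]) <= fine (mu [set x | s * l <= V x]) + fine (mu [set x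
  | s * l <= - V x]).
  rewrite -fineD ?fin_num_measure//.
  apply: fine_le; rewrite ?fin_num_measure ?fin_numD ?fin_num_measure//.
    apply: (@measurable_ge _ _ _ (fun x => `|V x / s|)).
    by apply: (measurableT_comp (@normr_measurable R setT)); apply: measurable_funM => //; exact:
      measurable_cst.
  apply: le_trans (measureU2 _ m1 m2); apply: le_measure; rewrite ?inE.
  - apply: (@measurable_ge _ _ _ (fun x => `|V x / s|)).
    by apply: (measurableT_comp (@normr_measurable R setT)); apply: measurable_funM => //; exact:
      measurable_cst.
  - exact: measurableU.
  - move=> x /=; rewrite normrM [`|s^-1|]gtr0_norm ?invr_gt0// ler_pdivlMr// mulrC.
    by rewrite ler_normr => /orP[]; [left|right].
have sK : K N * (s * l) `^ (- beta) = l `^ (- beta).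
  rewrite powRM ?ltW// /s -powRrM mulrN mulVf ?gt_eqF// powR_inv1 ?ltW// mulrA mulfV ?mul1r//.
  by rewrite gt_eqF.
apply: (@le_trans _ _ (K N * ((A1 + A2) * (s * l) `^ (- beta)))).
  rewrite ler_wpM2l ?(ltW (K0 N))//; apply: (le_trans le); rewrite mulrDl; apply: lerD; [exact:
    h1|exact: h2].
by rewrite mulrCA sK.
Qed.

End Moments.

(** * Arrays of rescaled jumps *)

Section StableArray.
Context {R : realType} {dE} {E : measurableType dE} {d} {Om : measurableType d}.
Variables (Pr : probability Om R) (P : R.-pker E ~> E) (mu : probability E R).
Variable X : nat -> {RV Pr >-> E}.
Variables (K : nat -> R) (W T : nat -> E -> R) (v : nat -> R).
Variables (beta c p q q' : R) (psi : R -> R -> R[i]).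

Definition jump_image (y : R) : R := c * `|y| `^ p.

(* [W N] and [T N] are [V] and [tau] rescaled by their typical jump sizes at time [K N]. *)
Record stable_array (a : R) : Prop := {
  sa_chain : markov_chain P mu X;
  sa_inv : invariant_law P mu;
  sa_gap : gap_bound P mu a;
  sa_K : forall N, 1 <= K N;
  sa_Koo : K N @[N --> \oo] --> +oo;
  sa_mW : forall N, measurable_fun setT (W N);
  sa_mT : forall N, measurable_fun setT (T N);
  sa_T : forall N x, 0 <= T N x;
  sa_beta : 0 < beta;
  sa_c : 0 < c;
  sa_q : [/\ 0 < q, q < 2 & q < p];
  sa_q' : 0 < q' < 1;
  sa_tail : exists2 A : R, 0 < A & forall N l, 0 < l ->
    K N * fine (mu [set x | l <= `|W N x|]) <= A * l `^ (- beta);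
  sa_smooth : exists2 C : R, 0 <= C & forall N l, 0 <= l ->
    n2 mu (transition_op P \1_[set x | l <= `|W N x|]) <= C * fine (mu [set x | l <= `|W N x|]);
  sa_mom : exists2 M : R, 0 <= M & forall N, K N * Ex mu (fun x => capped_power q (W N x)) <= M;
  sa_momT : exists2 M : R, 0 <= M & forall N, K N * Ex mu (fun x => capped_power q' (T N x)) <= M;
  sa_close : forall l : R, 0 < l ->
    K N * fine (mu [set x | l <= `|T N x - jump_image (W N x)|]) @[N --> \oo] --> 0;
  sa_Re : forall xi1 xi2 : R,
    K N * Ex mu (fun x => cos (W N x * xi1 + jump_image (W N x) * xi2) - 1) @[N --> \oo] -->
    complex.Re (psi xi1 xi2);
  sa_Im : forall xi1 xi2 : R,
    K N * Ex mu (fun x => sin (W N x * xi1 + jump_image (W N x) * xi2)) - xi1 * v N @[N --> \oo] -->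
    complex.Im (psi xi1 xi2) }.

Variable a : R.
Hypothesis H : stable_array a.

Let p0 : 0 < p. Proof. by case: (sa_q H) => q0 _; apply: lt_trans. Qed.

Definition small_part (delta y : R) : R := if `|y| < delta then y else 0.
Definition big_part (delta y : R) : R := if `|y| < delta then 0 else y.
Definition big_image (delta y : R) : R := if `|y| < delta then 0 else jump_image y.

Lemma measurable_if_lt (delta : R) (f g : R -> R) : measurable_fun setT f -> measurable_fun setT g
  ->
  measurable_fun setT (fun y : R => if `|y| < delta then f y else g y).
Proof.
move=> mf mg; apply: measurable_fun_ifT => //.
by apply: measurable_fun_ltr; [exact: (@normr_measurable R setT)|exact: measurable_cst].
Qed.

Lemma measurable_jump_image : measurable_fun setT jump_image.
Proof.
apply: measurable_funM; first exact: measurable_cst.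
exact: (measurableT_comp (measurable_powR p) (@normr_measurable R setT)).
Qed.

Lemma measurable_small_part delta : measurable_fun setT (small_part delta).
Proof. by apply: measurable_if_lt; [exact: measurable_id|exact: measurable_cst]. Qed.
Lemma measurable_big_part delta : measurable_fun setT (big_part delta).
Proof. by apply: measurable_if_lt; [exact: measurable_cst|exact: measurable_id]. Qed.
Lemma measurable_big_image delta : measurable_fun setT (big_image delta).
Proof. by apply: measurable_if_lt; [exact: measurable_cst|exact: measurable_jump_image]. Qed.

Lemma small_bigE delta y : y = small_part delta y + big_part delta y.
Proof. by rewrite /small_part /big_part; case: ifP; rewrite ?addr0 ?add0r. Qed.

Lemma abs_small_part delta y : 0 <= delta -> `|small_part delta y| <= delta.
Proof. by rewrite /small_part; case: ifP => [/ltW//|_]; rewrite normr0. Qed.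

Lemma bm_small_part delta N : 0 <= delta -> bm (fun x => small_part delta (W N x)).
Proof.
move=> d0; apply: (@bm_comp _ _ _ (small_part delta) delta); first exact: measurable_small_part.
  by move=> y; exact: abs_small_part.
exact: (sa_mW H).
Qed.

(** The spare exponent [2 - q] makes the variance of the small jumps vanish with [delta], uniformly
    in [N]. *)
Lemma small_part_sqr delta y : 0 < delta <= 1 ->
  small_part delta y ^+ 2 <= delta `^ (2 - q) * capped_power q y.
Proof.
move=> /andP[d0 d1]; have [q0 q2 _] := sa_q H.
rewrite /small_part; case: ifP => [yd|_]; last first.
  by rewrite expr0n/= mulr_ge0 ?powR_ge0 ?capped_power_ge0.
have y1 : `|y| <= 1 by rewrite (le_trans _ d1)// ltW.
have cE : capped_power q y = `|y| `^ q.
  rewrite /capped_power min_r//; have := ge0_ler_powR (ltW q0) (normr_ge0 y) ler01 y1.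
  by rewrite powR1.
rewrite cE -[y ^+ 2]ger0_norm ?sqr_ge0// normrX -powR_mulrn//.
have [->|yn] := eqVneq y 0; first by rewrite normr0 powR0 ?mulr_ge0 ?powR_ge0// gt_eqF.
rewrite -[leLHS](_ : `|y| `^ (2 - q) * `|y| `^ q = _); last first.
  by rewrite -powRD ?subrK// normr_eq0 yn implybT.
by rewrite ler_wpM2r ?powR_ge0//; apply: ge0_ler_powR; rewrite ?nnegrE ?subr_ge0 ?normr_ge0// ltW.
Qed.

Lemma jump_image_small delta y : 0 < delta <= 1 -> `|y| < delta ->
  0 <= jump_image y <= c * delta `^ (p - q) * capped_power q y.
Proof.
move=> /andP[d0 d1] yd; have [q0 q2 qp] := sa_q H; have c0 := sa_c H.
have y1 : `|y| <= 1 by rewrite (le_trans _ d1)// ltW.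
have cE : capped_power q y = `|y| `^ q.
  rewrite /capped_power min_r//; have := ge0_ler_powR (ltW q0) (normr_ge0 y) ler01 y1.
  by rewrite powR1.
rewrite /jump_image cE mulr_ge0 ?powR_ge0 ?(ltW c0)//= -mulrA ler_wpM2l ?(ltW c0)//.
have [->|yn] := eqVneq y 0; first by rewrite normr0 powR0 ?mulr_ge0 ?powR_ge0// gt_eqF.
rewrite -[leLHS](_ : `|y| `^ (p - q) * `|y| `^ q = _); last first.
  by rewrite -powRD ?subrK// normr_eq0 yn implybT.
by rewrite ler_wpM2r ?powR_ge0//; apply: ge0_ler_powR; rewrite ?nnegrE ?subr_ge0 ?normr_ge0// ltW.
Qed.

(** For [y <= 1] the minimum is interpolated as [h^(1 - q') y^q']; for [y > 1] it is at most [h]. *)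
Lemma min_capped_power h y : 0 <= h -> 0 <= y -> Num.min y h <= (h + h `^ (1 - q')) * capped_power
  q' y.
Proof.
move=> h0 y0; have /andP[q0 q1] := sa_q' H; rewrite /capped_power (ger0_norm y0).
have k0 : 0 <= h `^ (1 - q') by exact: powR_ge0.
have [y1|y1] := leP y 1; last first.
  rewrite [X in _ * X]min_l; last first.
    by have := ge0_ler_powR (ltW q0) ler01 y0 (ltW y1); rewrite powR1.
  by rewrite mulr1 ge_min; apply/orP; right; lra.
rewrite [X in _ * X]min_r; last by have := ge0_ler_powR (ltW q0) y0 ler01 y1; rewrite powR1.
have w0 : 0 <= y `^ q' by exact: powR_ge0.
apply: (@le_trans _ _ (h `^ (1 - q') * y `^ q')); last by rewrite ler_wpM2r// lerDr.
have m0 : 0 <= Num.min y h by rewrite le_min y0.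
have [->|mn] := eqVneq (Num.min y h) 0; first by rewrite mulr_ge0.
rewrite -[leLHS](powRr1 m0) -[1 in leLHS](subrK q') powRD ?mn ?implybT//.
apply: ler_pM; rewrite ?powR_ge0//.
  apply: ge0_ler_powR; rewrite ?nnegrE//; [by rewrite subr_ge0 ltW|by rewrite ge_min lexx orbT].
by apply: ge0_ler_powR; rewrite ?nnegrE//; [exact: ltW|rewrite ge_min lexx].
Qed.

(* If [T] is within [rho(delta) / 2] of [rho(W)], then either [W] is a small jump and [T] is at most
   [2 rho(delta)], or it is a big one and [T] is at least [rho(delta) / 2]. *)
Lemma image_error delta (w t : R) : 0 < delta -> 0 <= t ->
  `|t - jump_image w| < jump_image delta / 2 ->
  `|t - big_image delta w| <= Num.min t (2 * jump_image delta).
Proof.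
move=> d0 t0 close; have c0 := sa_c H.
have jd : 0 < jump_image delta by rewrite mulr_gt0// powR_gt0// normr_gt0 gt_eqF.
have mono (x y : R) : `|x| <= `|y| -> jump_image x <= jump_image y.
  move=> xy; rewrite ler_wpM2l ?(ltW c0)//; apply: ge0_ler_powR; rewrite ?nnegrE//; exact: ltW.
move: close; rewrite ltr_distl => /andP[l1 l2]; rewrite /big_image.
have [wd|dw] := ltP `|w| delta.
  rewrite subr0; have := mono w delta; rewrite (gtr0_norm d0) => /(_ (ltW wd)) h.
  by rewrite (ger0_norm t0) le_min lexx/=; lra.
have := mono delta w; rewrite (gtr0_norm d0) => /(_ dw) h.
rewrite le_min; apply/andP; split; apply/ler_normlP; split; lra.
Qed.

Lemma small_power (C e eps : R) : 0 <= C -> 0 < e -> 0 < eps ->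
  exists2 d0 : R, 0 < d0 <= 1 & forall del : R, 0 < del -> del <= d0 -> C * del `^ e <= eps.
Proof.
move=> C0 e0 eps0; have C1 : 0 < C + 1 by rewrite ltr_wpDl.
exists (Num.min 1 ((eps / (C + 1)) `^ e^-1)).
  by rewrite lt_min ltr01 powR_gt0 ?divr_gt0//= ge_min lexx.
move=> del del0 dd; have : del `^ e <= eps / (C + 1).
  apply: (@le_trans _ _ (((eps / (C + 1)) `^ e^-1) `^ e)).
    by apply: ge0_ler_powR; rewrite ?nnegrE ?powR_ge0 ?(ltW e0) ?(ltW del0)// (le_trans dd)//
      ge_min lexx orbT.
  by rewrite -powRrM mulVf ?gt_eqF// powRr1// divr_ge0 ?ltW.
rewrite ler_pdivlMr// => /(le_trans _); apply.
by rewrite mulrC ler_wpM2l ?powR_ge0// lerDl.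
Qed.

Lemma sum_markov (f : E -> R) (n : nat) (eta : R) : bm f -> (forall x, 0 <= f x) -> 0 < eta ->
  exists A : set Om, [/\ measurable A, fine (Pr A) <= n%:R * Ex mu f / eta &
    forall w, ~ A w -> \sum_(k < n) f (X k w) < eta].
Proof.
move=> bf f0 eta0; pose F w := \sum_(k < n) f (X k w).
have bF : bm F by apply: bm_sum => k; exact: (bm_chain X k bf).
have mA : measurable [set w | eta <= F w] by exact: (measurable_ge (bm_meas bF)).
exists [set w | eta <= F w]; split => //; last by move=> w /negP; rewrite -ltNge.
have -> : n%:R * Ex mu f = Ex Pr F.
  rewrite /F Ex_sum; last by move=> k; exact: (bm_chain X k bf).
  under eq_bigr => k _ do rewrite (Ex_chain (sa_chain H) (sa_inv H) k bf).
  by rewrite sumr_const card_ord mulr_natl.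
by apply: Ex_markov => // w; apply: sumr_ge0 => k _.
Qed.

Lemma hit_bound (B : set E) (n : nat) : measurable B ->
  exists A : set Om, [/\ measurable A, fine (Pr A) <= n%:R * fine (mu B) &
    forall w, ~ A w -> forall k, (k < n)%N -> ~ B (X k w)].
Proof.
move=> mB; have bB : bm (\1_B : E -> R) by exact: bm_indic.
have i0 x : 0 <= (\1_B x : R) by [].
have [A [mA pA hA]] := sum_markov n bB i0 ltr01.
exists A; split => //; first by rewrite (le_trans pA)// divr1 Ex_indic.
move=> w /hA; rewrite ltNge => /negP h k kn Bk; apply: h.
rewrite (bigD1 (Ordinal kn))//= indicE mem_set// lerDl.
by apply: sumr_ge0 => j _.
Qed.

Lemma measure_cover3 (A1 A2 A3 : set Om) (e : R) : measurable A1 -> measurable A2 -> measurable A3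
  ->
  fine (Pr A1) <= e / 3 -> fine (Pr A2) <= e / 3 -> fine (Pr A3) <= e / 3 ->
  fine (Pr (A1 `|` A2 `|` A3)) <= e.
Proof.
move=> m1 m2 m3 h1 h2 h3.
have m12 : measurable (A1 `|` A2) by exact: measurableU.
have fU (B C : set Om) : measurable B -> measurable C -> fine (Pr (B `|` C)) <= fine (Pr B) + fine
  (Pr C).
  move=> mB mC; rewrite -lee_fin EFinD !fine_muE//; last exact: measurableU.
  exact: measureU2.
have := fU _ _ m12 m3; have := fU _ _ m1 m2; lra.
Qed.

Let Kpos N : 0 < K N. Proof. exact: lt_le_trans (sa_K H N). Qed.

Let horizon (t0 : R) N : 0 <= t0 -> (Num.truncn (K N * t0)).+1%:R <= K N * (t0 + 1).
Proof.
move=> t00; rewrite -natr1 mulrDr mulr1; apply: lerD; last exact: sa_K H N.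
by rewrite truncn_le// mulr_ge0// ltW.
Qed.

Let jump_image_gt0 (delta : R) : 0 < delta -> 0 < jump_image delta.
Proof. by move=> d0; rewrite mulr_gt0 ?(sa_c H)// powR_gt0// normr_gt0 gt_eqF. Qed.

Let mTW N : measurable_fun setT (fun x => `|T N x - jump_image (W N x)|).
Proof.
apply: (measurableT_comp (@normr_measurable R setT)); apply: measurable_funB; first exact: sa_mT H
  N.
exact: (measurableT_comp measurable_jump_image (sa_mW H N)).
Qed.

Let bm_min N h : 0 <= h -> bm (fun x => Num.min (T N x) h).
Proof.
move=> h0; apply: (@bm_bounded _ _ _ h).
  by apply: measurable_minr; [exact: sa_mT H N|exact: measurable_cst].
by move=> x; rewrite ger0_norm ?le_min ?(sa_T H) ?h0// ge_min lexx orbT.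
Qed.

Let prod_bound (n F D G k t M : R) : 0 <= n -> 0 <= F -> 0 <= D -> 0 <= t ->
  n <= k * t -> F <= D * G -> k * G <= M -> n * F <= t * (D * M).
Proof.
move=> n0 F0 D0 t0 nk FD kM; apply: (@le_trans _ _ (k * t * (D * G))); first exact: ler_pM.
rewrite (_ : k * t * (D * G) = t * (D * (k * G))); last ring.
by rewrite ler_wpM2l// ler_wpM2l.
Qed.

(** The order of the quantifiers matters: [delta] does not depend on [N], and a single exceptional
    event serves all [n] up to [K t0]. It is the union of the failure of the maximal inequality, a
    visit where [T] is far from the image of [W], and a large sum of truncated values of [T]. *)
Lemma decomposition (t0 eta e : R) : 0 < t0 -> 0 < eta -> 0 < e ->
  exists2 d0 : R, 0 < d0 <= 1 & forall delta, 0 < delta -> delta <= d0 ->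
  exists N0, forall N, (N0 <= N)%N -> exists A : set Om, [/\ measurable A, fine (Pr A) <= e &
    forall w, ~ A w -> forall n : nat, n%:R <= K N * t0 ->
    `|\sum_(k < n) W N (X k w) - \sum_(k < n) big_part delta (W N (X k w))
       - n%:R * Ex mu (fun x => small_part delta (W N x))| <= eta /\
    `|\sum_(k < n) T N (X k w) - \sum_(k < n) big_image delta (W N (X k w))| <= eta].
Proof.
move=> t00 eta0 e0.
have [M M0 hM] := sa_mom H; have [M' M'0 hM'] := sa_momT H.
have [q0 q2 qp] := sa_q H; have /andP[q'0 q'1] := sa_q' H; have c0 := sa_c H.
have [[a0 a1] _] : (0 <= a /\ a < 1) /\ True by case: (sa_gap H) => /andP[].
have e3 : 0 < e / 3 by rewrite divr_gt0.
(* The maximal inequality bounds the sums by [4 * l]. *)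
pose l := eta / 5; have l0 : 0 < l by rewrite divr_gt0.
pose C1 := 5 * (t0 + 1) * M / ((1 - a) * l) ^+ 2.
have al0 : 0 < ((1 - a) * l) ^+ 2 by rewrite exprn_gt0// mulr_gt0// subr_gt0.
have C10 : 0 <= C1 by rewrite divr_ge0 ?(ltW al0)// !mulr_ge0// addr_ge0// ltW.
have q2p : 0 < 2 - q by rewrite subr_gt0.
have [d1 /andP[d10 d11] hd1] := small_power C10 q2p e3.
(* From [min_capped_power] with [h = 2 c delta^p]: for [delta <= 1], [h + h^(1 - q')] is at most a
   constant times [delta^(p (1 - q'))]. *)
pose C2 := t0 * ((2 * c + (2 * c) `^ (1 - q')) * M') / eta.
have cc0 : 0 <= 2 * c + (2 * c) `^ (1 - q') by rewrite addr_ge0 ?powR_ge0// mulr_ge0// ltW.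
have C20 : 0 <= C2 by rewrite divr_ge0 ?(ltW eta0)// mulr_ge0 ?(ltW t00)// mulr_ge0.
have pq : 0 < p * (1 - q') by rewrite mulr_gt0 ?subr_gt0.
have [d2 /andP[d20 d21] hd2] := small_power C20 pq e3.
exists (Num.min d1 d2); first by rewrite lt_min d10 d20 ge_min d11.
move=> delta delta0; rewrite le_min => /andP[dd1 dd2].
have delta1 : delta <= 1 by exact: le_trans dd1 d11.
have jd := jump_image_gt0 delta0.
have jd2 : 0 < jump_image delta / 2 by rewrite divr_gt0.
have e4 : 0 < e / 3 / (t0 + 1) by rewrite divr_gt0 ?addr_gt0.
have /cvgr0Pnorm_lt/(_ _ e4)[N0 _ hN0] := sa_close H jd2.
exists N0 => N NN0; pose n := Num.truncn (K N * t0).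
have nK : n%:R <= K N * (t0 + 1).
  by apply: le_trans (horizon N (ltW t00)); rewrite ler_nat.
have K0 := Kpos N.
have bs := bm_small_part N (ltW delta0).
pose f x := small_part delta (W N x) - Ex mu (fun x => small_part delta (W N x)).
have bf : bm f by apply: bmB => //; exact: bm_cst.
have f0 : Ex mu f = 0 by rewrite /f ExB ?Ex_cst ?subrr//; exact: bm_cst.
have [A1 [mA1 pA1 hA1]] := max_ineq (sa_chain H) (sa_inv H) (sa_gap H) n bf f0 l0.
pose B := [set x | jump_image delta / 2 <= `|T N x - jump_image (W N x)|].
have mB : measurable B by exact: (measurable_ge (mTW N)).
have [A2 [mA2 pA2 hA2]] := hit_bound n mB.
pose h := 2 * jump_image delta; have h0 : 0 <= h by rewrite mulr_ge0// ltW.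
have g0 x : 0 <= Num.min (T N x) h by rewrite le_min (sa_T H).
have [A3 [mA3 pA3 hA3]] := sum_markov n (bm_min N h0) g0 eta0.
exists (A1 `|` A2 `|` A3); split.
- by apply: measurableU => //; exact: measurableU.
- apply: measure_cover3 => //.
  + apply: (le_trans pA1); apply: le_trans (hd1 _ delta0 dd1).
    have fs : Ex mu (fun x => f x ^+ 2) <= delta `^ (2 - q) * Ex mu (fun x => capped_power q (W N
      x)).
      rewrite -n2_sqr; apply: (@le_trans _ _ (n2 mu (fun x => small_part delta (W N x)) ^+ 2)).
        by rewrite lerXn2r ?nnegrE ?n2_ge0// n2_center.
      have bc := bm_capped_power q (sa_mW H N).
      rewrite n2_sqr -ExZ//; apply: Ex_le; [exact: bm_sqr|exact: bmZ|].
      by move=> x; apply: small_part_sqr; rewrite delta0.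
    have t1 : 0 <= t0 + 1 by rewrite addr_ge0// ltW.
    have := prod_bound (ler0n R n.+1) (Ex_sqr_ge0 mu f) (powR_ge0 delta (2 - q)) t1 (horizon N (ltW
      t00)) fs (hM N).
    move=> pb; rewrite /C1 [leRHS](_ : _ = 5 * ((t0 + 1) * (delta `^ (2 - q) * M)) / ((1 - a) * l)
      ^+ 2); last ring.
    by rewrite ler_wpM2r ?invr_ge0 ?(ltW al0)// -mulrA ler_wpM2l.
  + apply: (le_trans pA2); have := hN0 N NN0; rewrite /= ger0_norm ?mulr_ge0 ?fine_ge0 ?(ltW K0)//.
    rewrite ltr_pdivlMr ?addr_gt0// => /ltW /(le_trans _); apply.
    by rewrite mulrAC ler_wpM2r ?fine_ge0.
  + apply: (le_trans pA3); apply: le_trans (hd2 _ delta0 dd2).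
    have bc := bm_capped_power q' (sa_mT H N).
    have hm : Ex mu (fun x => Num.min (T N x) h) <= (h + h `^ (1 - q')) * Ex mu (fun x =>
      capped_power q' (T N x)).
      rewrite -ExZ//; apply: Ex_le; [exact: bm_min|exact: bmZ|].
      by move=> x; apply: min_capped_power => //; exact: sa_T H N x.
    have hh : h + h `^ (1 - q') <= (2 * c + (2 * c) `^ (1 - q')) * delta `^ (p * (1 - q')).
      rewrite /h /jump_image (gtr0_norm delta0) mulrA powRM ?powR_ge0//; last by rewrite mulr_ge0//
        ltW.
      rewrite -powRrM [leRHS]mulrDl lerD2r ler_wpM2l//; first by rewrite mulr_ge0// ltW.
      by apply: ger_powR; rewrite ?delta0// ger_pMr// lerBlDr lerDl ltW.
    have nK' : n%:R <= K N * t0 by rewrite truncn_le// mulr_ge0// ltW.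
    have hh0 : 0 <= h + h `^ (1 - q') by rewrite addr_ge0 ?powR_ge0.
    have := prod_bound (ler0n R n) (Ex_ge0 mu g0) hh0 (ltW t00) nK' hm (hM' N).
    move=> pb; rewrite /C2 [leRHS](_ : _ = t0 * ((2 * c + (2 * c) `^ (1 - q')) * delta `^ (p * (1 -
      q')) * M') / eta); last ring.
    rewrite ler_wpM2r ?invr_ge0 ?(ltW eta0)//; apply: (le_trans pb).
    by rewrite ler_wpM2l ?(ltW t00)// ler_wpM2r.
- move=> w nA k kt.
  have kn : (k <= n)%N by rewrite /n truncn_ge_nat// mulr_ge0 ?ltW.
  split.
    have nA1 : ~ A1 w by move=> A1w; apply: nA; left; left.
    rewrite (_ : _ - _ = \sum_(j < k) f (X j w)); last first.
      rewrite /f [RHS]sumrB sumr_const card_ord mulr_natl -sumrB; congr (_ - _); apply: eq_bigr =>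
        j _.
      by rewrite [X in X - _](small_bigE delta) addrK.
    by apply: ltW; apply: lt_trans (hA1 w k nA1 kn) _; rewrite /l; lra.
  have nA2 : ~ A2 w by move=> A2w; apply: nA; left; right.
  have nA3 : ~ A3 w by move=> A3w; apply: nA; right.
  rewrite -sumrB; apply: (le_trans (ler_norm_sum _ _ _)).
  apply: le_trans (ltW (hA3 w nA3)).
  rewrite (big_ord_widen _ (fun j => `|T N (X j w) - big_image delta (W N (X j w))|) kn).
  rewrite big_mkcond/=; apply: ler_sum => j _; case: ifP => [jk|_]; last exact: g0.
  apply: image_error => //; first exact: sa_T H N _.
  by rewrite ltNge; apply/negP; exact: (hA2 w nA2 j (ltn_ord j)).
Qed.

(** The gap between centering the jumps cut at [delta] and the centering [v N]. The exponents need
    it in combination with the mean sine of the big jumps, and the path estimates need only a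
    bound. *)
Definition drift (delta : R) N := K N * Ex mu (fun x => small_part delta (W N x)) - v N.

Definition jump_phase (xi1 xi2 delta : R) N (x : E) : R :=
  xi1 * big_part delta (W N x) + xi2 * big_image delta (W N x).

Lemma measurable_jump_phase xi1 xi2 delta N : measurable_fun setT (jump_phase xi1 xi2 delta N).
Proof.
apply: measurable_funD; apply: measurable_funM; try exact: measurable_cst.
  exact: (measurableT_comp (measurable_big_part delta) (sa_mW H N)).
exact: (measurableT_comp (measurable_big_image delta) (sa_mW H N)).
Qed.

Lemma jump_phase_small xi1 xi2 delta N x : `|W N x| < delta -> jump_phase xi1 xi2 delta N x = 0.
Proof. by move=> h; rewrite /jump_phase /big_part /big_image h !mulr0 addr0. Qed.

Let mphase xi1 xi2 N : measurable_fun setT (fun x => W N x * xi1 + jump_image (W N x) * xi2).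
Proof.
apply: measurable_funD; apply: measurable_funM; try exact: measurable_cst; first exact: sa_mW H N.
exact: (measurableT_comp measurable_jump_image (sa_mW H N)).
Qed.

(** It vanishes with [delta] since [q < 2] and [q < p]: the first term is the second moment of the
    small jumps, the second comes from their images. *)
Let phase_error xi1 xi2 delta : R :=
  2 * xi1 ^+ 2 * delta `^ (2 - q) + (2 * xi2 ^+ 2 * c ^+ 2 + `|xi2| * c) * delta `^ (p - q).

Let phase_error_ge0 xi1 xi2 delta : 0 <= phase_error xi1 xi2 delta.
Proof.
have c0 := ltW (sa_c H); rewrite addr_ge0// mulr_ge0 ?powR_ge0//.
  by rewrite mulr_ge0 ?sqr_ge0.
apply: addr_ge0; last exact: mulr_ge0.
by apply: mulr_ge0; [apply: mulr_ge0 => //; exact: sqr_ge0|exact: sqr_ge0].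
Qed.

Let phase_sqr xi1 xi2 delta (y : R) : 0 < delta <= 1 -> `|y| < delta ->
  (y * xi1 + jump_image y * xi2) ^+ 2 + `|xi2 * jump_image y| <=
  phase_error xi1 xi2 delta * capped_power q y.
Proof.
move=> d01 yd; have c0 := ltW (sa_c H); have /andP[d0 d1] := d01.
have y2 := small_part_sqr y d01; rewrite /small_part yd in y2.
have /andP[j0 j1] := jump_image_small d01 yd.
have jc : jump_image y <= c.
  rewrite /jump_image ler_piMr//.
  by have := ge0_ler_powR (ltW p0) (normr_ge0 y) ler01 (le_trans (ltW yd) d1); rewrite powR1.
have k0 : 0 <= capped_power q y by exact: capped_power_ge0.
move: (capped_power q y) (jump_image y) k0 y2 j0 j1 jc => k j k0 y2 j0 j1 jc.
have h1 : (y * xi1 + j * xi2) ^+ 2 <= 2 * xi1 ^+ 2 * y ^+ 2 + 2 * xi2 ^+ 2 * j ^+ 2.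
  by rewrite -subr_ge0 (_ : _ - _ = (y * xi1 - j * xi2) ^+ 2) ?sqr_ge0//; ring.
have h2 : 2 * xi1 ^+ 2 * y ^+ 2 <= 2 * xi1 ^+ 2 * (delta `^ (2 - q) * k).
  by rewrite ler_wpM2l// mulr_ge0 ?sqr_ge0.
have h3 : 2 * xi2 ^+ 2 * j ^+ 2 <= 2 * xi2 ^+ 2 * (c * (c * delta `^ (p - q) * k)).
  have x0 : 0 <= 2 * xi2 ^+ 2 by apply: mulr_ge0 => //; exact: sqr_ge0.
  by rewrite ler_wpM2l// expr2; exact: ler_pM.
have h4 : `|xi2 * j| <= `|xi2| * (c * delta `^ (p - q) * k).
  by rewrite normrM (ger0_norm j0) ler_wpM2l.
apply: (le_trans (lerD (le_trans h1 (lerD h2 h3)) h4)).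
by rewrite le_eqVlt; apply/orP; left; apply/eqP; rewrite /phase_error; ring.
Qed.

Let Ex_error (f : E -> R) N (D M : R) : bm f -> 0 <= D -> K N * Ex mu (fun x => capped_power q (W N
  x)) <= M ->
  (forall x, `|f x| <= D * capped_power q (W N x)) -> `|K N * Ex mu f| <= D * M.
Proof.
move=> bf D0 hM hf; have bc := bm_capped_power q (sa_mW H N).
rewrite normrM (gtr0_norm (Kpos N)).
apply: (@le_trans _ _ (K N * (D * Ex mu (fun x => capped_power q (W N x))))).
  rewrite ler_wpM2l ?(ltW (Kpos N))//; apply: (le_trans (Ex_abs _ bf)).
  by rewrite -ExZ//; apply: Ex_le; [exact: bm_norm|exact: bmZ|].
by rewrite mulrCA ler_wpM2l.
Qed.

(** The small jumps that are removed contribute [xi1 * small_part] at first order, which the drift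
    restores. What remains is quadratic in the phase or linear in the image, and both are controlled
    by [capped_power]. *)
Lemma exponent_approx xi1 xi2 delta N M : 0 < delta <= 1 ->
  K N * Ex mu (fun x => capped_power q (W N x)) <= M ->
  `|K N * (Ex mu (fun x => cos (jump_phase xi1 xi2 delta N x)) - 1) -
    K N * Ex mu (fun x => cos (W N x * xi1 + jump_image (W N x) * xi2) - 1)| <=
    phase_error xi1 xi2 delta * M /\
  `|(K N * Ex mu (fun x => sin (jump_phase xi1 xi2 delta N x)) + xi1 * drift delta N) -
    (K N * Ex mu (fun x => sin (W N x * xi1 + jump_image (W N x) * xi2)) - xi1 * v N)| <=
    phase_error xi1 xi2 delta * M.
Proof.
move=> d01 hM; have /andP[d0 d1] := d01.
have mj := measurable_jump_phase xi1 xi2 delta N; have mp := mphase xi1 xi2 N.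
have bcj := bm_cos mj; have bsj := bm_sin mj; have bcp := bm_cos mp; have bsp := bm_sin mp.
have bs := bm_small_part N (ltW d0).
have b1 : bm (fun _ : E => 1 : R) by exact: bm_cst.
have big x : (`|W N x| < delta) = false -> jump_phase xi1 xi2 delta N x = W N x * xi1 + jump_image
  (W N x) * xi2.
  by move=> h; rewrite /jump_phase /big_part /big_image h mulrC (mulrC xi2).
have D0 := phase_error_ge0 xi1 xi2 delta.
have cp0 x : 0 <= phase_error xi1 xi2 delta * capped_power q (W N x).
  by rewrite mulr_ge0 ?capped_power_ge0.
split.
  rewrite ExB// Ex_cst -mulrBr [X in K N * X](_ : _ = Ex mu (fun x => cos (jump_phase xi1 xi2 delta
    N x) -
      cos (W N x * xi1 + jump_image (W N x) * xi2))); last by rewrite ExB//; ring.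
  apply: Ex_error => //; first exact: bmB.
  move=> x; case: (boolP (`|W N x| < delta)) => [h|/negbTE h]; last by rewrite big// subrr normr0.
  rewrite jump_phase_small// cos0 distrC; apply: (le_trans (cosB1_le _)).
  by apply: le_trans (phase_sqr xi1 xi2 d01 h); rewrite lerDl.
rewrite /drift [X in `|X|](_ : _ = K N * Ex mu (fun x => sin (jump_phase xi1 xi2 delta N x) +
    xi1 * small_part delta (W N x) - sin (W N x * xi1 + jump_image (W N x) * xi2))); last first.
  rewrite ExB ?ExD ?ExZ//; [by ring|exact: bmZ|by apply: bmD => //; exact: bmZ].
apply: Ex_error => //; first by apply: bmB => //; apply: bmD => //; exact: bmZ.
move=> x; case: (boolP (`|W N x| < delta)) => [h|/negbTE h]; last first.
  by rewrite big// /small_part h mulr0 addr0 subrr normr0.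
rewrite jump_phase_small// sin0 add0r /small_part h.
apply: le_trans (phase_sqr xi1 xi2 d01 h).
set u := W N x * xi1 + _.
rewrite (_ : xi1 * W N x - sin u = (u - sin u) - xi2 * jump_image (W N x)); last by rewrite /u;
  ring.
apply: (le_trans (ler_normB _ _)); rewrite lerD2r distrC; exact: sinB_le.
Qed.

Lemma exponent_limit xi1 xi2 (e : R) : 0 < e -> exists2 d0 : R, 0 < d0 <= 1 &
  forall delta, 0 < delta -> delta <= d0 -> \forall N \near \oo,
  `|K N * (Ex mu (fun x => cos (jump_phase xi1 xi2 delta N x)) - 1) - complex.Re (psi xi1 xi2)| <=
    e /\
  `|K N * Ex mu (fun x => sin (jump_phase xi1 xi2 delta N x)) + xi1 * drift delta N -
     complex.Im (psi xi1 xi2)| <= e.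
Proof.
move=> e0; have [M M0 hM] := sa_mom H; have [q0 q2 qp] := sa_q H; have c0 := ltW (sa_c H).
have e4 : 0 < e / 4 by rewrite divr_gt0.
have q2p : 0 < 2 - q by rewrite subr_gt0.
have pq : 0 < p - q by rewrite subr_gt0.
have C10 : 0 <= 2 * xi1 ^+ 2 * M by apply: mulr_ge0 => //; apply: mulr_ge0 => //; exact: sqr_ge0.
have C20 : 0 <= (2 * xi2 ^+ 2 * c ^+ 2 + `|xi2| * c) * M.
  apply: mulr_ge0 => //; apply: addr_ge0; last exact: mulr_ge0.
  by apply: mulr_ge0; [apply: mulr_ge0 => //; exact: sqr_ge0|exact: sqr_ge0].
have [d1 /andP[d10 d11] hd1] := small_power C10 q2p e4.
have [d2 /andP[d20 d21] hd2] := small_power C20 pq e4.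
exists (Num.min d1 d2); first by rewrite lt_min d10 d20 ge_min d11.
move=> delta delta0; rewrite le_min => /andP[dd1 dd2].
have d01 : 0 < delta <= 1 by rewrite delta0 (le_trans dd1).
have small : phase_error xi1 xi2 delta * M <= e / 2.
  rewrite /phase_error [leLHS](_ : _ = 2 * xi1 ^+ 2 * M * delta `^ (2 - q) +
    (2 * xi2 ^+ 2 * c ^+ 2 + `|xi2| * c) * M * delta `^ (p - q)); last ring.
  apply: le_trans (lerD (hd1 _ delta0 dd1) (hd2 _ delta0 dd2)) _; lra.
have e2 : 0 < e / 2 by rewrite divr_gt0.
have /cvgrPdist_le/(_ _ e2) cR := sa_Re H (xi1 := xi1) (xi2 := xi2).
have /cvgrPdist_le/(_ _ e2) cI := sa_Im H (xi1 := xi1) (xi2 := xi2).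
near=> N.
have [h1 h2] := exponent_approx xi1 xi2 d01 (hM N).
have g1 : `|K N * Ex mu (fun x => cos (W N x * xi1 + jump_image (W N x) * xi2) - 1) - complex.Re
  (psi xi1 xi2)| <= e / 2.
  by rewrite distrC; near: N; exact: cR.
have g2 : `|K N * Ex mu (fun x => sin (W N x * xi1 + jump_image (W N x) * xi2)) - xi1 * v N -
  complex.Im (psi xi1 xi2)| <= e / 2.
  by rewrite distrC; near: N; exact: cI.
split.
  apply: (le_trans (ler_distD (K N * Ex mu (fun x => cos (W N x * xi1 + jump_image (W N x) * xi2) -
    1)) _ _)).
  by have := le_trans h1 small; lra.
apply: (le_trans (ler_distD (K N * Ex mu (fun x => sin (W N x * xi1 + jump_image (W N x) * xi2)) -
  xi1 * v N) _ _)).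
by have := le_trans h2 small; lra.
Unshelve. all: by end_near. Qed.

Lemma jump_phase_bound xi1 xi2 delta A : 0 < delta ->
  (forall N l, 0 < l -> K N * fine (mu [set x | l <= `|W N x|]) <= A * l `^ (- beta)) -> forall N,
  `|K N * (Ex mu (fun x => cos (jump_phase xi1 xi2 delta N x)) - 1)| <= 2 * (A * delta `^ (- beta))
    /\
  `|K N * Ex mu (fun x => sin (jump_phase xi1 xi2 delta N x))| <= 2 * (A * delta `^ (- beta)).
Proof.
move=> d0 hA N; pose B := [set x | delta <= `|W N x|].
have mj := measurable_jump_phase xi1 xi2 delta N.
have bcj := bm_cos mj; have bsj := bm_sin mj.
have mB : measurable B by exact: (measurable_ge (measurableT_comp (@normr_measurable R setT) (sa_mW
  H N))).
have bB : bm (\1_B : E -> R) by exact: bm_indic.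
have key f : bm f -> (forall x, `|W N x| < delta -> f x = 0) -> (forall x, `|f x| <= 2) ->
    `|K N * Ex mu f| <= 2 * (A * delta `^ (- beta)).
  move=> bf f0 f2; rewrite normrM (gtr0_norm (Kpos N)).
  apply: (@le_trans _ _ (K N * (2 * fine (mu B)))); last by rewrite mulrCA ler_wpM2l// hA.
  rewrite ler_wpM2l ?(ltW (Kpos N))//; apply: (le_trans (Ex_abs _ bf)).
  rewrite -Ex_indic// -ExZ//; apply: Ex_le; [exact: bm_norm|exact: bmZ|].
  move=> x; rewrite indicE; case: (boolP (x \in B)) => xB; first by rewrite mulr1.
  by rewrite mulr0 f0 ?normr0// ltNge; apply: contra xB => h; rewrite inE.
split.
  rewrite (_ : Ex mu _ - 1 = Ex mu (fun x => cos (jump_phase xi1 xi2 delta N x) - 1)); last first.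
    by rewrite ExB ?Ex_cst//; exact: bm_cst.
  apply: key; first by apply: bmB => //; exact: bm_cst.
    by move=> x /jump_phase_small ->; rewrite cos0 subrr.
  move=> x; apply: (le_trans (ler_normB _ _)); rewrite normr1.
  by have := abs_cos_le1 (jump_phase xi1 xi2 delta N x); lra.
apply: key => //; first by move=> x /jump_phase_small ->; rewrite sin0.
by move=> x; apply: (le_trans (abs_sin_le1 _)); rewrite ler1n.
Qed.

(** At the frequency [(1, 0)] the drift is a convergent sequence minus a bounded mean sine, up to
    the approximation error. *)
Lemma drift_bound delta : 0 < delta <= 1 -> exists B : R, forall N, `|drift delta N| <= B.
Proof.
move=> d01; have /andP[d0 _] := d01; have [M M0 hM] := sa_mom H; have [A A0 hA] := sa_tail H.
have /cvg_seq_bounded[L [_ hL]] : cvgn (fun N => K N * Ex mu (fun x => sin (W N x * 1 + jump_image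
  (W N x) * 0)) - 1 * v N).
  by apply/cvg_ex; exists (complex.Im (psi 1 0)); exact: (sa_Im H).
exists (2 * (A * delta `^ (- beta)) + (`|L| + 1) + phase_error 1 0 delta * M) => N.
have [_ h1] := exponent_approx 1 0 d01 (hM N).
have [_ h2] := jump_phase_bound 1 0 d0 hA N.
have h3 : `|K N * Ex mu (fun x => sin (W N x * 1 + jump_image (W N x) * 0)) - 1 * v N| <= `|L| + 1.
  by apply: hL => //; apply: le_lt_trans (ler_norm _) _; rewrite ltrDl.
move: h1 h2 h3; rewrite mul1r.
move: (K N * Ex mu _) (K N * Ex mu _) (drift delta N) (1 * v N) => s1 s2 b w h1 h2 h3.
rewrite (_ : b = - s2 + (s1 - w) + ((s2 + b) - (s1 - w))); last ring.
apply: (le_trans (ler_normD _ _)); apply: lerD => //.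
by apply: (le_trans (ler_normD _ _)); rewrite normrN lerD.
Qed.

End StableArray.

(** * Finite-dimensional characteristic functions *)

Section BlockSums.
Context {V : nmodType}.
Variable n : nat -> nat.
Hypothesis n_nd : nondecreasing_seq n.
Hypothesis n0 : n 0%N = 0%N.

Lemma block_sum (F : nat -> V) L :
  \sum_(k < n L) F k = \sum_(j < L) \sum_(n j <= k < n j.+1) F k.
Proof.
elim: L => [|L IH]; first by rewrite n0 !big_ord0.
rewrite big_ord_recr/= -IH -!(big_mkord xpredT F).
by rewrite -big_cat_nat//; exact: n_nd.
Qed.

End BlockSums.

Section AbelSummation.
Context {R : realType}.
Variables (n : nat -> nat) (L : nat).
Hypothesis n_nd : nondecreasing_seq n.
Hypothesis n0 : n 0%N = 0%N.
Implicit Types (s G : nat -> R).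

Definition tail_sum s (j : nat) : R := \sum_(i < L.+1 | (j < i)%N) s i.
(** The total coefficient of the summand of index [k] in a combination of the partial sums up to
    [n i]. It is constant on each block between consecutive [n j], with value [tail_sum s j]. *)
Definition coef_at s (k : nat) : R := \sum_(i < L.+1 | (k < n i)%N) s i.

Lemma coef_at_block s j k : (n j <= k < n j.+1)%N -> coef_at s k = tail_sum s j.
Proof.
move=> /andP[jk kj]; apply: eq_bigl => i.
apply/idP/idP => [kn|ji]; last by apply: leq_trans kj _; exact: n_nd.
by rewrite ltnNge; apply/negP => /n_nd ij; have := leq_trans (leq_ltn_trans jk kn) ij; rewrite ltnn.
Qed.

Lemma abel_sum s G : \sum_(i < L.+1) s i * \sum_(k < n i) G k = \sum_(k < n L) coef_at s k * G k.
Proof.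
rewrite (eq_bigr (fun i : 'I_L.+1 => \sum_(k < n L) (if (k < n i)%N then s i * G k else 0))); last
  first.
  move=> i _; rewrite mulr_sumr -big_mkcond/=.
  rewrite (big_ord_widen _ (fun k => s i * G k) (_ : (n i <= n L)%N))//.
  by apply: n_nd; rewrite -ltnS ltn_ord.
rewrite exchange_big/=; apply: eq_bigr => k _.
by rewrite -big_mkcond/= mulr_suml.
Qed.

Lemma coef_block_sum (F : R -> R -> R) s1 s2 :
  \sum_(k < n L) F (coef_at s1 k) (coef_at s2 k) =
  \sum_(j < L) (n j.+1 - n j)%N%:R * F (tail_sum s1 j) (tail_sum s2 j).
Proof.
rewrite (block_sum n_nd n0 (fun k => F (coef_at s1 k) (coef_at s2 k))).
apply: eq_bigr => j _.
rewrite (eq_big_nat _ _ (F2 := fun=> F (tail_sum s1 j) (tail_sum s2 j))); last first.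
  by move=> k kj; rewrite !(coef_at_block _ kj).
by rewrite sumr_const_nat mulr_natl.
Qed.

Lemma tail_sum_linear s (t : R) : \sum_(i < L.+1) s i * (i%:R * t) = \sum_(j < L) tail_sum s j * t.
Proof.
rewrite (eq_bigr (fun i : 'I_L.+1 => \sum_(j < L) (if (j < i)%N then s i * t else 0))); last first.
  move=> i _; rewrite -big_mkcond/= mulr_natl -(big_ord_widen _ (fun=> s i * t) (_ : (i <= L)%N));
    last first.
    by rewrite -ltnS ltn_ord.
  by rewrite sumr_const card_ord mulrnAr.
rewrite exchange_big/=; apply: eq_bigr => j _.
by rewrite -big_mkcond/= mulr_suml.
Qed.

End AbelSummation.

Section ComplexExponential.
Context {R : realType}.
Local Open Scope complex_scope.

Lemma expR_lip (x y : R) : x <= 0 -> y <= 0 -> `|expR x - expR y| <= `|x - y|.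
Proof.
wlog xy : x y / x <= y.
  move=> hw x0 y0; have [|/ltW yx] := leP x y; first by move/hw; exact.
  by rewrite distrC (distrC x); exact: hw.
move=> x0 y0; rewrite distrC ger0_norm ?subr_ge0 ?ler_expR// distrC ger0_norm ?subr_ge0//.
have e1 : expR y <= 1 by rewrite -expR0 ler_expR.
have e2 := expR_ge1Dx (x - y).
have -> : expR x = expR y * expR (x - y) by rewrite -expRD; congr expR; ring.
have e3 := expR_ge0 y; nra.
Qed.

Lemma cexp_lip (x y x' y' : R) : x <= 0 -> x' <= 0 ->
  cmod (cexp (x +i* y) - cexp (x' +i* y')) <= 2 * (`|x - x'| + `|y - y'|).
Proof.
move=> x0 x'0; rewrite mulrDl mul1r; rewrite !cexpE.
have e1 : expR x <= 1 by rewrite -expR0 ler_expR.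
have ex := expR_lip x0 x'0.
have key (f : R -> R) : (forall t, `|f t| <= 1) -> (forall s t, `|f s - f t| <= `|s - t|) ->
    `|expR x * f y - expR x' * f y'| <= `|x - x'| + `|y - y'|.
  move=> f1 fl; rewrite (_ : _ - _ = (expR x - expR x') * f y' + expR x * (f y - f y')); last ring.
  apply: (le_trans (ler_normD _ _)); apply: lerD; rewrite normrM.
    by apply: le_trans ex; rewrite ler_piMr.
  by apply: le_trans (fl _ _); rewrite (ger0_norm (expR_ge0 _)) ler_piMl.
apply: cmod_sub_le => /=; apply: key; [exact: abs_cos_le1| |exact: abs_sin_le1|].
  by move=> s t; exact: cos_lip.
by move=> s t; exact: sin_lip.
Qed.

Lemma sum_complex n (x y : nat -> R) :
  \sum_(k < n) (x k +i* y k) = (\sum_(k < n) x k) +i* (\sum_(k < n) y k).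
Proof.
elim: n => [|n IH]; first by rewrite !big_ord0.
by rewrite !big_ord_recr/= IH.
Qed.

End ComplexExponential.

Lemma finite_threshold {R : realType} (L : nat) (Q : nat -> R -> Prop) :
  (forall j, exists2 d0 : R, 0 < d0 <= 1 & forall x, 0 < x -> x <= d0 -> Q j x) ->
  exists2 d0 : R, 0 < d0 <= 1 & forall x, 0 < x -> x <= d0 -> forall j, (j < L)%N -> Q j x.
Proof.
move=> h; elim: L => [|L [d /andP[d0 d1] IH]]; first by exists 1; rewrite ?ltr01 ?lexx.
have [d' /andP[d'0 d'1] hd'] := h L; exists (Num.min d d'); first by rewrite lt_min d0 d'0 ge_min
  d1.
move=> x x0; rewrite le_min => /andP[xd xd'] j; rewrite ltnS leq_eqVlt => /predU1P[->|jL].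
  exact: hd'.
exact: IH.
Qed.

Lemma finite_near (L : nat) (Q : nat -> nat -> Prop) :
  (forall j, (j < L)%N -> \forall N \near \oo, Q j N) ->
  \forall N \near \oo, forall j, (j < L)%N -> Q j N.
Proof.
elim: L => [|L IH] h; first exact: nearW.
have h1 : \forall N \near \oo, forall j, (j < L)%N -> Q j N.
  by apply: IH => j jL; apply: h; exact: ltnW.
have h2 := h L (ltnSn L).
near=> N => j; rewrite ltnS leq_eqVlt => /predU1P[->|]; first by near: N.
by move: j; near: N.
Unshelve. all: by end_near. Qed.

Lemma trig_perturb {R : realType} {d} {Om : measurableType d} (Pr : probability Om R)
    (f : R -> R) (u u' : Om -> R) (A : set Om) (eta e : R) :
  (forall t, `|f t| <= 1) -> (forall s t, `|f s - f t| <= `|s - t|) ->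
  bm (fun w => f (u w)) -> bm (fun w => f (u' w)) -> measurable A -> fine (Pr A) <= e -> 0 <= eta ->
  (forall w, ~ A w -> `|u w - u' w| <= eta) ->
  `|Ex Pr (fun w => f (u w)) - Ex Pr (fun w => f (u' w))| <= eta + 2 * e.
Proof.
move=> f1 fl bu bu' mA pA eta0 hA; have bA : bm (\1_A : Om -> R) by exact: bm_indic.
rewrite -ExB//; apply: (le_trans (Ex_abs _ (bmB bu bu'))).
apply: (@le_trans _ _ (Ex Pr (fun w => eta + 2 * \1_A w))).
  apply: Ex_le; [by apply: bm_norm; exact: bmB|by apply: bmD; [exact: bm_cst|exact: bmZ]|].
  move=> w; rewrite indicE; case: (boolP (w \in A)) => wA.
    rewrite mulr1; apply: (le_trans (ler_normB _ _)).
    by have := f1 (u w); have := f1 (u' w); lra.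
  rewrite mulr0 addr0; apply: (le_trans (fl _ _)); apply: hA => Aw.
  by move: wA; rewrite mem_set.
rewrite ExD; [|exact: bm_cst|exact: bmZ].
by rewrite Ex_cst ExZ// Ex_indic// lerD2l ler_wpM2l.
Qed.

Section CharacteristicLimit.
Context {R : realType} {dE} {E : measurableType dE} {d} {Om : measurableType d}.
Variables (Pr : probability Om R) (P : R.-pker E ~> E) (mu : probability E R).
Variable X : nat -> {RV Pr >-> E}.
Variables (K : nat -> R) (W T : nat -> E -> R) (v : nat -> R).
Variables (beta c p q q' : R) (psi : R -> R -> R[i]) (a : R).
Hypothesis H : stable_array P mu X K W T v beta c p q q' psi a.
Variable Y : nat -> Om -> skorokhod (R * R)%type.
Hypothesis YE : forall N w t, 0 <= t -> Y N w t =
  (\sum_(k < Num.truncn (K N * t)) W N (X k w) - v N * t, \sum_(k < Num.truncn (K N * t)) T N (X k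
    w)).
Local Open Scope complex_scope.

Let Kpos N : 0 < K N. Proof. exact: lt_le_trans (sa_K H N). Qed.

Lemma path_decomposition (t0 eta e : R) : 0 < t0 -> 0 < eta -> 0 < e ->
  exists2 d0 : R, 0 < d0 <= 1 & forall delta, 0 < delta -> delta <= d0 ->
  exists N0, forall N, (N0 <= N)%N -> exists A : set Om, [/\ measurable A, fine (Pr A) <= e &
    forall w, ~ A w -> forall t : R, 0 <= t <= t0 ->
    `|(Y N w t).1 - \sum_(k < Num.truncn (K N * t)) big_part delta (W N (X k w))
       - drift mu K W v delta N * t| <= eta /\
    `|(Y N w t).2 - \sum_(k < Num.truncn (K N * t)) big_image c p delta (W N (X k w))| <= eta].
Proof.
move=> t00 eta0 e0; have eta2 : 0 < eta / 2 by rewrite divr_gt0.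
have [d0 /andP[d00 d01] hd] := decomposition H t00 eta2 e0.
(* The second bound pays for replacing the integer part of [K t] by [K t] in the drift: the
   difference is at most one mean of a small jump, hence at most [delta]. *)
exists (Num.min d0 (eta / 2)); first by rewrite lt_min d00 eta2 ge_min d01.
move=> delta delta0; rewrite le_min => /andP[dd de].
have [N0 hN0] := hd delta delta0 dd; exists N0 => N /hN0[A [mA pA hA]].
exists A; split => // w nA t /andP[t_ge0 tt0].
have Kt : 0 <= K N * t by rewrite mulr_ge0// ltW.
have /andP[n1 n2'] := truncn_itv Kt.
have n2 : K N * t < (Num.truncn (K N * t))%:R + 1 by rewrite natr1.
have [|h1 h2] := hA w nA (Num.truncn (K N * t)).
  by rewrite (le_trans n1)// ler_wpM2l// ltW.
rewrite (YE _ _ t_ge0)/=; split; last by lra.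
set m1 := Ex mu (fun x => small_part delta (W N x)) in h1 *.
have m1d : `|m1| <= delta.
  apply: Ex_abs_le; first by apply: (bm_small_part H); exact: ltW.
  by move=> x; apply: abs_small_part; exact: ltW.
move: h1 n1 n2; rewrite /drift -/m1; set n := Num.truncn _.
move: (\sum_(k < n) big_part _ _) (\sum_(k < n) _) (n%:R : R) => B S nr h1 n1 n2.
rewrite (_ : S - v N * t - B - (K N * m1 - v N) * t = S - B - nr * m1 + (nr - K N * t) * m1); last
  ring.
apply: (le_trans (ler_normD _ _)).
have h3 : `|(nr - K N * t) * m1| <= delta.
  rewrite normrM; apply: (@le_trans _ _ (1 * delta)); last by rewrite mul1r.
  by apply: ler_pM => //; rewrite ler_norml; apply/andP; split; lra.
lra.
Qed.

Lemma measurable_coordinate N t : 0 <= t -> measurable_fun setT (fun w => (Y N w t).1) /\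
  measurable_fun setT (fun w => (Y N w t).2).
Proof.
move=> t_ge0; have mS (U : nat -> E -> R) : measurable_fun setT (U N) ->
    measurable_fun setT (fun w => \sum_(k < Num.truncn (K N * t)) U N (X k w)).
  move=> mU; apply: measurable_sum => k; apply: measurableT_comp => //; exact: measurable_chain.
split; last by under eq_fun do rewrite YE//; exact: mS (sa_mT H N).
under eq_fun do rewrite YE//.
by apply: measurable_funB; [exact: mS (sa_mW H N)|exact: measurable_cst].
Qed.

Variable m : nat.
Hypothesis m0 : (0 < m)%N.
Let L := (m ^ 2)%N.
Variables s1 s2 : nat -> R.

Let t (i : nat) : R := i%:R / m%:R.
Let n N (i : nat) := Num.truncn (K N * t i).

Let mR : 0 < m%:R :> R. Proof. by rewrite ltr0n. Qed.
Let t_ge0 i : 0 <= t i. Proof. by rewrite divr_ge0. Qed.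
Let tL : t L = m%:R. Proof. by rewrite /t /L natrX expr2 mulfK// gt_eqF. Qed.

Let n_nd N : nondecreasing_seq (n N).
Proof.
move=> i j ij; apply: le_truncn; rewrite ler_wpM2l ?(ltW (Kpos N))//.
by rewrite ler_wpM2r ?invr_ge0// ler_nat.
Qed.

Let n00 N : n N 0%N = 0%N.
Proof. by apply/eqP; rewrite /n /t mul0r mulr0 truncn0. Qed.

Let n_bounds N i : (n N i)%:R <= K N * t i /\ K N * t i < (n N i)%:R + 1.
Proof.
have Kt : 0 <= K N * t i by rewrite mulr_ge0// ltW.
by have /andP[] := truncn_itv Kt; rewrite natr1.
Qed.

Let eta1 j := tail_sum L s1 j.
Let eta2 j := tail_sum L s2 j.

Definition grid_dot (x : skorokhod (R * R)%type) : R :=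
  \sum_(i < L.+1) (s1 i * (x (t i)).1 + s2 i * (x (t i)).2).

(** The exponent of [grid_dot] for a process with independent stationary increments: after Abel
    summation the increment over the step [j], of length [1 / m], has the frequencies [eta1 j] and
    [eta2 j]. *)
Definition limit_exponent : R[i] :=
  (\sum_(j < L) complex.Re (psi (eta1 j) (eta2 j)) / m%:R) +i*
  (\sum_(j < L) complex.Im (psi (eta1 j) (eta2 j)) / m%:R).

Let phase delta N k x := jump_phase W c p (coef_at (n N) L s1 k) (coef_at (n N) L s2 k) delta N x.

Let dot_decomposition delta eta N w : 0 <= eta ->
  (forall t : R, 0 <= t <= m%:R ->
    `|(Y N w t).1 - \sum_(k < Num.truncn (K N * t)) big_part delta (W N (X k w))
       - drift mu K W v delta N * t| <= eta /\
    `|(Y N w t).2 - \sum_(k < Num.truncn (K N * t)) big_image c p delta (W N (X k w))| <= eta) ->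
  `|grid_dot (Y N w) - (\sum_(k < n N L) phase delta N k (X k w) +
     \sum_(j < L) eta1 j * (drift mu K W v delta N / m%:R))| <=
  \sum_(i < L.+1) (`|s1 i| + `|s2 i|) * eta.
Proof.
move=> eta0 h.
have E1 : \sum_(k < n N L) phase delta N k (X k w) =
    \sum_(i < L.+1) (s1 i * (\sum_(k < n N i) big_part delta (W N (X k w))) +
                     s2 i * (\sum_(k < n N i) big_image c p delta (W N (X k w)))).
  rewrite [RHS]big_split/= (abel_sum L (n_nd N) s1 (fun k => big_part delta (W N (X k w)))).
  rewrite (abel_sum L (n_nd N) s2 (fun k => big_image c p delta (W N (X k w)))).
  by rewrite -big_split.
have E2 : \sum_(j < L) eta1 j * (drift mu K W v delta N / m%:R) =
    \sum_(i < L.+1) s1 i * (drift mu K W v delta N * t i).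
  rewrite -tail_sum_linear; apply: eq_bigr => i _; congr (_ * _); rewrite /t; ring.
rewrite E1 E2 -big_split/= /grid_dot -sumrB; apply: (le_trans (ler_norm_sum _ _ _)).
apply: ler_sum => i _.
have [|h1 h2] := h (t i).
  rewrite t_ge0 -tL ler_wpM2r ?invr_ge0// ler_nat -ltnS; exact: ltn_ord.
have key (y1 y2 B I D a1 a2 : R) : `|y1 - B - D| <= eta -> `|y2 - I| <= eta ->
    `|a1 * y1 + a2 * y2 - (a1 * B + a2 * I + a1 * D)| <= (`|a1| + `|a2|) * eta.
  move=> k1 k2; rewrite [X in `|X|](_ : _ = a1 * (y1 - B - D) + a2 * (y2 - I)); last ring.
  by apply: (le_trans (ler_normD _ _)); rewrite !normrM mulrDl; apply: lerD; exact: ler_wpM2l.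
exact: key h1 h2.
Qed.

Lemma eventually_div (C e : R) : 0 < e -> \forall N \near \oo, C / K N <= e.
Proof.
move=> e0; have /cvgryPge/(_ (C / e)) h := sa_Koo H.
near=> N; have : C / e <= K N by near: N.
by rewrite ler_pdivrMr// [C / K N <= e]ler_pdivrMr// mulrC.
Unshelve. all: by end_near. Qed.

Let nKm N : (n N L)%:R <= K N * m%:R.
Proof. by have [h _] := n_bounds N L; rewrite -tL. Qed.

Let meas_phase delta N k : measurable_fun setT (phase delta N k).
Proof. exact: (measurable_jump_phase H). Qed.

(** [chain_char] for the level set at [delta], with [b <= A' / K] and at most [K m] steps; the error
    is a constant times the square root of [A' / K]. *)
Let phase_char_product delta e : 0 < delta -> 0 < e -> \forall N \near \oo,
  cmod ((Ex Pr (fun w => cos (\sum_(k < n N L) phase delta N k (X k w))) +i*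
         Ex Pr (fun w => sin (\sum_(k < n N L) phase delta N k (X k w)))) -
        \prod_(k < n N L) mean_char mu (phase delta N k)) <= e.
Proof.
move=> d0 e0; have [A A0 hA] := sa_tail H; have [C C0 hC] := sa_smooth H.
have [/andP[a0 a1] _] := sa_gap H.
pose A' := A * delta `^ (- beta); have A'0 : 0 <= A' by rewrite mulr_ge0 ?powR_ge0// ltW.
pose G := 24 * (C + 1) / (1 - a).
have G0 : 0 <= G by rewrite divr_ge0 ?subr_ge0 ?(ltW a1)// mulr_ge0// addr_ge0.
pose G1 := m%:R * (G * A'); have G10 : 0 <= G1 by rewrite mulr_ge0// mulr_ge0.
have G11 : 0 < G1 + 1 by rewrite ltr_wpDl.
have e1 : 0 < (e / (G1 + 1)) ^+ 2 by rewrite exprn_gt0// divr_gt0.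
have ev := eventually_div A' e1.
near=> N; pose B := [set x | delta <= `|W N x|].
have mB : measurable B by exact: (measurable_ge (measurableT_comp (@normr_measurable R setT) (sa_mW
  H N))).
apply: (le_trans (@chain_char _ _ _ _ _ Pr P mu X (sa_chain H) (sa_inv H) a B C (sa_gap H) mB C0 _
  (phase delta N) (n N L) (meas_phase delta N) _)).
- exact: hC _ _ (ltW d0).
- by move=> k x /negP; rewrite -ltNge => ?; exact: jump_phase_small.
have b0 : 0 <= fine (mu B) by exact: fine_ge0.
have Kb : fine (mu B) <= A' / K N by rewrite ler_pdivlMr// mulrC; exact: hA.
have AK : A' / K N <= (e / (G1 + 1)) ^+ 2 by near: N.
have sb : Num.sqrt (fine (mu B)) <= e / (G1 + 1).
  rewrite -[leRHS]ger0_norm ?divr_ge0 ?(ltW e0) ?(ltW G11)// -sqrtr_sqr ler_wsqrtr//.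
  exact: le_trans Kb AK.
have s0 := sqrtr_ge0 (fine (mu B)); rewrite -/G.
apply: (@le_trans _ _ (K N * m%:R * (G * (A' / K N) * (e / (G1 + 1))))).
  apply: ler_pM => //; first by rewrite mulr_ge0// mulr_ge0.
  by apply: ler_pM => //; [exact: mulr_ge0|exact: ler_wpM2l].
have -> : K N * m%:R * (G * (A' / K N) * (e / (G1 + 1))) = e * (G1 / (G1 + 1)).
  by rewrite /G1; field; rewrite gt_eqF// gt_eqF.
by rewrite ler_piMr ?(ltW e0)// ler_pdivrMr// mul1r lerDl.
Unshelve. all: by end_near. Qed.

Let mean_char_bound delta N k A' : 0 < delta ->
  (forall N l, 0 < l -> K N * fine (mu [set x | l <= `|W N x|]) <= A' * l `^ (- beta)) ->
  let z := mean_char mu (phase delta N k) - 1 in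
  [/\ z = complex.Re z +i* complex.Im z, complex.Re z <= 0,
    `|complex.Re z| <= 2 * (A' * delta `^ (- beta)) / K N &
    `|complex.Im z| <= 2 * (A' * delta `^ (- beta)) / K N].
Proof.
move=> d0 hA z; have [h1 h2] := jump_phase_bound H (coef_at (n N) L s1 k) (coef_at (n N) L s2 k) d0
  hA N.
have zE : z = (Ex mu (fun x => cos (phase delta N k x)) - 1) +i* Ex mu (fun x => sin (phase delta N
  k x)).
  by rewrite /z /mean_char; apply/eqP; rewrite eq_complex/= subr0 !eqxx.
rewrite zE; split => //=.
- rewrite subr_le0; apply: Ex_le_cst; first by apply: bm_cos; exact: meas_phase.
  by move=> x; exact: cos_le1.
- by rewrite ler_pdivlMr// mulrC -[X in X * _](gtr0_norm (Kpos N)) -normrM.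
- by rewrite ler_pdivlMr// mulrC -[X in X * _](gtr0_norm (Kpos N)) -normrM.
Qed.

(** Each factor is [1 + z] with [z] of order [1 / K], so [exp z] differs from it by order [1 / K^2],
    and there are at most [K m] factors. *)
Let product_exponential delta e : 0 < delta -> 0 < e -> \forall N \near \oo,
  cmod (\prod_(k < n N L) mean_char mu (phase delta N k) -
        cexp (\sum_(k < n N L) (mean_char mu (phase delta N k) - 1))) <= e.
Proof.
move=> d0 e0; have [A A0 hA] := sa_tail H.
pose A' := 2 * (A * delta `^ (- beta)).
have ev := eventually_div (m%:R * (8 * A' ^+ 2)) e0.
near=> N; rewrite cexp_sum.
have zh k := mean_char_bound N k d0 hA.
apply: (le_trans (cmod_prodB _ _ _)) => [k|k|].
- by apply: mean_char_le1; exact: meas_phase.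
- by have [-> x0 _ _] := zh k; rewrite cmod_cexp -expR0 ler_expR.
have KA : m%:R * (8 * A' ^+ 2) / K N <= e by near: N.
apply: le_trans KA.
apply: (@le_trans _ _ (\sum_(k < n N L) 8 * (A' / K N) ^+ 2)).
  apply: ler_sum => k _; rewrite cmodB; have [zE x0 hx hy] := zh k.
  move: zE x0 hx hy; set z := mean_char mu _ - 1 => zE x0 hx hy.
  have -> : cexp z - mean_char mu (phase delta N k) = cexp z - 1 - z by rewrite /z; ring.
  rewrite zE; apply: (le_trans (cexp_second_order _ x0)).
  have sq (u : R) : `|u| <= A' / K N -> u ^+ 2 <= (A' / K N) ^+ 2.
    by move=> hu; rewrite -(real_normK (num_real u)) lerXn2r ?nnegrE// (le_trans _ hu).
  have := sq _ hx; have := sq _ hy; lra.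
rewrite sumr_const card_ord -[_ *+ _]mulr_natl.
apply: (@le_trans _ _ (K N * m%:R * (8 * (A' / K N) ^+ 2))).
  by rewrite ler_wpM2r// mulr_ge0// sqr_ge0.
rewrite le_eqVlt; apply/orP; left; apply/eqP; field; by rewrite gt_eqF.
Unshelve. all: by end_near. Qed.

(** Inherited from [cos <= 1] before the limit. It places the limit exponent in the half-plane where
    [cexp] is Lipschitz. *)
Let Re_psi_le0 xi1 xi2 : complex.Re (psi xi1 xi2) <= 0.
Proof.
have h := sa_Re H (xi1 := xi1) (xi2 := xi2).
apply: (ler_cvg_to h (cvg_cst 0)); apply: nearW => N; apply: mulr_ge0_le0; first exact: ltW.
have mf : measurable_fun setT (fun x => W N x * xi1 + jump_image c p (W N x) * xi2).
  apply: measurable_funD; apply: measurable_funM; try exact: measurable_cst; first exact: sa_mW H N.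
  exact: (measurableT_comp (measurable_jump_image _ _) (sa_mW H N)).
apply: Ex_le_cst; first by apply: bmB; [exact: bm_cos|exact: bm_cst].
by move=> x; rewrite subr_le0 cos_le1.
Qed.

(** Rounding changes the length [K / m] of a block by at most one step, and a step contributes only
    order [1 / K] to the exponent. *)
Let n_increment N j : `|(n N j.+1 - n N j)%N%:R - K N / m%:R| <= 1.
Proof.
have [h1 h2] := n_bounds N j; have [h3 h4] := n_bounds N j.+1.
have E1 : K N * t j.+1 = K N * t j + K N / m%:R by rewrite /t -natr1; ring.
rewrite natrB; last exact: n_nd.
by move: h3 h4; rewrite E1 ler_norml => h3 h4; apply/andP; split; lra.
Qed.

Let riemann_error (nj k x D l r B e : R) : 0 < k -> 1 <= r -> 0 <= B -> 0 <= e -> `|nj - k / r| <=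
  1 -> `|x| <= B / k ->
  `|k * x + D - l| <= e -> `|nj * x + D / r - l / r| <= B / k + e.
Proof.
move=> k0 r1 B0 e0 h1 h2 h3; have r0 : 0 < r by exact: lt_le_trans r1.
rewrite (_ : _ - _ = (nj - k / r) * x + (k * x + D - l) / r); last by field; rewrite gt_eqF.
apply: (le_trans (ler_normD _ _)); apply: lerD.
  rewrite normrM -[leRHS]mul1r; exact: ler_pM.
rewrite normrM normfV (gtr0_norm r0) ler_pdivrMr//; apply: (le_trans h3).
by rewrite ler_peMr.
Qed.

Lemma block_exponent e : 0 < e -> exists2 d0 : R, 0 < d0 <= 1 & forall delta, 0 < delta -> delta <=
  d0 ->
  \forall N \near \oo,
  cmod (cexp (\sum_(k < n N L) (mean_char mu (phase delta N k) - 1) +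
              (0 +i* \sum_(j < L) eta1 j * (drift mu K W v delta N / m%:R))) - cexp limit_exponent)
                <= e.
Proof.
move=> e0; have [A A0 hA] := sa_tail H.
have l1 : 0 < L.+1%:R :> R by rewrite ltr0n.
(* Each of the [L] blocks errs by [2 e3], so the real and the imaginary part err by at most [e / 4]
   each, and [cexp_lip] doubles their sum. *)
pose e3 := e / (8 * L.+1%:R); have e30 : 0 < e3 by rewrite divr_gt0// mulr_gt0.
pose Q j delta := 0 < delta -> \forall N \near \oo,
  `|K N * (Ex mu (fun x => cos (jump_phase W c p (eta1 j) (eta2 j) delta N x)) - 1) -
     complex.Re (psi (eta1 j) (eta2 j))| <= e3 /\
  `|K N * Ex mu (fun x => sin (jump_phase W c p (eta1 j) (eta2 j) delta N x)) +
     eta1 j * drift mu K W v delta N - complex.Im (psi (eta1 j) (eta2 j))| <= e3.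
have [|d0 d01 hd] := @finite_threshold _ L Q.
  by move=> j; have [d1 d11 h] := exponent_limit H (eta1 j) (eta2 j) e30; exists d1 => // x x0 xd
    _; exact: h.
exists d0 => // delta delta0 dd.
have ev1 := finite_near (fun j jL => hd delta delta0 dd j jL delta0).
pose A' := 2 * (A * delta `^ (- beta)).
have A'0 : 0 <= A' by rewrite mulr_ge0// mulr_ge0 ?powR_ge0// ltW.
have ev2 := eventually_div A' e30.
near=> N.
have h1 j (jL : (j < L)%N) :
  `|K N * (Ex mu (fun x => cos (jump_phase W c p (eta1 j) (eta2 j) delta N x)) - 1) -
     complex.Re (psi (eta1 j) (eta2 j))| <= e3 /\
  `|K N * Ex mu (fun x => sin (jump_phase W c p (eta1 j) (eta2 j) delta N x)) +
     eta1 j * drift mu K W v delta N - complex.Im (psi (eta1 j) (eta2 j))| <= e3.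
  by move: j jL; near: N.
have h2 : A' / K N <= e3 by near: N.
pose xj j := Ex mu (fun x => cos (jump_phase W c p (eta1 j) (eta2 j) delta N x)) - 1.
pose yj j := Ex mu (fun x => sin (jump_phase W c p (eta1 j) (eta2 j) delta N x)).
have mE j : mean_char mu (jump_phase W c p (eta1 j) (eta2 j) delta N) - 1 = xj j +i* yj j.
  by rewrite /mean_char; apply/eqP; rewrite eq_complex/= subr0 !eqxx.
have sE : \sum_(k < n N L) (mean_char mu (phase delta N k) - 1) =
    (\sum_(j < L) (n N j.+1 - n N j)%N%:R * xj j) +i* (\sum_(j < L) (n N j.+1 - n N j)%N%:R * yj j).
  rewrite -(coef_block_sum L (n_nd N) (n00 N)
    (fun u1 u2 => Ex mu (fun x => cos (jump_phase W c p u1 u2 delta N x)) - 1) s1 s2).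
  rewrite -(coef_block_sum L (n_nd N) (n00 N)
    (fun u1 u2 => Ex mu (fun x => sin (jump_phase W c p u1 u2 delta N x))) s1 s2).
  rewrite -(sum_complex (n N L) (fun k => Ex mu (fun x => cos (phase delta N k x)) - 1)
    (fun k => Ex mu (fun x => sin (phase delta N k x)))); apply: eq_bigr => k _; rewrite /mean_char.
  by apply/eqP; rewrite eq_complex/= subr0 !eqxx.
have r1 : 1 <= m%:R :> R by rewrite ler1n.
have err j : (j < L)%N ->
    `|(n N j.+1 - n N j)%N%:R * xj j - complex.Re (psi (eta1 j) (eta2 j)) / m%:R| <= 2 * e3 /\
    `|(n N j.+1 - n N j)%N%:R * yj j + eta1 j * (drift mu K W v delta N / m%:R) -
       complex.Im (psi (eta1 j) (eta2 j)) / m%:R| <= 2 * e3.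
  move=> /h1[k1 k2]; have [b1 b2] := jump_phase_bound H (eta1 j) (eta2 j) delta0 hA N.
  have bd (x : R) : `|K N * x| <= A' -> `|x| <= A' / K N.
    by rewrite normrM (gtr0_norm (Kpos N)) => ?; rewrite ler_pdivlMr// mulrC.
  have g1 := @riemann_error _ _ _ 0 _ _ _ _ (Kpos N) r1 A'0 (ltW e30) (n_increment N j) (bd _ b1).
  have g2 := @riemann_error _ _ _ (eta1 j * drift mu K W v delta N) _ _ _ _ (Kpos N) r1 A'0 (ltW
    e30)
    (n_increment N j) (bd _ b2) k2.
  rewrite addr0 in g1; have := g1 _ k1; rewrite mul0r addr0 => g1'.
  rewrite [2 * e3]mulr_natl mulr2n; split; first by apply: (le_trans g1'); rewrite lerD2r.
  by rewrite mulrA; apply: (le_trans g2); rewrite lerD2r.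
have sumerr (f g : nat -> R) : (forall j, (j < L)%N -> `|f j - g j| <= 2 * e3) ->
    `|\sum_(j < L) f j - \sum_(j < L) g j| <= e / 4.
  move=> fg; rewrite -sumrB; apply: (le_trans (ler_norm_sum _ _ _)).
  apply: (@le_trans _ _ (\sum_(j < L) 2 * e3)); first by apply: ler_sum => j _; exact: fg.
  rewrite sumr_const card_ord -[_ *+ L]mulr_natl.
  apply: (@le_trans _ _ (L.+1%:R * (2 * e3))); first by rewrite ler_wpM2r ?ler_nat// mulr_ge0// ltW.
  by rewrite le_eqVlt; apply/orP; left; apply/eqP; rewrite /e3; field; rewrite gt_eqF.
rewrite sE; set D := \sum_(j < L) eta1 j * _.
have -> : (\sum_(j < L) (n N j.+1 - n N j)%N%:R * xj j) +i* (\sum_(j < L) (n N j.+1 - n N j)%N%:R *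
  yj j) + (0 +i* D) =
    (\sum_(j < L) (n N j.+1 - n N j)%N%:R * xj j) +i*
    (\sum_(j < L) ((n N j.+1 - n N j)%N%:R * yj j + eta1 j * (drift mu K W v delta N / m%:R))).
  by apply/eqP; rewrite eq_complex/= addr0 big_split/= !eqxx.
apply: (le_trans (cexp_lip _ _ _ _)).
- apply: sumr_le0 => j _; apply: mulr_ge0_le0 => //; rewrite subr_le0; apply: Ex_le_cst.
    by apply: bm_cos; exact: (measurable_jump_phase H).
  by move=> x; exact: cos_le1.
- by apply: sumr_le0 => j _; apply: mulr_le0_ge0.
have q1 := sumerr _ _ (fun j jL => proj1 (err j jL)).
have q2 := sumerr _ _ (fun j jL => proj2 (err j jL)).
apply: (@le_trans _ _ (2 * (e / 4 + e / 4))); last lra.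
by rewrite ler_wpM2l//; exact: lerD.
Unshelve. all: by end_near. Qed.

Lemma measurable_grid_dot N : measurable_fun setT (fun w => grid_dot (Y N w)).
Proof.
apply: measurable_sum => i; have [m1 m2] := measurable_coordinate N (t_ge0 i).
by apply: measurable_funD; apply: measurable_funM => //; exact: measurable_cst.
Qed.

(** Four replacements of cost [e / 4]: the path by its big jumps and drift, the chain by independent
    steps, the product by an exponential, and the exponent by its limit. The drift enters as a
    unimodular factor, which leaves the middle errors unchanged. *)
Theorem char_limit e : 0 < e -> \forall N \near \oo,
  cmod ((Ex Pr (fun w => cos (grid_dot (Y N w))) +i* Ex Pr (fun w => sin (grid_dot (Y N w)))) -
        cexp limit_exponent) <= e.
Proof.
move=> e0; pose S := \sum_(i < L.+1) (`|s1 i| + `|s2 i|).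
have S0 : 0 <= S by apply: sumr_ge0 => i _; rewrite addr_ge0.
have S1 : 0 < S + 1 by rewrite ltr_wpDl.
(* [trig_perturb] costs [3 e1] for the cosine and [3 e1] for the sine. *)
pose e1 := e / 24; have e10 : 0 < e1 by rewrite divr_gt0.
pose eta := e1 / (S + 1); have eta0 : 0 < eta by rewrite divr_gt0.
have e4 : 0 < e / 4 by rewrite divr_gt0.
have [d1 /andP[d10 d11] hd1] := path_decomposition mR eta0 e10.
have [d2 /andP[d20 d21] hd2] := block_exponent e4.
pose delta := Num.min d1 d2.
have delta0 : 0 < delta by rewrite lt_min d10.
have dd1 : delta <= d1 by rewrite ge_min lexx.
have dd2 : delta <= d2 by rewrite ge_min lexx orbT.
have [N0 hN0] := hd1 _ delta0 dd1.
have ev1 := phase_char_product delta0 e4; have ev2 := product_exponential delta0 e4.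
have ev3 := hd2 _ delta0 dd2.
near=> N.
have NN0 : (N0 <= N)%N by near: N; exists N0.
have T2 : cmod ((Ex Pr (fun w => cos (\sum_(k < n N L) phase delta N k (X k w))) +i*
    Ex Pr (fun w => sin (\sum_(k < n N L) phase delta N k (X k w)))) -
    \prod_(k < n N L) mean_char mu (phase delta N k)) <= e / 4 by near: N.
have T3 : cmod (\prod_(k < n N L) mean_char mu (phase delta N k) -
    cexp (\sum_(k < n N L) (mean_char mu (phase delta N k) - 1))) <= e / 4 by near: N.
have T4 : cmod (cexp (\sum_(k < n N L) (mean_char mu (phase delta N k) - 1) +
    (0 +i* \sum_(j < L) eta1 j * (drift mu K W v delta N / m%:R))) -
    cexp limit_exponent) <= e / 4 by near: N.
have [A [mA pA hA]] := hN0 N NN0.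
set D := \sum_(j < L) eta1 j * (drift mu K W v delta N / m%:R) in T4 *.
pose Phi w := \sum_(k < n N L) phase delta N k (X k w).
have mPhi : measurable_fun setT Phi.
  by apply: measurable_sum => k; apply: measurableT_comp; [exact: meas_phase|exact:
    measurable_chain].
have mPD : measurable_fun setT (fun w => Phi w + D) by apply: measurable_funD => //; exact:
  measurable_cst.
have close w : ~ A w -> `|grid_dot (Y N w) - (Phi w + D)| <= e1.
  move=> nA; apply: (le_trans (dot_decomposition (ltW eta0) (hA w nA))).
  rewrite -mulr_suml -/S /eta mulrCA ler_piMr ?(ltW e10)// ler_pdivrMr// mul1r lerDl//.
have mg := measurable_grid_dot N.
have T1 : cmod ((Ex Pr (fun w => cos (grid_dot (Y N w))) +i* Ex Pr (fun w => sin (grid_dot (Y N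
  w)))) -
    (Ex Pr (fun w => cos (Phi w + D)) +i* Ex Pr (fun w => sin (Phi w + D)))) <= e / 4.
  apply: (@le_trans _ _ ((e1 + 2 * e1) + (e1 + 2 * e1))); last by rewrite /e1; lra.
  apply: cmod_sub_le => /=.
    exact: (trig_perturb abs_cos_le1 (fun s t => cos_lip t s) (bm_cos mg) (bm_cos mPD) mA pA (ltW
      e10) close).
  exact: (trig_perturb abs_sin_le1 (fun s t => sin_lip t s) (bm_sin mg) (bm_sin mPD) mA pA (ltW
    e10) close).
have T0 : Ex Pr (fun w => cos (Phi w + D)) +i* Ex Pr (fun w => sin (Phi w + D)) =
    cexp (0 +i* D) * (Ex Pr (fun w => cos (Phi w)) +i* Ex Pr (fun w => sin (Phi w))).
  have bc := bm_cos mPhi; have bs := bm_sin mPhi.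
  under [X in Ex _ X +i* _]eq_fun do rewrite cosD mulrC [X in _ - X]mulrC.
  under [X in _ +i* Ex _ X]eq_fun do rewrite sinD mulrC [X in _ + X]mulrC.
  rewrite ExB; [|exact: bmZ|exact: bmZ]; rewrite ExD; [|exact: bmZ|exact: bmZ]; rewrite !ExZ//.
  by rewrite cexpE expR0 !mul1r; apply/eqP; rewrite eq_complex/=; apply/andP; split; apply/eqP;
    ring.
have c1 : cmod (cexp (0 +i* D)) = 1 by rewrite cmod_cexp expR0.
have mulD x y : cmod (x - y) <= e / 4 -> cmod (cexp (0 +i* D) * x - cexp (0 +i* D) * y) <= e / 4.
  by rewrite -mulrBr cmodM c1 mul1r.
have U2 := mulD _ _ T2; rewrite -T0 in U2.
have U3 := mulD _ _ T3; rewrite -cexpD [(0 +i* D) + _]addrC in U3.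
have chain (z0 z1 z2 z3 z4 : R[i]) : cmod (z0 - z1) <= e / 4 -> cmod (z1 - z2) <= e / 4 ->
    cmod (z2 - z3) <= e / 4 -> cmod (z3 - z4) <= e / 4 -> cmod (z0 - z4) <= e.
  by move=> k1 k2 k3 k4; have := cmod_dist z0 z4 z2; have := cmod_dist z0 z2 z1; have := cmod_dist
    z2 z4 z3; lra.
exact: chain T1 U2 U3 T4.
Unshelve. all: by end_near. Qed.

End CharacteristicLimit.

(** * Characteristic functions of Levy processes *)

Section IndependentProducts.
Context {R : realType} {d d0} {Om : measurableType d} {T : measurableType d0}.
Variables (Pr : probability Om R) (U : nat -> Om -> T) (n : nat).
Hypothesis mU : forall i, measurable_fun setT (U i).
Hypothesis indep : forall B : nat -> set T, (forall i, measurable (B i)) ->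
  Pr (\bigcap_(i in `I_n) [set w | B i (U i w)]) = (\prod_(i < n) Pr [set w | B i (U i w)])%E.

Let bmU (f : T -> R) i : bm f -> bm (fun w => f (U i w)).
Proof. by move=> bf; exact: bm_compT bf (mU i). Qed.

Let indic_case (B : nat -> set T) : (forall i, measurable (B i)) ->
  Ex Pr (fun w => \prod_(i < n) \1_(B i) (U i w)) = \prod_(i < n) Ex Pr (fun w => \1_(B i) (U i w)).
Proof.
move=> mB.
have mP i : measurable [set w | B i (U i w)].
  by have := mU i measurableT (mB i); rewrite setTI.
have iE (i : nat) : (fun w => \1_(B i) (U i w)) = \1_[set w | B i (U i w)] :> (Om -> R).
  by apply/funext => w; rewrite !indicE; congr (_%:R); apply/idP/idP; rewrite !inE.
under [RHS]eq_bigr => i _ do rewrite (iE i) (Ex_indic _ (mP i)).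
rewrite (_ : (fun w => _) = \1_(\bigcap_(i in `I_n) [set w | B i (U i w)])); last first.
  apply/funext => w; rewrite indicE; case: (boolP (w \in _)) => [|/negP].
    by rewrite inE => h; rewrite big1// => i _; rewrite indicE mem_set//; exact: (h i (ltn_ord i)).
  rewrite inE => h; have [i iB] : exists i : 'I_n, ~ B i (U i w).
    by apply: contrapT => hn; apply: h => i /= ni; apply: contrapT => hB; apply: hn; exists
      (Ordinal ni).
  by rewrite (bigD1 i)//= indicE memNset// mul0r.
rewrite Ex_indic; last by apply: bigcap_measurableType => i _; exact: mP.
apply: EFin_inj; rewrite fine_muE; last by apply: bigcap_measurableType => i _; exact: mP.
rewrite indep// (big_morph EFin EFinM erefl); apply: eq_bigr => i _.
by rewrite fine_muE.
Qed.

(** Indicators are replaced by bounded functions one coordinate at a time: in [Q k] the first [k]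
    functions are arbitrary and the others are indicators. *)
Lemma Ex_prod_independent (F : nat -> T -> R) : (forall i, bm (F i)) ->
  Ex Pr (fun w => \prod_(i < n) F i (U i w)) = \prod_(i < n) Ex Pr (fun w => F i (U i w)).
Proof.
pose Q k := forall F : nat -> T -> R, (forall i, bm (F i)) ->
  (forall i, (k <= i < n)%N -> exists2 B, measurable B & F i = \1_B) ->
  Ex Pr (fun w => \prod_(i < n) F i (U i w)) = \prod_(i < n) Ex Pr (fun w => F i (U i w)).
suff hQ k : Q k.
  by move=> bF; apply: (hQ n) => // i /andP[/leq_ltn_trans h /h]; rewrite ltnn.
elim: k => [|k IH] {}F bF hF.
  have /choice[B hB] : forall i, exists B, measurable B /\ ((i < n)%N -> F i = \1_B).
    move=> i; have [ni|ni] := ltnP i n; last by exists setT.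
    by have [B mB FB] := hF i ni; exists B.
  have FB (i : 'I_n) : F i = \1_(B i) := proj2 (hB i) (ltn_ord i).
  under eq_fun do under eq_bigr => i _ do rewrite FB.
  under [RHS]eq_bigr => i _ do rewrite FB.
  by apply: indic_case => i; case: (hB i).
have [kn|nk] := ltnP k n; last first.
  by apply: IH => // i /andP[ki ni]; have := leq_ltn_trans (leq_trans nk ki) ni; rewrite ltnn.
pose rest w := \prod_(i < n | i != Ordinal kn) F i (U i w).
pose crest := \prod_(i < n | i != Ordinal kn) Ex Pr (fun w => F i (U i w)).
have brest : bm rest by apply: bm_prod => i; exact: bmU.
pose L f := Ex Pr (fun w => f (U k w) * rest w) - Ex Pr (fun w => f (U k w)) * crest.
suff L0 : L (F k) = 0.
  rewrite [RHS](bigD1 (Ordinal kn))//=; under eq_fun do rewrite (bigD1 (Ordinal kn))//=.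
  by apply/eqP; rewrite -subr_eq0; apply/eqP.
have [_ [M hM]] := brest.
apply: (bm_linear_eq0 (L := L) (C := M + `|crest|)) (bF k).
- move=> f g bf bg; rewrite /L; have k1 := bmU k bf; have k2 := bmU k bg.
  under eq_fun do rewrite mulrDl.
  by rewrite !ExD//; [ring|exact: bmM|exact: bmM].
- move=> c f bf; rewrite /L; have k1 := bmU k bf.
  under eq_fun do rewrite -mulrA.
  by rewrite !ExZ//; [ring|exact: bmM].
- move=> A mA; rewrite /L; pose F' i := if i == k then \1_A else F i.
  have bF' i : bm (F' i) by rewrite /F'; case: ifP => _ //; exact: bm_indic.
  have ne (i : 'I_n) : i != Ordinal kn -> F' i = F i.
    by rewrite /F' -val_eqE/= => /negbTE ->.
  have E1 : (fun w => \prod_(i < n) F' i (U i w)) = (fun w => \1_A (U k w) * rest w).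
    apply/funext => w; rewrite (bigD1 (Ordinal kn))//= {1}/F' eqxx; congr (_ * _).
    by apply: eq_bigr => i /ne ->.
  have E2 : \prod_(i < n) Ex Pr (fun w => F' i (U i w)) = Ex Pr (fun w => \1_A (U k w)) * crest.
    rewrite (bigD1 (Ordinal kn))//= {1}/F' eqxx; congr (_ * _).
    by apply: eq_bigr => i /ne ->.
  rewrite -E1 -E2 IH//; first by rewrite subrr.
  move=> i /andP[ki ni]; rewrite /F'; case: (i =P k) => [_|/eqP ik]; first by exists A.
  by apply: hF; rewrite ltn_neqAle eq_sym ik ki.
- move=> f r bf fr; rewrite /L; have k1 := bmU k bf.
  apply: (le_trans (ler_normB _ _)); rewrite mulrDl; apply: lerD.
    by apply: Ex_abs_le => [|w]; [exact: bmM|rewrite normrM mulrC; exact: ler_pM].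
  by rewrite normrM mulrC ler_wpM2l//; exact: Ex_abs_le.
Qed.

End IndependentProducts.

Section IndependentCharacters.
Context {R : realType} {d d0} {Om : measurableType d} {T : measurableType d0}.
Variables (Pr : probability Om R) (U : nat -> Om -> T) (n : nat) (th : nat -> T -> R).
Hypothesis mU : forall i, measurable_fun setT (U i).
Hypothesis mth : forall i, measurable_fun setT (th i).
Hypothesis indep : forall B : nat -> set T, (forall i, measurable (B i)) ->
  Pr (\bigcap_(i in `I_n) [set w | B i (U i w)]) = (\prod_(i < n) Pr [set w | B i (U i w)])%E.
Local Open Scope complex_scope.

Let phase k w := \sum_(j < k) th j (U j w).

Let mphase k : measurable_fun setT (phase k).
Proof. by apply: measurable_sum => i; exact: measurableT_comp. Qed.

Let char i : R[i] := Ex Pr (fun w => cos (th i (U i w))) +i* Ex Pr (fun w => sin (th i (U i w))).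

(** Products of complex factors are obtained from real ones: the first [k] characters are already
    merged into the cosine and sine of a partial sum, and the other coordinates carry arbitrary real
    functions, among them the next cosine and sine. *)
Let partial k (G : nat -> T -> R) : (k <= n)%N -> (forall i, bm (G i)) ->
  Ex Pr (fun w => cos (phase k w) * \prod_(k <= i < n) G i (U i w)) +i*
  Ex Pr (fun w => sin (phase k w) * \prod_(k <= i < n) G i (U i w)) =
  \prod_(i < k) char i * (\prod_(k <= i < n) Ex Pr (fun w => G i (U i w)))%:C.
Proof.
elim: k G => [|k IH] G kn bG.
  under [X in Ex _ X +i* _]eq_fun do rewrite /phase big_ord0 cos0 mul1r big_mkord.
  under [X in _ +i* Ex _ X]eq_fun do rewrite /phase big_ord0 sin0 mul0r.
  by rewrite Ex_cst big_ord0 mul1r (Ex_prod_independent mU indep)// big_mkord.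
have bprod : bm (fun w => \prod_(k.+1 <= i < n) G i (U i w)).
  by apply: bm_prod => i; exact: bm_compT (bG i) (mU i).
have bc := bm_cos (mphase k); have bs := bm_sin (mphase k).
have btc : bm (fun x => cos (th k x)) by exact: bm_cos.
have bts : bm (fun x => sin (th k x)) by exact: bm_sin.
have bc1 := bm_compT btc (mU k); have bs1 := bm_compT bts (mU k).
pose G' f i := if i == k then f else G i.
have bG' f i : bm f -> bm (G' f i) by move=> bf; rewrite /G'; case: ifP.
have G'E f w : \prod_(k <= i < n) G' f i (U i w) = f (U k w) * \prod_(k.+1 <= i < n) G i (U i w).
  rewrite big_ltn// /G' eqxx; congr (_ * _); apply: eq_big_nat => i /andP[ki _].
  by rewrite (gtn_eqF ki).
have G'X f : \prod_(k <= i < n) Ex Pr (fun w => G' f i (U i w)) =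
    Ex Pr (fun w => f (U k w)) * \prod_(k.+1 <= i < n) Ex Pr (fun w => G i (U i w)).
  rewrite big_ltn// /G' eqxx; congr (_ * _); apply: eq_big_nat => i /andP[ki _].
  by rewrite (gtn_eqF ki).
have h1 := IH (G' (fun x => cos (th k x))) (ltnW kn) (fun i => bG' _ i btc).
have h2 := IH (G' (fun x => sin (th k x))) (ltnW kn) (fun i => bG' _ i bts).
rewrite !G'X in h1 h2.
have E f g : (fun w => f (phase k w) * \prod_(k <= i < n) G' g i (U i w)) =
    (fun w => f (phase k w) * (g (U k w) * \prod_(k.+1 <= i < n) G i (U i w))).
  by apply/funext => w; rewrite G'E.
rewrite !E in h1 h2.
have -> : (fun w => cos (phase k.+1 w) * \prod_(k.+1 <= i < n) G i (U i w)) =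
    (fun w => cos (phase k w) * (cos (th k (U k w)) * \prod_(k.+1 <= i < n) G i (U i w)) -
              sin (phase k w) * (sin (th k (U k w)) * \prod_(k.+1 <= i < n) G i (U i w))).
  by apply/funext => w; rewrite /phase big_ord_recr cosD; ring.
have -> : (fun w => sin (phase k.+1 w) * \prod_(k.+1 <= i < n) G i (U i w)) =
    (fun w => sin (phase k w) * (cos (th k (U k w)) * \prod_(k.+1 <= i < n) G i (U i w)) +
              cos (phase k w) * (sin (th k (U k w)) * \prod_(k.+1 <= i < n) G i (U i w))).
  by apply/funext => w; rewrite /phase big_ord_recr sinD; ring.
have b1 := bmM bc1 bprod; have b2 := bmM bs1 bprod.
rewrite ExB; [|exact: bmM|exact: bmM]; rewrite ExD; [|exact: bmM|exact: bmM].
set c1 := Ex Pr _ in h1 *; set c2 := Ex Pr _ in h2 *; set s1 := Ex Pr _ in h1 *; set s2 := Ex Pr _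
  in h2 *.
have -> : (c1 - s2) +i* (s1 + c2) = (c1 +i* s1) + (0 +i* 1) * (c2 +i* s2).
  by apply/eqP; rewrite eq_complex/=; apply/andP; split; apply/eqP; ring.
rewrite h1 h2 big_ord_recr/= !rmorphM/=.
have -> : char k = (Ex Pr (fun w => cos (th k (U k w))))%:C + (0 +i* 1) * (Ex Pr (fun w => sin (th
  k (U k w))))%:C.
  by apply/eqP; rewrite eq_complex/=; apply/andP; split; apply/eqP; ring.
ring.
Qed.

Lemma char_independent :
  Ex Pr (fun w => cos (\sum_(j < n) th j (U j w))) +i* Ex Pr (fun w => sin (\sum_(j < n) th j (U j
    w))) =
  \prod_(j < n) (Ex Pr (fun w => cos (th j (U j w))) +i* Ex Pr (fun w => sin (th j (U j w)))).
Proof.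
have := partial (leqnn n) (fun=> bm_cst 1).
under [X in Ex _ X +i* _]eq_fun do rewrite big_geq// mulr1.
under [X in _ +i* Ex _ X]eq_fun do rewrite big_geq// mulr1.
by rewrite big_geq// mulr1.
Qed.

End IndependentCharacters.

Section LevyCharacter.
Context {R : realType} {d} {Om : measurableType d}.
Variables (Pr : probability Om R) (Z : Om -> skorokhod (R * R)%type) (psi : R -> R -> R[i]).
Hypothesis Z_levy : levy_process Pr Z.
Hypothesis Z_exponent : has_exponent Pr Z psi.
Local Open Scope complex_scope.

Lemma Ex_same_law {d0} {T : measurableType d0} (U U' : Om -> T) (f : T -> R) :
  measurable_fun setT U -> measurable_fun setT U' ->
  (forall B, measurable B -> Pr [set w | B (U w)] = Pr [set w | B (U' w)]) -> bm f ->
  Ex Pr (fun w => f (U w)) = Ex Pr (fun w => f (U' w)).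
Proof.
move=> mU mU' law bf; apply/eqP; rewrite -subr_eq0; apply/eqP.
apply: (bm_linear_eq0 (L := fun f => Ex Pr (fun w => f (U w)) - Ex Pr (fun w => f (U' w))) (C :=
  2)) bf.
- move=> g h bg bh; have k1 := bm_compT bg mU; have k2 := bm_compT bg mU'.
  have k3 := bm_compT bh mU; have k4 := bm_compT bh mU'.
  by rewrite !ExD//; ring.
- move=> c g bg; have k1 := bm_compT bg mU; have k2 := bm_compT bg mU'.
  by rewrite !ExZ//; ring.
- move=> B mB; have E (V : Om -> T) : (fun w => \1_B (V w)) = \1_[set w | B (V w)] :> (Om -> R).
    by apply/funext => w; rewrite !indicE; congr (_%:R); apply/idP/idP; rewrite !inE.
  have mV (V : Om -> T) : measurable_fun setT V -> measurable [set w | B (V w)].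
    by move=> mV; have := mV measurableT _ mB; rewrite setTI.
  by rewrite !E !Ex_indic; [rewrite law ?subrr|exact: mV|exact: mV].
- move=> g r bg gr; apply: (le_trans (ler_normB _ _)); rewrite mulr_natl mulr2n.
  by apply: lerD; apply: Ex_abs_le => //; exact: bm_compT.
Qed.

Let trig_null (f : R -> R) (u u' : Om -> R) (A : set Om) :
  (forall t, `|f t| <= 1) -> (forall s t, `|f s - f t| <= `|s - t|) ->
  bm (fun w => f (u w)) -> bm (fun w => f (u' w)) -> measurable A -> fine (Pr A) <= 0 ->
  (forall w, ~ A w -> u w = u' w) -> Ex Pr (fun w => f (u w)) = Ex Pr (fun w => f (u' w)).
Proof.
move=> f1 fl bu bu' mA pA hA; apply/eqP; rewrite -subr_eq0 -normr_le0.
have := trig_perturb f1 fl bu bu' mA pA (lexx 0); rewrite mulr0 addr0; apply => w /hA ->.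
by rewrite subrr normr0.
Qed.

Let start : exists A : set Om, [/\ measurable A, fine (Pr A) <= 0 & forall w, ~ A w -> Z w 0 = 0].
Proof.
have [A [mA A0 hA]] := levy_start Z_levy; exists A; split => //; first by rewrite A0.
by move=> w nA; apply: contrapT => h; apply: nA; exact: hA.
Qed.

Let mZ t : measurable_fun setT (fun w => (Z w t).1) /\ measurable_fun setT (fun w => (Z w t).2).
Proof.
have := levy_measurable Z_levy t => mz.
by split; [exact: (measurableT_comp measurable_fst mz)|exact: (measurableT_comp measurable_snd mz)].
Qed.

Let mdiff s t : measurable_fun setT (fun w => Z w t - Z w s).
Proof.
have [m1 m2] := mZ t; have [m3 m4] := mZ s.
rewrite (_ : (fun w => _) = (fun w => ((Z w t).1 - (Z w s).1, (Z w t).2 - (Z w s).2))); last first.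
  by apply/funext => w; case: (Z w t) => ? ?; case: (Z w s) => ? ?.
by apply: measurable_fun_pair; exact: measurable_funB.
Qed.

Let lin (u1 u2 : R) (x : R * R) : R := u1 * x.1 + u2 * x.2.

Let mlin u1 u2 : measurable_fun setT (lin u1 u2).
Proof. by apply: measurable_funD; apply: measurable_funM => //; exact: measurable_cst. Qed.

Let char_at t u1 u2 : 0 <= t ->
  Ex Pr (fun w => cos (lin u1 u2 (Z w t))) +i* Ex Pr (fun w => sin (lin u1 u2 (Z w t))) =
  cexp (t%:C * psi u1 u2).
Proof.
move=> t_ge0; rewrite -Z_exponent// /cintegral /Ex /Rintegral.
by congr (fine _ +i* fine _); apply: eq_integral => w _; rewrite cexpE /= expR0 mul1r.
Qed.

Let char_increment s t u1 u2 : 0 <= s -> s <= t ->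
  Ex Pr (fun w => cos (lin u1 u2 (Z w t - Z w s))) +i* Ex Pr (fun w => sin (lin u1 u2 (Z w t - Z w
    s))) =
  cexp ((t - s)%:C * psi u1 u2).
Proof.
move=> s0 st; rewrite -char_at ?subr_ge0//.
have [A [mA pA hA]] := start.
have key (f : R -> R) : (forall t, `|f t| <= 1) -> (forall s t, `|f s - f t| <= `|s - t|) ->
    (forall u : R * R -> R, measurable_fun setT u -> bm (fun x => f (u x))) ->
    Ex Pr (fun w => f (lin u1 u2 (Z w t - Z w s))) = Ex Pr (fun w => f (lin u1 u2 (Z w (t - s)))).
  move=> f1 fl bf; have bfl := bf _ (mlin u1 u2).
  rewrite (Ex_same_law (mdiff s t) (mdiff 0 (t - s)) _ bfl); last first.
    by move=> B mB; exact: levy_stationary.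
  have b1 := bm_compT bfl (mdiff 0 (t - s)).
  have b2 := bm_compT bfl (levy_measurable Z_levy (t - s)).
  by apply: (trig_null f1 fl b1 b2 mA pA) => w /hA ->; rewrite subr0.
congr (_ +i* _); apply: key => //.
- exact: abs_cos_le1.
- by move=> *; exact: cos_lip.
- by move=> u; exact: bm_cos.
- exact: abs_sin_le1.
- by move=> *; exact: sin_lip.
- by move=> u; exact: bm_sin.
Qed.

(** Abel summation rewrites [grid_dot] as a combination of increments, which are independent; it
    uses that the process starts at 0, almost surely. *)
Theorem levy_char m (s1 s2 : nat -> R) : (0 < m)%N ->
  Ex Pr (fun w => cos (grid_dot m s1 s2 (Z w))) +i* Ex Pr (fun w => sin (grid_dot m s1 s2 (Z w))) =
  cexp (limit_exponent psi m s1 s2).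
Proof.
move=> m0; have mR : 0 < m%:R :> R by rewrite ltr0n.
pose L := (m ^ 2)%N; pose t (i : nat) : R := i%:R / m%:R.
have t_nd : nondecreasing_seq t by move=> i j ij; rewrite ler_wpM2r ?invr_ge0// ler_nat.
have t0 : t 0%N = 0 by rewrite /t mul0r.
pose U j w := Z w (t j.+1) - Z w (t j).
pose e1 j := tail_sum L s1 j; pose e2 j := tail_sum L s2 j.
pose D w := \sum_(j < L) lin (e1 j) (e2 j) (U j w).
have dotE w : Z w 0 = 0 -> grid_dot m s1 s2 (Z w) = D w.
  move=> Z0; have ZE i : Z w (t i) = \sum_(k < i) U k w.
    elim: i => [|i IH]; first by rewrite big_ord0 t0.
    by rewrite big_ord_recr/= -IH /U addrC subrK.
  have Z1 i : (Z w (t i)).1 = \sum_(k < i) (U k w).1.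
    by rewrite ZE; elim: (i) => [|j IH]; rewrite ?big_ord0// !big_ord_recr/= -IH.
  have Z2 i : (Z w (t i)).2 = \sum_(k < i) (U k w).2.
    by rewrite ZE; elim: (i) => [|j IH]; rewrite ?big_ord0// !big_ord_recr/= -IH.
  rewrite /grid_dot /D /lin !big_split/=.
  have id_nd : nondecreasing_seq (@id nat) by [].
  congr (_ + _).
    rewrite -(abel_sum L id_nd s1 (fun k => (U k w).1)); apply: eq_bigr => i _.
    by rewrite -Z1.
  rewrite -(abel_sum L id_nd s2 (fun k => (U k w).2)); apply: eq_bigr => i _.
  by rewrite -Z2.
have mU j : measurable_fun setT (U j) by exact: mdiff.
have mD : measurable_fun setT D by apply: measurable_sum => j; exact: measurableT_comp (mU j).
have mg : measurable_fun setT (fun w => grid_dot m s1 s2 (Z w)).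
  apply: measurable_sum => i; have [k1 k2] := mZ (i%:R / m%:R).
  by apply: measurable_funD; apply: measurable_funM => //; exact: measurable_cst.
have [A [mA pA hA]] := start.
have repl (f : R -> R) : (forall t, `|f t| <= 1) -> (forall s t, `|f s - f t| <= `|s - t|) ->
    (forall u : Om -> R, measurable_fun setT u -> bm (fun x => f (u x))) ->
    Ex Pr (fun w => f (grid_dot m s1 s2 (Z w))) = Ex Pr (fun w => f (D w)).
  move=> f1 fl bf; apply: (trig_null f1 fl (bf _ mg) (bf _ mD) mA pA) => w.
  by move=> /hA /dotE ->.
rewrite (repl cos)//; [|exact: abs_cos_le1|by move=> *; exact: cos_lip|by move=> u; exact: bm_cos].
rewrite (repl sin)//; [|exact: abs_sin_le1|by move=> *; exact: sin_lip|by move=> u; exact: bm_sin].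
rewrite (char_independent mU (fun j => mlin (e1 j) (e2 j))); last first.
  by move=> B mB; apply: (levy_independent Z_levy) => //; rewrite t0.
rewrite (eq_bigr (fun j : 'I_L => cexp ((m%:R^-1)%:C * psi (e1 j) (e2 j)))); last first.
  move=> j _; rewrite char_increment; last first.
  - exact: t_nd.
  - by rewrite divr_ge0.
  by rewrite /t -mulrBl -natrB// subSnn mul1r.
rewrite -cexp_sum; congr cexp; rewrite /limit_exponent -/L.
rewrite -(sum_complex L (fun j => complex.Re (psi (e1 j) (e2 j)) / m%:R)
  (fun j => complex.Im (psi (e1 j) (e2 j)) / m%:R)); apply: eq_bigr => j _.
by case: (psi _ _) => x y; apply/eqP; rewrite eq_complex/=; apply/andP; split; apply/eqP; ring.
Qed.

End LevyCharacter.

(** * Tightness *)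

Lemma large_power {R : realType} (C e eps : R) : 0 <= C -> 0 < e -> 0 < eps ->
  exists2 l : R, 0 < l & C * l `^ (- e) <= eps.
Proof.
move=> C0 e0 eps0; have C1 : 0 < C + 1 by rewrite ltr_wpDl.
have r0 : 0 < (C + 1) / eps by rewrite divr_gt0.
exists (((C + 1) / eps) `^ e^-1); first exact: powR_gt0.
rewrite powRN -powRrM mulVf ?gt_eqF// powRr1 ?(ltW r0)// invf_div mulrCA.
by rewrite ler_piMr ?(ltW eps0)// ler_pdivrMr// mul1r lerDl.
Qed.

Section Tightness.
Context {R : realType} {dE} {E : measurableType dE} {d} {Om : measurableType d}.
Variables (Pr : probability Om R) (P : R.-pker E ~> E) (mu : probability E R).
Variable X : nat -> {RV Pr >-> E}.
Variables (K : nat -> R) (W T : nat -> E -> R) (v : nat -> R).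
Variables (beta c p q q' : R) (psi : R -> R -> R[i]) (a : R).
Hypothesis H : stable_array P mu X K W T v beta c p q q' psi a.
Variable Y : nat -> Om -> skorokhod (R * R)%type.
Hypothesis YE : forall N w t, 0 <= t -> Y N w t =
  (\sum_(k < Num.truncn (K N * t)) W N (X k w) - v N * t, \sum_(k < Num.truncn (K N * t)) T N (X k
    w)).

Let Kpos N : 0 < K N. Proof. exact: lt_le_trans (sa_K H N). Qed.

Let big N (l : R) := [set x | l <= `|W N x|].

Let mbig N l : measurable (big N l).
Proof. exact: (measurable_ge (measurableT_comp (@normr_measurable R setT) (sa_mW H N))). Qed.

Let horizon N (t0 : R) : 0 <= t0 -> (Num.truncn (K N * t0))%:R <= K N * t0.
Proof. by move=> h; rewrite truncn_le mulr_ge0// ltW. Qed.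

(** With high probability no jump exceeds some [l] and fewer than [M] jumps exceed [d0], so the sum
    of big jumps is at most [M] times the largest one; the drift is bounded. *)
Lemma bounded_paths (t0 e : R) : 0 < t0 -> 0 < e -> exists B : R, exists N0, forall N, (N0 <= N)%N
  ->
  exists A : set Om, [/\ measurable A, fine (Pr A) <= e &
    forall w, ~ A w -> forall t : R, 0 <= t <= t0 -> `|(Y N w t).1| <= B /\ `|(Y N w t).2| <= B].
Proof.
move=> t00 e0; have e3 : 0 < e / 3 by rewrite divr_gt0.
have c0 := sa_c H; have beta0 := sa_beta H.
have [A A0 hA] := sa_tail H.
have [d0 d01 hd] := path_decomposition H YE t00 (@ltr01 R) e3.
have /andP[d00 d11] := d01.
have [N0 hN0] := hd d0 d00 (lexx _).
have [D hD] := drift_bound H d01.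
have tA0 : 0 <= t0 * A by rewrite mulr_ge0 ?ltW.
have [l l0 hl] := large_power tA0 beta0 e3.
(* A bound on the mean number of jumps above [d0], divided by the probability allowed to Markov's
   inequality. *)
pose M := t0 * A * d0 `^ (- beta) / (e / 3) + 1.
have M0 : 0 < M by rewrite ltr_wpDl// divr_ge0 ?(ltW e3)// mulr_ge0 ?powR_ge0.
pose B := 1 + M * l + M * jump_image c p l + D * t0.
have jl0 : 0 < jump_image c p l by rewrite mulr_gt0// powR_gt0// normr_gt0 gt_eqF.
exists B, N0 => N /hN0[A1 [mA1 pA1 hA1]].
pose n := Num.truncn (K N * t0); have nK := horizon N (ltW t00).
have [A2 [mA2 pA2 hA2]] := hit_bound H n (mbig N l).
have bI : bm (\1_(big N d0) : E -> R) by exact: bm_indic.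
have I0 x : 0 <= (\1_(big N d0) x : R) by [].
have [A3 [mA3 pA3 hA3]] := sum_markov H n bI I0 M0.
have tail (r : R) : 0 < r -> n%:R * fine (mu (big N r)) <= t0 * A * r `^ (- beta).
  move=> r0; apply: (@le_trans _ _ (K N * t0 * fine (mu (big N r)))).
    by rewrite ler_wpM2r// fine_ge0.
  rewrite (_ : K N * t0 * _ = t0 * (K N * fine (mu (big N r)))); last ring.
  by rewrite -[leRHS]mulrA ler_wpM2l ?(ltW t00)//; exact: hA.
exists (A1 `|` A2 `|` A3); split.
- by apply: measurableU => //; exact: measurableU.
- apply: measure_cover3 => //.
    by apply: (le_trans pA2); exact: le_trans (tail l l0) hl.
  apply: (le_trans pA3); rewrite Ex_indic// ler_pdivrMr//.
  apply: (le_trans (tail d0 d00)); rewrite /M mulrDr mulr1 [e / 3 * _]mulrC divfK ?gt_eqF//.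
  by rewrite lerDl ltW.
move=> w nA t /andP[t_ge0 tt0].
have nA1 : ~ A1 w by move=> h; apply: nA; left; left.
have nA2 : ~ A2 w by move=> h; apply: nA; left; right.
have nA3 : ~ A3 w by move=> h; apply: nA; right.
have [|h1 h2] := hA1 w nA1 t; first by rewrite t_ge0.
have tn : (Num.truncn (K N * t) <= n)%N by apply: le_truncn; rewrite ler_wpM2l// ltW.
have count (f : R -> R) (r : R) : 0 <= r -> (forall y, `|y| < d0 -> f y = 0) ->
    (forall y, `|y| <= l -> `|f y| <= r) -> `|\sum_(k < Num.truncn (K N * t)) f (W N (X k w))| <= M
      * r.
  move=> r0 f0 fr; apply: (le_trans (ler_norm_sum _ _ _)).
  apply: (@le_trans _ _ (\sum_(k < n) \1_(big N d0) (X k w) * r)).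
    rewrite (big_ord_widen n (fun k => `|f (W N (X k w))|) tn) big_mkcond/=.
    apply: ler_sum => k _; case: ifP => _; last by rewrite mulr_ge0.
    rewrite indicE; case: (boolP (X k w \in big N d0)) => [_|/negP h].
      by rewrite mul1r; apply: fr; rewrite leNgt; apply/negP => /ltW; exact: hA2 w nA2 k (ltn_ord
        k).
    by rewrite mul0r f0 ?normr0// ltNge; apply/negP => h'; apply: h; rewrite inE.
  by rewrite -mulr_suml ler_wpM2r// ltW// hA3.
have j1 : `|\sum_(k < Num.truncn (K N * t)) big_part d0 (W N (X k w))| <= M * l.
  apply: count; rewrite ?(ltW l0)//; first by move=> y h; rewrite /big_part h.
  by move=> y yl; rewrite /big_part; case: ifP => _ //; rewrite normr0 ltW.
have j2 : `|\sum_(k < Num.truncn (K N * t)) big_image c p d0 (W N (X k w))| <= M * jump_image c p l.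
  apply: count; rewrite ?(ltW jl0)//; first by move=> y h; rewrite /big_image h.
  move=> y yl; rewrite /big_image; case: ifP => _; first by rewrite normr0 ltW.
  have [q0 _ qp] := sa_q H; have p0 : 0 < p by exact: lt_trans qp.
  rewrite ger0_norm ?mulr_ge0 ?powR_ge0 ?(ltW c0)// ler_wpM2l ?(ltW c0)//.
  by apply: ge0_ler_powR; rewrite ?nnegrE ?(ltW p0)// (gtr0_norm l0).
have j3 : `|drift mu K W v d0 N * t| <= D * t0.
  rewrite normrM; apply: ler_pM => //; by rewrite ger0_norm.
have Ml : 0 <= M * l by rewrite mulr_ge0 ?ltW.
have Mj : 0 <= M * jump_image c p l by rewrite mulr_ge0 ?ltW.
have Dt : 0 <= D * t0 by apply: le_trans j3.
have comb (y S r g : R) : `|y - S - r| <= 1 -> `|S| <= g -> `|r| <= D * t0 -> `|y| <= 1 + g + D *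
  t0.
  move=> k1 k2 k3; rewrite (_ : y = (y - S - r) + S + r); last ring.
  by apply: (le_trans (ler_normD _ _)); apply: lerD => //; apply: (le_trans (ler_normD _ _));
    exact: lerD.
split.
  by apply: (le_trans (comb _ _ _ _ h1 j1 j3)); rewrite /B lerD2r lerDl.
have z3 : `|0 : R| <= D * t0 by rewrite normr0.
rewrite -[X in `|X|]subr0 in h2.
by apply: (le_trans (comb _ _ _ _ h2 j2 z3)); rewrite /B lerD2r -addrA lerD2l lerDr.
Qed.

(** Markov's inequality for the number of pairs of big jumps at most [r] steps apart; [i.+1] avoids
    pairing a time with itself. The independent part grows with [r], while the correlations sum to a
    geometric series. *)
Lemma pair_event (delta : R) (n r : nat) N (A C : R) : 0 < delta ->
  fine (mu (big N delta)) <= A -> 0 <= C ->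
  n2 mu (transition_op P \1_(big N delta)) <= C * fine (mu (big N delta)) ->
  exists F : set Om, [/\ measurable F,
    fine (Pr F) <= n%:R * (r%:R * A ^+ 2 + C * A * Num.sqrt A / (1 - a)) &
    forall w, ~ F w -> forall k i, (k < n)%N -> (i < r)%N ->
      delta <= `|W N (X k w)| -> `|W N (X (k + i.+1)%N w)| < delta].
Proof.
move=> delta0 bA C0 hC; have [/andP[a0 a1] _] := sa_gap H.
set B := big N delta in bA hC; have mB : measurable B := mbig N delta.
have b0 : 0 <= fine (mu B) by exact: fine_ge0.
have A0 : 0 <= A by exact: le_trans bA.
have bI : bm (\1_B : E -> R) by exact: bm_indic.
pose G w := \sum_(k < n) \sum_(i < r) (\1_B (X k w) * \1_B (X (k + i.+1)%N w) : R).
have bP (k i : nat) : bm (fun w => \1_B (X k w) * \1_B (X (k + i.+1)%N w) : R).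
  by apply: bmM; exact: (bm_chain X).
have bG : bm G by apply: bm_sum => k; apply: bm_sum => i; exact: bP.
have G0 w : 0 <= G w by apply: sumr_ge0 => k _; apply: sumr_ge0 => i _; exact: mulr_ge0.
exists [set w | 1 <= G w]; split.
- exact: (measurable_ge (bm_meas bG)).
- have mF : measurable [set w | 1 <= G w] := measurable_ge (bm_meas bG) 1.
  apply: (le_trans (@Ex_markov _ _ _ Pr _ G 1 bG mF ltr01 G0 _)) => //.
  rewrite divr1 Ex_sum; last by move=> k; apply: bm_sum => i; exact: bP.
  rewrite mulr_natl -[n in _ *+ n]card_ord -sumr_const; apply: ler_sum => k _.
  rewrite Ex_sum; last by move=> i; exact: bP.
  apply: (@le_trans _ _ (\sum_(i < r) (A ^+ 2 + a ^+ i * (C * A * Num.sqrt A)))).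
    apply: ler_sum => i _; have := pair_bound (sa_chain H) (sa_inv H) (sa_gap H) mB hC k i.
    rewrite -Ex_indic; last first.
      by apply: measurableI; rewrite -[_ @^-1` _]setTI; exact: measurable_chain.
    rewrite indicI (_ : \1__ \* _ = fun w => \1_B (X k w) * \1_B (X (k + i.+1)%N w)); last first.
      by apply/funext => w; rewrite !indicE; congr (_ * _); congr (_%:R); rewrite !inE.
    move=> h; apply: (le_trans h); apply: lerD; first by rewrite lerXn2r ?nnegrE.
    rewrite ler_wpM2l ?exprn_ge0//; apply: ler_pM; rewrite ?mulr_ge0 ?sqrtr_ge0//.
      exact: ler_wpM2l.
    exact: ler_wsqrtr.
  rewrite big_split/= sumr_const card_ord -[_ *+ r]mulr_natl lerD2l -mulr_suml mulrC.
  have a10 : 0 < 1 - a by rewrite subr_gt0.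
  rewrite ler_wpM2l ?mulr_ge0 ?sqrtr_ge0// -[leRHS]mul1r ler_pdivlMr//.
  have -> : (\sum_(i < r) a ^+ i) * (1 - a) = 1 - a ^+ r.
    by elim: (r) => [|i IH]; rewrite ?big_ord0 ?expr0 ?mul0r ?subrr// big_ord_recr/= mulrDl IH
      exprS; ring.
  by rewrite gerBl exprn_ge0.
move=> w /negP; rewrite -ltNge => G1 k i kn ir hk; rewrite ltNge; apply/negP => hi.
move: G1; rewrite ltNge => /negP; apply; rewrite /G (bigD1 (Ordinal kn))//= (bigD1 (Ordinal ir))//=.
rewrite [\1_B (X k w)]indicE mem_set// indicE mem_set// mul1r -addrA lerDl addr_ge0//.
  by apply: sumr_ge0 => j _; exact: mulr_ge0.
by apply: sumr_ge0 => j _; apply: sumr_ge0 => j' _; exact: mulr_ge0.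
Qed.

(** The summand of index [k] enters the sum when [K t] reaches [k.+1], which gives the shift of the
    index. *)
Let jump_times (delta : R) (n N : nat) (w : Om) : seq R :=
  [seq k.+1%:R / K N | k <- [seq k <- iota 0 n | delta <= `|W N (X k w)|]].

Let mem_jump_times delta n N w k : (k < n)%N -> delta <= `|W N (X k w)| ->
  k.+1%:R / K N \in jump_times delta n N w.
Proof. by move=> kn dk; apply/mapP; exists k => //; rewrite mem_filter dk mem_iota. Qed.

Let sorted_jump_times delta n r N w (h : R) : K N * h <= r%:R ->
  (forall k i, (k < n)%N -> (i < r)%N ->
      delta <= `|W N (X k w)| -> `|W N (X (k + i.+1)%N w)| < delta) ->
  sorted (fun a b : R => a + h < b) (jump_times delta n N w).
Proof.
move=> hr sep; set ks := [seq k <- iota 0 n | delta <= `|W N (X k w)|].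
apply: (@homo_sorted_in _ _ (fun k => (k < n)%N && (delta <= `|W N (X k w)|)) (fun k => k.+1%:R / K
  N : R)
  ltn (fun a b : R => a + h < b)).
- move=> k l; rewrite !unfold_in => /andP[kn dk] /andP[ln dl] /= kl.
  have rl : (r < l - k)%N.
    rewrite ltnNge; apply/negP => lr; have lk : (0 < l - k)%N by rewrite subn_gt0.
    have ir : ((l - k).-1 < r)%N by rewrite prednK.
    by have := sep k (l - k).-1 kn ir dk; rewrite prednK// subnKC ?(ltnW kl)// ltNge dl.
  rewrite ltr_pdivlMr// mulrDl divfK ?gt_eqF// mulrC [h * _]mulrC in hr *.
  apply: (@le_lt_trans _ _ (k.+1%:R + r%:R)); first by rewrite lerD2l.
  by rewrite -natrD ltr_nat addSn ltnS -ltn_subRL.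
- by apply/allP => k; rewrite mem_filter mem_iota add0n /= => /andP[-> ->].
- by apply: sorted_filter; [exact: ltn_trans|exact: iota_ltn_sorted].
Qed.

Let same_sum delta n N w (s s' : R) (f : R -> R) : 0 <= s -> 0 <= s' ->
  (Num.truncn (K N * s) <= n)%N -> (Num.truncn (K N * s') <= n)%N ->
  (forall y, `|y| < delta -> f y = 0) -> same_piece (jump_times delta n N w) s s' ->
  \sum_(k < Num.truncn (K N * s)) f (W N (X k w)) = \sum_(k < Num.truncn (K N * s')) f (W N (X k
    w)).
Proof.
move=> s0 s'0 sn s'n f0 sp.
wlog le : s s' s0 s'0 sn s'n sp / (Num.truncn (K N * s) <= Num.truncn (K N * s'))%N.
  move=> hw; have [/hw|/ltnW le] := leqP (Num.truncn (K N * s)) (Num.truncn (K N * s')); first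
    exact.
  by apply/esym; apply: hw => // t /sp ->.
rewrite (big_ord_widen _ (fun k => f (W N (X k w))) le) big_mkcond/=.
apply: eq_bigr => -[k kn] _ /=; case: ifPn => //; rewrite -leqNgt => sk; apply/esym/f0.
rewrite ltNge; apply/negP => dk.
have := sp _ (mem_jump_times (leq_trans kn s'n) dk).
have -> : (k.+1%:R / K N <= s') by rewrite ler_pdivrMr// mulrC -truncn_ge_nat// mulr_ge0// ltW.
move=> /idP; rewrite ler_pdivrMr// mulrC -truncn_ge_nat ?mulr_ge0 ?(ltW (Kpos N))//.
by rewrite ltnNge sk.
Qed.

Let eighths (x y z e : R) : 0 < e -> x <= e / 8 -> y <= e / 8 -> z <= e / 8 -> x + y + z <= e / 2.
Proof. by move=> e0 h1 h2 h3; lra. Qed.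

Lemma grid_tightness (e1 e2 : R) : 0 < e1 -> 0 < e2 ->
  exists m0, forall m, (m0 <= m)%N -> exists N0, forall N, (N0 <= N)%N ->
  exists F, [/\ measurable F, (Pr F <= e2%:E)%E &
    forall w, ~ F w -> sdist (grid m (Y N w)) (Y N w) <= e1].
Proof.
move=> e10 e20; have [/andP[a0 a1] _] := sa_gap H.
have a10 : 0 < 1 - a by rewrite subr_gt0.
have [A A0 hA] := sa_tail H; have [C C0 hC] := sa_smooth H.
pose t0 := e1^-1 + 1; have t00 : 0 < t0 by rewrite addr_gt0// invr_gt0.
have e80 : 0 < e1 / 8 by rewrite divr_gt0.
have e2h : 0 < e2 / 2 by rewrite divr_gt0.
have [delta d01 hd] := path_decomposition H YE t00 e80 e2h.
have /andP[delta0 _] := d01.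
have [N1 hN1] := hd delta delta0 (lexx _).
have [D hD] := drift_bound H d01.
have D0 : 0 <= D by exact: le_trans (normr_ge0 _) (hD 0%N).
pose A' := A * delta `^ (- beta); have A'0 : 0 <= A' by rewrite mulr_ge0 ?powR_ge0 ?ltW.
(* In this order: the mesh is below [e1], the grid reaches the horizon [t0], the drift over a time
   [2 / m] is at most [e1 / 4], and independent pairs of close big jumps have probability at most
   [e2 / 8]. *)
pose mbound := e1^-1 + t0 + 8 * D / e1 + 8 * (t0 * A' ^+ 2) / e2.
have k1 : 0 <= 8 * D / e1 by rewrite divr_ge0 ?(ltW e10)// mulr_ge0.
have k2 : 0 <= 8 * (t0 * A' ^+ 2) / e2.
  by rewrite divr_ge0 ?(ltW e20)// mulr_ge0// mulr_ge0 ?(ltW t00)// exprn_ge0.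
have k3 : 0 < e1^-1 by rewrite invr_gt0.
exists (Num.truncn mbound).+1 => m hm.
have mb : mbound < m%:R by rewrite (lt_le_trans (truncnS_gt _))// ler_nat.
have m0 : (0 < m)%N by apply: leq_trans hm.
have mR : 0 < m%:R :> R by rewrite ltr0n.
have q1 : e1^-1 < m%:R by move: mb; rewrite /mbound; lra.
have q2 : t0 <= m%:R by move: mb; rewrite /mbound; lra.
have q3 : 8 * D / e1 <= m%:R by move: mb; rewrite /mbound; lra.
have q4 : 8 * (t0 * A' ^+ 2) / e2 <= m%:R by move: mb; rewrite /mbound; lra.
pose G := t0 * (C * A' / (1 - a)).
have G0 : 0 <= G by rewrite mulr_ge0 ?(ltW t00)// divr_ge0 ?(ltW a10)// mulr_ge0.
have G1 : 0 < G + 1 by rewrite ltr_wpDl.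
have e28 : 0 < e2 / 8 by rewrite divr_gt0.
have g0 : 0 < (e2 / 8 / (G + 1)) ^+ 2 by rewrite exprn_gt0// divr_gt0.
have [N2 _ hN2] := eventually_div H A' g0.
have [N3 _ hN3] := eventually_div H (2 * (t0 * A' ^+ 2)) e28.
exists (maxn N1 (maxn N2 N3)) => N; rewrite !geq_max => /andP[/hN1[F1 [mF1 pF1 hF1]] /andP[/hN2 /=
  n2 /hN3 /= n3]].
pose n := Num.truncn (K N * t0); have nK := horizon N (ltW t00).
(* Rounded up so that jumps more than [r] steps apart are more than [1 / m] apart in time, as the
   grid requires. *)
pose r := (Num.truncn (K N / m%:R)).+1.
have Km0 : 0 <= K N / m%:R by rewrite divr_ge0// ltW.
have rK : r%:R <= K N / m%:R + 2.
  by have /andP[h _] := truncn_itv Km0; rewrite /r -natr1; lra.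
have Kr : K N * m%:R^-1 <= r%:R by apply: ltW; exact: truncnS_gt.
have bA : fine (mu (big N delta)) <= A' / K N by rewrite ler_pdivlMr// mulrC; exact: hA.
have [F2 [mF2 pF2 hF2]] := @pair_event delta n r N (A' / K N) C delta0 bA C0 (hC N _ (ltW delta0)).
have AK0 : 0 <= A' / K N by rewrite divr_ge0// ltW.
exists (F1 `|` F2); split; first exact: measurableU.
  have pF : fine (Pr F2) <= e2 / 2.
    apply: (le_trans pF2).
    set sq := Num.sqrt _; have sq0 : 0 <= sq by exact: sqrtr_ge0.
    have sqb : sq <= e2 / 8 / (G + 1).
      apply: (le_trans (ler_wsqrtr n2)); rewrite sqrtr_sqr ger0_norm//.
      by rewrite divr_ge0 ?(ltW e28) ?(ltW G1).
    apply: (@le_trans _ _ (K N * t0 * ((K N / m%:R + 2) * (A' / K N) ^+ 2 + C * (A' / K N) * sq /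
      (1 - a)))).
      apply: ler_pM => //.
        apply: addr_ge0; first by apply: mulr_ge0 => //; exact: exprn_ge0.
        by apply: divr_ge0; [do 2!apply: mulr_ge0 => //|exact: ltW].
      by rewrite lerD2r ler_wpM2r// exprn_ge0.
    have -> : K N * t0 * ((K N / m%:R + 2) * (A' / K N) ^+ 2 + C * (A' / K N) * sq / (1 - a)) =
        t0 * A' ^+ 2 / m%:R + 2 * (t0 * A' ^+ 2) / K N + G * sq.
      by rewrite /G; field; rewrite !gt_eqF.
    have u1 : t0 * A' ^+ 2 / m%:R <= e2 / 8.
      by move: q4; rewrite ler_pdivrMr// => q4; rewrite ler_pdivrMr//; lra.
    have u2 : G * sq <= e2 / 8.
      apply: (@le_trans _ _ (G * (e2 / 8 / (G + 1)))); first exact: ler_wpM2l.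
      by rewrite mulrA ler_pdivrMr// mulrC ler_wpM2l ?(ltW e28)// lerDl.
    exact: (eighths e20 u1 n3 u2).
  apply: (le_trans (measureU2 _ mF1 mF2)).
  have : ((fine (Pr F1) + fine (Pr F2))%:E <= e2%:E)%E by rewrite lee_fin [e2]splitr lerD.
  by rewrite EFinD !fine_muE.
move=> w nF; have nF1 : ~ F1 w by move=> h; apply: nF; left.
have nF2 : ~ F2 w by move=> h; apply: nF; right.
have m1 : m%:R^-1 < e1 by rewrite -[ltRHS]invrK ltf_pV2 ?posrE.
apply: (proj2 (@sdist_grid _ (jump_times delta n N w) m (Y N w) e1 m0 e10 _ _ m1 q2 _)).
- by move=> t /mapP[k _ ->]; rewrite divr_gt0.
- by apply: sorted_jump_times Kr _ => k i; exact: hF2.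
move=> s s' s_in s'_in ss sp.
have /andP[s0 st] := s_in; have /andP[s'0 s't] := s'_in.
have sn : (Num.truncn (K N * s) <= n)%N by apply: le_truncn; rewrite ler_wpM2l// ltW.
have s'n : (Num.truncn (K N * s') <= n)%N by apply: le_truncn; rewrite ler_wpM2l// ltW.
have [h1 h2] := hF1 w nF1 s s_in; have [h3 h4] := hF1 w nF1 s' s'_in.
have b1 := @same_sum delta n N w s s' (big_part delta) s0 s'0 sn s'n
  (fun y h => ltac:(by rewrite /big_part h)) sp.
have b2 := @same_sum delta n N w s s' (big_image c p delta) s0 s'0 sn s'n
  (fun y h => ltac:(by rewrite /big_image h)) sp.
rewrite -b1 in h3; rewrite -b2 in h4.
have dr : `|drift mu K W v delta N * (s - s')| <= e1 / 4.
  rewrite normrM; apply: (@le_trans _ _ (D * (2 / m%:R))); first exact: ler_pM.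
  by rewrite mulrA ler_pdivrMr//; move: q3; rewrite ler_pdivrMr//; lra.
have comb (y y' S d1 d2 : R) : `|y - S - d1| <= e1 / 8 -> `|y' - S - d2| <= e1 / 8 ->
    `|d1 - d2| <= e1 / 4 -> `|y - y'| < e1.
  move=> g1 g2 g3; rewrite (_ : y - y' = (y - S - d1) - (y' - S - d2) + (d1 - d2)); last ring.
  apply: (le_lt_trans (ler_normD _ _)); apply: (le_lt_trans (lerD (ler_normB _ _) (lexx _))); lra.
rewrite prod_normE/= gt_max; apply/andP; split.
  by apply: comb h1 h3 _; rewrite -mulrBr.
rewrite -[X in `|X|]subr0 in h2; rewrite -[X in `|X|]subr0 in h4.
by apply: comb h2 h4 _; rewrite subrr normr0 divr_ge0// ltW.
Qed.

End Tightness.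

(** * Convergence to the Levy process *)

Lemma dot_grid_coord {R : realType} m (xi : grid_index m -> R) (x : skorokhod (R * R)%type) :
  dot xi (grid_coord x) = grid_dot m (fun i => xi (inord i, true)) (fun i => xi (inord i, false)) x.
Proof.
rewrite /dot (eq_bigr (fun i : grid_index m => xi (i.1, i.2) * grid_coord x (i.1, i.2))); last by
  move=> [].
rewrite -(pair_bigA _ (fun i b => xi (i, b) * grid_coord x (i, b)))/= /grid_dot.
by apply: eq_bigr => i _; rewrite big_bool /grid_coord/= inord_val.
Qed.

Section LevyLimit.
Context {R : realType} {dE} {E : measurableType dE} {d} {Om : measurableType d}.
Variables (Pr : probability Om R) (P : R.-pker E ~> E) (mu : probability E R).
Variable X : nat -> {RV Pr >-> E}.
Variables (K : nat -> R) (W T : nat -> E -> R) (v : nat -> R).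
Variables (beta c p q q' : R) (psi : R -> R -> R[i]) (a : R).
Hypothesis H : stable_array P mu X K W T v beta c p q q' psi a.
Variable Y : nat -> Om -> skorokhod (R * R)%type.
Hypothesis YE : forall N w t, 0 <= t -> Y N w t =
  (\sum_(k < Num.truncn (K N * t)) W N (X k w) - v N * t, \sum_(k < Num.truncn (K N * t)) T N (X k
    w)).
Context {d'} {Om' : measurableType d'} (Pr' : probability Om' R).
Variable Z : Om' -> skorokhod (R * R)%type.
Hypothesis Z_levy : levy_process Pr' Z.
Hypothesis Z_exponent : has_exponent Pr' Z psi.

Let measurable_grid_coord {d0} {O : measurableType d0} (y : O -> skorokhod (R * R)%type) m :
  (forall t, 0 <= t -> measurable_fun setT (fun w => (y w t).1) /\ measurable_fun setT (fun w => (y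
    w t).2)) ->
  forall i : grid_index m, measurable_fun setT (fun w => grid_coord (y w) i).
Proof. by move=> my [i b]; have [|m1 m2] := my (i%:R / m%:R); rewrite ?divr_ge0//; case: b. Qed.

Let mZ t : measurable_fun setT (fun w => (Z w t).1) /\ measurable_fun setT (fun w => (Z w t).2).
Proof.
have := levy_measurable Z_levy t => mz.
by split; [exact: (measurableT_comp measurable_fst mz)|exact: (measurableT_comp measurable_snd mz)].
Qed.

Let cmod_Re_sub (x y x' y' : R) : `|x - x'| <= cmod ((x +i* y) - (x' +i* y'))%C.
Proof. exact: cmod_Re. Qed.

Let cmod_Im_sub (x y x' y' : R) : `|y - y'| <= cmod ((x +i* y) - (x' +i* y'))%C.
Proof. exact: cmod_Im. Qed.

(** [char_limit] and [levy_char] produce the same exponent for every linear form in the grid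
    values. *)
Let grid_law m (G : (grid_index m -> R) -> R) : (0 < m)%N ->
  (exists M : R, forall u, `|G u| <= M) -> lipschitz_sup G ->
  Ex Pr (fun w => G (grid_coord (Y N w))) @[N --> \oo] --> Ex Pr' (fun w => G (grid_coord (Z w))).
Proof.
move=> m0; apply: levy_continuity.
- by move=> N; apply: measurable_grid_coord => t; exact: (measurable_coordinate H YE).
- by apply: measurable_grid_coord => t _; exact: mZ.
- move=> xi; apply/cvgrPdist_le => e e0.
  have h := char_limit H YE m0 (fun i => xi (inord i, true)) (fun i => xi (inord i, false)) e0.
  rewrite -(levy_char Z_levy Z_exponent)// in h.
  apply: filterS h => N h; under eq_fun do rewrite dot_grid_coord.
  under [X in `|_ - Ex _ X|]eq_fun do rewrite dot_grid_coord.
  by rewrite distrC; apply: le_trans h; exact: cmod_Re_sub.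
- move=> xi; apply/cvgrPdist_le => e e0.
  have h := char_limit H YE m0 (fun i => xi (inord i, true)) (fun i => xi (inord i, false)) e0.
  rewrite -(levy_char Z_levy Z_exponent)// in h.
  apply: filterS h => N h; under eq_fun do rewrite dot_grid_coord.
  under [X in `|_ - Ex _ X|]eq_fun do rewrite dot_grid_coord.
  by rewrite distrC; apply: le_trans h; exact: cmod_Im_sub.
- move=> e e0; have mR : 0 < m%:R :> R by rewrite ltr0n.
  have [B [N0 hB]] := bounded_paths H YE mR e0.
  exists B, N0 => N /hB[A [mA pA hA]]; exists A; split => //.
    by rewrite -lee_fin fine_muE in pA.
  move=> w nA [i b]; have [|h1 h2] := hA w nA (i%:R / m%:R).
    rewrite divr_ge0//= ler_pdivrMr// -natrM ler_nat mulnn -ltnS; exact: ltn_ord.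
  by case: b.
Qed.

Theorem stable_array_cvg_in_law : cvg_in_law Pr Pr' Y Z.
Proof.
apply: cvg_in_law_of_grids.
- move=> N t t0; have [m1 m2] := measurable_coordinate H YE N t0.
  rewrite (_ : (fun w => _) = (fun w => ((Y N w t).1, (Y N w t).2))); first exact:
    measurable_fun_pair.
  by apply/funext => w; case: (Y N w t).
- by move=> t _; exact: (levy_measurable Z_levy t).
- exact: grid_law.
- move=> e1 e2 e10 e20; exact: (grid_tightness H YE e10 e20).
Qed.

End LevyLimit.

(** * Rescaling the chain *)

Lemma cvg_powR_neg {R : realType} (K : nat -> R) (e : R) : 0 < e -> K N @[N --> \oo] --> +oo ->
  K N `^ (- e) @[N --> \oo] --> 0.
Proof.
move=> e0 Koo; apply/cvgrPdist_le => eps eps0.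
have [l l0 hl] := large_power (@ler01 R) e0 eps0; rewrite mul1r in hl.
have /cvgryPge/(_ l) hK := Koo.
apply: filterS hK => N lK; rewrite sub0r normrN ger0_norm ?powR_ge0//; apply: le_trans hl.
have KN0 : 0 < K N by exact: lt_le_trans lK.
by rewrite !powRN lef_pV2 ?posrE ?powR_gt0//; apply: ge0_ler_powR; rewrite ?nnegrE ?(ltW e0) ?(ltW
  l0) ?(ltW KN0).
Qed.

Lemma cvg_in_law_near {R : realType} (V : normedModType R) d d' (Om : measurableType d)
    (Om' : measurableType d') (Pr : probability Om R) (Pr' : probability Om' R)
    (Y Y' : nat -> Om -> skorokhod V) (Z : Om' -> skorokhod V) :
  (\forall N \near \oo, Y N = Y' N) -> cvg_in_law Pr Pr' Y Z -> cvg_in_law Pr Pr' Y' Z.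
Proof.
move=> YY' cY F cF bF; apply: cvg_trans (cY F cF bF); apply: near_eq_cvg.
by apply: filterS YY' => N ->.
Qed.

Section Rescaling.
Context {R : realType} {dE} {E : measurableType dE} {d} {Om : measurableType d}.
Variables (Pr : probability Om R) (P : R.-pker E ~> E) (mu : probability E R).
Variable X : nat -> {RV Pr >-> E}.
Hypothesis X_markov : markov_chain P mu X.
Hypothesis mu_invariant : invariant_law P mu.
Hypothesis gap : spectral_gap P mu.
Variables (Q : R.-ker E ~> E) (density : E -> E -> R).
Hypothesis m_density : measurable_fun setT (fun z : E * E => density z.1 z.2).
Hypothesis density_ge0 : forall x y, 0 <= density x y.
Hypothesis PE : forall x A, measurable A -> P x A = (ac_part mu density x A + Q x A)%E.
Hypothesis density_sqr :
  (ereal_sup [set \int[mu]_x ((density x y) ^+ 2)%:E | y in setT] < +oo)%E.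
Variables (tau V : E -> R) (alpha beta c_alpha cp cm c gamma Cstar : R) (rho : R -> R).
Hypothesis m_tau : measurable_fun setT tau.
Hypothesis tau_gt0 : forall x, 0 < tau x.
Hypothesis alpha01 : 0 < alpha < 1.
Hypothesis c_alpha_ge0 : 0 <= c_alpha.
Hypothesis tau_tail : l `^ alpha * fine (mu [set x | l <= tau x]) @[l --> +oo] --> c_alpha.
Hypothesis mV : measurable_fun setT V.
Hypothesis beta0 : 0 < beta.
Hypothesis beta2 : beta < 2.
Hypothesis cp0 : 0 <= cp.
Hypothesis cm0 : 0 <= cm.
Hypothesis right_tail : l `^ beta * fine (mu [set x | l <= V x]) @[l --> +oo] --> cp.
Hypothesis left_tail : l `^ beta * fine (mu [set x | V x <= - l]) @[l --> +oo] --> cm.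
Hypothesis V_dominated : level_dominated mu Q density (fun x => `|V x|).
Hypothesis c0 : 0 < c.
Hypothesis rhoE : forall l, rho l = c * `|l| `^ (beta / alpha).
Hypothesis gamma_gt : alpha < gamma.
Hypothesis tau_rho : forall l : R, 0 < l ->
  (mu [set x | (l <= `|tau x - rho (V x)|)%R] <= (Cstar / l `^ gamma)%:E)%E.

Section StableArray.
Variable K : nat -> R.
Hypothesis K1 : forall N, 1 <= K N.
Hypothesis Koo : K N @[N --> \oo] --> +oo.

Let p := beta / alpha.
Let W N x := V x / K N `^ beta^-1.
Let T N x := tau x / K N `^ alpha^-1.
Let v N := K N * Ex mu (fun x => compensator beta (W N x)).

Let alpha0 : 0 < alpha. Proof. by case/andP: alpha01. Qed.
Let Kpos N : 0 < K N. Proof. exact: lt_le_trans (K1 N). Qed.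
Let betap : beta < p.
Proof. by rewrite /p ltr_pdivlMr// gtr_pMr//; case/andP: alpha01. Qed.

Let scaled_tail (a1 a2 k : R) : 0 < k ->
  (a1 <= `|a2 / k|) = (k * a1 <= `|a2|).
Proof. by move=> k0; rewrite normrM normfV (gtr0_norm k0) ler_pdivlMr// mulrC. Qed.

(** The exponent [beta / alpha] makes [rho] intertwine the two scalings: multiplying [V] by
    [K^(1 / beta)] multiplies [rho (V)] by [K^(1 / alpha)]. *)
Let scaled_image N x : `|T N x - jump_image c p (W N x)| = `|(tau x - rho (V x)) / K N `^ alpha^-1|.
Proof.
have s0 : 0 < K N `^ beta^-1 by exact: powR_gt0.
rewrite /T /jump_image /W rhoE normrM normfV (gtr0_norm s0) powRM ?invr_ge0 ?(ltW s0)//.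
have -> : (K N `^ beta^-1)^-1 `^ p = (K N `^ alpha^-1)^-1.
  rewrite -!powRN -powRrM mulNr; congr (_ `^ (- _)).
  by rewrite /p mulrA mulVf ?mul1r// gt_eqF.
by congr (`|_|); ring.
Qed.

(** At the scale [K^(1 / alpha)] the error tail is of order [K^(- gamma / alpha)], so a factor [K]
    is affordable. *)
Let close_limit l : 0 < l ->
  K N * fine (mu [set x | l <= `|T N x - jump_image c p (W N x)|]) @[N --> \oo] --> 0.
Proof.
move=> l0; pose e := gamma / alpha - 1.
have e0 : 0 < e by rewrite subr_gt0 ltr_pdivlMr// mul1r.
have up : Cstar / l `^ gamma * K N `^ (- e) @[N --> \oo] --> 0.
  by rewrite -[X in _ --> X](mulr0 (Cstar / l `^ gamma)); apply: cvgMr; exact: cvg_powR_neg.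
apply: (@squeeze_cvgr _ _ _ _ (fun=> 0)) up; last exact: cvg_cst.
apply: nearW => N; have s0 : 0 < K N `^ alpha^-1 by exact: powR_gt0.
rewrite mulr_ge0 ?(ltW (Kpos N)) ?fine_ge0//=.
have mA : measurable [set x | K N `^ alpha^-1 * l <= `|tau x - rho (V x)|].
  apply: (@measurable_ge _ _ _ (fun x => `|tau x - rho (V x)|)).
  apply: (measurableT_comp (@normr_measurable R setT)); apply: measurable_funB => //.
  exact: (measurableT_comp (measurable_rho rhoE)).
have -> : [set x | l <= `|T N x - jump_image c p (W N x)|] = [set x | K N `^ alpha^-1 * l <= `|tau
  x - rho (V x)|].
  by apply/seteqP; split => x /=; rewrite scaled_image scaled_tail.
have sl0 : 0 < K N `^ alpha^-1 * l by rewrite mulr_gt0.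
have := tau_rho sl0; rewrite -(fine_muE mu mA) lee_fin => h.
apply: (le_trans (ler_wpM2l (ltW (Kpos N)) h)).
rewrite powRM ?(ltW s0) ?(ltW l0)// -powRrM.
have -> : K N `^ (- e) = K N * (K N `^ (alpha^-1 * gamma))^-1.
  rewrite -powRN -[X in X * _]powRr1 ?(ltW (Kpos N))// -powRD; last by apply/implyP => _; rewrite
    gt_eqF.
  by congr (_ `^ _); rewrite /e; ring.
rewrite invfM; move: (_^-1) (_^-1) => u w; rewrite le_eqVlt; apply/orP; left; apply/eqP; ring.
Qed.

(** The moment exponents are midpoints of the allowed intervals: []beta, min 2 p[] for the jumps of
    [W], and []alpha, 1[] for [T]. *)
Lemma rescaled_array : exists a, stable_array P mu X K W T v beta c p ((beta + Num.min 2 p) / 2)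
  ((alpha + 1) / 2) (levy_exponent beta cp cm rho) a.
Proof.
have [a ha] := spectral_gap_bound mu_invariant gap.
have /andP[_ alpha1] := alpha01.
have bq : beta < (beta + Num.min 2 p) / 2.
  have : beta < Num.min 2 p by rewrite lt_min beta2.
  by move: (Num.min 2 p) => u h; lra.
have rhoE' : rho = jump_image c p by apply/funext.
have betap' := betap; have alpha0' := alpha0.
exists a; split => //.
- by move=> N; apply: measurable_funM => //; exact: measurable_cst.
- by move=> N; apply: measurable_funM => //; exact: measurable_cst.
- by move=> N x; rewrite divr_ge0 ?powR_ge0// ltW.
- split; first exact: lt_trans bq.
    have : Num.min 2 p <= 2 by rewrite ge_min lexx.
    by move: beta2 (Num.min 2 p) => b2 u h; lra.
  have : Num.min 2 p <= p by rewrite ge_min lexx orbT.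
  by move: (Num.min 2 p) betap' => u h1 h2; lra.
- by apply/andP; split; lra.
- exact: abs_tail_bound mV beta0 cp0 cm0 right_tail left_tail Kpos.
- have mNV : measurable_fun setT (fun x => `|V x|) by exact: (measurableT_comp (@normr_measurable R
  setT)).
  have [C C0 hC] := level_smoothing m_density density_ge0 PE density_sqr mNV V_dominated.
  exists C => // N l l0; have s0 : 0 < K N `^ beta^-1 by exact: powR_gt0.
  rewrite (_ : [set x | l <= `|W N x|] = [set x | K N `^ beta^-1 * l <= `|V x|]); last first.
    by apply/seteqP; split => x /=; rewrite /W scaled_tail.
  by apply: hC; rewrite mulr_ge0// ltW.
- exact: (moment_bound mV beta0 cp0 cm0 right_tail left_tail Kpos bq Koo).
(* The moment bound is two-sided; [tau] is positive, so its left tail has constant 0. *)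
- have left0 : l `^ alpha * fine (mu [set x | tau x <= - l]) @[l --> +oo] --> (0 : R).
    apply: (@cvg_trans _ ((fun=> 0 : R) @ +oo%R)); last exact: cvg_cst.
    apply: near_eq_cvg; near=> l; have l0 : 0 < l by near: l; exact: nbhs_pinfty_gt.
    rewrite (_ : [set x | tau x <= - l] = set0) ?measure0 ?mulr0//.
    apply/seteqP; split => x //=; rewrite leNgt; have := tau_gt0 x => h; move=> /negP; apply.
    by rewrite (lt_trans _ h)// oppr_lt0.
  have aq : alpha < (alpha + 1) / 2 by lra.
  exact: (moment_bound m_tau alpha0 c_alpha_ge0 (lexx 0) tau_tail left0 Kpos aq Koo).
- move=> xi1 xi2; have := limit_Re mV beta0 beta2 cp0 cm0 right_tail left_tail Kpos Koo betap (ltW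
  c0) rhoE.
  by move=> /(_ xi1 xi2); rewrite /exponent_Re rhoE'.
- move=> xi1 xi2; have := limit_Im_drift mV beta0 beta2 cp0 cm0 right_tail left_tail Kpos Koo betap
  (ltW c0) rhoE.
  by move=> /(_ xi1 xi2); rewrite rhoE'.
Unshelve. all: by end_near. Qed.

End StableArray.

Variable K : nat -> R.
Hypothesis Koo : K N @[N --> \oo] --> +oo.
Context {d'} {Om' : measurableType d'} (Pr' : probability Om' R).
Variable Z : Om' -> skorokhod (R * R)%type.
Hypothesis Z_levy : levy_process Pr' Z.
Hypothesis Z_exponent : has_exponent Pr' Z (levy_exponent beta cp cm rho).

(** One statement for all [beta], centered by the mean of the compensator. The regimes of the
    theorem differ only in the value of this mean. *)
Lemma rescaled_cvg_in_law :
  cvg_in_law Pr Pr'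
    (fun N w => rescaled_path (K N) (K N `^ (- beta^-1)) (K N `^ (- alpha^-1))
       (K N * Ex mu (fun x => compensator beta (V x / K N `^ beta^-1)))
       (partial_sum X V w) (partial_sum X tau w)) Z.
Proof.
(* [stable_array] asks for [K N >= 1] at every [N], whereas divergence gives it only eventually. *)
pose K' N := Num.max 1 (K N).
have K'1 N : 1 <= K' N by rewrite le_max lexx.
have /cvgryPge/(_ 1) K1 := Koo.
have KK' : \forall N \near \oo, K' N = K N by apply: filterS K1 => N; exact: max_r.
have K'oo : K' N @[N --> \oo] --> +oo.
  by apply: cvg_trans Koo; apply: near_eq_cvg; apply: filterS KK' => N ->.
have [a H] := rescaled_array K'1 K'oo.
apply: (@cvg_in_law_near _ _ _ _ _ _ _ _ (fun N w => rescaled_path (K' N) (K' N `^ (- beta^-1))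
  (K' N `^ (- alpha^-1)) (K' N * Ex mu (fun x => compensator beta (V x / K' N `^ beta^-1)))
  (partial_sum X V w) (partial_sum X tau w))).
  by apply: filterS KK' => N ->.
apply: (stable_array_cvg_in_law H _ Z_levy Z_exponent) => N w t t0.
rewrite /= rescaled_fun_ge0// /partial_sum !mulr_sumr !powRN; congr (_ - _, _).
  by apply: eq_bigr => k _; rewrite mulrC.
by apply: eq_bigr => k _; rewrite mulrC.
Qed.

Lemma centered_cvg_in_law : beta != 1 -> (1 < beta -> (\int[mu]_x (V x)%:E = 0)%E) ->
  cvg_in_law Pr Pr'
    (fun N w => rescaled_path (K N) (K N `^ (- beta^-1)) (K N `^ (- alpha^-1)) 0
       (partial_sum X V w) (partial_sum X tau w)) Z.
Proof.
move=> beta1 centered; apply: cvg_in_law_near rescaled_cvg_in_law.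
have /cvgryPge/(_ 1) K1 := Koo.
apply: filterS K1 => N K1.
suff -> : Ex mu (fun x => compensator beta (V x / K N `^ beta^-1)) = 0 by rewrite mulr0.
rewrite /compensator (negbTE beta1); case: ltP => b1; first by rewrite Ex_cst.
have {}b1 : 1 < beta by rewrite lt_neqAle eq_sym beta1.
have KN0 : 0 < K N by exact: lt_le_trans K1.
have s0 : 0 < K N `^ beta^-1 by exact: powR_gt0.
have /andP[al0 al1] := alpha01.
have betap : beta < beta / alpha by rewrite ltr_pdivlMr// gtr_pMr.
(* Applied to a constant sequence of scales, which yields the integrability of [V] at the scale
   [K N]. *)
have := integrable_compensator mV beta0 beta2 cp0 cm0 right_tail left_tail (fun=> KN0) betap (ltW
  c0) rhoE 0.
rewrite /compensator (negbTE beta1) ltNge (ltW b1)/= => iV.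
have := centered b1.
under eq_integral => x _ do rewrite -(mulfVK (lt0r_neq0 s0) (V x)) mulrC EFinM.
rewrite integralZl// => h; rewrite /Ex /Rintegral.
have fI := integrable_fin_num measurableT iV.
move: h; rewrite -(fineK fI) -EFinM => -[/eqP]; rewrite mulf_eq0 gt_eqF//= => /eqP ->//.
Qed.

(** For [beta = 1] the scale is [K N] itself, so the cut of the compensator at 1 is the cut of [V]
    at [K N], and the factor [K N] cancels. *)
Lemma truncated_cvg_in_law : beta = 1 ->
  cvg_in_law Pr Pr'
    (fun N w => rescaled_path (K N) (K N `^ (-1)) (K N `^ (- alpha^-1))
       (\int[mu]_x (V x * \1_[set y | (`|V y| <= K N)%R] x))%R
       (partial_sum X V w) (partial_sum X tau w)) Z.
Proof.
move=> beta1; apply: cvg_in_law_near rescaled_cvg_in_law.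
have /cvgryPge/(_ 1) K1 := Koo.
apply: filterS K1 => N K1; rewrite beta1 invr1.
have KN0 : 0 < K N by exact: lt_le_trans K1.
rewrite powRr1 ?(ltW KN0)//; suff -> : K N * Ex mu (fun x => compensator 1 (V x / K N)) =
  (\int[mu]_x (V x * \1_[set y | (`|V y| <= K N)%R] x))%R by [].
have cE x : compensator 1 (V x / K N) = (K N)^-1 * (V x * \1_[set y | (`|V y| <= K N)%R] x).
  rewrite /compensator ltxx eqxx mulrAC [RHS]mulrC; congr (_ * _ * _).
  have iff : (V x / K N \in `[-1, 1]%classic) = (x \in [set y | (`|V y| <= K N)%R]).
    apply/idP/idP; rewrite !inE/= in_itv/= -ler_norml normrM normfV;
      by rewrite (gtr0_norm KN0) ler_pdivrMr// mul1r.
  by rewrite !indicE iff.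
have mA : measurable [set y | `|V y| <= K N].
  have mN : measurable_fun setT (fun x => `|V x|) by exact: (measurableT_comp (@normr_measurable R
    setT)).
  by have := mN measurableT _ (measurable_itv `]-oo, K N]); rewrite setTI set_itvNyc.
have bV : bm (fun x => V x * \1_[set y | (`|V y| <= K N)%R] x).
  apply: (@bm_bounded _ _ _ (K N)); first by apply: measurable_funM => //; exact: measurable_indic.
  move=> x; rewrite indicE; case: (boolP (x \in _)); rewrite ?mulr1 ?mulr0 ?normr0 ?(ltW KN0)//.
  by rewrite inE.
under [X in _ * Ex _ X]eq_fun do rewrite cE.
by rewrite ExZ// mulrA mulfV ?mul1r// gt_eqF.
Qed.

End Rescaling.

Theorem theorem2p6 (R : realType) (E : completeMetricType R)
    (E_separable : separable E)
    (d : measure_display) (Om : measurableType d) (Pr : probability Om R)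
    (P : R.-pker borel E ~> borel E) (mu : probability (borel E) R)
    (X : nat -> {RV Pr >-> borel E})
    (X_markov : markov_chain P mu X)
    (mu_invariant : invariant_law P mu) (mu_ergodic : ergodic_law P mu)
    (A1 : spectral_gap P mu)
    (Q : R.-ker borel E ~> borel E) (p : borel E -> borel E -> R)
    (p_measurable : measurable_fun setT (fun z : borel E * borel E => p z.1 z.2))
    (p_ge0 : forall x y, 0 <= p x y)
    (A2_decomposition : forall x A, measurable A ->
       P x A = (ac_part mu p x A + Q x A)%E)
    (A2_bound : (ereal_sup [set \int[mu]_x ((p x y) ^+ 2)%:E | y in setT]
                 < +oo)%E)
    (tau : borel E -> R) (tau_measurable : measurable_fun setT tau)
    (tstar : R) (tstar_gt0 : 0 < tstar) (tau_ge : forall x, tstar <= tau x)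
    (alpha : R) (alpha_gt0 : 0 < alpha) (alpha_lt1 : alpha < 1)
    (c_alpha : R) (c_alpha_gt0 : 0 < c_alpha)
    (A3_tail : l `^ alpha * fine (mu [set x | l <= tau x]) @[l --> +oo]
               --> c_alpha)
    (A4 : level_dominated mu Q p tau)
    (V : borel E -> R) (V_measurable : measurable_fun setT V)
    (beta : R) (beta_gt0 : 0 < beta) (beta_lt2 : beta < 2)
    (cp cm : R) (cp_ge0 : 0 <= cp) (cm_ge0 : 0 <= cm) (cpm_gt0 : 0 < cp + cm)
    (B1_right_tail : l `^ beta * fine (mu [set x | l <= V x]) @[l --> +oo]
                     --> cp)
    (B1_left_tail : l `^ beta * fine (mu [set x | V x <= - l]) @[l --> +oo]
                    --> cm)
    (B1_centered : 1 < beta -> (\int[mu]_x (V x)%:E = 0)%E)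
    (B2 : level_dominated mu Q p (fun x => `|V x|))
    (C_alpha_beta : R)
    (C_alpha_betaE : C_alpha_beta = (c_alpha / (cm + cp)) `^ alpha^-1)
    (rho : R -> R)
    (rhoE : forall l, rho l = C_alpha_beta * `|l| `^ (beta / alpha))
    (Cstar gamma : R) (Cstar_gt0 : 0 < Cstar) (gamma_gt : alpha < gamma)
    (tau_rho : forall l : R, 0 < l ->
       (mu [set x | (l <= `|tau x - rho (V x)|)%R] <= (Cstar / l `^ gamma)%:E)%E)
    (K : nat -> R) (K_increasing : nondecreasing_seq K)
    (K_infty : K n @[n --> \oo] --> +oo)
    (d' : measure_display) (Om' : measurableType d') (Pr' : probability Om' R)
    (Z : Om' -> skorokhod (R * R)%type)
    (Z_levy : levy_process Pr' Z)
    (Z_exponent : has_exponent Pr' Z (levy_exponent beta cp cm rho)) :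
  let t_sum := partial_sum X tau in
  let S_sum := partial_sum X V in
  (beta != 1 ->
     cvg_in_law Pr Pr'
       (fun N w => rescaled_path (K N) (K N `^ (- beta^-1)) (K N `^ (- alpha^-1))
          0 (S_sum w) (t_sum w)) Z)
  /\
  (beta = 1 ->
     let V_ N := fun x => V x * \1_[set y | (`|V y| <= K N)%R] x in
     let v_ N := (\int[mu]_x V_ N x)%R in
     (exists2 beta' : R, 1 < beta' &
        (ereal_sup [set 'N[mu]_beta'%:E[EFin \o transition_op P (V_ N)]
                   | N in [set N | (1 <= N)%N]] < +oo)%E) ->
     cvg_in_law Pr Pr'
       (fun N w => rescaled_path (K N) (K N `^ (-1)) (K N `^ (- alpha^-1))
          (v_ N) (S_sum w) (t_sum w)) Z).
Proof.
have tau_gt0 x : 0 < tau x by exact: lt_le_trans (tau_ge x).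
have C0 : 0 < C_alpha_beta by rewrite C_alpha_betaE powR_gt0// divr_gt0// addrC.
have alpha01 : 0 < alpha < 1 by rewrite alpha_gt0.
split=> [beta1|beta1 V_ v_ _].
  exact: (centered_cvg_in_law X_markov mu_invariant A1 p_measurable p_ge0 A2_decomposition A2_bound
    tau_measurable tau_gt0 alpha01 (ltW c_alpha_gt0) A3_tail V_measurable beta_gt0 beta_lt2 cp_ge0
      cm_ge0
    B1_right_tail B1_left_tail B2 C0 rhoE gamma_gt tau_rho K_infty Z_levy Z_exponent beta1
      B1_centered).
exact: (truncated_cvg_in_law X_markov mu_invariant A1 p_measurable p_ge0 A2_decomposition A2_bound
  tau_measurable tau_gt0 alpha01 (ltW c_alpha_gt0) A3_tail V_measurable beta_gt0 beta_lt2 cp_ge0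
    cm_ge0
  B1_right_tail B1_left_tail B2 C0 rhoE gamma_gt tau_rho K_infty Z_levy Z_exponent beta1).
Qed.
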